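(* Let $\Sigma^+$ be a topologically mixing one-sided countable Markov shift with finite Gurevich entropy, let $\phi$ be a $\theta$-weakly H\''older continuous SPR potential with $\sup\phi<\infty$, and let $m$ be the unique equilibrium measure of $\phi$. Let $\beta>0$ with $e^{-\beta}\le\theta$. (1) For every $\psi\in\mathcal H_\beta$, $\sigma_m(\psi)=0$ if and only if $\psi=r-r\circ\sigma+c$ with $c\in\mathbb R$ and $r$ continuous (possibly unbounded). (2) If $\psi,\varphi\in\mathcal H_\beta$ and $\psi-\varphi=r-r\circ\sigma+c$ with $r$ continuous and $c\in\mathbb R$, then $\sigma_m(\psi)=\sigma_m(\varphi)$. (3) There is a constant $M=M_\theta(\phi)>1$ depending only on $\theta$ and $\phi$ such that $\sigma_m(\psi)\le M\|\psi\|_\beta$ for all $\psi\in\mathcal H_\beta$.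
   Context: One-sided TMS over a countable directed graph: $\Sigma^+=\{(x_0,x_1,\dots):x_i\to x_{i+1}\}$, left shift $\sigma$, metric $e^{-t(\underline x,\underline y)}$, $t=\min\{i:x_i\ne y_i\}$; mixing: strongly connected, gcd of loop lengths 1. $\theta$-weakly H\''older: $\sup\{|\phi(\underline x)-\phi(\underline y)|:x_i=y_i,i<n\}\le A\theta^n$ for $n\ge2$. $\phi_n=\sum_{k<n}\phi\circ\sigma^k$; $P_G(\phi)=\lim\frac1n\log\sum_{\sigma^n\underline x=\underline x}e^{\phi_n(\underline x)}1_{[a]}(\underline x)$; Gurevich entropy $P_G(0)$. Equilibrium measure: invariant probability maximizing $h_\mu(\sigma)+\int\phi d\mu$. SPR: $\limsup\frac1n\log Z_n^\ast(\phi,a)<P_G(\phi)$ for some (every) state $a$, with $Z_n^\ast(\phi,a)=\sum_{\sigma^n\underline x=\underline x}e^{\phi_n(\underline x)}1_{[\tau_a=n]}(\underline x)$, $\tau_a$ the first return time to $[a]$ (equivalent to the paper's discriminant definition). $\mathcal H_\beta$: $\|\psi\|_\beta=\|\psi\|_\infty+\sup_{\underline x\ne\underline y}|\psi(\underline x)-\psi(\underline y)|e^{\beta t(\underline x,\underline y)}<\infty$. Asymptotic variance: $\sigma_m^2(\psi)=\lim_n\frac1n\int(\psi_n-\int\psi_ndm)^2dm$, $\psi_n=\sum_{k<n}\psi\circ\sigma^k$, $\sigma_m(\psi)\ge0$. *)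

(* Defs.v *)
From mathcomp Require Import all_boot all_order all_algebra.
From mathcomp Require Import all_classical all_reals all_analysis.
Set Implicit Arguments. Unset Strict Implicit. Unset Printing Implicit Defensive.
Import GRing.Theory Num.Theory numFieldNormedType.Exports.
Local Open Scope classical_set_scope.
Local Open Scope ring_scope.

(* Points of the ambient sequence space are maps nat -> V.  The
   sigma-algebra is the one generated by the one-coordinate cylinders,
   i.e. the Borel sigma-algebra of the product of discrete spaces
   (for countable V). *)
Definition cylinders (V : Type) : set (set (nat -> V)) :=
  [set A | exists (i : nat) (a : V), A = [set x | x i = a]].

Notation seqM V := (g_sigma_algebraType (@cylinders V)).

Definition sshift (V : Type) (x : nat -> V) : nat -> V := fun i => x i.+1.

Definition TMS (V : eqType) (E : rel V) : set (nat -> V) :=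
  [set x | forall i, E (x i) (x i.+1)].

Definition walk (V : eqType) (E : rel V) (n : nat) (u v : V) : Prop :=
  exists w : nat -> V, [/\ w 0%N = u, w n = v &
    forall i, (i < n)%N -> E (w i) (w i.+1)].

Definition strongly_connected (V : eqType) (E : rel V) : Prop :=
  forall u v : V, exists n, walk E n u v.

Definition aperiodic (V : eqType) (E : rel V) : Prop :=
  forall d : nat,
    (forall (n : nat) (a : V), (0 < n)%N -> walk E n a a -> (d %| n)%N) ->
    d = 1%N.

Definition top_mixing (V : eqType) (E : rel V) : Prop :=
  strongly_connected E /\ aperiodic E.

Definition agree (V : Type) (n : nat) (x y : nat -> V) : Prop :=
  forall i, (i < n)%N -> x i = y i.

Definition birk (R : realType) (V : Type) (f : (nat -> V) -> R) (n : nat)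
  (x : nat -> V) : R :=
  \sum_(k < n) f (iter k (@sshift V) x).

Definition elog (R : realType) (z : \bar R) : \bar R :=
  match z with
  | r%:E => if (0 < r)%R then (ln r)%:E else -oo
  | +oo => +oo
  | -oo => -oo
  end%E.

Definition Zper (R : realType) (V : pointedType) (E : rel V)
  (phi : (nat -> V) -> R) (a : V) (n : nat) : \bar R :=
  \esum_(x in [set x | [/\ TMS E x, iter n (@sshift V) x = x & x 0%N = a]])
    (expR (birk phi n x))%:E.

Definition Zfirst (R : realType) (V : pointedType) (E : rel V)
  (phi : (nat -> V) -> R) (a : V) (n : nat) : \bar R :=
  \esum_(x in [set x | [/\ TMS E x, iter n (@sshift V) x = x, x 0%N = a &
                          forall i, (0 < i < n)%N -> x i <> a]])
    (expR (birk phi n x))%:E.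

Definition growth (R : realType) (Z : nat -> \bar R) : \bar R :=
  limn_esup (fun n => ((n.+1%:R : R)^-1)%:E * elog (Z n.+1))%E.

Definition PG (R : realType) (V : pointedType) (E : rel V)
  (phi : (nat -> V) -> R) (a : V) : \bar R := growth (Zper E phi a).

Definition finite_gurevich_entropy (R : realType) (V : pointedType)
  (E : rel V) : Prop :=
  forall a : V, (PG E (fun _ : nat -> V => 0%R : R) a < +oo)%E.

Definition SPR (R : realType) (V : pointedType) (E : rel V)
  (phi : (nat -> V) -> R) : Prop :=
  exists a : V, (growth (Zfirst E phi a) < PG E phi a)%E.

Definition weakly_holder (R : realType) (V : eqType) (E : rel V) (theta : R)
  (phi : (nat -> V) -> R) : Prop :=
  exists A : R, forall n : nat, (2 <= n)%N ->
    forall x y, TMS E x -> TMS E y -> agree n x y ->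
      `|phi x - phi y| <= A * theta ^+ n.

(* ||psi||_beta = ||psi||_oo + sup_{x <> y} |psi x - psi y| e^{beta t(x,y)},
   where t(x,y) = n means x,y agree on 0..n-1 and x n <> y n.
   (0 is added to both sets so that the suprema are >= 0.) *)
Definition Hnorm (R : realType) (V : eqType) (E : rel V) (beta : R)
  (psi : (nat -> V) -> R) : \bar R :=
  (ereal_sup ([set 0%E] `|` [set (`|psi x|)%:E | x in TMS E]) +
   ereal_sup ([set 0%E] `|`
     [set z | exists (n : nat) (x y : nat -> V),
        [/\ TMS E x, TMS E y, agree n x y, x n <> y n &
            z = (`|psi x - psi y| * expR (beta * n%:R))%:E]]))%E.

Definition in_H (R : realType) (V : eqType) (E : rel V) (beta : R)
  (psi : (nat -> V) -> R) : Prop := (Hnorm E beta psi < +oo)%E.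

Definition cont_on_TMS (R : realType) (V : eqType) (E : rel V)
  (r : (nat -> V) -> R) : Prop :=
  forall x, TMS E x -> forall eps : R, 0 < eps ->
    exists n : nat, forall y, TMS E y -> agree n x y -> `|r y - r x| < eps.

Definition shift_inv_prob (R : realType) (V : pointedType) (E : rel V)
  (mu : probability (seqM V) R) : Prop :=
  mu (TMS E : set (seqM V)) = 1%E /\
  forall A : set (seqM V), measurable A ->
    mu (@sshift V @^-1` A : set (seqM V)) = mu A.

Definition fin_partition (V : pointedType) (P : seq (set (seqM V))) : Prop :=
  [/\ forall i, (i < size P)%N -> measurable (nth set0 P i),
      forall i j, (i < size P)%N -> (j < size P)%N -> i <> j ->
        nth set0 P i `&` nth set0 P j = set0 &
      forall x, exists2 i, (i < size P)%N & nth set0 P i x].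

Definition eta (R : realType) (t : R) : R := - (t * ln t).

(* H_mu( P v sigma^-1 P v ... v sigma^-(n-1) P ) *)
Definition Hjoin (R : realType) (V : pointedType) (mu : probability (seqM V) R)
  (P : seq (set (seqM V))) (n : nat) : R :=
  \sum_(w : {ffun 'I_n -> 'I_(size P)})
     eta (fine (mu ([set x | forall k : 'I_n,
                       nth set0 P (w k) (iter k (@sshift V) x)] : set (seqM V)))).

(* h_mu(sigma, P) = lim_n (1/n) H_mu(P_0^{n-1}) (the limit exists) *)
Definition hpart (R : realType) (V : pointedType) (mu : probability (seqM V) R)
  (P : seq (set (seqM V))) : \bar R :=
  limn_esup (fun n => ((n.+1%:R : R)^-1 * Hjoin mu P n.+1)%:E).

Definition KSentropy (R : realType) (V : pointedType)
  (mu : probability (seqM V) R) : \bar R :=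
  ereal_sup [set hpart mu P | P in @fin_partition V].

Definition press_fun (R : realType) (V : pointedType) (E : rel V)
  (phi : (nat -> V) -> R) (mu : probability (seqM V) R) : \bar R :=
  (KSentropy mu + \int[mu]_(x in (TMS E : set (seqM V))) (phi x)%:E)%E.

Definition equilibrium (R : realType) (V : pointedType) (E : rel V)
  (phi : (nat -> V) -> R) (mu : probability (seqM V) R) : Prop :=
  shift_inv_prob E mu /\
  forall nu : probability (seqM V) R, shift_inv_prob E nu ->
    (press_fun E phi nu <= press_fun E phi mu)%E.

Definition var_seq (R : realType) (V : pointedType) (E : rel V)
  (m : probability (seqM V) R) (psi : (nat -> V) -> R) (n : nat) : R :=
  (n%:R)^-1 * Rintegral m (TMS E : set (seqM V))
     (fun x => (birk psi n x - Rintegral m (TMS E : set (seqM V)) (birk psi n)) ^+ 2).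

Definition asym_var (R : realType) (V : pointedType) (E : rel V)
  (m : probability (seqM V) R) (psi : (nat -> V) -> R) : R :=
  limn (var_seq E m psi).

Definition sigma_m (R : realType) (V : pointedType) (E : rel V)
  (m : probability (seqM V) R) (psi : (nat -> V) -> R) : R :=
  Num.sqrt (asym_var E m psi).

(* Main.v *)
(** The transfer operator L of phi - P has, by strong positive recurrence, exponentially
    small taboo sums over excursions away from a state a; hence the operator induced on the
    cylinder [a] has a positive eigenfunction of eigenvalue 1 (a defect of harmonicity would
    survive a small decrease of P), which extends to an L-eigenfunction h. After normalising
    L by h, the induced operator contracts a cone of log-regular functions, which produces
    an invariant measure with L^* mu = mu; its Gibbs property bounds the pressure of every
    invariant measure by P, its conditional entropy attains P, so mu = m.

    For psi in H_beta the contraction solves u - L u = psi - c with u continuous and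
    dominated by S = ||psi|| times the expected excursion length, which is in L^2. Then
    psi - c = chi + l o sigma - l with l = L u, and chi = u - l o sigma is a reverse
    martingale difference: the variance of the Birkhoff sums is n int chi^2 up to a bounded
    coboundary. Hence sigma_m(psi)^2 = int chi^2 <= (M S)^2, and it vanishes iff chi = 0,
    since m has full support. If psi and vphi are cohomologous through a continuous r, the
    difference of their chi is a reverse martingale difference and a coboundary R - R o sigma;
    testing it against a bounded increasing function of R o sigma shows that it is 0. *)
From HB Require Import structures.
Require Import Defs.
From mathcomp Require Import all_boot all_order all_algebra.
From mathcomp Require Import all_classical all_reals all_analysis.
From mathcomp Require Import measurable_realfun ring lra.
Set Implicit Arguments. Unset Strict Implicit. Unset Printing Implicit Defensive.
Import Order.TTheory GRing.Theory Num.Theory numFieldNormedType.Exports.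
Local Open Scope classical_set_scope.
Local Open Scope ring_scope.

(** * Positive operators and preimages *)

Section PositiveOperators.
Local Open Scope ereal_scope.
Context {R : realType} {X : Type} (D : set X).
Implicit Types (F G : X -> \bar R) (w : X -> R).

Definition nneg F := forall x, 0 <= F x.

Record posop (T : (X -> \bar R) -> X -> \bar R) : Prop := Posop {
  po_ge0 : forall F, nneg F -> nneg (T F);
  po_sum : forall F : nat -> X -> \bar R, (forall n, nneg (F n)) ->
    forall x, T (fun y => \sum_(n <oo) F n y) x = \sum_(n <oo) T (F n) x;
  po_scale : forall (r : R) F, (0 <= r)%R -> nneg F ->
    forall x, T (fun y => r%:E * F y) x = r%:E * T F x;
  po_le : forall F G, nneg F -> nneg G -> (forall x, D x -> F x <= G x) ->
    forall x, D x -> T F x <= T G x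
}.

Lemma nneseries_from2 (f : nat -> \bar R) (n : nat) : (forall i, 0 <= f i) ->
  (forall i, (n <= i)%N -> f i = 0) -> \sum_(i <oo) f i = \sum_(0 <= i < n) f i.
Proof.
move=> f0 fn; rewrite (nneseries_split 0 n)//= add0n [X in _ + X]eseries0 ?adde0//.
by move=> i ni _; apply: fn.
Qed.

Variable T : (X -> \bar R) -> X -> \bar R.
Hypothesis pT : posop T.

Lemma po_eq F G : nneg F -> nneg G -> (forall x, D x -> F x = G x) ->
  forall x, D x -> T F x = T G x.
Proof.
move=> F0 G0 FG x Dx; apply/eqP; rewrite eq_le.
by apply/andP; split; apply: (po_le pT) => // y Dy; rewrite FG.
Qed.

Lemma po_0 x : T (fun=> 0) x = 0.
Proof.
have := po_scale pT (lexx (0%R : R)) (F := fun=> 0) (fun=> lexx _) x.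
have -> : (fun _ : X => 0%:E * 0) = (fun=> 0 : \bar R) by apply/funext => y; rewrite mul0e.
by rewrite mul0e.
Qed.

Lemma po_add F G : nneg F -> nneg G ->
  forall x, T (fun y => F y + G y) x = T F x + T G x.
Proof.
move=> F0 G0 x.
pose H (n : nat) := if n is 0%N then F else if n is 1%N then G else fun=> 0.
have H0 n : nneg (H n) by case: n => [|[|n]] // y; rewrite /H.
have E y : F y + G y = \sum_(n <oo) H n y.
  rewrite (@nneseries_from2 _ 2).
  - by rewrite big_nat_recr//= big_nat1.
  - by move=> i; apply: H0.
  - by case=> [|[]].
rewrite (_ : F \+ G = (fun y => \sum_(n <oo) H n y)); last exact/funext.
rewrite (po_sum pT)// (@nneseries_from2 _ 2); first by rewrite big_nat_recr//= big_nat1.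
  by move=> i; apply: po_ge0.
by case=> [|[|i]]// _; rewrite /H po_0.
Qed.

Lemma po_fsum (I : Type) (r : seq I) (F : I -> X -> \bar R) : (forall i, nneg (F i)) ->
  forall x, T (fun y => \sum_(i <- r) F i y) x = \sum_(i <- r) T (F i) x.
Proof.
move=> F0 x; elim: r => [|i r IH].
  rewrite big_nil (_ : (fun y => _) = fun=> 0) ?po_0//.
  by apply/funext => y; rewrite big_nil.
rewrite big_cons -IH -po_add//; first by congr (T _ x); apply/funext => y; rewrite big_cons.
by move=> y; apply: sume_ge0 => k _; apply: F0.
Qed.

Lemma po_iter n : posop (iter n T).
Proof.
elim: n => [|n IH]; first by split => //.
split.
- by move=> F F0 x /=; apply: po_ge0 => //; apply: (po_ge0 IH).
- move=> F F0 x /=; rewrite -(po_sum pT); last by move=> k; apply: (po_ge0 IH).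
  by congr (T _ x); apply/funext => y; apply: (po_sum IH).
- move=> r F r0 F0 x /=; rewrite -(po_scale pT)//; last exact: (po_ge0 IH).
  by congr (T _ x); apply/funext => y; apply: (po_scale IH).
- move=> F G F0 G0 FG x Dx /=; apply: (po_le pT) => //; try exact: (po_ge0 IH).
  exact: (po_le IH).
Qed.

Lemma po_comp U : posop U -> posop (fun F => T (U F)).
Proof.
move=> pU; split.
- by move=> F F0 x; apply: po_ge0 => //; apply: (po_ge0 pU).
- move=> F F0 x; rewrite -(po_sum pT); last by move=> k; apply: (po_ge0 pU).
  by congr (T _ x); apply/funext => y; apply: (po_sum pU).
- move=> r F r0 F0 x; rewrite -(po_scale pT)//; last exact: (po_ge0 pU).
  by congr (T _ x); apply/funext => y; apply: (po_scale pU).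
- move=> F G F0 G0 FG x Dx; apply: (po_le pT) => //; try exact: (po_ge0 pU).
  exact: (po_le pU).
Qed.

Definition resolvent F x := \sum_(n <oo) iter n T F x.

Lemma po_resolvent : posop resolvent.
Proof.
split.
- by move=> F F0 x; apply: nneseries_ge0 => n _ _; apply: po_ge0; first exact: po_iter.
- move=> F F0 x; rewrite /resolvent nneseries_interchange; last first.
    by move=> i j; apply: po_ge0 => //; apply: po_iter.
  by apply: eq_eseriesr => n _; apply: (po_sum (po_iter n)).
- move=> r F r0 F0 x; rewrite /resolvent -nneseriesZl//; last first.
    by move=> i _; apply: po_ge0; first exact: po_iter.
  by apply: eq_eseriesr => n _; apply: (po_scale (po_iter n)).
- move=> F G F0 G0 FG x Dx; apply: lee_nneseries => n _ *.
    by apply: po_ge0 => //; apply: po_iter.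
  by apply: (po_le (po_iter n)).
Qed.

Lemma resolventE F x : nneg F -> resolvent F x = F x + T (resolvent F) x.
Proof.
move=> F0; rewrite /resolvent nneseries_recl//; last by move=> n _; apply: (po_ge0 (po_iter n)).
congr (_ + _); rewrite (po_sum pT); last by move=> n; apply: (po_ge0 (po_iter n)).
rewrite -(@nneseries_addn _ (fun n => iter n T F x) 1); last first.
  by move=> n; apply: (po_ge0 (po_iter n)).
by apply: eq_eseriesr => n _; rewrite addn1.
Qed.

Lemma resolvent_min G U : nneg G -> nneg U ->
  (forall x, D x -> G x + T U x <= U x) -> forall x, D x -> resolvent G x <= U x.
Proof.
move=> G0 U0 GU x Dx; apply: lime_le.
  by apply: is_cvg_nneseries => n _ _; apply: (po_ge0 (po_iter n)).
apply: nearW => n.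
suff H : forall y, D y -> \sum_(0 <= i < n) iter i T G y <= U y by exact: H.
elim: n => [|n IH] y Dy; first by rewrite big_geq.
rewrite big_nat_recl//= (le_trans _ (GU _ Dy))// leeD2l//.
rewrite -(@po_fsum nat (index_iota 0 n) (fun i => iter i T G)).
  by apply: (po_le pT) => // z; apply: sume_ge0 => i _; apply: (po_ge0 (po_iter i)).
by move=> i; apply: (po_ge0 (po_iter i)).
Qed.

End PositiveOperators.

Section ShiftSpace.
Context {R : realType} {V : pointedType} (E : rel V).
Implicit Types (x y z : nat -> V) (F G : (nat -> V) -> \bar R) (w : (nat -> V) -> R).

Definition bcons (b : V) x : nat -> V := fun i => if i is j.+1 then x j else b.

Lemma bcons_sshift x : bcons (x 0%N) (sshift x) = x.
Proof. by apply/funext; case. Qed.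

Lemma TMS_bcons b x : E b (x 0%N) -> TMS E x -> TMS E (bcons b x).
Proof. by move=> bx Ex [|i] /=; [exact: bx|exact: Ex]. Qed.

Lemma TMS_sshift x : TMS E x -> TMS E (sshift x).
Proof. by move=> Ex i; apply: Ex. Qed.

Lemma iter_sshiftE n x i : iter n (@sshift V) x i = x (i + n)%N.
Proof.
elim: n i => [|n IH] i; first by rewrite addn0.
by rewrite iterS /sshift IH addSnnS.
Qed.

Lemma TMS_iter n x : TMS E x -> TMS E (iter n (@sshift V) x).
Proof. by move=> Ex i; rewrite !iter_sshiftE addSn; apply: Ex. Qed.

Lemma agree_bcons n b x y : agree n x y -> agree n.+1 (bcons b x) (bcons b y).
Proof. by move=> xy [|i] //=; rewrite ltnS; exact: xy. Qed.

Lemma agreeW m n x y : (m <= n)%N -> agree n x y -> agree m x y.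
Proof. by move=> mn xy i im; apply: xy; apply: leq_trans mn. Qed.

Lemma agree_sym n x y : agree n x y -> agree n y x.
Proof. by move=> xy i /xy. Qed.

Lemma agree_iter k n x y : agree n x y ->
  agree (n - k) (iter k (@sshift V) x) (iter k (@sshift V) y).
Proof.
move=> xy i ink; rewrite !iter_sshiftE; apply: xy.
by rewrite addnC -ltn_subRL.
Qed.

Definition cyl (s : seq V) : set (nat -> V) := [set x | forall i, (i < size s)%N -> x i = nth point s i].

Definition preop F x : \bar R := \esum_(b in [set b | E b (x 0%N)]) F (bcons b x).

Definition wmul w F x : \bar R := ((w x)%:E * F x)%E.

Lemma po_wmul (D : set (nat -> V)) w : (forall x, 0 <= w x) -> posop D (wmul w).
Proof.
move=> w0; split.
- by move=> F F0 x; rewrite mule_ge0 ?lee_fin.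
- by move=> F F0 x; rewrite /wmul -nneseriesZl// => i _; apply: F0.
- by move=> r F r0 F0 x; rewrite /wmul muleCA.
- by move=> F G F0 G0 FG x Dx; rewrite lee_wpmul2l ?lee_fin//; apply: FG.
Qed.

Lemma esum_nneseries (T : choiceType) (I : set T) (a : nat -> T -> \bar R) :
  (forall n t, (0 <= a n t)%E) ->
  (\esum_(t in I) \sum_(n <oo) a n t = \sum_(n <oo) \esum_(t in I) a n t)%E.
Proof.
move=> a0; rewrite nneseries_esumT; last by move=> n; apply: esum_ge0.
rewrite esum_esum//.
rewrite (reindex_esum (I `*`` (fun=> setT)) _ (fun k => (k.2, k.1))).
  rewrite -(esum_esum (a := fun i j => a j i))//.
  by apply: eq_esum => i Ii; rewrite nneseries_esumT.
split.
- by move=> [i n] /= [].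
- by move=> [i n] [j k] _ _ /= [-> ->].
- by move=> [n i] /= [_ Ii]; exists (i, n).
Qed.

Lemma esumZl (T : choiceType) (I : set T) (a : T -> \bar R) (r : R) : 0 <= r ->
  (forall t, (0 <= a t)%E) ->
  (\esum_(t in I) (r%:E * a t) = r%:E * \esum_(t in I) a t)%E.
Proof.
move=> r0 a0; have [->|rn0] := eqVneq r 0.
  by rewrite mul0e esum1// => i _; rewrite mul0e.
have rp : 0 < r by rewrite lt_neqAle eq_sym rn0.
rewrite /esum -ereal_sup_pZl//.
congr ereal_sup; rewrite image_comp; apply: eq_imagel => X _ /=.
by rewrite ge0_mule_fsumr// => t _; apply: a0.
Qed.

Lemma po_preop : posop (TMS E) preop.
Proof.
split.
- by move=> F F0 x; apply: esum_ge0.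
- by move=> F F0 x; rewrite /preop esum_nneseries// => n t; apply: F0.
- by move=> r F r0 F0 x; rewrite /preop esumZl// => t; apply: F0.
- by move=> F G F0 G0 FG x Dx; apply: le_esum => b /= bx; apply/FG/TMS_bcons.
Qed.

Definition transfer w F := preop (wmul w F).

Lemma po_transfer w : (forall x, 0 <= w x) -> posop (TMS E) (transfer w).
Proof. by move=> w0; apply: po_comp; [exact: po_preop|exact: po_wmul]. Qed.

Lemma wmul_indicN (D : set (nat -> V)) F : nneg F ->
  forall x, F x = (wmul \1_(~` D) F x + wmul \1_D F x)%E.
Proof.
move=> F0 x; rewrite /wmul !indicE.
have [xD|xD] := boolP (x \in D); first by rewrite in_setC xD/= mul0e mul1e add0e.
by rewrite in_setC xD/= mul1e mul0e adde0.
Qed.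

Lemma wmul_in D F x : D x -> wmul \1_D F x = F x.
Proof. by move=> Dx; rewrite /wmul indicE mem_set//= mul1e. Qed.

Lemma wmul_notin D F x : ~ D x -> wmul \1_D F x = 0%E.
Proof. by move=> Dx; rewrite /wmul indicE memNset//= mul0e. Qed.

End ShiftSpace.

(** * Log-regular functions and excursions *)

Section Regularity.
Context {R : realType} {V : pointedType} (E : rel V) (theta : R).
Hypothesis theta01 : 0 < theta < 1.
Implicit Types (x y z : nat -> V) (F G : (nat -> V) -> \bar R) (w : (nat -> V) -> R).

Let theta0 : 0 < theta. Proof. by case/andP: theta01. Qed.
Let theta1 : theta < 1. Proof. by case/andP: theta01. Qed.

Definition reg (c : R) F := forall n x y, (1 <= n)%N -> TMS E x -> TMS E y ->
  agree n x y -> (F x <= (expR (c * theta ^+ n))%:E * F y)%E.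

Definition regw (kappa : R) w := forall n x y, (2 <= n)%N -> TMS E x -> TMS E y ->
  agree n x y -> w x <= expR (kappa * theta ^+ n) * w y.

Lemma exprn_gt0' n : 0 < theta ^+ n. Proof. exact: exprn_gt0. Qed.
Lemma reg_le c c' F : nneg F -> c <= c' -> reg c F -> reg c' F.
Proof.
move=> F0 cc rF n x y n1 Ex Ey xy; apply: (le_trans (rF n x y n1 Ex Ey xy)).
apply: lee_wpmul2r => //.
by rewrite lee_fin ler_expR ler_wpM2r// ltW// exprn_gt0'.
Qed.

Lemma reg_cst c (r : R) : 0 <= c -> 0 <= r -> reg c (fun=> r%:E).
Proof.
move=> c0 r0 n x y _ _ _ _; rewrite -EFinM lee_fin ler_peMl// -expR0 ler_expR.
by rewrite mulr_ge0// ltW// exprn_gt0'.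
Qed.

Lemma reg_add c F G : nneg F -> nneg G -> reg c F -> reg c G ->
  reg c (fun x => F x + G x)%E.
Proof.
move=> F0 G0 rF rG n x y n1 Ex Ey xy; rewrite ge0_muleDr//.
by apply: leeD; [exact: rF|exact: rG].
Qed.

Lemma reg_scale c (r : R) F : 0 <= r -> reg c F -> reg c (fun x => r%:E * F x)%E.
Proof.
move=> r0 rF n x y n1 Ex Ey xy; rewrite muleCA; apply: lee_wpmul2l; rewrite ?lee_fin//.
exact: rF.
Qed.

Lemma reg_series c (F : nat -> (nat -> V) -> \bar R) : (forall n, nneg (F n)) ->
  (forall n, reg c (F n)) -> reg c (fun x => \sum_(n <oo) F n x)%E.
Proof.
move=> F0 rF n x y n1 Ex Ey xy; rewrite -nneseriesZl; last by move=> i _; apply: F0.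
by apply: lee_nneseries => i *; [exact: F0|exact: rF].
Qed.

Lemma reg_wmul c (D : set (nat -> V)) F : (forall x y, x 0%N = y 0%N -> D x -> D y) ->
  nneg F -> reg c F -> reg c (wmul \1_D F).
Proof.
move=> Dxy F0 rF n x y n1 Ex Ey xy.
have xy0 : x 0%N = y 0%N by apply: xy.
have [Dx|Dx] := pselect (D x); last first.
  rewrite wmul_notin// mule_ge0 ?lee_fin ?expR_ge0//.
  by rewrite mule_ge0// lee_fin indicE.
by rewrite !wmul_in//; [exact: rF|exact: Dxy Dx].
Qed.

Lemma reg_transfer kappa c w F : (forall x, 0 <= w x) -> nneg F ->
  regw kappa w -> reg c F -> reg ((kappa + c) * theta) (transfer E w F).
Proof.
move=> w0 F0 rw rF n x y n1 Ex Ey xy.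
have xy0 : x 0%N = y 0%N by apply: xy.
rewrite /transfer /preop -xy0 -esumZl ?expR_ge0//; last first.
  by move=> b; rewrite mule_ge0// lee_fin.
apply: le_esum => b /= bx; rewrite /wmul.
have Ebx := TMS_bcons bx Ex.
have Eby : TMS E (bcons b y) by apply: TMS_bcons; rewrite -?xy0.
have bxy := agree_bcons b xy.
have h1 := rw n.+1 _ _ n1 Ebx Eby bxy.
have h2 := rF n.+1 _ _ isT Ebx Eby bxy.
apply: (@le_trans _ _ ((expR (kappa * theta ^+ n.+1) * w (bcons b y))%:E *
   ((expR (c * theta ^+ n.+1))%:E * F (bcons b y)))%E).
  by apply: lee_pmul => //; rewrite lee_fin.
rewrite EFinM muleACA -EFinM -expRD.
by rewrite (_ : _ + _ = (kappa + c) * theta * theta ^+ n)// exprS; ring.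
Qed.

Lemma reg_compare c F x y : nneg F -> 0 <= c -> reg c F -> TMS E x -> TMS E y -> x 0%N = y 0%N ->
  (F x <= (expR c)%:E * F y)%E.
Proof.
move=> F0 c0 rF Ex Ey xy.
apply: (le_trans (rF 1%N x y isT Ex Ey _)); first by case.
apply: lee_wpmul2r => //; rewrite lee_fin ler_expR expr1 ler_piMr// ltW//.
Qed.

Lemma reg_ltoo c F x y : nneg F -> 0 <= c -> reg c F -> TMS E x -> TMS E y -> x 0%N = y 0%N ->
  (F x < +oo -> F y < +oo)%E.
Proof.
move=> F0 c0 rF Ex Ey xy Fx; apply: (le_lt_trans (reg_compare F0 c0 rF Ey Ex (esym xy))).
by rewrite lte_mul_pinfty// lee_fin expR_ge0.
Qed.

Variable a : V.
Definition cyl1 : set (nat -> V) := [set x | x 0%N = a].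
Definition taboo (T : ((nat -> V) -> \bar R) -> (nat -> V) -> \bar R) F := T (wmul \1_(~` cyl1) F).
Definition entry (T : ((nat -> V) -> \bar R) -> (nat -> V) -> \bar R) F := T (wmul \1_cyl1 F).
(* [loopop T F x] sums over the words prepended to [x] whose first letter is [a] and whose
   other letters differ from [a]: on [a] it is the operator of the first-return map. *)
Definition loopop (T : ((nat -> V) -> \bar R) -> (nat -> V) -> \bar R) F :=
  resolvent (taboo T) (entry T F).

Section Ops.
Variable T : ((nat -> V) -> \bar R) -> (nat -> V) -> \bar R.
Hypothesis pT : posop (TMS E) T.

Lemma indic_ge0' (D : set (nat -> V)) x : 0 <= (\1_D x : R).
Proof. by rewrite indicE. Qed.

Lemma po_taboo : posop (TMS E) (taboo T).
Proof. by apply: po_comp => //; apply: po_wmul => x; exact: indic_ge0'. Qed.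

Lemma po_entry : posop (TMS E) (entry T).
Proof. by apply: po_comp => //; apply: po_wmul => x; exact: indic_ge0'. Qed.

Lemma po_loop : posop (TMS E) (loopop T).
Proof. by apply: po_comp; [exact/po_resolvent/po_taboo|exact: po_entry]. Qed.

Lemma nneg_wmul (D : set (nat -> V)) F : nneg F -> nneg (wmul (\1_D : _ -> R) F).
Proof. by move=> F0 x; rewrite mule_ge0// lee_fin indic_ge0'. Qed.

Lemma taboo_entry F x : nneg F -> T F x = (taboo T F x + entry T F x)%E.
Proof.
move=> F0; rewrite -(po_add pT); [|exact: nneg_wmul..].
by congr (T _ x); apply/funext => y; apply: wmul_indicN.
Qed.

Lemma entry_eq F G x : nneg F -> nneg G -> (forall y, TMS E y -> y 0%N = a -> F y = G y) ->
  TMS E x -> entry T F x = entry T G x.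
Proof.
move=> F0 G0 FG; apply: (po_eq pT); [exact: nneg_wmul..|] => y Ey.
have [ya|ya] := pselect (cyl1 y); first by rewrite !wmul_in//; apply: FG.
by rewrite !wmul_notin.
Qed.

Lemma entry_le F G x : nneg F -> nneg G -> (forall y, TMS E y -> y 0%N = a -> (F y <= G y)%E) ->
  TMS E x -> (entry T F x <= entry T G x)%E.
Proof.
move=> F0 G0 FG; apply: (po_le pT); [exact: nneg_wmul..|] => y Ey.
have [ya|ya] := pselect (cyl1 y); first by rewrite !wmul_in//; apply: FG.
by rewrite !wmul_notin.
Qed.

Lemma loop_le F G x : nneg F -> nneg G -> (forall y, TMS E y -> y 0%N = a -> (F y <= G y)%E) ->
  TMS E x -> (loopop T F x <= loopop T G x)%E.
Proof.
move=> F0 G0 FG; apply: (po_le (po_resolvent po_taboo)).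
- exact: po_ge0 po_entry _ F0.
- exact: po_ge0 po_entry _ G0.
- by move=> y Ey; apply: entry_le.
Qed.

Lemma loop_eq F G x : nneg F -> nneg G -> (forall y, TMS E y -> y 0%N = a -> F y = G y) ->
  TMS E x -> loopop T F x = loopop T G x.
Proof.
by move=> F0 G0 FG Ex; apply/eqP; rewrite eq_le; apply/andP; split; apply: loop_le => // y *;
  rewrite FG.
Qed.

Lemma loopE F x : nneg F -> loopop T F x = (entry T F x + taboo T (loopop T F) x)%E.
Proof. by move=> F0; apply: (resolventE po_taboo); apply: po_ge0 po_entry _ F0. Qed.

End Ops.

Lemma reg_taboo kappa c w F : (forall x, 0 <= w x) -> nneg F ->
  regw kappa w -> reg c F -> reg ((kappa + c) * theta) (taboo (transfer E w) F).
Proof.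
move=> w0 F0 rw rF; apply: reg_transfer => //; first exact: nneg_wmul.
by apply: reg_wmul => // x y; rewrite /setC/cyl1 /= => ->.
Qed.

Lemma reg_entry kappa c w F : (forall x, 0 <= w x) -> nneg F ->
  regw kappa w -> reg c F -> reg ((kappa + c) * theta) (entry (transfer E w) F).
Proof.
move=> w0 F0 rw rF; apply: reg_transfer => //; first exact: nneg_wmul.
by apply: reg_wmul => // x y; rewrite /setC/cyl1 /= => ->.
Qed.

Definition stable kappa c := (kappa + c) * theta <= c.

Lemma reg_iter (T : ((nat -> V) -> \bar R) -> (nat -> V) -> \bar R) kappa c F k :
  posop (TMS E) T -> (forall c F, nneg F -> reg c F -> reg ((kappa + c) * theta) (T F)) ->
  stable kappa c -> nneg F -> reg c F -> reg c (iter k T F).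
Proof.
move=> pT rT cc F0 rF; elim: k => [//|k IH] /=.
have Fk : nneg (iter k T F) by apply: po_ge0 (po_iter pT k) _ F0.
by apply: reg_le cc _; [exact: po_ge0 pT _ Fk|exact: rT].
Qed.

Lemma reg_resolvent (T : ((nat -> V) -> \bar R) -> (nat -> V) -> \bar R) kappa c F :
  posop (TMS E) T -> (forall c F, nneg F -> reg c F -> reg ((kappa + c) * theta) (T F)) ->
  stable kappa c -> nneg F -> reg c F -> reg c (resolvent T F).
Proof.
move=> pT rT cc F0 rF; apply: reg_series => n; first exact: po_ge0 (po_iter pT n) _ F0.
exact: reg_iter pT rT cc F0 rF.
Qed.

Lemma reg_loop kappa c w F : (forall x, 0 <= w x) -> nneg F -> regw kappa w ->
  stable kappa ((kappa + c) * theta) -> reg c F ->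
  reg ((kappa + c) * theta) (loopop (transfer E w) F).
Proof.
move=> w0 F0 rw cc rF; have pT := po_transfer E w0.
apply: (@reg_resolvent _ kappa) => //; first exact: po_taboo.
- by move=> c' G G0 rG; exact: reg_taboo.
- exact: po_ge0 (po_entry pT) _ F0.
- exact: reg_entry.
Qed.

End Regularity.

Section Walks.
Context {V : pointedType} (E : rel V).

Lemma walk0 u v : walk E 0 u v -> u = v.
Proof. by move=> [w [<-]]. Qed.

Lemma walkS n u v : walk E n.+1 u v -> exists2 u', E u u' & walk E n u' v.
Proof.
move=> [w [w0 wn ww]]; exists (w 1%N); first by rewrite -w0; apply: ww.
by exists (fun i => w i.+1); split => // i ilt; apply: ww.
Qed.

Lemma strongly_connected_ind (P : V -> Prop) (a : V) : strongly_connected E ->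
  P a -> (forall b b', E b b' -> P b' -> P b) -> forall b, P b.
Proof.
move=> sc Pa PE b; have [n wn] := sc b a.
elim: n b wn => [|n IH] b; first by move=> /walk0 ->.
by move=> /walkS[b' bb' /IH]; exact: PE.
Qed.

Lemma strongly_connected_ind_fwd (P : V -> Prop) (a : V) : strongly_connected E ->
  P a -> (forall b b', E b b' -> P b -> P b') -> forall b, P b.
Proof.
move=> sc Pa PE b; have [n wn] := sc a b.
elim: n a Pa wn => [|n IH] a Pa; first by move=> /walk0 <-.
by move=> /walkS[b' bb' /IH]; apply; exact: PE bb' Pa.
Qed.

Hypothesis mixE : top_mixing E.

Lemma edge_ex b : exists b', E b b'.
Proof.
have [sc ap] := mixE.
have [a0 [c ac]] : exists a0 c, E a0 c.
  apply: contrapT => /forallNP N; have := ap 2%N; suff H : forall n a, (0 < n)%N -> walk E n a a -> False.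
    by move=> /(_ (fun n a n0 w => False_ind _ (H n a n0 w))).
  by move=> [//|n] a _ /walkS[u au _]; apply: (N a); exists u.
have [[|n]] := sc b a0; first by move=> /walk0 ->; exists c.
by move=> /walkS[u bu _]; exists u.
Qed.

Lemma TMS_ex b : exists2 x, TMS E x & x 0%N = b.
Proof.
have [f fE] := choice edge_ex.
by exists (fun i => iter i f b) => // i; apply: fE.
Qed.

End Walks.

(** * Exponential growth and periodic points *)

Section Growth.
Context {R : realType}.
Implicit Types (u : nat -> \bar R) (Z : nat -> \bar R).

Lemma limn_esup_lt u (l : \bar R) : (limn_esup u < l)%E -> \forall n \near \oo, (u n < l)%E.
Proof.
move=> /ereal_inf_lt[_ [W [N _ NW] <-]] Wl.
by exists N => // n Nn; apply: le_lt_trans Wl; apply: ereal_sup_ubound; exists n => //; apply: NW.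
Qed.

Lemma limn_esup_le u (l : \bar R) : (\forall n \near \oo, (u n <= l)%E) -> (limn_esup u <= l)%E.
Proof.
move=> H; apply: (@le_trans _ _ (ereal_sup (u @` [set n | (u n <= l)%E]))).
  by apply: ereal_inf_lbound; exists [set n | (u n <= l)%E].
by apply: ge_ereal_sup => _ [n un <-].
Qed.

Lemma elog_le (z : \bar R) (t : R) : (0 <= z)%E -> (elog z <= t%:E)%E = (z <= (expR t)%:E)%E.
Proof.
case: z => [r| |]//=; rewrite !lee_fin => r0.
case: ifPn => rp; first by rewrite lee_fin -{2}(lnK rp) ler_expR.
by rewrite leNye (le_trans _ (expR_ge0 t))// leNgt.
Qed.

Lemma growth_lt Z (p : \bar R) : (forall n, 0 <= Z n)%E -> (growth Z < p)%E ->
  exists2 q : R, (q%:E < p)%E & \forall n \near \oo, (Z n.+1 <= (expR (n.+1%:R * q))%:E)%E.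
Proof.
move=> Z0 gp; have [q gq qp] : exists2 q : R, (growth Z < q%:E)%E & (q%:E < p)%E.
  move: gp; move: (growth Z) => g; case: p => [p| |]; case: g => [g| |]//.
  - by rewrite lte_fin => gp; exists ((g + p) / 2); rewrite lte_fin ?midf_lt.
  - by move=> _; exists (p - 1); rewrite ?ltNyr// lte_fin ltrBlDr ltrDl.
  - by move=> _; exists (g + 1); rewrite ?ltry// lte_fin ltrDl.
  - by move=> _; exists 0; rewrite ?ltry ?ltNyr.
exists q => //; near=> n.
have : ((n.+1%:R^-1)%:E * elog (Z n.+1) < q%:E)%E by near: n; exact: limn_esup_lt.
rewrite -elog_le// => /ltW; rewrite lee_pdivrMl// => H.
Unshelve. all: by end_near.
Qed.

Lemma growth_le Z (K p : R) : 0 < K -> (forall n, 0 <= Z n)%E ->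
  (forall n, (Z n.+1 <= (K * expR (n.+1%:R * p))%:E)%E) -> (growth Z <= p%:E)%E.
Proof.
move=> K0 Z0 ZK; apply/lee_addgt0Pr => e e0; apply: limn_esup_le; near=> n.
rewrite lee_pdivrMl// elog_le//; apply: (le_trans (ZK n)).
rewrite lee_fin mulrDr expRD [K * _]mulrC ler_wpM2l ?expR_ge0//.
rewrite -(lnK K0) ler_expR -ler_pdivrMr//.
near: n; exists (`|Num.ceil (ln K / e)|)%N => // n /= hn.
apply: (le_trans (ceil_ge _)); apply: (@le_trans _ _ (`|Num.ceil (ln K / e)|%:~R)).
  by rewrite ler_int ler_norm.
by rewrite -abszE -pmulrn ler_nat (leq_trans hn)//.
Unshelve. all: by end_near.
Qed.

End Growth.

Lemma esum_bigcup_disjoint (R : realType) (I T : choiceType) (K : set I) (J : I -> set T)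
    (f : T -> \bar R) : trivIset setT J -> (forall x, 0 <= f x)%E ->
  (\esum_(i in \bigcup_(k in K) (J k)) f i = \esum_(i in K) \esum_(j in J i) f j)%E.
Proof.
move=> tJ f0; rewrite esum_esum//; apply: reindex_esum => //; split.
- by move=> [/= i j] [Ki Jij]; exists i.
- move=> [/= i1 j1] [/= i2 j2]; rewrite ?inE/=.
  move=> [K1 J1] [K2 J2] j12; congr (_, _) => //.
  by apply: (@tJ i1 i2) => //; exists j1; split=> //; rewrite j12.
- by move=> j [i Ki Jij]/=; exists (i, j).
Qed.

Section Birkhoff.
Context {R : realType} {V : pointedType} (E : rel V) (theta : R).
Hypothesis theta01 : 0 < theta < 1.
Implicit Types (x y z : nat -> V) (f : (nat -> V) -> R).

Let theta0 : 0 < theta. Proof. by case/andP: theta01. Qed.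
Let theta1 : theta < 1. Proof. by case/andP: theta01. Qed.

Lemma birk0 f x : birk f 0 x = 0. Proof. by rewrite /birk big_ord0. Qed.

Lemma birkSr f n x : birk f n.+1 x = birk f n x + f (iter n (@sshift V) x).
Proof. by rewrite /birk big_ord_recr. Qed.

Lemma birkS f n x : birk f n.+1 x = f x + birk f n (sshift x).
Proof.
rewrite /birk big_ord_recl /=; congr (_ + _); apply: eq_bigr => i _.
by rewrite -iterSr.
Qed.

Definition wholder (A : R) f := forall n, (2 <= n)%N ->
  forall x y, TMS E x -> TMS E y -> agree n x y -> `|f x - f y| <= A * theta ^+ n.

Definition holderc (A : R) := A * theta / (1 - theta).

Lemma holderc_ge0 A : 0 <= A -> 0 <= holderc A.
Proof. by move=> A0; rewrite divr_ge0 ?mulr_ge0 ?subr_ge0 ?(ltW theta0) ?(ltW theta1). Qed.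

Lemma holderc_fix A : (A + holderc A) * theta = holderc A.
Proof. by rewrite /holderc; field; rewrite subr_eq0 gt_eqF. Qed.

Lemma birk_dist A f N m x y : 0 <= A -> wholder A f -> (1 <= m)%N -> TMS E x -> TMS E y ->
  agree (N + m) x y -> `|birk f N x - birk f N y| <= holderc A * theta ^+ m.
Proof.
move=> A0 wf; elim: N m => [|N IH] m m1 Ex Ey xy.
  by rewrite !birk0 subrr normr0 mulr_ge0 ?holderc_ge0 ?exprn_ge0 ?(ltW theta0).
rewrite !birkSr opprD addrACA (le_trans (ler_normD _ _))//.
have h1 := IH m.+1 isT Ex Ey; rewrite -addSnnS in h1.
have h2 := wf m.+1 m1 _ _ (TMS_iter N Ex) (TMS_iter N Ey).
apply: (le_trans (lerD (h1 xy) (h2 _))).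
  by have := @agree_iter _ N _ _ _ xy; rewrite addSnnS addKn.
by rewrite exprS !mulrA -!mulrDl [holderc A + A]addrC holderc_fix.
Qed.

Lemma wholder_regw A f : wholder A f -> regw E theta A (fun x => expR (f x)).
Proof.
move=> wf n x y n2 Ex Ey xy; rewrite -expRD ler_expR -lerBlDr.
by apply: (le_trans (ler_norm _)); apply: wf.
Qed.

Lemma wholder_sub A f (p : R) : wholder A f -> wholder A (fun x => f x - p).
Proof. by move=> wf n n2 x y Ex Ey xy; rewrite opprB addrA subrK; apply: wf. Qed.

Lemma birk_sub f (p : R) n x : birk (fun x => f x - p) n x = birk f n x - n%:R * p.
Proof. by rewrite /birk sumrB sumr_const card_ord mulr_natl. Qed.

Definition preset (a : V) (t : bool) N x : set (nat -> V) :=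
  [set y | [/\ TMS E y, iter N (@sshift V) y = x, y 0%N = a &
    t -> forall i, (0 < i < N)%N -> y i <> a]].

Definition perset (a : V) (t : bool) N : set (nat -> V) :=
  [set y | [/\ TMS E y, iter N (@sshift V) y = y, y 0%N = a &
    t -> forall i, (0 < i < N)%N -> y i <> a]].

Definition expbirk f N y : \bar R := (expR (birk f N y))%:E.

Definition presum f a t N x : \bar R := \esum_(y in preset a t N x) expbirk f N y.

Lemma presum_ge0 f a t N x : (0 <= presum f a t N x)%E.
Proof. by apply: esum_ge0 => y _; rewrite lee_fin expR_ge0. Qed.

Lemma presumS f a t N x : TMS E x -> (0 < N)%N ->
  presum f a t N.+1 x =
  (if t then taboo a (transfer E (fun x => expR (f x))) else transfer E (fun x => expR (f x)))
    (presum f a t N) x.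
Proof.
move=> Ex N0; set w := fun x => _.
pose C : set (nat -> V) := if t then ~` cyl1 a else setT.
rewrite [RHS](_ : _ = transfer E w (wmul \1_C (presum f a t N)) x); last first.
  rewrite {}/C; case: t => //; congr (transfer _ _ _ x); apply/funext => y.
  by rewrite wmul_in.
rewrite /transfer/preop.
pose Y b := if `[< C (bcons b x) >] then preset a t N (bcons b x) else set0.
transitivity (\esum_(b in [set b | E b (x 0%N)]) \esum_(y in Y b) expbirk f N.+1 y).
  rewrite -esum_bigcup_disjoint; last 2 first.
  - move=> b b' _ _ [y [yb yb']].
    have h b0 : Y b0 y -> iter N (@sshift V) y 0%N = b0.
      by rewrite /Y; case: asboolP => // _ [_ -> _ _].
    by rewrite -(h b)// (h b').
  - by move=> y; rewrite lee_fin expR_ge0.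
  congr esum; apply/seteqP; split => [y [Ey yx ya yt]|y [b /= bx]].
    exists (y N) => /=; first by have := Ey N; rewrite -yx iterS /sshift iter_sshiftE.
    have yN : iter N (@sshift V) y = bcons (y N) x.
      by rewrite -yx iterS -[LHS]bcons_sshift iter_sshiftE.
    rewrite /Y; case: asboolP => [_|]; first by split=> // tt i /andP[i0 iN]; apply: yt => //; rewrite i0 ltnW.
    by case; rewrite /C; have [tt|//] := boolP t; apply: (yt tt); rewrite N0 leqnn.
  rewrite /Y; case: asboolP => // Cb [Ey yx ya yt]; split => //; first by rewrite iterS yx.
  move=> tt i /andP[i0]; rewrite ltnS leq_eqVlt => /predU1P[->|iN]; last by apply: yt => //; rewrite i0.
  have -> : y N = b by rewrite -[N]add0n -iter_sshiftE yx.
  by move: Cb; rewrite /C tt.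
apply: eq_esum => b /= bx; rewrite /wmul /Y.
case: asboolP => Cb; last by rewrite esum_set0 indicE memNset//= mul0e mule0.
rewrite indicE mem_set//= mul1e /presum -esumZl ?expR_ge0//; last first.
  by move=> y; rewrite lee_fin expR_ge0.
apply: eq_esum => y [Ey yx _ _].
by rewrite /expbirk birkSr yx -EFinM -expRD addrC.
Qed.

Lemma presum1 f a t x : TMS E x ->
  presum f a t 1 x = entry a (transfer E (fun x => expR (f x))) (fun=> 1%E) x.
Proof.
move=> Ex; rewrite /entry/transfer/preop /presum.
pose Y b : set (nat -> V) := [set y | y = bcons b x /\ b = a].
transitivity (\esum_(b in [set b | E b (x 0%N)]) \esum_(y in Y b) expbirk f 1 y).
  rewrite -esum_bigcup_disjoint; last 2 first.
  - by move=> b b' _ _ [y [[/= -> _] [/= /(congr1 (fun z => z 0%N)) /=]]].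
  - by move=> y; rewrite lee_fin expR_ge0.
  congr esum; apply/seteqP; split => [y [Ey /= yx ya yt]|y [b /= bx [-> ba]]].
    exists a => /=; last by split=> //; rewrite -yx -ya bcons_sshift.
    by have := Ey 0%N; rewrite -yx ya.
  split => //; first exact: TMS_bcons.
  by move=> _ [].
apply: eq_esum => b /= bx; rewrite /wmul /Y.
have [ba|ba] := pselect (b = a).
  rewrite (_ : [set y | _] = [set bcons b x]); last by apply/seteqP; split => y /= => [[]|].
  rewrite esum_set1 ?lee_fin ?expR_ge0// indicE mem_set//= mul1e mule1.
  by rewrite /expbirk birkSr birk0 add0r.
rewrite (_ : [set y | _] = set0); last by apply/seteqP; split => y // [].
by rewrite esum_set0 indicE memNset//= mul0e mule0.
Qed.

Lemma presum_taboo f a N x : TMS E x ->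
  presum f a true N.+1 x =
  iter N (taboo a (transfer E (fun x => expR (f x)))) (entry a (transfer E (fun x => expR (f x))) (fun=> 1%E)) x.
Proof.
have pT := po_transfer E (w := fun x => expR (f x)) (fun x => expR_ge0 _).
elim: N x => [|N IH] x Ex; first by rewrite presum1.
rewrite presumS//= ; apply: (po_eq (po_taboo a pT)) => //.
- by move=> y; apply: presum_ge0.
- by apply: po_ge0 (po_iter (po_taboo a pT) N) _ _; apply: po_ge0 (po_entry a pT) _ _ => y.
Qed.

Lemma presum_iter f a N x : TMS E x ->
  presum f a false N.+1 x = iter N.+1 (transfer E (fun x => expR (f x))) (wmul \1_(cyl1 a) (fun=> 1%E)) x.
Proof.
have pT := po_transfer E (w := fun x => expR (f x)) (fun x => expR_ge0 _).
elim: N x => [|N IH] x Ex; first by rewrite presum1.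
rewrite presumS// iterS; apply: (po_eq pT) => //.
- by move=> y; apply: presum_ge0.
- by apply: po_ge0 (po_iter pT N.+1) _ _; apply: nneg_wmul.
Qed.

Lemma presum_perset A f a t N x : 0 <= A -> wholder A f -> TMS E x -> x 0%N = a -> (0 < N)%N ->
  (presum f a t N x <= (expR (holderc A))%:E * (\esum_(y in perset a t N) expbirk f N y) /\
   \esum_(y in perset a t N) expbirk f N y <= (expR (holderc A))%:E * presum f a t N x)%E.
Proof.
move=> A0 wf Ex xa N0.
pose per (y : nat -> V) : nat -> V := fun i => y (i %% N)%N.
have perN y i : y N = y 0%N -> (i <= N)%N -> per y i = y i.
  move=> yN; rewrite leq_eqVlt => /predU1P[->|iN]; first by rewrite /per modnn yN.
  by rewrite /per modn_small.
have perE y : y 0%N = y N -> TMS E y -> TMS E (per y).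
  move=> y0N Ey i; have -> : per y i.+1 = y ((i %% N).+1).
    rewrite /per -addn1 -modnDml addn1.
    have := ltn_pmod i N0; rewrite leq_eqVlt => /predU1P[->|h]; last by rewrite modn_small.
    by rewrite modnn.
  exact: Ey.
have preN y : preset a t N x y -> y N = a.
  by case=> _ yx _ _; rewrite -xa -yx iter_sshiftE.
have bij : set_bij (preset a t N x) (perset a t N) per.
  split.
  - move=> y yp; have yN := preN _ yp; case: yp => Ey yx ya yt; split.
    + by apply: perE => //; rewrite ya.
    + by apply/funext => i; rewrite iter_sshiftE /per modnDr.
    + by rewrite /per mod0n.
    + by move=> tt i /andP[i0 iN]; rewrite perN ?(ltnW iN)//; [apply: yt => //; rewrite i0|rewrite yN].
  - move=> y y' /set_mem yp /set_mem yp' yy; apply/funext => i.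
    have [iN|Ni] := ltnP i N.
      by have := congr1 (fun z => z i) yy; rewrite /per modn_small.
    case: yp => _ yx _ _; case: yp' => _ yx' _ _.
    by rewrite -(subnK Ni) -!iter_sshiftE yx yx'.
  - move=> z [Ez zp za zt].
    have zN : z N = a by rewrite -za -{2}zp iter_sshiftE.
    have zper k : z (k %% N)%N = z k.
      rewrite {2}(divn_eq k N); elim: (k %/ N)%N => [|q IH]; first by rewrite mul0n add0n.
      by rewrite IH -{1}zp iter_sshiftE; congr (z _); rewrite mulSn -[in RHS]addnA [RHS]addnC.
    exists (fun i => if (i < N)%N then z i else x (i - N)%N); last first.
      by apply/funext => i; rewrite /per ltn_pmod// zper.
    split.
    + move=> i; have [iN|Ni] := ltnP i.+1 N; first by rewrite (ltnW iN); apply: Ez.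
      have [iN|Ni'] := ltnP i N; last by rewrite subSn//; apply: Ex.
      have -> : i.+1 = N by apply/eqP; rewrite eqn_leq iN Ni.
      rewrite subnn xa -zN; have -> : N = i.+1 by apply/eqP; rewrite eqn_leq iN Ni.
      exact: Ez.
    + by apply/funext => i; rewrite iter_sshiftE ltnNge leq_addl/= addnK.
    + by rewrite N0.
    + by move=> tt i /andP[i0 iN]; rewrite iN; apply: zt => //; rewrite i0.
rewrite (reindex_esum _ _ _ _ bij) /presum.
have H y : preset a t N x y ->
    `|birk f N y - birk f N (per y)| <= holderc A.
  move=> yp; have yN := preN _ yp; case: yp => Ey yx ya yt.
  apply: (le_trans (@birk_dist A f N 1 y (per y) A0 wf isT Ey _ _)).
  - by apply: perE => //; rewrite ya.
  - by move=> i; rewrite addn1 ltnS => iN; rewrite perN// yN.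
  - by rewrite expr1 ler_piMr// ?holderc_ge0 ?(ltW theta1).
split; (rewrite -esumZl ?expR_ge0//; last by move=> y; rewrite lee_fin expR_ge0); apply: le_esum => y /H;
  rewrite ler_norml => /andP[h1 h2]; rewrite /expbirk -EFinM -expRD lee_fin ler_expR; lra.
Qed.

End Birkhoff.

(** * The eigenfunction of a strongly positive recurrent potential *)

Section MoreOperators.
Context {R : realType} {X : Type} (D : set X).
Implicit Types (F G : X -> \bar R).
Variable T : (X -> \bar R) -> X -> \bar R.
Hypothesis pT : posop D T.

Lemma po_mono_lim (F : nat -> X -> \bar R) G x (B : \bar R) : D x ->
  (forall n, nneg (F n)) -> nneg G -> (forall n y, F n y <= F n.+1 y)%E ->
  (forall y, D y -> forall b, (forall n, F n y <= b)%E -> (G y <= b)%E) ->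
  (forall n, T (F n) x <= B)%E -> (T G x <= B)%E.
Proof.
move=> Dx F0 G0 Fm FG TB.
pose d n y : \bar R := if F n y \is a fin_num then (F n.+1 y - F n y)%E else 0%E.
have d0 n : nneg (d n).
  by move=> y; rewrite /d; case: ifPn => // fn; rewrite sube_ge0 ?Fm ?fn.
have dS n y : (F n.+1 y = F n y + d n y)%E.
  rewrite /d; case: ifPn => fn; first by rewrite addeC subeK.
  have Fny : F n y = +oo%E.
    by move: fn (F0 n y); case: (F n y).
  by apply/eqP; rewrite Fny eq_le leey -{1}Fny adde0 Fny -Fny Fm.
have FE n y : (F n y = F 0%N y + \sum_(0 <= k < n) d k y)%E.
  elim: n => [|n IH]; first by rewrite big_geq// adde0.
  by rewrite big_nat_recr//= addeA -IH dS.
pose S y := (F 0%N y + \sum_(n <oo) d n y)%E.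
have S0 : nneg S by move=> y; rewrite adde_ge0 ?F0//; apply: nneseries_ge0 => n _ _; apply: d0.
have GS y : D y -> (G y <= S y)%E.
  move=> Dy; apply: FG => // n; rewrite FE leeD2l//.
  by apply: nneseries_lim_ge => k _ _; apply: d0.
apply: (le_trans (po_le pT G0 S0 GS Dx)).
rewrite (po_add pT (F0 0%N)); last by move=> y; apply: nneseries_ge0 => n _ _; apply: d0.
rewrite (po_sum pT)//.
have TF n : (T (F n) x = T (F 0%N) x + \sum_(0 <= k < n) T (d k) x)%E.
  rewrite -(po_fsum pT)// -(po_add pT)//; last by move=> y; apply: sume_ge0 => k _; apply: d0.
  by congr (T _ x); apply/funext => y; rewrite FE.
have Td0 n : (0 <= T (d n) x)%E by apply: (po_ge0 pT).
have cv : ((fun n => T (F 0%N) x + \sum_(0 <= k < n) T (d k) x)%E @ \oo -->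
    (T (F 0%N) x + \sum_(k <oo) T (d k) x)%E).
  apply: cvgeD; [|exact: cvg_cst|exact: is_cvg_nneseries].
  apply: ge0_adde_def; rewrite !inE; first exact: (po_ge0 pT).
  exact: nneseries_ge0.
rewrite -(cvg_lim _ cv)//; apply: lime_le; first by apply/cvg_ex; exists (T (F 0%N) x + \sum_(k <oo) T (d k) x)%E.
by apply: nearW => n; rewrite -TF.
Qed.

End MoreOperators.

Section Bounds.
Context {R : realType}.

Lemma eventually_bounded (u : nat -> \bar R) (v : nat -> R) :
  (forall n, 0 <= u n)%E -> (forall n, u n < +oo)%E -> (forall n, 0 < v n) ->
  (\forall n \near \oo, (u n <= (v n)%:E)%E) ->
  exists2 K : R, 0 < K & forall n, (u n <= (K * v n)%:E)%E.
Proof.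
move=> u0 uoo v0 [N _ uv].
pose K := 1 + \sum_(0 <= k < N) fine (u k) / v k.
have t0 k : 0 <= fine (u k) / v k by rewrite divr_ge0 ?fine_ge0// ltW.
have K1 : 1 <= K by rewrite lerDl sumr_ge0.
exists K => [|n]; first exact: lt_le_trans K1.
have [nN|Nn] := ltnP n N; last first.
  by apply: (le_trans (uv n Nn)); rewrite lee_fin ler_peMl// ltW.
have -> : u n = (fine (u n))%:E by rewrite fineK// ge0_fin_numE.
rewrite lee_fin -ler_pdivrMr// /K (bigD1_seq n)/= ?mem_index_iota ?iota_uniq//.
  by rewrite addrCA lerDl addr_ge0// sumr_ge0.
Qed.

Lemma expR_sub1_le (x : R) : expR x - 1 <= x * expR x.
Proof.
have := expR_ge1Dx (- x); rewrite expRN => h.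
rewrite -(ler_pM2r (x := (expR x)^-1)) ?invr_gt0 ?expR_gt0//.
rewrite mulrBl divff ?gt_eqF ?expR_gt0// mulfK ?gt_eqF ?expR_gt0//.
by rewrite mul1r; lra.
Qed.

Lemma geometric_nneseries (K q : R) : 0 <= K -> 0 <= q < 1 ->
  (\sum_(n <oo) (K * q ^+ n)%:E = (K / (1 - q))%:E)%E.
Proof.
move=> K0 /andP[q0 q1]; apply/cvg_lim => //.
have -> : (fun n => \sum_(0 <= k < n) (K * q ^+ k)%:E)%E =
   EFin \o (series (geometric K q)).
  by apply/funext => n /=; rewrite /series /geometric /= sumEFin.
apply: cvg_EFin; first exact: nearW.
by apply: cvg_geometric_series; rewrite ger0_norm.
Qed.

End Bounds.

Section Pressure.
Context {R : realType} {V : pointedType} (E : rel V) (theta : R).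
Hypothesis theta01 : 0 < theta < 1.
Hypothesis mixE : top_mixing E.
Variables (phi : (nat -> V) -> R) (A C P : R) (a : V).
Hypothesis A0 : 0 <= A.
Hypothesis phiA : wholder E theta A phi.
Hypothesis phiC : forall x, TMS E x -> phi x <= C.
Hypothesis entropy_fin : (PG E (fun _ : nat -> V => 0%R : R) a < +oo)%E.
Hypothesis PGE : PG E phi a = P%:E.
Hypothesis SPRa : (growth (Zfirst E phi a) < PG E phi a)%E.
Implicit Types (x y z : nat -> V) (F G : (nat -> V) -> \bar R) (p q : R).

Let theta0 : 0 < theta. Proof. by case/andP: theta01. Qed.
Let theta1 : theta < 1. Proof. by case/andP: theta01. Qed.
Local Notation c := (holderc theta A).
Let c0 : 0 <= c. Proof. exact: holderc_ge0. Qed.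

Lemma ZperE f n : Zper E f a n = (\esum_(y in perset E a false n) expbirk f n y)%E :> \bar R.
Proof. by congr esum; apply/seteqP; split => x [] //. Qed.

Lemma ZfirstE f n : Zfirst E f a n = (\esum_(y in perset E a true n) expbirk f n y)%E :> \bar R.
Proof.
by congr esum; apply/seteqP; split => x [h1 h2 h3 h4]; split => //; apply: h4.
Qed.

Lemma expbirk_ge0 (f : (nat -> V) -> R) n y : (0 <= expbirk f n y)%E.
Proof. by rewrite lee_fin expR_ge0. Qed.

Lemma perset_ge0 (f : (nat -> V) -> R) t n : (0 <= \esum_(y in perset E a t n) expbirk f n y)%E.
Proof. by apply: esum_ge0 => y _; apply: expbirk_ge0. Qed.

Lemma le_esum_subset (I J : set (nat -> V)) (g : (nat -> V) -> \bar R) : I `<=` J -> nneg g ->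
  (\esum_(y in I) g y <= \esum_(y in J) g y)%E.
Proof.
move=> IJ g0; rewrite [leRHS](esumID I)//; rewrite setIidr// leeDl//.
exact: esum_ge0.
Qed.

Lemma perset_sub_mul n j : perset E a false n `<=` perset E a false (n * j).
Proof.
move=> z [Ez zp za _]; split=> //.
elim: j => [|j IH]; first by rewrite muln0.
by rewrite mulnS iterD IH zp.
Qed.

Lemma perset_sub_taboo n : perset E a true n `<=` perset E a false n.
Proof. by move=> z [Ez zp za _]; split. Qed.

Lemma expbirk_zero n y : expbirk (fun=> 0 : R) n y = 1%E.
Proof. by rewrite /expbirk /birk big1// expR0. Qed.

Lemma expbirk_le n y : TMS E y ->
  (expbirk phi n y <= (expR (n%:R * C))%:E * expbirk (fun=> 0%R) n y)%E.
Proof.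
move=> Ey; rewrite expbirk_zero mule1 lee_fin ler_expR /birk.
rewrite -[n in n%:R]card_ord -sumr_const mulr_suml ler_sum// => i _.
by rewrite mul1r; apply: phiC; apply: TMS_iter.
Qed.

Lemma perset_zero_bound : exists2 k : R, 0 <= k & exists2 K : R, 0 < K & forall n,
  (\esum_(y in perset E a false n.+1) expbirk (fun=> 0%R) n.+1 y <= (K * expR (n.+1%:R * k))%:E :> \bar R)%E.
Proof.
have Z0 n : (0 <= Zper E (fun=> 0%R : R) a n)%E by rewrite ZperE perset_ge0.
have [q _ [N _ qZ]] := growth_lt Z0 entropy_fin.
have E1 m : (\esum_(y in perset E a false m) expbirk (fun=> 0%R : R) m y =
    \esum_(y in perset E a false m) 1)%E.
  by apply: eq_esum => y _; exact: expbirk_zero.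
exists (Num.max q 0); first by rewrite le_max lexx orbT.
apply: eventually_bounded.
- by move=> n; apply: perset_ge0.
- move=> n; have := qZ ((n.+1 * N.+1).-1).
  rewrite prednK ?muln_gt0// ZperE => /(_ _)/= h.
  apply: le_lt_trans (le_lt_trans (h _) (ltry _)).
    have := @le_esum_subset _ _ (fun=> 1%E) (@perset_sub_mul n.+1 N.+1) (fun=> lee01).
    by rewrite !E1.
  by rewrite plusE leq_addr.
- by move=> n; apply: expR_gt0.
- exists N => // n Nn /=; rewrite -ZperE; apply: le_trans (qZ n Nn) _.
  by rewrite lee_fin ler_expR ler_wpM2l// le_max lexx.
Qed.

Lemma perset_phi_ltoo t n : (\esum_(y in perset E a t n.+1) expbirk phi n.+1 y < +oo)%E.
Proof.
have [k k0 [K K0 kK]] := perset_zero_bound.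
apply: (@le_lt_trans _ _ (\esum_(y in perset E a false n.+1) expbirk phi n.+1 y)%E).
  apply: le_esum_subset; last by move=> y; apply: expbirk_ge0.
  by case: t => //; apply: perset_sub_taboo.
apply: (@le_lt_trans _ _ ((expR (n.+1%:R * C))%:E * \esum_(y in perset E a false n.+1) expbirk (fun=> 0%R) n.+1 y)%E).
  rewrite -esumZl ?expR_ge0//; last by move=> y; apply: expbirk_ge0.
  by apply: le_esum => y [Ey _ _ _]; apply: expbirk_le.
apply: (@le_lt_trans _ _ ((expR (n.+1%:R * C))%:E * (K * expR (n.+1%:R * k))%:E)%E).
  by apply: lee_wpmul2l; rewrite ?lee_fin ?expR_ge0.
by rewrite -EFinM ltry.
Qed.

Lemma taboo_bound : exists2 p1 : R, p1 < P & exists2 K : R, 0 < K & forall n x,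
  TMS E x -> x 0%N = a -> (presum E phi a true n.+1 x <= (K * expR (n.+1%:R * p1))%:E)%E.
Proof.
have Z0 n : (0 <= Zfirst E phi a n)%E by rewrite ZfirstE perset_ge0.
have [q qP qZ] := growth_lt Z0 SPRa.
exists q; first by rewrite PGE lte_fin in qP.
have qZ' : \forall n \near \oo, (\esum_(y in perset E a true n.+1) expbirk phi n.+1 y <= (expR (n.+1%:R * q))%:E)%E.
  by move: qZ; apply: filterS => n; rewrite ZfirstE.
have [K K0 H] := eventually_bounded (fun n => perset_ge0 phi true n.+1) (fun n => perset_phi_ltoo true n)
  (fun n => expR_gt0 _) qZ'.
exists (expR c * K); first by rewrite mulr_gt0 ?expR_gt0.
  move=> n x Ex xa; have [h _] := presum_perset theta01 true A0 phiA Ex xa (ltn0Sn n).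
  apply: (le_trans h); rewrite -mulrA EFinM; apply: lee_wpmul2l; rewrite ?lee_fin ?expR_ge0//.
Qed.

Lemma wholder0 : wholder E theta A (fun=> 0).
Proof. by move=> n n2 x y _ _ _; rewrite subrr normr0 mulr_ge0// exprn_ge0// ltW. Qed.

Lemma taboo_zero_bound : exists2 k : R, 0 <= k & exists2 K : R, 0 < K & forall n x,
  TMS E x -> x 0%N = a -> (presum E (fun=> 0%R) a true n.+1 x <= (K * expR (n.+1%:R * k))%:E)%E.
Proof.
have [k k0 [K K0 kK]] := perset_zero_bound; exists k => //.
exists (expR c * K); first by rewrite mulr_gt0 ?expR_gt0.
move=> n x Ex xa; have [h _] := presum_perset theta01 true A0 wholder0 Ex xa (ltn0Sn n).
apply: (le_trans h); rewrite -mulrA EFinM; apply: lee_wpmul2l; rewrite ?lee_fin ?expR_ge0//.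
apply: le_trans (kK n); apply: le_esum_subset; first exact: perset_sub_taboo.
by move=> y; apply: expbirk_ge0.
Qed.

Lemma return_bound p : P < p -> exists2 q : R, q < p & exists2 K : R, 0 < K & forall n x,
  TMS E x -> x 0%N = a -> (presum E phi a false n.+1 x <= (K * expR (n.+1%:R * q))%:E)%E.
Proof.
move=> Pp; have Z0 n : (0 <= Zper E phi a n)%E by rewrite ZperE perset_ge0.
have Pp' : (growth (Zper E phi a) < p%:E)%E by rewrite -/(PG E phi a) PGE lte_fin.
have [q qP qZ] := growth_lt Z0 Pp'.
exists q; first by rewrite lte_fin in qP.
have qZ' : \forall n \near \oo, (\esum_(y in perset E a false n.+1) expbirk phi n.+1 y <= (expR (n.+1%:R * q))%:E)%E.
  by move: qZ; apply: filterS => n; rewrite ZperE.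
have [K K0 H] := eventually_bounded (fun n => perset_ge0 phi false n.+1) (fun n => perset_phi_ltoo false n)
  (fun n => expR_gt0 _) qZ'.
exists (expR c * K); first by rewrite mulr_gt0 ?expR_gt0.
  move=> n x Ex xa; have [h _] := presum_perset theta01 false A0 phiA Ex xa (ltn0Sn n).
  apply: (le_trans h); rewrite -mulrA EFinM; apply: lee_wpmul2l; rewrite ?lee_fin ?expR_ge0//.
Qed.

Definition wphi p x : R := expR (phi x - p).
Definition LP p := transfer E (wphi p).

Lemma wphi_ge0 p x : 0 <= wphi p x. Proof. exact: expR_ge0. Qed.

Lemma po_LP p : posop (TMS E) (LP p).
Proof. by apply: po_transfer => x; apply: wphi_ge0. Qed.

Lemma regw_wphi p : regw E theta A (wphi p).
Proof. by apply: wholder_regw; apply: wholder_sub. Qed.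

Lemma presum_shift p t N x :
  presum E (fun x => phi x - p) a t N x = ((expR (- (N%:R * p)))%:E * presum E phi a t N x)%E.
Proof.
rewrite /presum -esumZl ?expR_ge0//; last by move=> y; apply: expbirk_ge0.
by apply: eq_esum => y _; rewrite /expbirk birk_sub -EFinM -expRD addrC.
Qed.

Definition one_a : (nat -> V) -> \bar R := wmul \1_(cyl1 a) (fun=> 1%E).
Lemma one_a_ge0 : nneg one_a. Proof. by apply: nneg_wmul. Qed.

Lemma iter_LP p N x : TMS E x ->
  iter N.+1 (LP p) one_a x = ((expR (- (N.+1%:R * p)))%:E * presum E phi a false N.+1 x)%E.
Proof. by move=> Ex; rewrite -presum_shift presum_iter. Qed.

Lemma iter_taboo_LP p N x : TMS E x ->
  iter N (taboo a (LP p)) (entry a (LP p) (fun=> 1%E)) x =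
  ((expR (- (N.+1%:R * p)))%:E * presum E phi a true N.+1 x)%E.
Proof. by move=> Ex; rewrite -presum_shift presum_taboo. Qed.

Lemma supersolution p U x : nneg U -> (forall y, TMS E y -> (one_a y + LP p U y <= U y)%E) ->
  TMS E x -> x 0%N = a -> (U x < +oo)%E -> P <= p.
Proof.
move=> U0 hU Ex xa Ux.
have H := resolvent_min (po_LP p) one_a_ge0 U0 hU Ex.
have Hn N : (iter N.+1 (LP p) one_a x <= U x)%E.
  apply: le_trans H; rewrite /resolvent.
  apply: (@le_trans _ _ (\sum_(0 <= i < N.+2) iter i (LP p) one_a x)%E).
    rewrite big_nat_recr//= leeDr//; apply: sume_ge0 => i _.
    exact: po_ge0 (po_iter (po_LP p) i) _ one_a_ge0 _.
  by apply: nneseries_lim_ge => i _ _; exact: po_ge0 (po_iter (po_LP p) i) _ one_a_ge0 _.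
have Uf : U x = (fine (U x))%:E by rewrite fineK// ge0_fin_numE.
rewrite -lee_fin -PGE; apply: (@growth_le _ _ (expR c * (fine (U x) + 1))).
- by rewrite mulr_gt0 ?expR_gt0// ltr_pwDr// fine_ge0.
- by move=> n; rewrite ZperE perset_ge0.
move=> n; rewrite ZperE.
have [_ h] := presum_perset theta01 false A0 phiA Ex xa (ltn0Sn n).
apply: (le_trans h); rewrite -mulrA EFinM; apply: lee_wpmul2l; rewrite ?lee_fin ?expR_ge0//.
have := Hn n; rewrite iter_LP// expRN -lee_pdivlMl ?invr_gt0 ?expR_gt0// invrK.
move=> h'; apply: (le_trans h'); rewrite Uf -EFinM lee_fin mulrC ler_wpM2r ?expR_ge0//.
by rewrite lerDl.
Qed.

Definition green p := resolvent (LP p) one_a.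

Lemma green_ge0 p : nneg (green p).
Proof. exact: po_ge0 (po_resolvent (po_LP p)) _ one_a_ge0. Qed.

Lemma cstable : stable theta A c.
Proof. by rewrite /stable holderc_fix. Qed.

Lemma reg_one_a : reg E theta c one_a.
Proof.
apply: reg_wmul => //; first by move=> x y; rewrite /cyl1/= => ->.
exact: reg_cst.
Qed.

Lemma reg_green p : reg E theta c (green p).
Proof.
apply: (@reg_resolvent _ _ _ _ theta01 _ A) => //; [exact: po_LP| |exact: cstable|exact: one_a_ge0|exact: reg_one_a].
move=> c' F F0 rF; apply: reg_transfer => //; [exact: wphi_ge0|exact: regw_wphi].
Qed.

Lemma green_ltoo p x : P < p -> TMS E x -> x 0%N = a -> (green p x < +oo)%E.
Proof.
move=> Pp Ex xa; have [q qp [K K0 H]] := return_bound Pp.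
have I0 i : (0 <= iter i (LP p) one_a x)%E by exact: po_ge0 (po_iter (po_LP p) i) _ one_a_ge0 _.
have -> : green p x = (one_a x + \sum_(n <oo) iter n.+1 (LP p) one_a x)%E.
  rewrite /green (resolventE (po_LP p) _ one_a_ge0) /resolvent (po_sum (po_LP p))// => n.
  exact: po_ge0 (po_iter (po_LP p) n) _ one_a_ge0.
rewrite lte_add_pinfty//; first by rewrite /one_a wmul_in// ltry.
set r := expR (q - p).
have r01 : 0 <= r < 1 by rewrite expR_ge0/= -expR0 ltr_expR subr_lt0.
apply: (@le_lt_trans _ _ (\sum_(n <oo) ((K * r) * r ^+ n)%:E)%E).
  apply: lee_nneseries => n *; first exact: I0.
  rewrite iter_LP//; apply: (@le_trans _ _ ((expR (- (n.+1%:R * p)))%:E * (K * expR (n.+1%:R * q))%:E)%E).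
    by apply: lee_wpmul2l; rewrite ?lee_fin ?expR_ge0// H.
  rewrite -EFinM lee_fin mulrCA -expRD -mulrA -exprS /r -expRM_natl -mulr_natl.
  by rewrite mulrBr addrC.
by rewrite geometric_nneseries ?ltry// mulr_ge0 ?expR_ge0// ltW.
Qed.

Lemma wphi_shift p q y : wphi p y = expR (q - p) * wphi q y.
Proof. by rewrite /wphi -expRD; congr expR; ring. Qed.

Lemma LP_shift p q F x : nneg F -> LP p F x = ((expR (q - p))%:E * LP q F x)%E.
Proof.
move=> F0; rewrite /LP /transfer -(po_scale (po_preop E)) ?expR_ge0//; last first.
  by apply: po_ge0 (po_wmul (TMS E) (wphi_ge0 q)) _ F0.
congr (preop _ _ x); apply/funext => y.
by rewrite /wmul (wphi_shift p q) EFinM muleA.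
Qed.

Lemma iter_taboo_shift p q F n x : nneg F ->
  iter n (taboo a (LP p)) (entry a (LP p) F) x =
  ((expR (n.+1%:R * (q - p)))%:E * iter n (taboo a (LP q)) (entry a (LP q) F) x)%E.
Proof.
move=> F0; elim: n x => [|n IH] x /=.
  by rewrite mul1r /entry (LP_shift p q)//; apply: nneg_wmul.
have pq := po_taboo a (po_LP q).
have E0 : nneg (entry a (LP q) F) by apply: po_ge0 (po_entry a (po_LP q)) _ F0.
have I0 : nneg (iter n (taboo a (LP q)) (entry a (LP q) F)) by exact: po_ge0 (po_iter pq n) _ E0.
rewrite (_ : iter n (taboo a (LP p)) _ = fun y => ((expR (n.+1%:R * (q - p)))%:E *
    iter n (taboo a (LP q)) (entry a (LP q) F) y)%E); last exact/funext.
rewrite (po_scale (po_taboo a (po_LP p))) ?expR_ge0//.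
rewrite {1}/taboo (LP_shift p q); last exact: nneg_wmul.
rewrite muleA -EFinM -expRD; congr (_ * _)%E; congr (expR _)%:E.
by rewrite -[n.+2]addn1 natrD mulrDl mul1r.
Qed.

(* The decreasing family of infima of normalised Green functions as [p] decreases to [P];
   its supremum is [LP P]-superharmonic. *)
Lemma superharmonic_ex x1 : TMS E x1 -> x1 0%N = a ->
  exists s : (nat -> V) -> \bar R, [/\ nneg s, reg E theta c s,
    forall x, TMS E x -> (LP P s x <= s x)%E,
    forall x, TMS E x -> x 0%N = a -> (s x <= (expR c)%:E)%E &
    forall x, TMS E x -> x 0%N = a -> ((expR (- c))%:E <= s x)%E].
Proof.
move=> Ex1 x1a.
pose p (j : nat) := P + j.+1%:R^-1.
have Pp j : P < p j by rewrite ltrDl invr_gt0.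
pose g j := fine (green (p j) x1).
have gE j : green (p j) x1 = (g j)%:E.
  by rewrite /g fineK// ge0_fin_numE ?green_ltoo// green_ge0.
have g1 j : 1 <= g j.
  rewrite -lee_fin -gE /green (resolventE (po_LP (p j)) _ one_a_ge0).
  rewrite {1}/one_a wmul_in// leeDl//; apply: (po_ge0 (po_LP _)); exact: green_ge0.
have g0 j : 0 < g j by apply: lt_le_trans (g1 j).
pose h j x := ((g j)^-1%:E * green (p j) x)%E.
have h0 j : nneg (h j) by move=> x; rewrite mule_ge0 ?green_ge0// lee_fin invr_ge0 ltW.
have hreg j : reg E theta c (h j) by apply: reg_scale; [rewrite invr_ge0 ltW|exact: reg_green].
have hsup j x : TMS E x -> (LP (p j) (h j) x <= h j x)%E.
  move=> Ex; rewrite /h (po_scale (po_LP _)) ?invr_ge0 ?(ltW (g0 j))//; last exact: green_ge0.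
  apply: lee_wpmul2l; first by rewrite lee_fin invr_ge0 ltW.
  rewrite {2}/green (resolventE (po_LP (p j)) _ one_a_ge0) leeDr//.
  exact: one_a_ge0.
pose I j x := ereal_inf [set h i x | i in [set i | (j <= i)%N]].
have I0 j : nneg (I j).
  by move=> x; apply: le_ereal_inf_tmp => _ [i _ <-]; apply: h0.
have Ih i j x : (j <= i)%N -> (I j x <= h i x)%E.
  by move=> ji; apply: ereal_inf_lbound; exists i.
have Im j x : (I j x <= I j.+1 x)%E.
  by apply: le_ereal_inf_tmp => _ [i ji <-]; apply: Ih; apply: ltnW.
have Ireg j : reg E theta c (I j).
  move=> n x y n1 Ex Ey xy; rewrite -lee_pdivrMl ?expR_gt0//.
  apply: le_ereal_inf_tmp => _ [i ji <-]; rewrite lee_pdivrMl ?expR_gt0//.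
  by apply: (le_trans (Ih i j x ji)); apply: hreg.
pose s x := ereal_sup (range (I ^~ x)).
have Is j x : (I j x <= s x)%E by apply: ereal_sup_ubound; exists j.
have s0 : nneg s by move=> x; apply: le_trans (Is 0%N x); apply: I0.
have ImW j k x : (j <= k)%N -> (I j x <= I k x)%E.
  move=> /subnK <-; elim: (k - j)%N => [//|d IH]; rewrite addSn; exact: le_trans (Im _ _).
exists s; split => //.
- move=> n x y n1 Ex Ey xy; apply: ge_ereal_sup => _ [j _ <-].
  apply: (le_trans (Ireg j n x y n1 Ex Ey xy)); apply: lee_wpmul2l => //.
- move=> x Ex.
  have H k : (LP P s x <= (expR (k.+1%:R^-1))%:E * s x)%E.
    apply: (po_mono_lim (po_LP P) (F := fun j => I (k + j)%N) Ex) => //.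
    + by move=> j y; rewrite addnS.
    + move=> y Ey b hb; apply: ge_ereal_sup => _ [j _ <-].
      by apply: le_trans (hb j); apply: ImW; rewrite leq_addl.
    + move=> j; apply: (@le_trans _ _ ((expR (k.+1%:R^-1))%:E * I (k + j)%N x)%E); last first.
        by apply: lee_wpmul2l => //; rewrite lee_fin expR_ge0.
      rewrite -lee_pdivrMl ?expR_gt0//; apply: le_ereal_inf_tmp => _ [i /= ji <-].
      rewrite lee_pdivrMl ?expR_gt0//.
      apply: (@le_trans _ _ (LP P (h i) x)).
        by apply: (po_le (po_LP P)) => // y Ey; apply: Ih.
      rewrite (LP_shift P (p i))//.
      have -> : p i - P = i.+1%:R^-1 by rewrite /p addrAC subrr add0r.
      apply: lee_pmul.
      * by rewrite lee_fin expR_ge0.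
      * exact: (po_ge0 (po_LP (p i))).
      * rewrite lee_fin ler_expR lef_pV2 ?posrE// ler_nat ltnS.
        by apply: leq_trans ji; rewrite leq_addr.
      * exact: hsup.
  have [sx|sx] := eqVneq (s x) +oo%E; first by rewrite sx leey.
  have sf : s x \is a fin_num by rewrite ge0_fin_numE// lt_neqAle sx leey.
  have Lf : LP P s x \is a fin_num.
    rewrite ge0_fin_numE ?(po_ge0 (po_LP P))//; apply: le_lt_trans (H 0%N) _.
    by rewrite -(fineK sf) -EFinM ltry.
  rewrite -(fineK sf) -(fineK Lf) lee_fin.
  have H' k : fine (LP P s x) <= expR (k.+1%:R^-1) * fine (s x).
    by rewrite -lee_fin EFinM !fineK.
  have cv : (fun k : nat => expR (k.+1%:R^-1) * fine (s x)) @ \oo --> expR 0 * fine (s x).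
    apply: cvgM; last exact: cvg_cst.
    by apply: (cvg_comp _ _ (@cvg_harmonic R)); exact: continuous_expR.
  rewrite expR0 mul1r in cv; rewrite -(cvg_lim _ cv)//.
  apply: limr_ge; first by apply/cvg_ex; exists (fine (s x)).
  exact: nearW.
- move=> x Ex xa; apply: ge_ereal_sup => _ [j _ <-]; apply: (le_trans (Ih j j x (leqnn j))).
  rewrite /h lee_pdivrMl//.
  apply: (le_trans (reg_compare theta01 (@green_ge0 (p j)) c0 (@reg_green (p j)) Ex Ex1 _)); first by rewrite xa.
  by rewrite gE muleC.
- move=> x Ex xa; apply: le_trans (Is 0%N x); apply: le_ereal_inf_tmp => _ [j _ <-].
  rewrite /h lee_pdivlMl// -EFinM mulrC expRN EFinM -lee_pdivlMl ?invr_gt0 ?expR_gt0// invrK.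
  have := reg_compare theta01 (@green_ge0 (p j)) c0 (@reg_green (p j)) Ex1 Ex _.
  by rewrite gE; apply; rewrite xa.
Qed.

Definition LL p := loopop a (LP p).

Lemma po_LL p : posop (TMS E) (LL p).
Proof. exact: po_loop (po_LP p). Qed.

Lemma LL_superharmonic p s x : nneg s -> (forall x, TMS E x -> (LP p s x <= s x)%E) ->
  TMS E x -> (LL p s x <= s x)%E.
Proof.
move=> s0 sS; apply: (resolvent_min (po_taboo a (po_LP p))) => //.
  exact: po_ge0 (po_entry a (po_LP p)) _ s0.
by move=> y Ey; rewrite addeC -(taboo_entry a (po_LP p))//; apply: sS.
Qed.

Lemma LL_iter_eq p n F G x : nneg F -> nneg G ->
  (forall y, TMS E y -> y 0%N = a -> F y = G y) ->
  TMS E x -> x 0%N = a -> iter n (LL p) F x = iter n (LL p) G x.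
Proof.
move=> F0 G0 FG Ex xa; elim: n x Ex xa => [|n IH] x Ex xa /=; first exact: FG.
apply: (loop_eq (po_LP p)) => //.
- exact: po_ge0 (po_iter (po_LL p) n) _ F0.
- exact: po_ge0 (po_iter (po_LL p) n) _ G0.
Qed.

Lemma reg_LL p F : nneg F -> reg E theta c F -> reg E theta c (LL p F).
Proof.
move=> F0 rF; rewrite -[X in reg _ _ X _](holderc_fix theta01 A).
apply: reg_loop => //; [exact: wphi_ge0|exact: regw_wphi|].
by rewrite holderc_fix//; exact: cstable.
Qed.

Lemma LL_excess_bound p V0 (d : R) : 0 < d -> nneg V0 ->
  (forall x, TMS E x -> x 0%N = a -> (LL p V0 x + d%:E <= V0 x)%E) ->
  (forall x, TMS E x -> x 0%N = a -> (V0 x < +oo)%E) -> P <= p.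
Proof.
move=> d0 V00 hV Voo.
pose U x := ((d^-1)%:E * V0 x)%E.
have U0 : nneg U by move=> x; rewrite mule_ge0// lee_fin invr_ge0 ltW.
pose W x := if x 0%N == a then U x else LL p U x.
have LU0 : nneg (LL p U) by exact: po_ge0 (po_LL p) _ U0.
have W0 : nneg W by move=> x; rewrite /W; case: ifP.
have [x1 Ex1 x1a] := TMS_ex mixE a.
apply: (@supersolution p W x1) => //; last first.
  rewrite /W x1a eqxx /U; apply: lte_mul_pinfty => //; first by rewrite lee_fin invr_ge0 ltW.
  exact: Voo.
have LW y : TMS E y -> LP p W y = LL p U y.
  move=> Ey; rewrite (taboo_entry a (po_LP p))// [RHS](loopE a (po_LP p))// addeC; congr (_ + _)%E.
    by apply: (entry_eq (po_LP p)) => // z Ez za; rewrite /W za eqxx.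
  apply: (po_eq (po_LP p)) => //; [exact: nneg_wmul..|] => z Ez.
  have [za|za] := eqVneq (z 0%N) a; first by rewrite !wmul_notin// => /(_ za).
  by rewrite !wmul_in /W ?(negbTE za)//; apply/eqP.
move=> y Ey; rewrite LW// /W; case: eqVneq => ya.
  rewrite /one_a wmul_in// /U (po_scale (po_LL p)) ?invr_ge0 ?(ltW d0)//.
  rewrite -(@lee_pmul2l _ d%:E)//.
  rewrite ge0_muleDr// ?mule1; last by rewrite mule_ge0 ?(po_ge0 (po_LL p))// lee_fin invr_ge0 ltW.
  rewrite !muleA -EFinM divff ?gt_eqF// !mul1e addeC.
  exact: hV.
by rewrite /one_a wmul_notin ?add0e//; apply/eqP.
Qed.

Lemma entry_iter_le p n F (M : R) x : 0 <= M -> nneg F ->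
  (forall y, TMS E y -> y 0%N = a -> (F y <= M%:E)%E) -> TMS E x ->
  (iter n (taboo a (LP p)) (entry a (LP p) F) x <=
   M%:E * iter n (taboo a (LP p)) (entry a (LP p) (fun=> 1)) x)%E.
Proof.
move=> M0 F0 FM Ex.
have e1 : nneg (entry a (LP p) (fun=> 1%E)) by apply: (po_ge0 (po_entry a (po_LP p))) => y.
have eF : nneg (entry a (LP p) F) by apply: (po_ge0 (po_entry a (po_LP p))).
rewrite -(po_scale (po_iter (po_taboo a (po_LP p)) n))//.
apply: (po_le (po_iter (po_taboo a (po_LP p)) n)) => //.
  by move=> y; rewrite mule_ge0.
move=> y Ey; rewrite -(po_scale (po_entry a (po_LP p)))//.
apply: (entry_le (po_LP p)) => // z; first by rewrite mule1 lee_fin.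
by move=> Ez za; rewrite mule1; apply: FM.
Qed.

(* Strict superharmonicity of a bounded function would survive a small decrease of [P]. *)
Lemma no_strict_excess F (d M : R) : 0 < d -> nneg F ->
  (forall x, TMS E x -> x 0%N = a -> (LL P F x + d%:E <= F x)%E) ->
  (forall x, TMS E x -> x 0%N = a -> (F x <= M%:E)%E) -> False.
Proof.
move=> d0 F0 hF FM0.
have {FM0} [{}M M0 FM] : exists2 M : R, 0 < M & forall x, TMS E x -> x 0%N = a -> (F x <= M%:E)%E.
  exists (`|M| + 1); first by rewrite ltr_wpDl.
  move=> x Ex xa; apply: (le_trans (FM0 x Ex xa)); rewrite lee_fin.
  by apply: (le_trans (ler_norm _)); rewrite lerDl.
have [p1 p1P [K K0 HK]] := taboo_bound.
pose e1 := (P - p1) / 4; have e10 : 0 < e1 by rewrite divr_gt0// subr_gt0.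
pose rho := expR (p1 - P + 2 * e1).
have rho01 : 0 <= rho < 1.
  by rewrite expR_ge0/= -expR0 ltr_expR /e1; move: p1P; lra.
have rho0 : 0 < rho by exact: expR_gt0.
have /andP[_ rho1] := rho01.
pose B := M * K * rho / (1 - rho) / e1.
have B0 : 0 < B by rewrite /B !divr_gt0 ?mulr_gt0 ?subr_gt0.
pose e := Num.min e1 (d / 2 / B).
have e0 : 0 < e by rewrite /e lt_min e10/=; apply: divr_gt0 => //; apply: divr_gt0.
have ee1 : e <= e1 by rewrite /e ge_min lexx.
have eB : e * B <= d / 2 by rewrite -ler_pdivlMr// /e ge_min lexx orbT.
suff : P <= P - e by rewrite lerDl oppr_ge0 leNgt e0.
have LF0 := po_ge0 (po_LL P) F0.
apply: (@LL_excess_bound (P - e) F (d / 2)) => //; first by rewrite divr_gt0.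
- move=> x Ex xa.
  suff H : (LL (P - e) F x <= LL P F x + (d / 2)%:E)%E.
    apply: le_trans (hF x Ex xa); apply: (le_trans (leeD2r _ H)).
    by rewrite -addeA -EFinD -splitr.
  have eF p' : nneg (entry a (LP p') F) by apply: (po_ge0 (po_entry a (po_LP p'))).
  have i0 p' n : nneg (iter n (taboo a (LP p')) (entry a (LP p') F)).
    exact: po_ge0 (po_iter (po_taboo a (po_LP p')) n) _ (eF p').
  apply: (@le_trans _ _ (\sum_(n <oo) (iter n (taboo a (LP P)) (entry a (LP P) F) x +
      ((e / e1 * M * K * rho) * rho ^+ n)%:E))%E).
    apply: lee_nneseries => n *; first exact: i0.
    rewrite (@iter_taboo_shift _ P)// opprB addrC subrK.
    rewrite [X in (expR X)%:E](_ : _ = n.+1%:R * e); last by rewrite mulr_natl.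
    have tn : (iter n (taboo a (LP P)) (entry a (LP P) F) x <= (M * (K * expR (n.+1%:R * (p1 - P))))%:E)%E.
      apply: (le_trans (entry_iter_le P n (ltW M0) F0 FM Ex)); rewrite EFinM.
      apply: lee_wpmul2l; first by rewrite lee_fin ltW.
      rewrite iter_taboo_LP//; apply: (@le_trans _ _ ((expR (- (n.+1%:R * P)))%:E * (K * expR (n.+1%:R * p1))%:E)%E).
        by apply: lee_wpmul2l; rewrite ?lee_fin ?expR_ge0// HK.
      by rewrite -EFinM lee_fin mulrCA -expRD mulrBr addrC.
    have tf : iter n (taboo a (LP P)) (entry a (LP P) F) x \is a fin_num.
      by rewrite ge0_fin_numE ?i0//; apply: le_lt_trans tn (ltry _).
    rewrite -(fineK tf) -EFinM -EFinD lee_fin.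
    rewrite -{1}(fineK tf) lee_fin in tn.
    set t := fine _ in tn *; have t0 : 0 <= t by rewrite fine_ge0// i0.
    rewrite -lerBlDl -{2}[t]mul1r -mulrBl.
    apply: (le_trans (ler_wpM2r t0 (expR_sub1_le _))).
    apply: (@le_trans _ _ (n.+1%:R * e * expR (n.+1%:R * e) * (M * (K * expR (n.+1%:R * (p1 - P)))))).
      by apply: ler_wpM2l tn; rewrite !mulr_ge0 ?expR_ge0// ltW.
    have h1 : n.+1%:R * e1 <= expR (n.+1%:R * e1).
      by apply: le_trans (expR_ge1Dx _); rewrite lerDr.
    have h2 : expR (n.+1%:R * e) <= expR (n.+1%:R * e1) by rewrite ler_expR ler_wpM2l.
    have -> : rho ^+ n = expR (n.+1%:R * e1) * expR (n.+1%:R * e1) * expR (n.+1%:R * (p1 - P)) / rho.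
      rewrite -[LHS](mulfK (lt0r_neq0 rho0)) -exprSr /rho -expRM_natl -!expRD -mulr_natl.
      by congr (expR _ / _); ring.
    have -> : e / e1 * M * K * rho * (expR (n.+1%:R * e1) * expR (n.+1%:R * e1) * expR (n.+1%:R * (p1 - P)) / rho) =
       (expR (n.+1%:R * e1) / e1 * e) * expR (n.+1%:R * e1) * (M * (K * expR (n.+1%:R * (p1 - P)))).
      by field; rewrite !gt_eqF.
    apply: ler_wpM2r; first by rewrite !mulr_ge0 ?expR_ge0// ltW.
    apply: ler_pM => //; [by rewrite mulr_ge0// ltW|].
    by apply: ler_wpM2r; [exact: ltW|rewrite ler_pdivlMr].
  rewrite nneseriesD; [|by move=> n _ _; apply: i0|by move=> n _ _; rewrite lee_fin !mulr_ge0 ?exprn_ge0 ?invr_ge0// ltW].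
  rewrite leeD2l// geometric_nneseries//; last by rewrite !mulr_ge0 ?invr_ge0// ltW.
  rewrite lee_fin; apply: le_trans eB; rewrite /B le_eqVlt; apply/orP; left; apply/eqP.
  by field; rewrite !gt_eqF ?subr_gt0.
- by move=> x Ex xa; apply: le_lt_trans (FM x Ex xa) (ltry _).
Qed.

Lemma loop_eigenfunction : exists ha : (nat -> V) -> \bar R, [/\ nneg ha, reg E theta c ha,
  forall x, TMS E x -> x 0%N = a -> LL P ha x = ha x,
  forall x, TMS E x -> x 0%N = a -> (ha x <= (expR c)%:E)%E &
  forall x, TMS E x -> x 0%N = a -> (0 < ha x)%E].
Proof.
have [x1 Ex1 x1a] := TMS_ex mixE a.
have [s [s0 sreg sS sC sc]] := superharmonic_ex Ex1 x1a.
have LLs x : TMS E x -> (LL P s x <= s x)%E by apply: LL_superharmonic.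
have in0 n F : nneg F -> nneg (iter n (LL P) F) by exact: (po_ge0 (po_iter (po_LL P) n)).
pose Xa x := TMS E x /\ x 0%N = a.
pose D x := if pselect (Xa x) then (s x - LL P s x)%E else 0%E.
have LLfin x : TMS E x -> x 0%N = a -> LL P s x \is a fin_num.
  move=> Ex xa; rewrite ge0_fin_numE ?(po_ge0 (po_LL P))//.
  by apply: le_lt_trans (LLs x Ex) _; apply: le_lt_trans (sC x Ex xa) (ltry _).
have D0 : nneg D.
  move=> x; rewrite /D; case: pselect => // -[Ex xa].
  by rewrite sube_ge0 ?LLs ?LLfin.
have sD x : TMS E x -> x 0%N = a -> s x = (D x + LL P s x)%E.
  by move=> Ex xa; rewrite /D; case: pselect => [?|[//]]; rewrite subeK ?LLfin.
have siter n x : TMS E x -> x 0%N = a ->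
    s x = (\sum_(0 <= k < n) iter k (LL P) D x + iter n (LL P) s x)%E.
  move=> Ex xa; elim: n => [|n ->]; first by rewrite big_geq// add0e.
  rewrite big_nat_recr//= -addeA; congr (_ + _)%E.
  rewrite (@LL_iter_eq _ _ _ (fun y => D y + LL P s y)%E)//; last first.
    by move=> y; rewrite adde_ge0// (po_ge0 (po_LL P)).
  rewrite (po_add (po_iter (po_LL P) n))//; last exact: (po_ge0 (po_LL P)).
  by rewrite -iterSr.
pose G := resolvent (LL P) D.
have G0 : nneg G by exact: po_ge0 (po_resolvent (po_LL P)) _ D0.
have Gs x : TMS E x -> x 0%N = a -> (G x <= s x)%E.
  move=> Ex xa; apply: lime_le; first by apply: is_cvg_nneseries => n _ _; apply: in0.
  by apply: nearW => n; rewrite (siter n x)// leeDl// in0.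
have sfin x : TMS E x -> x 0%N = a -> s x \is a fin_num.
  by move=> Ex xa; rewrite ge0_fin_numE//; apply: le_lt_trans (sC x Ex xa) (ltry _).
have Gfin x : TMS E x -> x 0%N = a -> G x \is a fin_num.
  move=> Ex xa; rewrite ge0_fin_numE//; apply: le_lt_trans (Gs x Ex xa) _.
  by rewrite -ge0_fin_numE ?sfin.
pose ha x := if pselect (Xa x) then (s x - G x)%E else 0%E.
have ha0 : nneg ha.
  move=> x; rewrite /ha; case: pselect => // -[Ex xa].
  by rewrite sube_ge0 ?Gs ?Gfin.
have haE x : TMS E x -> x 0%N = a -> ha x = (s x - G x)%E.
  by move=> Ex xa; rewrite /ha; case: pselect => [//|[//]].
have sha x : TMS E x -> x 0%N = a -> s x = (ha x + G x)%E.
  by move=> Ex xa; rewrite haE// subeK ?Gfin.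
have cvg_ha x : TMS E x -> x 0%N = a -> iter n (LL P) s x @[n --> \oo] --> ha x.
  move=> Ex xa; rewrite haE//.
  have -> : (fun n => iter n (LL P) s x) = (fun n => s x - \sum_(0 <= k < n) iter k (LL P) D x)%E.
    apply/funext => n; rewrite (siter n x Ex xa) [X in (X - _)%E]addeC addeK//.
    rewrite ge0_fin_numE; last by apply: sume_ge0 => k _; apply: in0.
    apply: (@le_lt_trans _ _ (s x)); last by rewrite -ge0_fin_numE ?sfin.
    by rewrite (siter n x)// leeDl// in0.
  apply: cvgeB; [by rewrite fin_num_adde_defr ?sfin|exact: cvg_cst|].
  by apply: is_cvg_nneseries => n _ _; apply: in0.
have ireg n : reg E theta c (iter n (LL P) s).
  by elim: n => [//|n IH] /=; apply: reg_LL => //; apply: in0.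
exists ha; split => //.
- move=> n x y n1 Ex Ey xy; have xy0 : x 0%N = y 0%N by apply: xy.
  have [xa|xa] := pselect (x 0%N = a); last first.
    rewrite {1}/ha; case: pselect => [[? //]|?].
    by rewrite mule_ge0// lee_fin expR_ge0.
  have ya : y 0%N = a by rewrite -xy0.
  have cx := cvg_ha x Ex xa; have cy := cvg_ha y Ey ya.
  have cy' : ((expR (c * theta ^+ n))%:E * iter k (LL P) s y)%E @[k --> \oo] -->
    ((expR (c * theta ^+ n))%:E * ha y)%E by apply: cvgeZl.
  rewrite -(cvg_lim _ cx)// -(cvg_lim _ cy')//; apply: lee_lim.
  + by apply/cvg_ex; exists (ha x).
  + by apply/cvg_ex; exists ((expR (c * theta ^+ n))%:E * ha y)%E.
  + by apply: nearW => k; apply: ireg.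
- move=> x Ex xa.
  have h1 : (LL P s x = LL P ha x + LL P G x)%E.
    rewrite -(po_add (po_LL P))//; apply: (loop_eq (po_LP P)) => //.
    by move=> y; rewrite adde_ge0.
  have h2 : G x = (D x + LL P G x)%E by apply: (resolventE (po_LL P)).
  have Gf := Gfin x Ex xa; have sf := sfin x Ex xa.
  have Df : D x \is a fin_num.
    rewrite ge0_fin_numE//; apply: (@le_lt_trans _ _ (s x)); last by rewrite -ge0_fin_numE.
    by rewrite sD// leeDl// (po_ge0 (po_LL P)).
  have LGf : LL P G x \is a fin_num.
    rewrite ge0_fin_numE ?(po_ge0 (po_LL P))//; apply: (@le_lt_trans _ _ (G x)).
      by rewrite h2 leeDr.
    by rewrite -ge0_fin_numE.
  have Lhf : LL P ha x \is a fin_num.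
    rewrite ge0_fin_numE ?(po_ge0 (po_LL P))//; apply: (@le_lt_trans _ _ (LL P s x)).
      by rewrite h1 leeDl// (po_ge0 (po_LL P)).
    by rewrite -ge0_fin_numE ?LLfin// (po_ge0 (po_LL P)).
  have haf : ha x \is a fin_num by rewrite haE// fin_numB sf Gf.
  have := sha x Ex xa; rewrite sD// h1 h2.
  rewrite -(fineK Df) -(fineK LGf) -(fineK Lhf) -(fineK haf) -!EFinD => -[] h3.
  by congr (_%:E); move: h3; lra.
- move=> x Ex xa; apply: le_trans (sC x Ex xa); rewrite haE//.
  by rewrite leeBlDr ?Gfin// leeDl.
- move=> x Ex xa; rewrite lt_neqAle ha0 andbT eq_sym; apply/eqP => hax.
  pose d := expR (- c) / 2; have d0 : 0 < d by rewrite divr_gt0 ?expR_gt0.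
  have [n sn] : exists n, (iter n (LL P) s x < (d * expR (- c))%:E)%E.
    apply: contrapT => /forallNP H; have := cvg_ha x Ex xa; rewrite hax => cv.
    suff : ((d * expR (- c))%:E <= (0 : \bar R))%E by rewrite leNgt lte_fin mulr_gt0 ?expR_gt0.
    rewrite -(cvg_lim _ cv)//; apply: lime_ge; first by apply/cvg_ex; exists 0%E.
    by apply: nearW => n; rewrite leNgt; apply/negP/H.
  have snd y : TMS E y -> y 0%N = a -> (iter n (LL P) s y <= d%:E)%E.
    move=> Ey ya; apply: (le_trans (reg_compare theta01 (in0 n s s0) c0 (ireg n) Ey Ex _)); first by rewrite ya.
    rewrite -lee_pdivlMl ?expR_gt0//; apply: (le_trans (ltW sn)).
    by rewrite -EFinM lee_fin -expRN mulrC.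
  have isle k y : TMS E y -> y 0%N = a -> (iter k (LL P) s y <= s y)%E.
    by move=> Ey ya; rewrite [leRHS](siter k y)// leeDr// sume_ge0// => i _; apply: in0.
  pose F y := (\sum_(k <- index_iota 0 n) iter k (LL P) s y)%E.
  have F0 : nneg F by move=> y; apply: sume_ge0 => k _; apply: in0.
  have FM y : TMS E y -> y 0%N = a -> (F y <= (n%:R * expR c)%:E)%E.
    move=> Ey ya; apply: (@le_trans _ _ (\sum_(k <- index_iota 0 n) (expR c)%:E)%E).
      by apply: lee_sum => k _; apply: le_trans (isle k y Ey ya) (sC y Ey ya).
    by rewrite sumEFin big_const_nat subn0 iter_addr_0 lee_fin mulr_natl.
  apply: (@no_strict_excess F d (n%:R * expR c)) => //.
  move=> y Ey ya.
  have LF : LL P F y = (\sum_(k <- index_iota 0 n) iter k.+1 (LL P) s y)%E.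
    by rewrite /F (po_fsum (po_LL P))// => k; apply: in0.
  have Ff : F y \is a fin_num by rewrite ge0_fin_numE//; apply: le_lt_trans (FM y Ey ya) (ltry _).
  have H : (LL P F y + s y = F y + iter n (LL P) s y)%E.
    by rewrite LF /F addeC -big_nat_recr//= big_nat_recl.
  have LFf : LL P F y \is a fin_num.
    rewrite ge0_fin_numE ?(po_ge0 (po_LL P))//; apply: (@le_lt_trans _ _ (F y + iter n (LL P) s y)%E).
      by rewrite -H leeDl.
    apply: lte_add_pinfty; first by rewrite -ge0_fin_numE.
    exact: le_lt_trans (snd y Ey ya) (ltry _).
  have inf : iter n (LL P) s y \is a fin_num.
    by rewrite ge0_fin_numE ?in0//; apply: le_lt_trans (snd y Ey ya) (ltry _).
  have := snd y Ey ya; have := sc y Ey ya; move: H.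
  rewrite -(fineK Ff) -(fineK LFf) -(fineK (sfin y Ey ya)) -(fineK inf) -!EFinD !lee_fin => -[].
  by rewrite /d; lra.
Qed.

Lemma transfer_term (w : (nat -> V) -> R) F b x : (forall x, 0 <= w x) -> nneg F -> E b (x 0%N) ->
  ((w (bcons b x))%:E * F (bcons b x) <= transfer E w F x)%E.
Proof.
move=> w0 F0 bx; have F0' y : (0 <= wmul w F y)%E by rewrite mule_ge0// lee_fin.
rewrite /transfer /preop (esumID [set b])//.
have -> : [set b0 | E b0 (x 0%N)] `&` [set b] = [set b].
  by apply/seteqP; split => [z []//|z /= ->].
by rewrite esum_set1// leeDl//; apply: esum_ge0.
Qed.

Lemma eigenfunction : exists h : (nat -> V) -> \bar R, [/\ nneg h, reg E theta c h,
  forall x, TMS E x -> LP P h x = h x, forall x, TMS E x -> LL P h x = h x &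
  forall x, TMS E x -> (0 < h x < +oo)%E].
Proof.
have [ha [ha0 har haE haC hap]] := loop_eigenfunction.
pose h := LL P ha.
have h0 : nneg h by exact: po_ge0 (po_LL P) _ ha0.
have hE x : TMS E x -> LL P h x = h x by apply: (loop_eq (po_LP P)).
have LPh x : TMS E x -> LP P h x = h x.
  move=> Ex; rewrite (taboo_entry a (po_LP P))// [RHS](loopE a (po_LP P))// addeC.
  by congr (_ + _)%E; apply: (entry_eq (po_LP P)).
have hr : reg E theta c h by exact: reg_LL.
exists h; split => // x Ex; apply/andP; split.
- suff H : forall b, forall x, TMS E x -> x 0%N = b -> (0 < h x)%E by exact: H.
  move=> b; apply: (strongly_connected_ind_fwd (a := a) (P := fun b => forall x, TMS E x -> x 0%N = b -> (0 < h x)%E) mixE.1 _ _ b).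
    by move=> y Ey ya; rewrite /h haE//; apply: hap.
  move=> b1 b2 b12 H y Ey yb; rewrite -LPh//.
  apply: (lt_le_trans _ (transfer_term (@wphi_ge0 P) h0 (_ : E b1 (y 0%N)))); last by rewrite yb.
  by rewrite mule_gt0 ?lte_fin ?expR_gt0// H//; apply: TMS_bcons; rewrite ?yb.
- suff H : forall b, forall x, TMS E x -> x 0%N = b -> (h x < +oo)%E by exact: H.
  move=> b; apply: (strongly_connected_ind (a := a) (P := fun b => forall x, TMS E x -> x 0%N = b -> (h x < +oo)%E) mixE.1 _ _ b).
    by move=> y Ey ya; rewrite /h haE//; apply: le_lt_trans (haC y Ey ya) (ltry _).
  move=> b1 b2 b12 H y Ey yb; have [z Ez zb] := TMS_ex mixE b2.
  have bz : E b1 (z 0%N) by rewrite zb.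
  apply: (reg_ltoo theta01 h0 c0 hr (TMS_bcons bz Ez) Ey); first by rewrite yb.
  have := transfer_term (@wphi_ge0 P) h0 bz.
  rewrite -/(LP P h z) LPh// -lee_pdivlMl ?expR_gt0// => /le_lt_trans; apply.
  by rewrite lte_mul_pinfty ?lee_fin ?invr_ge0 ?expR_ge0// H.
Qed.

End Pressure.

(** * Normalisation *)

Section Normalisation.
Context {R : realType} {V : pointedType} (E : rel V) (theta : R).
Hypothesis theta01 : 0 < theta < 1.
Variables (w : (nat -> V) -> R) (a : V) (A c : R) (h : (nat -> V) -> \bar R).
Hypothesis w0 : forall x, 0 < w x.
Hypothesis wreg : regw E theta A w.
Hypothesis h0 : nneg h.
Hypothesis c0 : 0 <= c.
Hypothesis hreg : reg E theta c h.
Hypothesis hfin : forall x, TMS E x -> (0 < h x < +oo)%E.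
Hypothesis hL : forall x, TMS E x -> transfer E w h x = h x.
Hypothesis hLL : forall x, TMS E x -> loopop a (transfer E w) h x = h x.
Implicit Types (x y z : nat -> V) (F G : (nat -> V) -> \bar R).

Let theta0 : 0 < theta. Proof. by case/andP: theta01. Qed.
Let theta1 : theta < 1. Proof. by case/andP: theta01. Qed.

Definition hr x : R := if `[< TMS E x >] then fine (h x) else 1.
Definition gn x : R := w x * hr x / hr (sshift x).

Lemma hr_gt0 x : 0 < hr x.
Proof. by rewrite /hr; case: asboolP => // Ex; apply: fine_gt0; apply: hfin. Qed.

Lemma hrE x : TMS E x -> (hr x)%:E = h x.
Proof.
move=> Ex; rewrite /hr asboolT// fineK// ge0_fin_numE//.
by have /andP[] := hfin Ex.
Qed.

Lemma gn_gt0 x : 0 < gn x.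
Proof. by rewrite divr_gt0 ?mulr_gt0// hr_gt0. Qed.

Lemma gn_ge0 x : 0 <= gn x. Proof. exact: ltW (gn_gt0 x). Qed.

Lemma hr_reg n x y : (1 <= n)%N -> TMS E x -> TMS E y -> agree n x y ->
  hr x <= expR (c * theta ^+ n) * hr y.
Proof. by move=> n1 Ex Ey xy; rewrite -lee_fin EFinM !hrE//; apply: hreg. Qed.

Definition kappan := A + c + c / theta.

Lemma regw_gn : regw E theta kappan gn.
Proof.
move=> [//|n] x y n2 Ex Ey xy; rewrite /gn.
have h1 := wreg n2 Ex Ey xy.
have h2 := hr_reg (ltnW n2) Ex Ey xy.
have xy' : agree n (sshift y) (sshift x) by move=> i ni; symmetry; apply: xy.
have h3 := hr_reg (n2 : (1 <= n)%N) (TMS_sshift Ey) (TMS_sshift Ex) xy'.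
rewrite ler_pdivrMr ?hr_gt0//.
apply: (@le_trans _ _ ((expR (A * theta ^+ n.+1) * w y) * (expR (c * theta ^+ n.+1) * hr y))).
  by apply: ler_pM => //; apply: ltW; rewrite ?w0 ?hr_gt0.
have -> : kappan * theta ^+ n.+1 = A * theta ^+ n.+1 + c * theta ^+ n.+1 + c * theta ^+ n.
  by rewrite /kappan exprS; field; rewrite gt_eqF.
rewrite !expRD; set e1 := expR _; set e2 := expR (c * theta ^+ n.+1); set e3 := expR (c * theta ^+ n).
have e10 : 0 < e1 by exact: expR_gt0.
have e20 : 0 < e2 by exact: expR_gt0.
have -> : e1 * e2 * e3 * (w y * hr y / hr (sshift y)) * hr (sshift x) =
  e1 * w y * (e2 * hr y) * ((e3 * hr (sshift x)) / hr (sshift y)) by field; rewrite gt_eqF ?hr_gt0.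
apply: ler_peMr; first by rewrite !mulr_ge0// ltW// ?w0 ?hr_gt0.
by rewrite ler_pdivlMr ?hr_gt0// mul1r.
Qed.

Lemma po_w : posop (TMS E) (transfer E w).
Proof. by apply: po_transfer => x; apply: ltW. Qed.

Definition Ln := transfer E gn.

Lemma po_Ln : posop (TMS E) Ln.
Proof. by apply: po_transfer => x; apply: gn_ge0. Qed.

Lemma nneg_hr F : nneg F -> nneg (wmul hr F).
Proof. by move=> F0 x; rewrite mule_ge0// lee_fin ltW// hr_gt0. Qed.

Lemma Ln_conj F x : nneg F -> Ln F x = (((hr x)^-1)%:E * transfer E w (wmul hr F) x)%E.
Proof.
move=> F0; rewrite /transfer -(po_scale (po_preop E)); last 2 first.
- by rewrite invr_ge0 ltW// hr_gt0.
- by apply: po_ge0 (po_wmul (TMS E) (fun x => ltW (w0 x))) _ _; exact: nneg_hr.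
rewrite /Ln /transfer /preop; apply: eq_esum => b _.
by rewrite /wmul /gn /= !EFinM !muleA; congr (_ * _)%E; rewrite -!EFinM; congr (_%:E); ring.
Qed.

Lemma wmul_hrC (D : set (nat -> V)) F : wmul hr (wmul \1_D F) = wmul (\1_D : _ -> R) (wmul hr F).
Proof. by apply/funext => y; rewrite /wmul muleCA. Qed.

Lemma taboo_iter_conj n F x : nneg F ->
  iter n (taboo a Ln) (entry a Ln F) x =
  (((hr x)^-1)%:E * iter n (taboo a (transfer E w)) (entry a (transfer E w) (wmul hr F)) x)%E.
Proof.
move=> F0; elim: n x => [|n IH] x /=.
  by rewrite /entry Ln_conj; [rewrite wmul_hrC|exact: nneg_wmul].
rewrite {1}/taboo Ln_conj; last first.
  by apply: nneg_wmul; apply: po_ge0 (po_iter (po_taboo a po_Ln) n) _ _; exact: (po_ge0 (po_entry a po_Ln)).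
congr (_ * _)%E; rewrite wmul_hrC; congr (taboo _ _ _ x).
apply/funext => y; rewrite /wmul IH muleA -EFinM divff ?gt_eqF ?hr_gt0//.
by rewrite mul1e.
Qed.

Lemma Ln1 x : TMS E x -> Ln (fun=> 1%E) x = 1%E.
Proof.
move=> Ex; rewrite Ln_conj//.
rewrite (po_eq po_w (G := h)) //; last by move=> y Ey; rewrite /wmul hrE// mule1.
  by rewrite hL// -hrE// -EFinM mulVf// gt_eqF// hr_gt0.
exact: nneg_hr.
Qed.

Lemma loop1 x : TMS E x -> loopop a Ln (fun=> 1%E) x = 1%E.
Proof.
move=> Ex; rewrite /loopop /resolvent.
under eq_eseriesr do rewrite taboo_iter_conj//.
rewrite nneseriesZl; last first.
  move=> n _; apply: po_ge0 (po_iter (po_taboo a po_w) n) _ _ _; apply: (po_ge0 (po_entry a po_w)).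
  exact: nneg_hr.
have -> : (\sum_(n <oo) iter n (taboo a (transfer E w)) (entry a (transfer E w) (wmul hr (fun=> 1))) x)%E = h x.
  rewrite -hLL//; apply: (loop_eq po_w) => //; first exact: nneg_hr.
  by move=> y Ey _; rewrite /wmul hrE// mule1.
by rewrite -hrE// -EFinM mulVf// gt_eqF// hr_gt0.
Qed.

Lemma taboo_tail (K q : R) : 0 < K -> 0 < q ->
  (forall n x, TMS E x -> x 0%N = a ->
    (iter n (taboo a (transfer E w)) (entry a (transfer E w) (fun=> 1)) x <= (K * q ^+ n)%:E)%E) ->
  forall n x, TMS E x -> x 0%N = a ->
    (iter n (taboo a Ln) (entry a Ln (fun=> 1)) x <= (expR c * K * q ^+ n)%:E)%E.
Proof.
move=> K0 q0 H n x Ex xa; rewrite taboo_iter_conj// lee_pdivrMl ?hr_gt0//.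
have pt := po_iter (po_taboo a po_w) n.
have e1 : nneg (entry a (transfer E w) (fun=> 1%E)) by exact: (po_ge0 (po_entry a po_w)).
have e2 : nneg (entry a (transfer E w) (wmul hr (fun=> 1%E))).
  by apply: (po_ge0 (po_entry a po_w)); exact: nneg_hr.
apply: (@le_trans _ _ ((expR c * hr x)%:E * iter n (taboo a (transfer E w)) (entry a (transfer E w) (fun=> 1)) x)%E).
  rewrite -(po_scale pt)//; last by rewrite mulr_ge0 ?expR_ge0// ltW// hr_gt0.
  have m0 : 0 <= expR c * hr x by rewrite mulr_ge0 ?expR_ge0// ltW// hr_gt0.
  apply: (po_le pt) => //; first by move=> y; rewrite mule_ge0// lee_fin.
  move=> y Ey; rewrite -(po_scale (po_entry a po_w))//.
  apply: (entry_le po_w) => //; [exact: nneg_hr|by move=> z; rewrite mule1 lee_fin|].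
  move=> z Ez za; rewrite /wmul !mule1 lee_fin -lee_fin EFinM !hrE//.
  by apply: (reg_compare theta01 h0 c0 hreg Ez Ex); rewrite xa.
apply: (@le_trans _ _ ((expR c * hr x)%:E * (K * q ^+ n)%:E)%E).
  by apply: lee_wpmul2l; [rewrite lee_fin mulr_ge0 ?expR_ge0// ltW// hr_gt0|exact: H].
by rewrite -!EFinM lee_fin le_eqVlt; apply/orP; left; apply/eqP; ring.
Qed.

End Normalisation.

(** * Contraction of the loop operator *)

Section SpectralGap.
Context {R : realType} {V : pointedType} (E : rel V) (theta : R).
Hypothesis theta01 : 0 < theta < 1.
Variables (g : (nat -> V) -> R) (a : V) (kappa K q : R) (x0 : nat -> V).
Hypothesis kappa0 : 0 <= kappa.
Hypothesis g0 : forall x, 0 <= g x.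
Hypothesis greg : regw E theta kappa g.
Hypothesis Ex0 : TMS E x0.
Hypothesis x0a : x0 0%N = a.
Local Notation L := (transfer E g).
Local Notation LL := (loopop a L).
Local Notation N := (resolvent (taboo a L)).
Hypothesis L1 : forall x, TMS E x -> L (fun=> 1%E) x = 1%E.
Hypothesis LL1 : forall x, TMS E x -> LL (fun=> 1%E) x = 1%E.
Hypothesis K0 : 0 < K.
Hypothesis q01 : 0 < q < 1.
Hypothesis tail : forall n x, TMS E x -> x 0%N = a ->
  (iter n (taboo a L) (entry a L (fun=> 1)) x <= (K * q ^+ n)%:E)%E.
Implicit Types (x y z : nat -> V) (F G : (nat -> V) -> \bar R).

Let theta0 : 0 < theta. Proof. by case/andP: theta01. Qed.
Let theta1 : theta < 1. Proof. by case/andP: theta01. Qed.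
Let pL : posop (TMS E) L. Proof. exact: po_transfer. Qed.
Let pA : posop (TMS E) (taboo a L). Proof. exact: po_taboo. Qed.
Let pB : posop (TMS E) (entry a L). Proof. exact: po_entry. Qed.
Let pN : posop (TMS E) N. Proof. exact: po_resolvent. Qed.
Let pLL : posop (TMS E) LL. Proof. exact: po_loop. Qed.

Definition cc := 2 * holderc theta kappa + 1.
Definition cc' := (kappa + cc) * theta.

Let hk0 : 0 <= holderc theta kappa. Proof. exact: holderc_ge0. Qed.

Lemma cc_gt0 : 0 < cc. Proof. by rewrite /cc; move: hk0; lra. Qed.

Lemma cc'_lt : cc' < cc.
Proof.
have := holderc_fix theta01 kappa; rewrite /cc' /cc; set H := holderc theta kappa => hE.
have h0 : 0 <= H by exact: hk0.
have -> : (kappa + (2 * H + 1)) * theta = (kappa + H) * theta + (H + 1) * theta by ring.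
rewrite hE; have : (H + 1) * theta < H + 1 by rewrite gtr_pMr//; lra.
by lra.
Qed.

Lemma cc'_ge0 : 0 <= cc'.
Proof. by apply: mulr_ge0; [apply: addr_ge0 => //; exact: ltW cc_gt0|exact: ltW]. Qed.

Lemma stable_cc : stable theta kappa cc. Proof. exact: ltW cc'_lt. Qed.

Lemma stable_cc' : stable theta kappa cc'.
Proof.
by rewrite /stable {2}/cc' ler_wpM2r ?(ltW theta0)// lerD2l ltW// cc'_lt.
Qed.

Lemma reg_LLcc F : nneg F -> reg E theta cc F -> reg E theta cc' (LL F).
Proof. by move=> F0 rF; apply: reg_loop => //; exact: stable_cc'. Qed.

Lemma reg_ccW F : nneg F -> reg E theta cc' F -> reg E theta cc F.
Proof. by move=> F0; apply: reg_le => //; exact: ltW cc'_lt. Qed.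

Lemma reg_Ncc F : nneg F -> reg E theta cc F -> reg E theta cc (N F).
Proof.
move=> F0 rF; apply: (@reg_resolvent _ _ _ _ theta01 _ kappa) => //; last exact: stable_cc.
by move=> c' G G0 rG; exact: reg_taboo.
Qed.

Lemma LL_cst (r : R) x : 0 <= r -> TMS E x -> LL (fun=> r%:E) x = r%:E.
Proof.
move=> r0 Ex; rewrite (_ : (fun=> r%:E) = (fun y => r%:E * (fun=> 1) y)%E); last first.
  by apply/funext => y; rewrite mule1.
by rewrite (po_scale pLL)// LL1// mule1.
Qed.

Lemma LL_bound F (M : R) x : nneg F -> 0 <= M ->
  (forall y, TMS E y -> y 0%N = a -> (F y <= M%:E)%E) -> TMS E x -> (LL F x <= M%:E)%E.
Proof. by move=> F0 M0 FM Ex; rewrite -[leRHS](LL_cst M0 Ex); apply: (loop_le pL). Qed.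

Lemma LLi_ge0 k F : nneg F -> nneg (iter k LL F).
Proof. exact: (po_ge0 (po_iter pLL k)). Qed.

Lemma LLi_le k F G x : nneg F -> nneg G ->
  (forall y, TMS E y -> y 0%N = a -> (F y <= G y)%E) ->
  TMS E x -> x 0%N = a -> (iter k LL F x <= iter k LL G x)%E.
Proof.
move=> F0 G0 FG Ex xa; elim: k x Ex xa => [|k IH] x Ex xa /=; first exact: FG.
by apply: (loop_le pL) => //; exact: LLi_ge0.
Qed.

Lemma LLi_eq k F G x : nneg F -> nneg G ->
  (forall y, TMS E y -> y 0%N = a -> F y = G y) ->
  TMS E x -> x 0%N = a -> iter k LL F x = iter k LL G x.
Proof.
by move=> F0 G0 FG Ex xa; apply/eqP; rewrite eq_le; apply/andP; split; apply: LLi_le => // y *;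
  rewrite FG.
Qed.

Lemma LLi_cst k (r : R) x : 0 <= r -> TMS E x -> x 0%N = a -> iter k LL (fun=> r%:E) x = r%:E.
Proof.
move=> r0; elim: k x => [//|k IH] x Ex xa /=; rewrite -[RHS](LL_cst r0 Ex).
apply: (loop_eq pL) => //; first exact: LLi_ge0.
Qed.

(* [eta1] is chosen so that subtracting [eta1 * G x0] keeps a [cc']-regular [G] in the
   larger cone of [cc]-regular functions. *)
Definition eta1 := (cc - cc') / cc * expR (- (cc + cc')).
Definition eta0 := eta1 * expR (- cc').

Let cc0 := cc_gt0.
Let cc'c := cc'_lt.
Let cc'0 := cc'_ge0.

Lemma eta1_gt0 : 0 < eta1.
Proof. by rewrite mulr_gt0 ?divr_gt0 ?subr_gt0 ?expR_gt0. Qed.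

Lemma eta1_le1 : eta1 <= expR (- cc').
Proof.
rewrite /eta1 opprD expRD mulrA ler_piMl ?expR_ge0//.
rewrite mulr_ile1 ?expR_ge0//.
- by rewrite divr_ge0 ?subr_ge0 ?(ltW cc'c) ?(ltW cc0).
- by rewrite ler_pdivrMr// mul1r gerBl.
- by rewrite -expR0 ler_expR oppr_le0 ltW.
Qed.

Lemma eta0_bounds : 0 < eta0 <= 1.
Proof.
rewrite mulr_gt0 ?eta1_gt0 ?expR_gt0//= mulr_ile1 ?expR_ge0 ?(ltW eta1_gt0)//.
- by apply: (le_trans eta1_le1); rewrite -expR0 ler_expR oppr_le0.
- by rewrite -expR0 ler_expR oppr_le0.
Qed.

Lemma cone_ineq (t : R) : 0 < t <= 1 ->
  eta1 * expR cc' * (expR (cc * t) - 1) <= expR (cc * t) - expR (cc' * t).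
Proof.
move=> /andP[t0 t1].
have h1 : expR (cc * t) - 1 <= cc * t * expR cc.
  apply: (le_trans (expR_sub1_le _)); rewrite ler_wpM2l ?mulr_ge0 ?(ltW t0) ?(ltW cc0)//.
  by rewrite ler_expR ler_piMr// ltW.
have h2 : (cc - cc') * t <= expR (cc * t) - expR (cc' * t).
  have -> : cc * t = cc' * t + (cc - cc') * t by ring.
  rewrite expRD (_ : forall u v : R, u * v - u = u * (v - 1)); last by move=> u v; ring.
  apply: (@le_trans _ _ (1 * ((cc - cc') * t))); first by rewrite mul1r.
  apply: ler_pM => //; first by rewrite mulr_ge0 ?subr_ge0 ?ltW.
    by rewrite -expR0 ler_expR mulr_ge0// ltW.
  by have := expR_ge1Dx ((cc - cc') * t); lra.
apply: le_trans h2.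
apply: (@le_trans _ _ (eta1 * expR cc' * (cc * t * expR cc))).
  by apply: ler_wpM2l => //; rewrite mulr_ge0 ?expR_ge0// ltW// eta1_gt0.
rewrite /eta1 opprD expRD !expRN le_eqVlt; apply/orP; left; apply/eqP.
by field; rewrite !gt_eqF ?expR_gt0.
Qed.

Lemma cone_step F (M : R) : nneg F -> reg E theta cc F -> 0 <= M ->
  (forall x, TMS E x -> x 0%N = a -> (F x <= M%:E)%E) ->
  exists (r : R) (F' : (nat -> V) -> \bar R), [/\ 0 <= r, nneg F', reg E theta cc F',
    forall x, TMS E x -> x 0%N = a -> (F' x <= ((1 - eta0) * M)%:E)%E &
    forall x, TMS E x -> x 0%N = a -> LL F x = (r%:E + F' x)%E].
Proof.
move=> F0 rF M0 FM; pose G x := fine (LL F x).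
have GM x : TMS E x -> (LL F x <= M%:E)%E by move=> Ex; apply: LL_bound.
have GE x : TMS E x -> LL F x = (G x)%:E.
  move=> Ex; rewrite /G fineK// ge0_fin_numE ?(po_ge0 pLL)//.
  exact: le_lt_trans (GM x Ex) (ltry _).
have G0 x : 0 <= G x by rewrite fine_ge0// (po_ge0 pLL).
have Greg n x y : (1 <= n)%N -> TMS E x -> TMS E y -> agree n x y ->
    G x <= expR (cc' * theta ^+ n) * G y.
  by move=> n1 Ex Ey xy; rewrite -lee_fin EFinM -!GE//; apply: reg_LLcc.
have Gcomp x y : TMS E x -> TMS E y -> x 0%N = a -> y 0%N = a -> G x <= expR cc' * G y.
  move=> Ex Ey xa ya; rewrite -lee_fin EFinM -!GE//.
  apply: (reg_compare theta01 _ cc'0 _ Ex Ey); [exact: (po_ge0 pLL)|exact: reg_LLcc|by rewrite xa].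
pose r := eta1 * G x0.
have rle x : TMS E x -> x 0%N = a -> r <= G x.
  move=> Ex xa; rewrite /r; apply: (@le_trans _ _ (expR (- cc') * (expR cc' * G x))).
    by apply: ler_pM => //; [exact: ltW eta1_gt0|exact: eta1_le1|exact: Gcomp].
  by rewrite mulrA -expRD addNr expR0 mul1r.
pose F' x := if pselect (TMS E x /\ x 0%N = a) then (G x - r)%:E else 0%E.
have F'0 : nneg F'.
  by move=> x; rewrite /F'; case: pselect => // -[Ex xa]; rewrite lee_fin subr_ge0 rle.
have F'E x : TMS E x -> x 0%N = a -> F' x = (G x - r)%:E.
  by move=> Ex xa; rewrite /F'; case: pselect => // -[].
exists r, F'; split => //.
- by rewrite mulr_ge0// ltW// eta1_gt0.
- move=> n x y n1 Ex Ey xy; have xy0 : x 0%N = y 0%N by apply: xy.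
  have [xa|xa] := pselect (x 0%N = a); last first.
    rewrite {1}/F'; case: pselect => [[? //]|?].
    by rewrite mule_ge0// lee_fin expR_ge0.
  have ya : y 0%N = a by rewrite -xy0.
  rewrite !F'E// -EFinM lee_fin.
  have t01 : 0 < theta ^+ n <= 1 by rewrite exprn_gt0//= exprn_ile1// ltW.
  have h1 := cone_ineq t01.
  have h2 := Greg n x y n1 Ex Ey xy.
  have h3 : r <= eta1 * expR cc' * G y.
    by rewrite /r -mulrA ler_wpM2l ?(ltW eta1_gt0)//; exact: Gcomp.
  set e1 := expR (cc * theta ^+ n) in h1 *; set e2 := expR (cc' * theta ^+ n) in h1 h2 *.
  have e11 : 0 <= e1 - 1.
    by rewrite subr_ge0 /e1 -expR0 ler_expR mulr_ge0 ?(ltW cc0)// exprn_ge0// ltW.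
  have h4 : r * (e1 - 1) <= G y * (e1 - e2).
    apply: (@le_trans _ _ (eta1 * expR cc' * G y * (e1 - 1))); first exact: ler_wpM2r.
    rewrite [leLHS](_ : _ = G y * (eta1 * expR cc' * (e1 - 1))); last by ring.
    exact: ler_wpM2l.
  have -> : e1 * (G y - r) = G y * e2 + (G y * (e1 - e2) - r * (e1 - 1)) - r by ring.
  rewrite lerB//; apply: (le_trans h2); rewrite mulrC lerDl subr_ge0//.
- move=> x Ex xa; rewrite F'E// lee_fin.
  apply: (@le_trans _ _ ((1 - eta0) * G x)); last first.
    apply: ler_wpM2l; first by rewrite subr_ge0; case/andP: eta0_bounds.
    by rewrite -lee_fin -GE//; exact: GM.
  rewrite mulrBl mul1r lerD2l lerN2 /r /eta0 -mulrA ler_wpM2l ?(ltW eta1_gt0)//.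
  rewrite -(ler_pM2l (expR_gt0 cc')) mulrA -expRD subrr expR0 mul1r.
  exact: Gcomp.
- by move=> x Ex xa; rewrite GE// F'E// -EFinD addrC subrK.
Qed.

Definition rho := 1 - eta0.

Lemma rho01 : 0 <= rho < 1.
Proof. by have /andP[h1 h2] := eta0_bounds; rewrite /rho subr_ge0 h2/= ltrBlDr ltrDl. Qed.

Lemma cone_iter F (M : R) k : nneg F -> reg E theta cc F -> 0 <= M ->
  (forall x, TMS E x -> x 0%N = a -> (F x <= M%:E)%E) ->
  exists (r : R) (F' : (nat -> V) -> \bar R), [/\ 0 <= r, nneg F', reg E theta cc F',
    forall x, TMS E x -> x 0%N = a -> (F' x <= (rho ^+ k * M)%:E)%E &
    forall x, TMS E x -> x 0%N = a -> iter k LL F x = (r%:E + F' x)%E].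
Proof.
move=> F0 rF M0 FM; have /andP[r0 r1] := rho01.
elim: k => [|k [r [F1 [rk0 F10 rF1 F1M F1E]]]].
  by exists 0, F; split => //; [move=> x; rewrite mul1r; exact: FM|move=> x _ _; rewrite add0e].
have M1 : 0 <= rho ^+ k * M by rewrite mulr_ge0 ?exprn_ge0.
have [r' [F2 [r'0 F20 rF2 F2M F2E]]] := cone_step F10 rF1 M1 F1M.
exists (r + r'), F2; split => //; first by rewrite addr_ge0.
- by move=> x Ex xa; rewrite exprS -mulrA; exact: F2M.
- move=> x Ex xa; rewrite iterS (loop_eq pL (G := fun y => (r%:E + F1 y)%E))//.
  + by rewrite (po_add pLL)// LL_cst// F2E// addeA EFinD.
  + exact: LLi_ge0.
  + by move=> y; rewrite adde_ge0.
Qed.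

Lemma LLi_fin F (M : R) k x : nneg F -> 0 <= M ->
  (forall x, TMS E x -> x 0%N = a -> (F x <= M%:E)%E) -> TMS E x -> x 0%N = a ->
  (iter k LL F x)%E = (fine (iter k LL F x))%:E /\ fine (iter k LL F x) <= M.
Proof.
move=> F0 M0 FM Ex xa.
have h : (iter k LL F x <= M%:E)%E.
  by rewrite -[leRHS](LLi_cst k M0 Ex xa); apply: LLi_le.
have e : (iter k LL F x)%E = (fine (iter k LL F x))%:E.
  by rewrite fineK// ge0_fin_numE ?LLi_ge0//; apply: le_lt_trans h (ltry _).
by split => //; rewrite -lee_fin -e.
Qed.

Definition alpha F := limn (fun k => fine (iter k LL F x0)).

Lemma cvg_geomM (M : R) : (fun k => rho ^+ k * M) @ \oo --> (0 : R).
Proof.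
rewrite -[X in _ --> X](mul0r M); apply: cvgMl; apply: cvg_expr.
by have /andP[h1 h2] := rho01; rewrite ger0_norm.
Qed.

Lemma alpha_unique F (M l : R) : (forall k, `|fine (iter k LL F x0) - l| <= rho ^+ k * M) ->
  alpha F = l.
Proof.
move=> H; apply/cvg_lim => //; apply/cvgrPdist_le => e e0.
have := cvg_geomM M => /cvgrPdist_le/(_ _ e0); apply: filterS => k.
rewrite sub0r normrN distrC => h; apply: (le_trans (H k)); apply: le_trans h.
exact: ler_norm.
Qed.

Lemma alpha_reg F (M : R) : nneg F -> reg E theta cc F -> 0 <= M ->
  (forall x, TMS E x -> x 0%N = a -> (F x <= M%:E)%E) ->
  forall k x, TMS E x -> x 0%N = a -> `|fine (iter k LL F x) - alpha F| <= rho ^+ k * M.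
Proof.
move=> F0 rF M0 FM; have /andP[r0 r1] := rho01.
have [kap hk] : exists kap : nat -> R, forall k x j, TMS E x -> x 0%N = a -> (k <= j)%N ->
    kap k <= fine (iter j LL F x) <= kap k + rho ^+ k * M.
  have H k : exists r : R, forall x j, TMS E x -> x 0%N = a -> (k <= j)%N ->
      r <= fine (iter j LL F x) <= r + rho ^+ k * M.
    have [r [F' [rk0 F'0 rF' F'M F'E]]] := cone_iter k F0 rF M0 FM.
    exists r => x j Ex xa kj; rewrite -[j](subnK kj) iterD.
    have M1 : 0 <= rho ^+ k * M by rewrite mulr_ge0 ?exprn_ge0.
    have e : iter (j - k) LL (iter k LL F) x = (r%:E + iter (j - k) LL F' x)%E.
      rewrite (@LLi_eq _ _ (fun y => (r%:E + F' y)%E))//; [|exact: LLi_ge0|by move=> y; rewrite adde_ge0].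
      by rewrite (po_add (po_iter pLL _))// LLi_cst.
    have [e2 h2] := LLi_fin (j - k) F'0 M1 F'M Ex xa.
    by rewrite e e2 /= lerDl lerD2l h2 fine_ge0//; exact: LLi_ge0.
  by have [f hf] := choice H; exists f.
have kapb j k : kap j <= kap k + rho ^+ k * M.
  have /andP[h1 _] := hk j x0 (maxn j k) Ex0 x0a (leq_maxl _ _).
  have /andP[_ h2] := hk k x0 (maxn j k) Ex0 x0a (leq_maxr _ _).
  exact: le_trans h1 h2.
pose l := sup (range kap).
have hs : has_sup (range kap).
  split; first by exists (kap 0%N), 0%N.
  by exists (kap 0%N + rho ^+ 0 * M) => _ [j _ <-]; exact: kapb.
have l1 k : kap k <= l by apply: sup_upper_bound => //; exists k.
have l2 k : l <= kap k + rho ^+ k * M.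
  by apply: ge_sup; [exists (kap 0%N), 0%N|move=> _ [j _ <-]; exact: kapb].
have hl k x : TMS E x -> x 0%N = a -> `|fine (iter k LL F x) - l| <= rho ^+ k * M.
  move=> Ex xa; have /andP[h1 h2] := hk k x k Ex xa (leqnn k).
  by rewrite ler_norml; have := l1 k; have := l2 k; lra.
by move=> k x Ex xa; rewrite (@alpha_unique F M l)//; [exact: hl|move=> j; exact: hl].
Qed.

Lemma N1_bound : exists2 M0 : R, 1 <= M0 & forall x, TMS E x -> x 0%N = a -> (N (fun=> 1) x <= M0%:E)%E.
Proof.
have /andP[q0 q1] := q01.
pose Q := K / (1 - q); have Q0 : 0 < Q by rewrite divr_gt0 ?subr_gt0.
have i0 n F : nneg F -> nneg (iter n (taboo a L) F) by exact: (po_ge0 (po_iter pA n)).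
have e1 : nneg (entry a L (fun=> 1%E)) by exact: (po_ge0 pB).
have An n x : TMS E x -> x 0%N = a -> (iter n (taboo a L) (fun=> 1) x <= (Q * q ^+ n)%:E)%E.
  move=> Ex xa; rewrite (po_eq (po_iter pA n) (G := LL (fun=> 1%E)))//; last 2 first.
  - exact: po_ge0 pLL _ _.
  - by move=> y Ey; rewrite LL1.
  rewrite /loopop /resolvent (po_sum (po_iter pA n)); last by move=> k; exact: i0.
  apply: (@le_trans _ _ (\sum_(k <oo) ((K * q ^+ n) * q ^+ k)%:E)%E).
    apply: lee_nneseries => [k _ _|k _]; first by apply: (i0); exact: (i0).
    by rewrite -iterD -mulrA -exprD; exact: tail.
  have hq : 0 <= q < 1 by rewrite (ltW q0).
  have hK : 0 <= K * q ^+ n by rewrite mulr_ge0 ?exprn_ge0 ?(ltW K0) ?(ltW q0).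
  rewrite geometric_nneseries//.
  by rewrite lee_fin /Q mulrAC.
exists (Num.max 1 (Q / (1 - q))); first by rewrite le_max lexx.
move=> x Ex xa; apply: (@le_trans _ _ (Q / (1 - q))%:E); last by rewrite lee_fin le_max lexx orbT.
rewrite -(geometric_nneseries (ltW Q0)); last by rewrite (ltW q0).
by apply: lee_nneseries => n *; [exact: i0|exact: An].
Qed.

Variable M0 : R.
Hypothesis M01 : 1 <= M0.
Hypothesis N1M : forall x, TMS E x -> x 0%N = a -> (N (fun=> 1) x <= M0%:E)%E.

Let M00 : 0 <= M0. Proof. exact: le_trans ler01 M01. Qed.
Let N0 F : nneg F -> nneg (N F). Proof. exact: (po_ge0 pN). Qed.
Let n1 : nneg (fun _ : nat -> V => 1%E : \bar R). Proof. by []. Qed.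

Definition sreg (C M : R) F := [/\ nneg F, 0 <= C, 0 <= M,
  forall x, TMS E x -> (F x <= M%:E)%E & reg E theta cc (fun x => F x + C%:E)%E].

Lemma N_bound F (M : R) x : nneg F -> 0 <= M -> (forall x, TMS E x -> (F x <= M%:E)%E) ->
  TMS E x -> x 0%N = a -> (N F x <= (M0 * M)%:E)%E.
Proof.
move=> F0 M_0 FM Ex xa; apply: (@le_trans _ _ (M%:E * N (fun=> 1) x)%E).
  rewrite -(po_scale pN)//; apply: (po_le pN) => //; first by move=> y; rewrite mule1 lee_fin.
  by move=> y Ey; rewrite mule1; apply: FM.
by rewrite mulrC EFinM lee_wpmul2l ?lee_fin// N1M.
Qed.

Lemma reg_one : reg E theta cc (fun _ : nat -> V => 1%E : \bar R).
Proof. by apply: reg_cst => //; exact: ltW cc_gt0. Qed.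

Definition ell0 F := alpha (N F).

Lemma ell0_dist C M F : sreg C M F -> forall k x, TMS E x -> x 0%N = a ->
  `|fine (iter k LL (N F) x) - ell0 F| <= rho ^+ k * (M0 * (M + C + C)).
Proof.
move=> [F0 C0 M_0 FM rF].
pose G1 := N (fun x => F x + C%:E)%E.
have FC0 : nneg (fun x => F x + C%:E)%E by move=> x; rewrite adde_ge0.
have G1E x : G1 x = (N F x + C%:E * N (fun=> 1) x)%E.
  rewrite -(po_scale pN)//; rewrite -(po_add pN)//; last by move=> y; rewrite mule1 lee_fin.
  by congr (N _ x); apply/funext => y; rewrite mule1.
have G10 : nneg G1 by exact: N0.
have G1b x : TMS E x -> x 0%N = a -> (G1 x <= (M0 * (M + C))%:E)%E.
  move=> Ex xa; apply: N_bound => //; first by rewrite addr_ge0.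
  by move=> y Ey; rewrite EFinD leeD2r// FM.
have G1r : reg E theta cc G1 by exact: reg_Ncc.
have MC0 : 0 <= M0 * (M + C) by rewrite mulr_ge0// addr_ge0.
have h1 := alpha_reg G10 G1r MC0 G1b.
have h2 := alpha_reg (N0 n1) (reg_Ncc n1 reg_one) M00 N1M.
have key k x : TMS E x -> x 0%N = a ->
    `|fine (iter k LL (N F) x) - (alpha G1 - C * alpha (N (fun=> 1%E)))| <= rho ^+ k * (M0 * (M + C + C)).
  move=> Ex xa; have := h1 k x Ex xa; have := h2 k x Ex xa.
  have [e1 _] := LLi_fin k G10 MC0 G1b Ex xa.
  have [e2 _] := LLi_fin k (N0 n1) M00 N1M Ex xa.
  have NFb y : TMS E y -> y 0%N = a -> (N F y <= (M0 * M)%:E)%E by move=> *; exact: N_bound.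
  have [e3 _] := LLi_fin k (N0 F0) (mulr_ge0 M00 M_0) NFb Ex xa.
  have : iter k LL G1 x = (iter k LL (N F) x + C%:E * iter k LL (N (fun=> 1)) x)%E.
    rewrite -(po_scale (po_iter pLL k))//; last exact: N0.
    rewrite -(po_add (po_iter pLL k)) //; first by congr (iter _ _ _ x); apply/funext.
    - exact: N0.
    - by move=> y; rewrite mule_ge0// N0.
  rewrite e1 e2 e3 -EFinM -EFinD => -[] -> /=.
  set v := fine (iter k LL (N (fun=> 1%E)) x); set u := fine _.
  set b1 := alpha G1; set b2 := alpha _ => h3 h4.
  have -> : u - (b1 - C * b2) = (u + C * v - b1) - C * (v - b2) by ring.
  apply: (le_trans (ler_normB _ _)); rewrite normrM (ger0_norm C0).
  apply: (le_trans (lerD h4 (ler_wpM2l C0 h3))).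
  by rewrite le_eqVlt; apply/orP; left; apply/eqP; ring.
move=> k x Ex xa; rewrite /ell0 (alpha_unique (l := alpha G1 - C * alpha (N (fun=> 1%E))) (M := M0 * (M + C + C))).
  exact: key.
by move=> j; exact: key.
Qed.

Lemma sreg_fin C M F k x : sreg C M F -> TMS E x -> x 0%N = a ->
  (iter k LL (N F) x)%E = (fine (iter k LL (N F) x))%:E /\ fine (iter k LL (N F) x) <= M0 * M.
Proof.
move=> [F0 C0 M_0 FM rF] Ex xa.
by apply: LLi_fin => //; [exact: N0|exact: mulr_ge0|move=> *; exact: N_bound].
Qed.

Lemma ell0_cvg C M F : sreg C M F -> (fun k => fine (iter k LL (N F) x0)) @ \oo --> ell0 F.
Proof.
move=> sF; apply/cvgrPdist_le => e e0.
have := cvg_geomM (M0 * (M + C + C)) => /cvgrPdist_le/(_ _ e0); apply: filterS => k.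
rewrite sub0r normrN => h; rewrite distrC; apply: (le_trans (ell0_dist sF k Ex0 x0a)).
exact: le_trans (ler_norm _) h.
Qed.

Lemma ell0_ge0 C M F : sreg C M F -> 0 <= ell0 F.
Proof.
move=> sF; rewrite -(cvg_lim _ (ell0_cvg sF))//; apply: limr_ge; first by apply/cvg_ex; exists (ell0 F); exact: ell0_cvg sF.
apply: nearW => k; rewrite fine_ge0//; apply: LLi_ge0; apply: N0; by case: sF.
Qed.

Lemma ell0_le C M F C' M' G : sreg C M F -> sreg C' M' G ->
  (forall x, TMS E x -> (F x <= G x)%E) -> ell0 F <= ell0 G.
Proof.
move=> sF sG FG; rewrite -(cvg_lim _ (ell0_cvg sF))// -(cvg_lim _ (ell0_cvg sG))//.
apply: ler_lim.
- by apply/cvg_ex; exists (ell0 F); exact: ell0_cvg sF.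
- by apply/cvg_ex; exists (ell0 G); exact: ell0_cvg sG.
apply: nearW => k; have [e1 _] := sreg_fin k sF Ex0 x0a; have [e2 _] := sreg_fin k sG Ex0 x0a.
rewrite -lee_fin -e1 -e2; case: sF => F0 _ _ _ _; case: sG => G0 _ _ _ _.
apply: LLi_le => //; [exact: N0|exact: N0|move=> y Ey _; exact: (po_le pN)].
Qed.

Lemma ell0_eq C M F C' M' G : sreg C M F -> sreg C' M' G ->
  (forall x, TMS E x -> F x = G x) -> ell0 F = ell0 G.
Proof.
by move=> sF sG FG; apply/eqP; rewrite eq_le; apply/andP; split;
  [apply: ell0_le sF sG _|apply: ell0_le sG sF _] => x Ex; rewrite FG.
Qed.

Lemma ell0_add C M F C' M' G : sreg C M F -> sreg C' M' G ->
  ell0 (fun x => F x + G x)%E = ell0 F + ell0 G.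
Proof.
move=> sF sG; apply/cvg_lim => //.
rewrite (_ : (fun k => _) = (fun k => fine (iter k LL (N F) x0) + fine (iter k LL (N G) x0))).
  by apply: cvgD; [exact: ell0_cvg sF|exact: ell0_cvg sG].
apply/funext => k; have [e1 _] := sreg_fin k sF Ex0 x0a; have [e2 _] := sreg_fin k sG Ex0 x0a.
case: sF => F0 _ _ _ _; case: sG => G0 _ _ _ _.
have -> : iter k LL (N (fun x => F x + G x)%E) x0 = (iter k LL (N F) x0 + iter k LL (N G) x0)%E.
  rewrite -(po_add (po_iter pLL k)); [|exact: N0|exact: N0].
  by congr (iter _ _ _ x0); apply/funext => y; rewrite (po_add pN).
by rewrite e1 e2.
Qed.

Lemma ell0_scale C M F (r : R) : 0 <= r -> sreg C M F ->
  ell0 (fun x => r%:E * F x)%E = r * ell0 F.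
Proof.
move=> r0 sF; apply/cvg_lim => //.
rewrite (_ : (fun k => _) = (fun k => r * fine (iter k LL (N F) x0))).
  by apply: cvgMr; exact: ell0_cvg sF.
apply/funext => k; have [e1 _] := sreg_fin k sF Ex0 x0a.
case: sF => F0 _ _ _ _.
have -> : iter k LL (N (fun x => r%:E * F x)%E) x0 = (r%:E * iter k LL (N F) x0)%E.
  rewrite -(po_scale (po_iter pLL k))//; last exact: N0.
  by congr (iter _ _ _ x0); apply/funext => y; rewrite (po_scale pN).
by rewrite e1.
Qed.

Lemma ell0_zero : ell0 (fun=> 0%E) = 0.
Proof.
apply/cvg_lim => //; rewrite (_ : (fun k => _) = (fun=> 0)); first exact: cvg_cst.
apply/funext => k; rewrite (_ : N (fun=> 0%E) = fun=> 0%E); first by rewrite (po_0 (po_iter pLL k)).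
by apply/funext => y; rewrite (po_0 pN).
Qed.

Lemma ell0_series (f : nat -> (nat -> V) -> \bar R) F C M :
  (forall n, sreg C M (f n)) -> (forall n, sreg C M (fun x => \sum_(0 <= i < n) f i x)%E) ->
  sreg C M F -> (forall x, TMS E x -> F x = \sum_(n <oo) f n x)%E ->
  (\sum_(n <oo) (ell0 (f n))%:E = (ell0 F)%:E)%E.
Proof.
move=> sf sS sF FE.
have ef n : 0 <= ell0 (f n) by exact: ell0_ge0 (sf n).
have f0 n : nneg (f n) by case: (sf n).
have F0 : nneg F by case: sF.
have eS n : ell0 (fun x => \sum_(0 <= i < n) f i x)%E = \sum_(0 <= i < n) ell0 (f i).
  elim: n => [|n IH].
    rewrite big_geq// -[RHS]ell0_zero; congr ell0; apply/funext => y.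
    by rewrite big_geq.
  rewrite big_nat_recr//= -IH -(ell0_add (sS n) (sf n)).
  by congr ell0; apply/funext => y; rewrite big_nat_recr.
apply/eqP; rewrite eq_le; apply/andP; split.
  apply: lime_le; first by apply: is_cvg_nneseries => n _ _; rewrite lee_fin.
  apply: nearW => n; rewrite sumEFin lee_fin -eS; apply: (ell0_le (sS n) sF).
  move=> x Ex; rewrite FE//; apply: nneseries_lim_ge => i _ _; exact: f0.
set Lam := (\sum_(n <oo) (ell0 (f n))%:E)%E.
have LamS n : ((ell0 (fun x => \sum_(0 <= i < n) f i x)%E)%:E <= Lam)%E.
  rewrite eS -sumEFin; apply: nneseries_lim_ge => i _ _; by rewrite lee_fin.
have H k : ((ell0 F)%:E <= Lam + (2 * (rho ^+ k * (M0 * (M + C + C))))%:E)%E.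
  set r := rho ^+ k * _.
  have [eF _] := sreg_fin k sF Ex0 x0a.
  have h1 := ell0_dist sF k Ex0 x0a.
  have kF : (iter k LL (N F) x0 <= Lam + r%:E)%E.
    rewrite (@LLi_eq k (N F) (fun x => \sum_(n <oo) N (f n) x)%E)//; [|exact: N0| |]; last 2 first.
    - by move=> y; apply: nneseries_ge0 => n _ _; exact: N0.
    - move=> y Ey ya; rewrite -(po_sum pN)//; apply: (po_eq pN) => //.
      by move=> z; apply: nneseries_ge0 => n _ _; exact: f0.
    rewrite (po_sum (po_iter pLL k)); last by move=> n; exact: N0.
    apply: lime_le; first by apply: is_cvg_nneseries => n _ _; apply: LLi_ge0; exact: N0.
    apply: nearW => n.
    rewrite -(po_fsum (po_iter pLL k)); last by move=> i; exact: N0.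
    have -> : (fun y => \sum_(i <- index_iota 0 n) N (f i) y)%E = N (fun x => \sum_(0 <= i < n) f i x)%E.
      by apply/funext => y; rewrite (po_fsum pN).
    have [eS' _] := sreg_fin k (sS n) Ex0 x0a.
    have h2 := ell0_dist (sS n) k Ex0 x0a.
    rewrite eS'; apply: (@le_trans _ _ ((ell0 (fun x => \sum_(0 <= i < n) f i x)%E)%:E + r%:E)%E); last exact: leeD2r.
    by rewrite -EFinD lee_fin; move: h2; rewrite ler_norml => /andP[_]; rewrite -/r; lra.
  apply: (@le_trans _ _ (iter k LL (N F) x0 + r%:E)%E).
    by rewrite eF -EFinD lee_fin; move: h1; rewrite ler_norml => /andP[+ _]; rewrite -/r; lra.
  apply: (le_trans (leeD2r _ kF)); rewrite -addeA -EFinD.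
  by rewrite (_ : 2 * r = r + r)//; ring.
have [->|Lf] := eqVneq Lam +oo%E; first by rewrite leey.
have Lam0 : (0 <= Lam)%E by apply: nneseries_ge0 => n _ _; rewrite lee_fin.
have Lfin : Lam \is a fin_num by rewrite ge0_fin_numE// lt_neqAle Lf leey.
rewrite -(fineK Lfin) lee_fin.
have cv : (fun k : nat => fine Lam + 2 * (rho ^+ k * (M0 * (M + C + C)))) @ \oo --> fine Lam + 2 * 0.
  by apply: cvgD; [exact: cvg_cst|apply: cvgMr; exact: cvg_geomM].
rewrite mulr0 addr0 in cv; rewrite -(cvg_lim _ cv)//; apply: limr_ge.
  by apply/cvg_ex; exists (fine Lam).
by apply: nearW => k; have := H k; rewrite -(fineK Lfin) -EFinD lee_fin.
Qed.

Lemma resolvent_shift F x : nneg F -> N F x = (F x + N (taboo a L F) x)%E.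
Proof.
move=> F0; rewrite /resolvent nneseries_recl//; last first.
  by move=> k _; exact: (po_ge0 (po_iter pA k)).
congr (_ + _)%E; rewrite -(@nneseries_addn _ (fun n => iter n (taboo a L) F x) 1).
  by apply: eq_eseriesr => n _; rewrite addn1 iterSr.
by move=> n; exact: (po_ge0 (po_iter pA n)).
Qed.

Lemma sreg_L C M F : sreg C M F -> sreg C M (L F).
Proof.
move=> [F0 C0 M_0 FM rF]; split => //.
- exact: (po_ge0 pL).
- move=> x Ex; apply: (@le_trans _ _ (L (fun=> M%:E) x)).
    by apply: (po_le pL) => // y; rewrite lee_fin.
  rewrite (_ : (fun=> M%:E) = (fun y => M%:E * (fun=> 1) y)%E); last by apply/funext => y; rewrite mule1.
  by rewrite (po_scale pL)// L1// mule1.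
- have FC0 : nneg (fun x => F x + C%:E)%E by move=> x; rewrite adde_ge0.
  have h : reg E theta cc (L (fun x => F x + C%:E)%E).
    apply: reg_ccW; first exact: (po_ge0 pL).
    exact: reg_transfer.
  have e x : TMS E x -> L (fun x => F x + C%:E)%E x = (L F x + C%:E)%E.
    move=> Ex; rewrite (po_add pL)//; congr (_ + _)%E.
    rewrite (_ : (fun=> C%:E) = (fun y => C%:E * (fun=> 1) y)%E); last by apply/funext => y; rewrite mule1.
    by rewrite (po_scale pL)// L1// mule1.
  by move=> n x y n_1 Ex Ey xy; rewrite -!e//; apply: h.
Qed.

Lemma alpha_sreg C M F : sreg C M F -> (fun k => fine (iter k LL F x0)) @ \oo --> alpha F /\
  forall k, iter k LL F x0 = (fine (iter k LL F x0))%:E.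
Proof.
move=> [F0 C0 M_0 FM rF].
have FC0 : nneg (fun x => F x + C%:E)%E by move=> x; rewrite adde_ge0.
have FCb x : TMS E x -> x 0%N = a -> (F x + C%:E <= (M + C)%:E)%E.
  by move=> Ex _; rewrite EFinD leeD2r// FM.
have MC : 0 <= M + C by rewrite addr_ge0.
have h1 := alpha_reg FC0 rF MC FCb.
have FMa x : TMS E x -> x 0%N = a -> (F x <= M%:E)%E by move=> Ex _; exact: FM.
have e2 k := (LLi_fin k F0 M_0 FMa Ex0 x0a).1.
have key k : `|fine (iter k LL F x0) - (alpha (fun x => F x + C%:E)%E - C)| <= rho ^+ k * (M + C).
  have := h1 k x0 Ex0 x0a.
  rewrite (po_add (po_iter pLL k))// LLi_cst// e2 /= opprB addrA => h.
  by rewrite -addrA in h; rewrite addrA in h.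
split => //; rewrite (alpha_unique key).
apply/cvgrPdist_le => e e0.
have := cvg_geomM (M + C) => /cvgrPdist_le/(_ _ e0); apply: filterS => k.
rewrite sub0r normrN => h; rewrite distrC; apply: (le_trans (key k)).
exact: le_trans (ler_norm _) h.
Qed.

Lemma ell0_L C M F : sreg C M F -> ell0 (L F) = ell0 F.
Proof.
move=> sF; have sLF := sreg_L sF.
have [cF eF] := alpha_sreg sF.
have cF' : (fun k => fine (iter k.+1 LL F x0)) @ \oo --> alpha F by rewrite (@cvg_shiftS _ (fun k => fine (iter k LL F x0))).
have F0 : nneg F by case: sF.
have E1 k : fine (iter k LL (N (L F)) x0) + fine (iter k LL F x0) =
    fine (iter k LL (N F) x0) + fine (iter k.+1 LL F x0).
  have [e1 _] := sreg_fin k sLF Ex0 x0a; have [e2 _] := sreg_fin k sF Ex0 x0a.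
  have A0 : nneg (taboo a L F) by exact: (po_ge0 pA).
  have B0 : nneg (entry a L F) by exact: (po_ge0 pB).
  have h y : (N (L F) y + F y = N F y + LL F y)%E.
    have -> : N (L F) y = (N (taboo a L F) y + LL F y)%E.
      rewrite /loopop -(po_add pN)//; congr (N _ y); apply/funext => z.
      by rewrite (taboo_entry a pL).
    by rewrite (resolvent_shift y F0) addeC addeA.
  have : (iter k LL (N (L F)) x0 + iter k LL F x0 = iter k LL (N F) x0 + iter k.+1 LL F x0)%E.
    rewrite iterSr -!(po_add (po_iter pLL k))//; [|exact: N0|exact: (po_ge0 pLL)|by apply: N0; exact: (po_ge0 pL)].
    by congr (iter _ _ _ x0); apply/funext.
  by rewrite e1 e2 (eF k) (eF k.+1) -!EFinD => -[].
have c1 : (fun k => fine (iter k LL (N (L F)) x0) + fine (iter k LL F x0)) @ \oo --> ell0 (L F) + alpha F.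
  by apply: cvgD => //; exact: ell0_cvg sLF.
have c2 : (fun k => fine (iter k LL (N (L F)) x0) + fine (iter k LL F x0)) @ \oo --> ell0 F + alpha F.
  under eq_fun do rewrite E1.
  by apply: cvgD => //; exact: ell0_cvg sF.
by apply: (@addIr _ (alpha F)); apply: (cvg_unique _ c1 c2).
Qed.

Lemma ell0_one : 1 <= ell0 (fun=> 1%E).
Proof.
have s1 : sreg 0 1 (fun=> 1%E).
  by split => //; apply: reg_add => //; [exact: reg_one|apply: reg_cst => //; exact: ltW cc_gt0].
rewrite -(cvg_lim _ (ell0_cvg s1))//; apply: limr_ge.
  by apply/cvg_ex; exists (ell0 (fun=> 1%E)); exact: ell0_cvg s1.
apply: nearW => k; have [e1 _] := sreg_fin k s1 Ex0 x0a.
rewrite -lee_fin -e1 -[leLHS](LLi_cst k ler01 Ex0 x0a); apply: LLi_le => //; first exact: N0.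
move=> y Ey ya; rewrite resolvent_shift// leeDl//; apply: N0; exact: (po_ge0 pA).
Qed.

End SpectralGap.

(** * A probability with prescribed cylinder masses *)

Section MakeProbability.
Context {d} {T : measurableType d} {R : realType}.
Variable mu0 : set T -> \bar R.
Hypothesis mu00 : mu0 set0 = 0%E.
Hypothesis mu0ge : forall A, (0 <= mu0 A)%E.
Hypothesis mu0s : semi_sigma_additive mu0.
Hypothesis mu01 : mu0 setT = 1%E.
Definition made_measure := mu0.
HB.instance Definition _ := isMeasure.Build _ _ _ made_measure mu00 mu0ge mu0s.
HB.instance Definition _ := Measure_isProbability.Build _ _ _ made_measure mu01.
Lemma probability_ex : exists P : probability T R, forall A, P A = mu0 A.
Proof. by exists (made_measure : probability T R). Qed.
End MakeProbability.

Section Decoding.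
Context {T : Type}.
Variable code : T -> nat.
Hypothesis code_inj : injective code.

Definition dec (k : nat) : option T := if pselect (exists b, code b = k) is left e then Some (projT1 (cid e)) else None.

Lemma decK b : dec (code b) = Some b.
Proof.
rewrite /dec; case: pselect => [e|[]]; last by exists b.
by congr Some; case: cid => b' /= /code_inj.
Qed.

Lemma dec_code k b : dec k = Some b -> code b = k.
Proof. by rewrite /dec; case: pselect => // e [<-]; case: cid. Qed.

Definition wcode (s : seq T) : nat := pickle (map code s).

Lemma wcode_inj : injective wcode.
Proof. by move=> s s' /(pcan_inj (@pickleK _)); exact: inj_map. Qed.

Lemma countable_seq : countable [set: seq T].
Proof. by apply/countable_injP; exists wcode => s s' _ _ /wcode_inj. Qed.

End Decoding.

Section Coding.
Context {R : realType} {V : pointedType}.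
Variable code : V -> nat.
Hypothesis code_inj : injective code.

Local Notation dec := (dec code).
Local Notation decK := (decK code_inj).

Variable c : seq V -> R.
Hypothesis c0 : forall w, 0 <= c w.
Hypothesis c1 : c [::] = 1.
Definition child (w : seq V) (k : nat) : R := if dec k is Some b then c (rcons w b) else 0.
Hypothesis csum : forall w, (\sum_(k <oo) (child w k)%:E = (c w)%:E)%E.

Lemma child_ge0 w k : 0 <= child w k.
Proof. by rewrite /child; case: (dec k). Qed.

Lemma child_sum_le w n : \sum_(0 <= k < n) child w k <= c w.
Proof.
rewrite -lee_fin -csum -sumEFin; apply: nneseries_lim_ge => k _ _.
by rewrite lee_fin child_ge0.
Qed.

(* Words are read backwards: the head of the list is the last letter. *)
Fixpoint left_end (w : seq V) : R :=
  if w is b :: w' then left_end w' + \sum_(0 <= k < code b) child (rev w') k else 0.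

Definition cell (w : seq V) : set R := `[left_end w, left_end w + c (rev w)[%classic.

Lemma cellP w t : cell w t <-> left_end w <= t < left_end w + c (rev w).
Proof. by rewrite /cell /= in_itv. Qed.

Lemma cell_sub b w : cell (b :: w) `<=` cell w.
Proof.
move=> t; rewrite !cellP /= rev_cons => /andP[h1 h2]; apply/andP; split.
  by apply: le_trans h1; rewrite lerDl; apply: sumr_ge0 => k _; exact: child_ge0.
apply: (lt_le_trans h2); rewrite -addrA lerD2l.
apply: le_trans (child_sum_le (rev w) (code b).+1).
by rewrite big_nat_recr//= [child _ (code b)]/child decK.
Qed.

Lemma cell_next w t : cell w t -> exists b, cell (b :: w) t.
Proof.
rewrite cellP => /andP[h1 h2].
have [n hn] : exists n, t < left_end w + \sum_(0 <= k < n) child (rev w) k.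
  apply: contrapT => /forallNP H.
  suff : c (rev w) <= t - left_end w by lra.
  rewrite -lee_fin -csum; apply: lime_le.
    by apply: is_cvg_nneseries => k _ _; rewrite lee_fin child_ge0.
  apply: nearW => n; rewrite sumEFin lee_fin; have /negP := H n; rewrite -leNgt; lra.
have [m hm mmin] := ex_minnP (ex_intro (fun n => t < left_end w + \sum_(0 <= k < n) child (rev w) k) n hn).
case: m hm mmin => [|m] hm mmin; first by move: hm; rewrite big_geq// addr0 ltNge h1.
have hm' : left_end w + \sum_(0 <= k < m) child (rev w) k <= t.
  by rewrite leNgt; apply/negP => /mmin; rewrite ltnn.
move: hm; rewrite big_nat_recr//= [child _ m]/child; case dm : (dec m) => [b|]; last first.
  by rewrite addr0 ltNge hm'.
move=> hm; exists b; rewrite cellP /= rev_cons (dec_code dm) hm' /=.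
by rewrite -addrA.
Qed.

Lemma cell_uniq b b' w t : cell (b :: w) t -> cell (b' :: w) t -> b = b'.
Proof.
have H b1 b2 : (code b1 < code b2)%N -> cell (b1 :: w) t -> cell (b2 :: w) t -> False.
  move=> b12; rewrite !cellP /= !rev_cons => /andP[_ h1] /andP[h2 _].
  have : \sum_(0 <= k < (code b1).+1) child (rev w) k <= \sum_(0 <= k < code b2) child (rev w) k.
    rewrite (@big_cat_nat _ _ _ (code b1).+1 0%N (code b2))//= lerDl.
    by apply: sumr_ge0 => k _; exact: child_ge0.
  by rewrite big_nat_recr//= [child _ (code b1)]/child decK; lra.
move=> h h'; apply: code_inj; apply/eqP; case: ltngtP => // hb.
  by have := H _ _ hb h h'.
by have := H _ _ hb h' h.
Qed.

Lemma cell_root t : cell [::] t <-> 0 <= t < 1.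
Proof. by rewrite cellP /= c1 add0r. Qed.

Definition nextb (w : seq V) (t : R) : V :=
  if pselect (exists b, cell (b :: w) t) is left e then projT1 (cid e) else point.

Fixpoint past (t : R) n : seq V := if n is m.+1 then nextb (past t m) t :: past t m else [::].

Definition pfx n (x : nat -> V) : seq V := [seq x i | i <- iota 0 n].

Definition decode (t : R) : nat -> V := fun n => nextb (past t n) t.

Lemma cell_past t n : 0 <= t < 1 -> cell (past t n) t.
Proof.
move=> t01; elim: n => [|n IH]; first by rewrite /= cell_root.
rewrite /= {1}/nextb; case: pselect => [e|[]]; last exact: cell_next.
by case: cid.
Qed.

Lemma cell_pastE t w : 0 <= t < 1 -> cell w t <-> w = past t (size w).
Proof.
move=> t01; split => [|->]; last exact: cell_past.
elim: w => [//|b w IH] h /=; have wE := IH (cell_sub h).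
rewrite -wE; congr (_ :: _).
by have := cell_past (size w).+1 t01; rewrite /= -wE; exact: cell_uniq h.
Qed.

Lemma rev_past t n : rev (past t n) = pfx n (decode t).
Proof.
elim: n => [//|n IH]; rewrite /= rev_cons IH /pfx -[in RHS]addn1 iotaD map_cat.
by rewrite cats1.
Qed.

Lemma pfx_size n x : size (pfx n x) = n :> nat.
Proof. by rewrite size_map size_iota. Qed.

Lemma cylP (s : seq V) x : cyl s x <-> pfx (size s) x = s.
Proof.
split => [h|h i si]; last by rewrite -h (nth_map 0%N) ?size_iota// nth_iota.
apply: (@eq_from_nth _ point); first exact: pfx_size.
by move=> i; rewrite pfx_size => si; rewrite -h// (nth_map 0%N) ?size_iota// nth_iota.
Qed.

Lemma cell_cyl t w : 0 <= t < 1 -> cell (rev w) t <-> cyl w (decode t).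
Proof.
move=> t01; rewrite cell_pastE// size_rev cylP -rev_past; split => [h|h].
  by rewrite -h revK.
by rewrite -{1}h revK.
Qed.

Local Notation D := (`[0, 1[%classic : set R).

Lemma measurable_cell w : measurable (cell w).
Proof. exact: measurable_itv. Qed.

Lemma decode_measurable : measurable_fun D (decode : R -> seqM V).
Proof.
apply: (@measurability _ _ _ (seqM V) _ _ (@cylinders V)) => //.
move=> _ [_ [i [b ->]] <-].
have -> : D `&` decode @^-1` [set x | x i = b] =
    \bigcup_(w in [set w : seq V | size w = i.+1 /\ nth point w i = b]) (D `&` cell (rev w)).
  apply/seteqP; split => [t [Dt /= tb]|t [w [/= sw wb] [Dt ct]]].
    have t01 : 0 <= t < 1 by move: Dt; rewrite /= in_itv.
    exists (pfx i.+1 (decode t)).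
      by split; [exact: pfx_size|rewrite (nth_map 0%N) ?size_iota// nth_iota].
    by split => //; apply/cell_cyl => //; apply/cylP; rewrite pfx_size.
  split => //=; have t01 : 0 <= t < 1 by move: Dt; rewrite /= in_itv.
  by move/cell_cyl : ct => /(_ t01) ->; rewrite ?sw.
rewrite bigcup_mkcond; apply: countable_bigcupT_measurable; first exact: (countable_seq code_inj).
move=> w; case: ifP => // _; apply: measurableI => //; exact: measurable_cell.
Qed.

Lemma coded_probability : exists mu : probability (seqM V) R, forall w, mu (cyl w) = (c w)%:E.
Proof.
pose mu0 (A : set (seqM V)) : \bar R := lebesgue_measure (D `&` decode @^-1` A).
have [mu muE] : exists mu : probability (seqM V) R, forall A, mu A = mu0 A.
  apply: probability_ex.
  - by rewrite /mu0 preimage_set0 setI0 measure0.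
  - by move=> A; apply: measure_ge0.
  - move=> F mF tF mUF; rewrite /mu0 preimage_bigcup setI_bigcupr.
    apply: measure_semi_sigma_additive.
    + by move=> n; exact: decode_measurable.
    + apply/trivIsetP => /= i j _ _ ij; rewrite setIACA setIid -preimage_setI.
      by move/trivIsetP : tF => /(_ _ _ _ _ ij) ->//; rewrite preimage_set0 setI0.
    + by rewrite -setI_bigcupr -preimage_bigcup; exact: decode_measurable.
  - rewrite /mu0 preimage_setT setIT lebesgue_measure_itv/= lte_fin ltr01.
    by rewrite -EFinD subr0.
exists mu => w; rewrite muE /mu0.
have -> : D `&` decode @^-1` (cyl w) = cell (rev w).
  apply/seteqP; split => [t [Dt /= tw]|t ct].
    by apply/cell_cyl => //; move: Dt; rewrite /= in_itv.
  have t01 : 0 <= t < 1.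
    apply/cell_root; elim: (rev w) ct => [//|b w' IH] /cell_sub; exact: IH.
  by split; [rewrite /= in_itv|apply/cell_cyl].
rewrite lebesgue_measure_itv/= revK lte_fin ltrDl.
case: ltP => h; first by rewrite -EFinD addrAC subrr add0r.
by congr (_%:E); apply/eqP; rewrite eq_le c0 h.
Qed.

End Coding.

(** * Measurability and duality *)

Section Measurability.
Context {R : realType} {V : pointedType} (E : rel V).
Variable code : V -> nat.
Hypothesis code_inj : injective code.
Implicit Types (x y z : nat -> V) (F G : (nat -> V) -> \bar R).

Lemma measurable_coord (i : nat) (b : V) : measurable ([set x | x i = b] : set (seqM V)).
Proof. by apply: sub_sigma_algebra; exists i, b. Qed.

Lemma measurable_cyl w : measurable (cyl w : set (seqM V)).
Proof.
have -> : cyl w = \bigcap_(i in [set i | (i < size w)%N]) [set x : seqM V | x i = nth point w i].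
  by apply/seteqP; split => [x h i|x h i] /=; exact: h.
by apply: bigcap_measurableType => i _; exact: measurable_coord.
Qed.

Lemma bigcup_measurable_countable (I : choiceType) (W : set I) (F : I -> set (seqM V)) :
  countable [set: I] -> (forall i, measurable (F i)) -> measurable (\bigcup_(i in W) F i).
Proof.
move=> cI mF; rewrite bigcup_mkcond; apply: countable_bigcupT_measurable => // w.
by case: ifP.
Qed.

Lemma measurable_cylfam (W : set (seq V)) : measurable (\bigcup_(w in W) (cyl w : set (seqM V))).
Proof. by apply: bigcup_measurable_countable => //; [exact: (countable_seq code_inj)|exact: measurable_cyl]. Qed.

Lemma measurable_TMS : measurable (TMS E : set (seqM V)).
Proof.
have -> : TMS E = \bigcap_i (\bigcup_(b in [set b : V | True]) ([set x : seqM V | x i = b] `&`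
   \bigcup_(b' in [set b' : V | E b b']) [set x : seqM V | x i.+1 = b'])).
  apply/seteqP; split => [x h i _|x h i]; first by exists (x i) => //; split => //; exists (x i.+1) => //=; exact: h.
  by have [b _ [/= <-] [b' /= + ->]] := h i I.
have cV : countable [set: V] by apply/countable_injP; exists code => x y _ _ /code_inj.
apply: bigcap_measurableType => i _; apply: bigcup_measurable_countable => // b.
apply: measurableI; first exact: measurable_coord.
by apply: bigcup_measurable_countable => // b'; exact: measurable_coord.
Qed.

Definition openT (U : set (nat -> V)) := forall x, TMS E x -> U x ->
  exists n, forall z, TMS E z -> agree n x z -> U z.

Lemma openT_measurable U : openT U -> measurable (TMS E `&` U : set (seqM V)).
Proof.
move=> oU; have -> : TMS E `&` U = TMS E `&`
    (\bigcup_(w in [set w | TMS E `&` cyl w `<=` U]) cyl w).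
  apply/seteqP; split => x [Ex]; last by case=> w wU wx; split => //; apply: wU.
  move=> Ux; split => //; have [n hn] := oU x Ex Ux.
  exists (pfx n x); last by apply/cylP; rewrite pfx_size.
  move=> z [Ez /cylP]; rewrite pfx_size => zx; apply: hn => // i ni.
  have := congr1 (fun s => nth point s i) zx.
  by rewrite !(nth_map 0%N) ?size_iota// nth_iota.
apply: measurableI; first exact: measurable_TMS.
exact: measurable_cylfam.
Qed.

Definition mf F := measurable_fun (TMS E : set (seqM V)) (F : seqM V -> \bar R).

Lemma lsc_mf F : (forall y : R, openT [set x | (y%:E < F x)%E]) -> mf F.
Proof.
move=> h; apply: (@measurability _ _ (seqM V) (\bar R) _ _ (@ErealGenOInfty.G R)); first exact: ErealGenOInfty.measurableE.
move=> _ [_ [y ->] <-]; rewrite (_ : _ @^-1` _ = [set x | (y%:E < F x)%E]); first exact: openT_measurable.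
by apply/seteqP; split => x /=; rewrite in_itv/= andbT.
Qed.

Lemma cont_mf (r : (nat -> V) -> R) : cont_on_TMS E r -> mf (EFin \o r).
Proof.
move=> cr; apply: lsc_mf => y x Ex /=; rewrite lte_fin => yx.
have := cr x Ex (r x - y); rewrite subr_gt0 => /(_ yx)[n hn].
exists n => z Ez xz /=; have := hn z Ez xz; rewrite ltr_norml => /andP[+ _].
by rewrite lte_fin; lra.
Qed.

Lemma mf_real (r : (nat -> V) -> R) : mf (EFin \o r) -> measurable_fun (TMS E : set (seqM V)) (r : seqM V -> R).
Proof. by move/measurable_EFinP. Qed.

Lemma measurable_bcons b : measurable_fun setT (bcons b : seqM V -> seqM V).
Proof.
apply: (@measurability _ _ _ (seqM V) _ _ (@cylinders V)) => //.
move=> _ [_ [i [c ->]] <-]; rewrite setTI; case: i => [|j].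
  have [->|bc] := pselect (b = c).
    rewrite (_ : _ @^-1` _ = setT)//; by apply/seteqP.
  by rewrite (_ : _ @^-1` _ = set0)//; apply/seteqP; split.
exact: (measurable_coord j c).
Qed.

Lemma measurable_sshift : measurable_fun setT (@sshift V : seqM V -> seqM V).
Proof.
apply: (@measurability _ _ _ (seqM V) _ _ (@cylinders V)) => //.
move=> _ [_ [i [c ->]] <-]; rewrite setTI; exact: (measurable_coord i.+1 c).
Qed.

Lemma mf_sshift F : mf F -> mf (fun x => F (sshift x)).
Proof.
move=> mF; apply: (measurable_comp (F := TMS E : set (seqM V)) (f := F : seqM V -> _) (g := @sshift V : seqM V -> seqM V)) => //.
- exact: measurable_TMS.
- by move=> _ [x Ex <-]; exact: TMS_sshift.
- by apply: measurable_funTS; exact: measurable_sshift.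
Qed.

Lemma mf_indic (A : set (nat -> V)) : measurable (A : set (seqM V)) -> mf (EFin \o (\1_A : _ -> R)).
Proof. by move=> mA; apply: measurable_funTS; apply/measurable_EFinP; exact: (@measurable_indic _ (seqM V)). Qed.

Lemma mf_wmul (w : (nat -> V) -> R) F : mf (EFin \o w) -> mf F -> mf (wmul w F).
Proof. by move=> mw mF; exact: emeasurable_funM. Qed.

Lemma mf_series (f : nat -> (nat -> V) -> \bar R) : (forall n, nneg (f n)) -> (forall n, mf (f n)) ->
  mf (fun x => \sum_(n <oo) f n x)%E.
Proof.
move=> f0 mff; rewrite /mf; exact: (@ge0_emeasurable_sum _ (seqM V) R (TMS E) f xpredT (fun k x _ _ => f0 k x) (fun k _ => mff k)).
Qed.

Lemma preop_series F x : nneg F -> preop E F x =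
  (\sum_(k <oo) (if dec code k is Some b then if E b (x 0%N) then F (bcons b x) else 0 else 0))%E.
Proof.
move=> F0; set G := (X in (\sum_(k <oo) X k)%E).
have G0 k : (0 <= G k)%E by rewrite /G; case: (dec code k) => // b; case: ifP => // _; exact: F0.
rewrite nneseries_esumT//.
have -> : (\esum_(k in [set: nat]) G k = \esum_(k in code @` [set b | E b (x 0%N)]) G k)%E.
  rewrite [RHS]esum_mkcond; apply: eq_esum => k _; case: ifPn => // /negP kN.
  rewrite /G; case dk : (dec code k) => [b|//]; case: ifP => // Eb; case: kN.
  by apply/mem_set; exists b => //; exact: dec_code.
rewrite esum_image; last by move=> b b' _ _; exact: code_inj.
by apply: eq_esum => b Eb; rewrite /G decK// Eb.
Qed.

Lemma mf_cst (r : \bar R) : mf (fun=> r). Proof. exact: measurable_cst. Qed.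

Lemma mf_if (U : set (nat -> V)) F : measurable (U : set (seqM V)) ->
  measurable_fun (TMS E `&` U : set (seqM V)) (F : seqM V -> _) -> mf (fun x => if `[< U x >] then F x else 0%E).
Proof.
move=> mU mF; rewrite /mf (_ : (fun x => _) = F \_ U); last first.
  by apply/funext => x; rewrite patchE; case: asboolP => Ux; [rewrite mem_set|rewrite memNset].
exact/(measurable_restrict (F : seqM V -> _) mU measurable_TMS).
Qed.

Lemma mf_preop F : nneg F -> mf F -> mf (preop E F).
Proof.
move=> F0 mF; rewrite (_ : preop E F = fun x => (\sum_(k <oo) (if dec code k is Some b then
    if E b (x 0%N) then F (bcons b x) else 0 else 0))%E); last first.
  by apply/funext => x; exact: preop_series.
apply: mf_series => k.
  by move=> x; case: (dec code k) => // b; case: ifP => // _; exact: F0.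
case: (dec code k) => [b|]; last exact: mf_cst.
pose U := [set x : nat -> V | E b (x 0%N)].
have UE : U = \bigcup_(v in [set v | E b v]) [set x | x 0%N = v].
  by apply/seteqP; split => [x Ux|x [v Ev /= xv]]; [exists (x 0%N)|rewrite /U/= xv].
have cV : countable [set: V] by apply/countable_injP; exists code => x y _ _ /code_inj.
have mU : measurable (U : set (seqM V)).
  by rewrite UE; apply: bigcup_measurable_countable => // v; exact: measurable_coord.
rewrite (_ : (fun x => _) = fun x => if `[< U x >] then F (bcons b x) else 0%E); last first.
  by apply/funext => x; case: asboolP => [->//|]; rewrite /U/=; case: (E _ _).
apply: mf_if => //.
apply: (measurable_comp (F := TMS E : set (seqM V)) (f := F : seqM V -> _) (g := bcons b : seqM V -> seqM V)) => //.
- exact: measurable_TMS.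
- by move=> _ [x [Ex Ux] <-]; exact: TMS_bcons.
- by apply: measurable_funTS; exact: measurable_bcons.
Qed.

Lemma mf_transfer (w : (nat -> V) -> R) F : (forall x, 0 <= w x) -> mf (EFin \o w) -> nneg F -> mf F ->
  mf (transfer E w F).
Proof.
move=> w0 mw F0 mF; apply: mf_preop; last exact: mf_wmul.
by move=> x; rewrite /wmul mule_ge0// lee_fin.
Qed.

End Measurability.

Section RegMeasurable.
Context {R : realType} {V : pointedType} (E : rel V) (theta : R).
Hypothesis theta01 : 0 < theta < 1.
Variable code : V -> nat.
Hypothesis code_inj : injective code.
Implicit Types (x y z : nat -> V) (F G : (nat -> V) -> \bar R).

Lemma expR_geom_cvg (c : R) : (fun n : nat => expR (c * theta ^+ n)) @ \oo --> (1 : R).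
Proof.
have /andP[t0 t1] := theta01.
have h : (fun n : nat => c * theta ^+ n) @ \oo --> c * 0.
  by apply: cvgMr; apply: cvg_expr; rewrite ger0_norm//; exact: ltW.
rewrite mulr0 in h; rewrite -expR0; exact: (cvg_comp _ expR h (@continuous_expR R 0)).
Qed.

Lemma le_exp_lim (c u v : R) (n0 : nat) : (forall n, (n0 <= n)%N -> u <= expR (c * theta ^+ n) * v) -> u <= v.
Proof.
move=> h; have cv : (fun n : nat => expR (c * theta ^+ n) * v) @ \oo --> 1 * v.
  by apply: cvgMl; exact: expR_geom_cvg.
rewrite mul1r in cv; rewrite -(cvg_lim _ cv)//; apply: limr_ge; first by apply/cvg_ex; exists v.
by near=> n; apply: h; near: n; exact: nbhs_infty_ge.
Unshelve. all: by end_near. Qed.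

Lemma reg_open (c : R) (n0 : nat) F : nneg F ->
  (forall n x y, (n0 <= n)%N -> TMS E x -> TMS E y -> agree n x y -> (F x <= (expR (c * theta ^+ n))%:E * F y)%E) ->
  forall y : R, openT E [set x | (y%:E < F x)%E].
Proof.
move=> F0 rF y x Ex /= yx; apply: contrapT => H.
have {}H n : exists z, [/\ TMS E z, agree n x z & (F z <= y%:E)%E].
  apply: contrapT => N; apply: H; exists n => z Ez xz; rewrite ltNge; apply/negP => zy.
  by apply: N; exists z.
have y0 : 0 <= y by have [z [_ _ zy]] := H 0%N; rewrite -lee_fin; apply: le_trans zy.
have h n : (n0 <= n)%N -> (F x <= (expR (c * theta ^+ n) * y)%:E)%E.
  move=> n_; have [z [Ez xz zy]] := H n; apply: (le_trans (rF _ _ _ n_ Ex Ez xz)).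
  by rewrite EFinM; apply: lee_wpmul2l => //; rewrite lee_fin expR_ge0.
have Ff : F x \is a fin_num.
  by rewrite ge0_fin_numE//; apply: (le_lt_trans (h n0 (leqnn _))); exact: ltry.
move: yx; rewrite -(fineK Ff) lte_fin ltNge => /negP; apply; apply: (@le_exp_lim c _ _ n0) => n n_.
by rewrite -lee_fin (fineK Ff); exact: h.
Qed.

Lemma mf_reg c F : nneg F -> reg E theta c F -> mf E F.
Proof. by move=> F0 rF; apply: (lsc_mf code_inj); apply: (@reg_open c 1%N) => // n x y; exact: rF. Qed.

Lemma mf_regw kappa (w : (nat -> V) -> R) : (forall x, 0 <= w x) -> regw E theta kappa w -> mf E (EFin \o w).
Proof.
move=> w0 rw; apply: (lsc_mf code_inj); apply: (@reg_open kappa 2%N) => [x|n x y]; first by rewrite lee_fin.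
by move=> *; rewrite /= -EFinM lee_fin; exact: rw.
Qed.

End RegMeasurable.

Section Integral.
Import HBNNSimple.
Context {R : realType} {V : pointedType} (E : rel V).
Variable code : V -> nat.
Hypothesis code_inj : injective code.
Variable mu : probability (seqM V) R.
Implicit Types (F G : (nat -> V) -> \bar R).

Definition tint F : \bar R := (\int[mu]_(x in (TMS E : set (seqM V))) F x)%E.

Let mTMS := measurable_TMS E code_inj.
Local Notation mf := (mf E).

Lemma tint_ge0 F : nneg F -> (0 <= tint F)%E.
Proof. by move=> F0; apply: integral_ge0 => x _; exact: F0. Qed.

Lemma tint_eq F G : (forall x, TMS E x -> F x = G x) -> tint F = tint G.
Proof. by move=> h; apply: eq_integral => x /set_mem; exact: h. Qed.

Lemma tint_le F G : nneg F -> mf F -> mf G -> (forall x, TMS E x -> (F x <= G x)%E) -> (tint F <= tint G)%E.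
Proof. by move=> F0 mF mG h; apply: ge0_le_integral => // x _; exact: F0. Qed.

Lemma tint_add F G : nneg F -> nneg G -> mf F -> mf G -> tint (fun x => F x + G x)%E = (tint F + tint G)%E.
Proof. by move=> F0 G0 mF mG; apply: ge0_integralD. Qed.

Lemma tint_scale F (r : R) : nneg F -> mf F -> 0 <= r -> tint (fun x => r%:E * F x)%E = (r%:E * tint F)%E.
Proof. by move=> F0 mF r0; apply: ge0_integralZl_EFin => // x _; exact: F0. Qed.

Lemma tint_series (f : nat -> (nat -> V) -> \bar R) : (forall n, nneg (f n)) -> (forall n, mf (f n)) ->
  tint (fun x => \sum_(n <oo) f n x)%E = (\sum_(n <oo) tint (f n))%E.
Proof. by move=> f0 mff; apply: (integral_nneseries mu mTMS) => // n x _; exact: f0. Qed.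

Lemma tint_indic (A : set (nat -> V)) : measurable (A : set (seqM V)) ->
  tint (EFin \o (\1_A : _ -> R)) = mu (A `&` TMS E : set (seqM V)).
Proof. by move=> mA; exact: (integral_indic mu mTMS mA). Qed.

Hypothesis muT : mu (TMS E : set (seqM V)) = 1%E.

Lemma mu_TMS (A : set (nat -> V)) : measurable (A : set (seqM V)) ->
  mu (A `&` TMS E : set (seqM V)) = mu (A : set (seqM V)).
Proof.
move=> mA; have muC : mu (~` TMS E : set (seqM V)) = 0%E.
  by rewrite (probability_setC mu mTMS) muT -EFinB subrr.
have mC : measurable (~` TMS E : set (seqM V)) by exact: measurableC.
have mAI : measurable (A `&` TMS E : set (seqM V)) by exact: measurableI.
apply/eqP; rewrite eq_le; apply/andP; split; first by apply: le_measure; rewrite ?inE// => x [].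
rewrite -[leRHS](measureU0 mAI mC muC); apply: le_measure; rewrite ?inE//; first exact: measurableU.
by move=> x Ax; have [Ex|Ex] := pselect (TMS E x); [left|right].
Qed.

Lemma tint_indicT (A : set (nat -> V)) : measurable (A : set (seqM V)) ->
  tint (EFin \o (\1_A : _ -> R)) = mu (A : set (seqM V)).
Proof. by move=> mA; rewrite tint_indic// mu_TMS. Qed.

Lemma tint_cst (r : R) : 0 <= r -> tint (fun=> r%:E) = r%:E.
Proof. by move=> r0; rewrite /tint integral_cst//= muT mule1. Qed.

Lemma mf_sum (I : Type) (s : seq I) (F : I -> (nat -> V) -> \bar R) :
  (forall i, mf (F i)) -> mf (fun x => \sum_(i <- s) F i x)%E.
Proof.
move=> mF; elim: s => [|i s IH].
  by under eq_fun do rewrite big_nil; exact: mf_cst.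
by under eq_fun do rewrite big_cons; exact: (emeasurable_funD (mF i) IH).
Qed.

Lemma tint_fsum (I : Type) (s : seq I) (F : I -> (nat -> V) -> \bar R) : (forall i, nneg (F i)) ->
  (forall i, mf (F i)) -> tint (fun x => \sum_(i <- s) F i x)%E = (\sum_(i <- s) tint (F i))%E.
Proof.
move=> F0 mF; elim: s => [|i s IH].
  by under eq_fun do rewrite big_nil; rewrite big_nil tint_cst.
rewrite big_cons -IH -tint_add//.
- by congr tint; apply/funext => x; rewrite big_cons.
- by move=> x; apply: sume_ge0 => j _; exact: F0.
- exact: mf_sum.
Qed.

Lemma tint_mono (F : nat -> (nat -> V) -> \bar R) G : (forall n, nneg (F n)) -> (forall n, mf (F n)) ->
  (forall n x, TMS E x -> (F n x <= F n.+1 x)%E) -> (forall x, TMS E x -> (fun n => F n x) @ \oo --> G x) ->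
  (fun n => tint (F n)) @ \oo --> tint G.
Proof.
move=> F0 mF Fh FG.
have h m n x : TMS E x -> (m <= n)%N -> (F m x <= F n x)%E.
  by move=> Ex /subnK <-; elim: (n - m)%N => [//|k IH]; rewrite addSn; apply: (le_trans IH); exact: Fh.
rewrite (_ : tint G = limn (fun n => tint (F n))).
  apply: ereal_nondecreasing_is_cvgn => m n mn; apply: tint_le => // x Ex; exact: h.
rewrite -(monotone_convergence mu mTMS)//; last by move=> x Ex m n; exact: h.
  by apply: tint_eq => x Ex; apply/esym/cvg_lim => //; exact: FG.
by move=> n x _; exact: F0.
Qed.

Lemma nnsfun_decomp (h : {nnsfun seqM V >-> R}) : exists s : seq R, forall x : seqM V,
  ((h x)%:E = \sum_(r <- s) (`|r|%:E * (EFin \o \1_(h @^-1` [set r])) x))%E.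
Proof.
exists (finmap.enum_fset (fset_set (range h))) => x; rewrite [in LHS](fimfunE h) fsbig_finite//= -sumEFin.
apply: eq_big_seq => r; rewrite in_fset_set// inE => -[y _ <-].
by rewrite ger0_norm.
Qed.

Section Dual.
Variable g : (nat -> V) -> R.
Hypothesis g0 : forall x, 0 <= g x.
Hypothesis mg : mf (EFin \o g).
Hypothesis L1 : forall x, TMS E x -> transfer E g (fun=> 1%E) x = 1%E.
Hypothesis dualcyl : forall w, tint (transfer E g (EFin \o \1_(cyl w))) = mu (cyl w : set (seqM V)).
Local Notation L := (transfer E g).
Let pL : posop (TMS E) L := po_transfer E g0.

Lemma nneg_indic (A : set (nat -> V)) : nneg (EFin \o (\1_A : _ -> R)).
Proof. by move=> x; rewrite lee_fin; exact: indic_ge0'. Qed.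

Lemma cyl_setI_closed : setI_closed [set A : set (seqM V) | A = set0 \/ exists w, A = cyl w].
Proof.
move=> A B [->|[w ->]]; first by left; rewrite set0I.
move=> [->|[w' ->]]; first by left; rewrite setI0.
have H w1 w2 : (size w1 <= size w2)%N -> cyl w1 `&` cyl w2 = set0 \/ exists w, cyl w1 `&` cyl w2 = cyl w :> set (nat -> V).
  move=> s12; have [e|e] := pselect (take (size w1) w2 = w1).
    right; exists w2; apply/seteqP; split => [x [] //|x h]; split => // i iw.
    by rewrite h ?(leq_trans iw s12)// -[in RHS]e nth_take.
  left; apply/seteqP; split => // x [h1 h2]; apply: e.
  apply: (@eq_from_nth _ point); rewrite size_takel// => i iw.
  by rewrite nth_take// -h1// h2// (leq_trans iw s12).
have [h|h] := leqP (size w) (size w'); first exact: H.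
by rewrite setIC; apply: H; exact: ltnW.
Qed.

Lemma measurable_gen_cyl (A : set (seqM V)) : measurable A ->
  <<s [set A : set (seqM V) | A = set0 \/ exists w, A = cyl w] >> A.
Proof.
apply: smallest_sub; first exact: smallest_sigma_algebra.
move=> _ [i [b ->]].
have -> : [set x : nat -> V | x i = b] =
    \bigcup_k (if dec (wcode code) k is Some w then if (size w == i.+1) && (nth point w i == b) then cyl w else set0 else set0).
  apply/seteqP; split => [x /= xb|x [k _]].
    exists (wcode code (pfx i.+1 x)) => //; rewrite (decK (wcode_inj code_inj)) pfx_size eqxx/=.
    rewrite (nth_map 0%N) ?size_iota// nth_iota// add0n xb eqxx.
    by apply/cylP; rewrite pfx_size.
  case: (dec _ k) => [w|//]; case: ifP => // /andP[/eqP sw /eqP wb] h /=.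
  by rewrite h ?sw.
have [_ _ H] := @smallest_sigma_algebra _ setT [set A : set (seqM V) | A = set0 \/ exists w, A = cyl w].
apply: H => k; apply: sub_sigma_algebra.
case: (dec _ k) => [w|]; last by left.
by case: ifP => _; [right; exists w|left].
Qed.

Lemma dual_set (A : set (nat -> V)) : measurable (A : set (seqM V)) ->
  tint (L (EFin \o \1_A)) = mu (A : set (seqM V)).
Proof.
move=> mA.
have [nu nuE] : exists nu : probability (seqM V) R, forall A : set (seqM V), measurable A -> nu A = tint (L (EFin \o \1_A)).
  pose mu0 (A : set (seqM V)) : \bar R := tint (L (EFin \o \1_A)).
  suff [nu h] : exists nu : probability (seqM V) R, forall A, nu A = mu0 A by exists nu.
  apply: probability_ex.
  - rewrite /mu0 (_ : EFin \o _ = fun=> 0%E); last by apply/funext => x; rewrite /= indic0.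
    by rewrite (_ : L _ = fun=> 0%E) ?tint_cst//; apply/funext => x; rewrite (po_0 pL).
  - move=> B; apply: tint_ge0; apply: (po_ge0 pL); exact: nneg_indic.
  - move=> F mF tF mUF.
    have -> : mu0 (\bigcup_n F n) = (\sum_(n <oo) mu0 (F n))%E.
      rewrite -tint_series; last 2 first.
      - by move=> n; apply: (po_ge0 pL); exact: nneg_indic.
      - by move=> n; apply: (mf_transfer code_inj) => //; [exact: nneg_indic|exact (@mf_indic R V E _ (mF n))].
      apply: tint_eq => x Ex; rewrite -(po_sum pL)//; last by move=> n; exact: nneg_indic.
      congr (L _ x); apply/funext => y /=; rewrite (indic_bigcup) //.
    by apply: is_cvg_nneseries => n _ _; apply: tint_ge0; apply: (po_ge0 pL); exact: nneg_indic.
  - rewrite /mu0 -(@tint_cst 1)//; apply: tint_eq => x Ex; rewrite -[RHS](L1 Ex).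
    by congr (L _ x); apply/funext => y; rewrite /= indicT.
rewrite -nuE//; apply: (@g_sigma_algebra_measure_unique _ R (seqM V) [set A : set (seqM V) | A = set0 \/ exists w, A = cyl w] _ (fun=> setT) _ _ nu mu _ _ _ A).
- by move=> B [->|[w ->]]; [exact: measurable0|exact: measurable_cyl].
- by move=> _; right; exists [::]; apply/seteqP; split.
- by rewrite bigcup_const//; exists 0%N.
- exact: cyl_setI_closed.
- by move=> B [->|[w ->]]; [rewrite !measure0|exact: (etrans (nuE _ (measurable_cyl w)) (dualcyl w))].
- by move=> _; exact: (le_lt_trans (probability_le1 nu measurableT) (ltry _)).
- exact: measurable_gen_cyl.
Qed.

Lemma dual F : nneg F -> mf F -> tint (L F) = tint F.
Proof.
move=> F0 mF.
pose h n := nnsfun_approx mTMS mF n.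
have ih n x : ((h n x)%:E <= (h n.+1 x)%:E)%E.
  by rewrite lee_fin; have /(_ n n.+1 (leqnSn n))/lefP := nd_nnsfun_approx mTMS mF; exact.
have h0 n : nneg (EFin \o h n) by move=> x; rewrite lee_fin.
have mh n : mf (EFin \o h n) by apply: measurable_funTS; apply/measurable_EFinP.
have hF x : TMS E x -> (fun n => (h n x)%:E) @ \oo --> F x.
  by move=> Ex; apply: (cvg_nnsfun_approx mTMS mF) => // z _; exact: F0.
have eh n : tint (L (EFin \o h n)) = tint (EFin \o h n).
  have [s hs] := nnsfun_decomp (h n).
  pose G (r : R) := fun x => (`|r|%:E * (EFin \o (\1_(h n @^-1` [set r]) : _ -> R)) x)%E.
  have G0 r : nneg (G r) by move=> x; rewrite /G mule_ge0//; exact: nneg_indic.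
  have mI r : measurable (h n @^-1` [set r] : set (seqM V)) by rewrite -[X in measurable X]setTI; exact: measurable_funP.
  have mG r : mf (G r) by apply: (mf_wmul (w := fun=> `|r|)); [exact: mf_cst|exact (@mf_indic R V E _ (mI r))].
  have -> : EFin \o h n = fun x => (\sum_(r <- s) G r x)%E by apply/funext.
  rewrite tint_fsum// (_ : L _ = fun x => (\sum_(r <- s) L (G r) x)%E); last by apply/funext => x; exact: (po_fsum pL s G0).
  rewrite tint_fsum; last 2 first.
  - by move=> r; exact: (po_ge0 pL).
  - by move=> r; exact: (mf_transfer code_inj).
  apply: eq_bigr => r _; rewrite /G tint_scale//; [|exact: nneg_indic|exact (@mf_indic R V E _ (mI r))].
  rewrite tint_indicT// -(dual_set (mI r)) -tint_scale//; last 2 first.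
  - by apply: (po_ge0 pL); exact: nneg_indic.
  - by apply: (mf_transfer code_inj) => //; [exact: nneg_indic|exact (@mf_indic R V E _ (mI r))].
  by apply: tint_eq => x Ex; rewrite (po_scale pL)//; exact: nneg_indic.
have c1 := tint_mono h0 mh (fun n x _ => ih n x) hF.
have LF0 n : nneg (L (EFin \o h n)) by exact: (po_ge0 pL).
have mLF n : mf (L (EFin \o h n)) by exact: (mf_transfer code_inj).
have Lle n x : TMS E x -> (L (EFin \o h n) x <= L (EFin \o h n.+1) x)%E.
  by move=> Ex; apply: (po_le pL) => // y _; exact: ih.
have c2 : (fun n => tint (L (EFin \o h n))) @ \oo --> tint (L F).
  apply: tint_mono => // x Ex.
  have nd : {homo (fun n => L (EFin \o h n) x) : m n / (m <= n)%N >-> (m <= n)%E}.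
    by move=> m n /subnK <-; elim: (n - m)%N => [//|k IH]; rewrite addSn; apply: (le_trans IH); exact: Lle.
  have cv := ereal_nondecreasing_cvgn nd; rewrite (_ : L F x = ereal_sup (range (fun n => L (EFin \o h n) x)))//.
  have hle n y : TMS E y -> ((EFin \o h n) y <= F y)%E.
    move=> Ey; rewrite -(cvg_lim _ (hF y Ey))//; apply: lime_ge; first by apply/cvg_ex; exists (F y); exact: hF.
    exists n => // m /= /subnK <-; elim: (m - n)%N => [//|k IH]; rewrite addSn; exact: (le_trans IH).
  apply/eqP; rewrite eq_le; apply/andP; split.
    apply: (po_mono_lim pL (F := fun n => EFin \o h n)) => //; last by move=> n; apply: ereal_sup_ubound; exists n.
    move=> y Ey b hb; rewrite -(cvg_lim _ (hF y Ey))//; apply: lime_le; first by apply/cvg_ex; exists (F y); exact: hF.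
    exact: nearW.
  by apply: ge_ereal_sup => _ [n _ <-]; apply: (po_le pL) => // y; exact: hle.
rewrite (funext eh) in c2.
exact: (cvg_unique _ c2 c1).
Qed.

End Dual.
End Integral.

(** * The invariant measure *)

Section EquilibriumMeasure.
Context {R : realType} {V : pointedType} (E : rel V) (theta : R).
Hypothesis theta01 : 0 < theta < 1.
Variable code : V -> nat.
Hypothesis code_inj : injective code.
Variables (g : (nat -> V) -> R) (a : V) (kappa M0 : R) (x0 : nat -> V).
Hypothesis kappa0 : 0 <= kappa.
Hypothesis g0 : forall x, 0 <= g x.
Hypothesis greg : regw E theta kappa g.
Hypothesis Ex0 : TMS E x0.
Hypothesis x0a : x0 0%N = a.
Local Notation L := (transfer E g).
Local Notation LL := (loopop a L).
Local Notation N := (resolvent (taboo a L)).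
Hypothesis L1 : forall x, TMS E x -> L (fun=> 1%E) x = 1%E.
Hypothesis LL1 : forall x, TMS E x -> LL (fun=> 1%E) x = 1%E.
Hypothesis M01 : 1 <= M0.
Hypothesis N1M : forall x, TMS E x -> x 0%N = a -> (N (fun=> 1) x <= M0%:E)%E.
Implicit Types (F G : (nat -> V) -> \bar R).

Local Notation sreg := (sreg E theta kappa).
Local Notation ell0 := (ell0 E g a x0).
Local Notation cc := (cc theta kappa).
Let theta0 : 0 < theta. Proof. by case/andP: theta01. Qed.
Let cc0 : 0 < cc := cc_gt0 theta01 kappa0.
Let ellS f F C M := ell0_series theta01 kappa0 g0 greg Ex0 x0a LL1 M01 N1M (f := f) (F := F) (C := C) (M := M).
Let ell_eq C M F C' M' G := ell0_eq theta01 kappa0 g0 greg Ex0 x0a LL1 M01 N1M (C := C) (M := M) (F := F) (C' := C') (M' := M') (G := G).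
Let ell_le C M F C' M' G := ell0_le theta01 kappa0 g0 greg Ex0 x0a LL1 M01 N1M (C := C) (M := M) (F := F) (C' := C') (M' := M') (G := G).
Let ell_add C M F C' M' G := ell0_add theta01 kappa0 g0 greg Ex0 x0a LL1 M01 N1M (C := C) (M := M) (F := F) (C' := C') (M' := M') (G := G).
Let ell_scale C M F r := @ell0_scale R V E theta theta01 g a kappa x0 kappa0 g0 greg Ex0 x0a LL1 M0 M01 N1M C M F r.
Let ell_ge0 C M F := @ell0_ge0 R V E theta theta01 g a kappa x0 kappa0 g0 greg Ex0 x0a LL1 M0 M01 N1M C M F.
Let ell1_ge1 : 1 <= ell0 (fun=> 1%E) := ell0_one theta01 kappa0 g0 greg Ex0 x0a LL1 M01 N1M.
Let pL : posop (TMS E) L := po_transfer E g0.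

(* Locally constant functions are not log-regular, but become so after adding a constant;
   this is the reason for the additive constant in [sreg]. *)
Definition cylfun (n : nat) F := forall x y, TMS E x -> TMS E y -> agree n x y -> F x = F y.

Lemma sreg_cylfun n (M : R) F : nneg F -> 0 <= M -> (forall x, TMS E x -> (F x <= M%:E)%E) -> cylfun n F ->
  sreg (M / (cc * theta ^+ n)) M F.
Proof.
move=> F0 M_0 FM cF; have p0 : 0 < cc * theta ^+ n by rewrite mulr_gt0// exprn_gt0.
have C0 : 0 <= M / (cc * theta ^+ n) by rewrite divr_ge0// ltW.
split => // m x y _ Ex Ey xy.
have [nm|mn] := leqP n m.
  rewrite (cF x y)//; last by apply: agreeW xy.
  rewrite -[leLHS]mul1e; apply: lee_wpmul2r; first by rewrite adde_ge0// ?lee_fin//; exact: F0.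
  by rewrite lee_fin -expR0 ler_expR mulr_ge0// ?(ltW cc0)// exprn_ge0// ltW.
apply: (@le_trans _ _ ((M + M / (cc * theta ^+ n))%:E)); first by rewrite EFinD leeD2r// FM.
apply: (@le_trans _ _ ((expR (cc * theta ^+ m))%:E * (M / (cc * theta ^+ n))%:E)%E); last first.
  by apply: lee_wpmul2l; rewrite ?lee_fin ?expR_ge0// leeDr//; exact: F0.
rewrite -EFinM lee_fin.
apply: (@le_trans _ _ ((1 + cc * theta ^+ n) * (M / (cc * theta ^+ n)))).
  set p := _ * theta ^+ n in p0 *; rewrite le_eqVlt; apply/orP; left; apply/eqP.
  by field; rewrite gt_eqF.
apply: ler_wpM2r => //; apply: le_trans (expR_ge1Dx _) _; rewrite ler_expR.
apply: ler_wpM2l; first exact: ltW.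
apply: ler_wiXn2l; [exact: ltW|by case/andP: theta01 => _ /ltW|exact: ltnW].
Qed.

Lemma cylfun_icyl w n : (size w <= n)%N -> cylfun n (EFin \o (\1_(cyl w) : _ -> R)).
Proof.
move=> sw x y _ _ xy; congr (_%:E); rewrite !indicE; congr (_%:R); congr nat_of_bool.
apply/idP/idP => /set_mem h; apply/mem_set => i iw; rewrite -h//; [symmetry|]; apply: xy; exact: leq_trans iw sw.
Qed.

Lemma sreg_icyl w n : (size w <= n)%N -> sreg (1 / (cc * theta ^+ n)) 1 (EFin \o (\1_(cyl w) : _ -> R)).
Proof.
move=> sw; apply: sreg_cylfun => //; [exact: nneg_indic| |exact: cylfun_icyl].
by move=> x _; rewrite lee_fin indicE lern1 leq_b1.
Qed.

Lemma sreg1 : sreg 0 1 (fun=> 1%E).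
Proof.
split => //; apply: reg_add => //; [exact: reg_one|apply: reg_cst => //; exact: ltW cc0].
Qed.

Lemma sreg_scale C M F (r : R) : 0 <= r -> sreg C M F -> sreg (r * C) (r * M) (fun x => r%:E * F x)%E.
Proof.
move=> r0 [F0 C0 M_0 FM rF]; split; rewrite ?mulr_ge0//.
- by move=> x; rewrite mule_ge0//; exact: F0.
- by move=> x Ex; rewrite EFinM; apply: lee_wpmul2l; rewrite ?lee_fin ?FM.
rewrite (_ : (fun x => _) = fun x => (r%:E * (F x + C%:E))%E); first exact: reg_scale.
by apply/funext => x; rewrite ge0_muleDr//; exact: F0.
Qed.

Lemma sreg_add C M F C' M' G : sreg C M F -> sreg C' M' G -> sreg (C + C') (M + M') (fun x => F x + G x)%E.
Proof.
move=> [F0 C0 M_0 FM rF] [G0 C0' M_0' GM rG]; split; rewrite ?addr_ge0//.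
- by move=> x; rewrite adde_ge0.
- by move=> x Ex; rewrite EFinD; apply: leeD; [exact: FM|exact: GM].
rewrite (_ : (fun x => _) = fun x => ((F x + C%:E) + (G x + C'%:E))%E).
  by apply: reg_add => // x; rewrite adde_ge0.
by apply/funext => x; rewrite EFinD addeACA.
Qed.

Lemma ell0_cst (r : R) : 0 <= r -> sreg 0 r (fun=> r%:E) /\ ell0 (fun=> r%:E) = r * ell0 (fun=> 1%E).
Proof.
move=> r0; have -> : (fun=> r%:E) = (fun x : nat -> V => r%:E * (fun=> 1%E) x)%E.
  by apply/funext => x; rewrite mule1.
split; last exact: ell_scale sreg1.
by have := sreg_scale r0 sreg1; rewrite mulr0 mulr1.
Qed.

Lemma ell0_affine C M F (r D : R) : 0 <= r -> 0 <= D -> sreg C M F ->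
  sreg (r * C + 0) (r * M + D) (fun x => r%:E * F x + D%:E)%E /\
  ell0 (fun x => r%:E * F x + D%:E)%E = r * ell0 F + D * ell0 (fun=> 1%E).
Proof.
move=> r0 D0 sF; have [sD <-] := ell0_cst D0; have sr := sreg_scale r0 sF.
split; first exact: sreg_add.
by rewrite (ell_add sr sD) (ell_scale r0 sF).
Qed.

Definition rep (w : seq V) : nat -> V := if pselect (exists x, TMS E x /\ cyl w x) is left e then projT1 (cid e) else x0.

Lemma rep_TMS w : TMS E (rep w).
Proof. by rewrite /rep; case: pselect => // e; case: cid => x [] . Qed.

Lemma rep_pfx n x : TMS E x -> agree n x (rep (pfx n x)).
Proof.
move=> Ex i ni; rewrite /rep; case: pselect => [e|[]]; last first.
  by exists x; split => //; apply/cylP; rewrite pfx_size.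
case: cid => y [_ /cylP] /=; rewrite pfx_size => h.
have := congr1 (fun s => nth point s i) h.
by rewrite !(nth_map 0%N) ?size_iota// nth_iota.
Qed.

Lemma nneseries_one (f : nat -> \bar R) k : (forall j, 0 <= f j)%E -> (forall j, j <> k -> f j = 0%E) ->
  (\sum_(j <oo) f j = f k)%E.
Proof.
move=> f0 fk; rewrite nneseries_esumT// (_ : [set: nat] = [set k] `|` ~` [set k]); last by rewrite setUv.
have -> : (\esum_(i in [set k] `|` ~` [set k]) f i = \esum_(i in [set k]) f i)%E.
  rewrite setUv esum_mkcond [RHS]esum_mkcond; apply: eq_esum => j _.
  by rewrite in_setT; case: ifPn => // /negP h; apply: fk => jk; apply: h; apply/mem_set.
by rewrite esum_set1.
Qed.

Definition wterm n F k : (nat -> V) -> \bar R := fun x =>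
  if dec (wcode code) k is Some w then if size w == n then ((fine (F (rep w)))%:E * (\1_(cyl w) x)%:E)%E else 0%E else 0%E.

Lemma wterm_sum n F x : nneg F -> (forall x, TMS E x -> F x \is a fin_num) -> TMS E x ->
  (\sum_(k <oo) wterm n F k x = F (rep (pfx n x)))%E.
Proof.
move=> F0 Ff Ex; rewrite (nneseries_one (k := wcode code (pfx n x))).
- rewrite /wterm (decK (wcode_inj code_inj)) pfx_size eqxx indicE mem_set ?mulr1 ?mule1.
    by rewrite fineK//; apply: Ff; exact: rep_TMS.
  by apply/cylP; rewrite pfx_size.
- move=> j; rewrite /wterm; case: (dec _ _) => // w; case: ifP => // _; rewrite mule_ge0// lee_fin; first exact: fine_ge0.
- move=> j; rewrite /wterm; case dj : (dec _ _) => [w|//] jk; case: ifP => // /eqP sw.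
  rewrite indicE memNset ?mule0// => /cylP; rewrite sw => h; apply: jk.
  by rewrite -(dec_code dj) h.
Qed.

Section WithMu.
Variable mu : probability (seqM V) R.
Hypothesis muT : mu (TMS E : set (seqM V)) = 1%E.
Hypothesis mucyl : forall w, mu (cyl w : set (seqM V)) = (ell0 (EFin \o (\1_(cyl w) : _ -> R)) / ell0 (fun=> 1%E))%:E.

Lemma sreg_mf C M F : sreg C M F -> mf E F.
Proof.
move=> [F0 C0 M_0 FM rF].
have h : mf E (fun x => F x + C%:E - C%:E)%E.
  apply: emeasurable_funB; last exact: mf_cst.
  apply: (mf_reg theta01 code_inj) => [x|]; last exact: rF.
  by rewrite adde_ge0//; exact: F0.
by rewrite (_ : F = fun x => F x + C%:E - C%:E)%E//; apply/funext => x; rewrite addeK.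
Qed.

Lemma tint_cylapprox n C M F : sreg C M F ->
  tint E mu (fun x => F (rep (pfx n x))) = (ell0 (fun x => F (rep (pfx n x))) / ell0 (fun=> 1%E))%:E /\
  sreg (M / (cc * theta ^+ n)) M (fun x => F (rep (pfx n x))).
Proof.
move=> [F0 C0 M_0 FM rF].
have Ff x : TMS E x -> F x \is a fin_num.
  by move=> Ex; rewrite ge0_fin_numE//; apply: le_lt_trans (FM x Ex) (ltry _).
have w0 k : nneg (wterm n F k).
  move=> x; rewrite /wterm; case: (dec _ _) => // w; case: ifP => // _; rewrite mule_ge0// lee_fin; exact: fine_ge0.
have cw k : cylfun n (wterm n F k).
  move=> x y Ex Ey xy; rewrite /wterm; case: (dec _ _) => // w; case: ifP => // /eqP sw.
  congr (_ * _)%E; apply: (cylfun_icyl (w := w) (n := n)) => //; by rewrite sw.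
have sumM k x : TMS E x -> (\sum_(0 <= i < k) wterm n F i x <= M%:E)%E.
  move=> Ex; apply: (@le_trans _ _ (\sum_(i <oo) wterm n F i x)%E).
    by apply: nneseries_lim_ge => i _ _; exact: w0.
  by rewrite wterm_sum//; apply: FM; exact: rep_TMS.
have sS k : sreg (M / (cc * theta ^+ n)) M (fun x => \sum_(0 <= i < k) wterm n F i x)%E.
  apply: sreg_cylfun => //; first by move=> x; apply: sume_ge0 => i _; exact: w0.
    exact: sumM.
  by move=> x y Ex Ey xy; apply: eq_bigr => i _; exact: cw.
have sw k : sreg (M / (cc * theta ^+ n)) M (wterm n F k).
  apply: sreg_cylfun => //; move=> x Ex; apply: le_trans (sumM k.+1 x Ex).
  by rewrite big_nat_recr//= leeDr//; apply: sume_ge0 => i _; exact: w0.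
have sF : sreg (M / (cc * theta ^+ n)) M (fun x => F (rep (pfx n x))).
  apply: sreg_cylfun => //; first by move=> x _; apply: FM; exact: rep_TMS.
  move=> x y Ex Ey xy; congr (F (rep _)); apply: (@eq_from_nth _ point); rewrite !pfx_size// => i ni.
  by rewrite !(nth_map 0%N) ?size_iota// nth_iota// add0n; exact: xy.
split => //.
have e1 : 0 < ell0 (fun=> 1%E) by exact: lt_le_trans ltr01 ell1_ge1.
transitivity (tint E mu (fun x => \sum_(k <oo) wterm n F k x)%E); first by apply: tint_eq => x Ex; rewrite wterm_sum.
rewrite (tint_series code_inj) //; last by move=> k; exact: sreg_mf (sw k).
transitivity (\sum_(k <oo) ((ell0 (fun=> 1%E))^-1%:E * (ell0 (wterm n F k))%:E))%E.
  apply: eq_eseriesr => k _; rewrite /wterm; case: (dec _ _) => [w|]; last first.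
    by rewrite (tint_cst code_inj muT)// ell0_zero// mule0.
  case: (boolP (size w == n)) => [/eqP sw'|_]; last by rewrite (tint_cst code_inj muT)// ell0_zero// mule0.
  have r0 : 0 <= fine (F (rep w)) by rewrite fine_ge0.
  have mc := measurable_cyl w.
  rewrite (tint_scale code_inj) //; last exact: (@mf_indic R V E _ mc).
  rewrite (tint_indicT code_inj muT mc) mucyl -!EFinM; congr (_%:E).
  rewrite (ell_scale (C := 1 / (cc * theta ^+ n)) (M := 1)) //; last by apply: sreg_icyl; rewrite sw'.
  by rewrite -/(EFin \o \1_(cyl w)) mulrA mulrC.
rewrite nneseriesZl; last by move=> k _; rewrite lee_fin; exact: ell_ge0 (sw k).
have h := ellS sw sS sF; rewrite {}h; first by rewrite -EFinM mulrC.
by move=> x Ex; rewrite wterm_sum.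
Qed.

Lemma tint_ell C M F : sreg C M F -> tint E mu F = (ell0 F / ell0 (fun=> 1%E))%:E.
Proof.
move=> sF; have [F0 C0 M_0 FM rF] := sF.
have e1 : 0 < ell0 (fun=> 1%E) by exact: lt_le_trans ltr01 ell1_ge1.
set e := ell0 (fun=> 1%E) in e1 *.
have mF := sreg_mf sF.
have iM : (tint E mu F <= M%:E)%E.
  rewrite -(tint_cst code_inj muT M_0); apply: (tint_le code_inj) => //; exact: mf_cst.
have i0 : (0 <= tint E mu F)%E by exact: tint_ge0.
have ifin : tint E mu F \is a fin_num by rewrite ge0_fin_numE// (le_lt_trans iM)// ltry.
rewrite -(fineK ifin); congr (_%:E); set I := fine _.
have IE : tint E mu F = I%:E by rewrite fineK.
pose Fn n := fun x => F (rep (pfx n x)).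
have sFn n : sreg (M / (cc * theta ^+ n)) M (Fn n) by case: (tint_cylapprox n sF).
have iFn n : tint E mu (Fn n) = (ell0 (Fn n) / e)%:E by case: (tint_cylapprox n sF).
have mFn n := sreg_mf (sFn n).
have Fn0 n : nneg (Fn n) by case: (sFn n).
pose t n := expR (cc * theta ^+ n).
have t1 n : 1 <= t n by rewrite -expR0 ler_expR mulr_ge0// ?(ltW cc0)// exprn_ge0// ltW.
have key n x y : (1 <= n)%N -> TMS E x -> TMS E y -> agree n x y -> (F x <= (t n)%:E * F y + ((t n - 1) * C)%:E)%E.
  move=> n1 Ex Ey xy; have := rF n x y n1 Ex Ey xy.
  rewrite ge0_muleDr ?lee_fin//.
  rewrite -EFinM -/(t n) (_ : t n * C = (t n - 1) * C + C); last by ring.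
  by rewrite EFinD addeA leeD2rE.
have tC n : 0 <= (t n - 1) * C by rewrite mulr_ge0// subr_ge0.
have t0 n : 0 <= t n by exact: le_trans ler01 (t1 n).
have rx n x : TMS E x -> agree n (rep (pfx n x)) x by move=> Ex; apply: agree_sym; exact: rep_pfx.
pose u := ell0 F / e.
have u0 : 0 <= u by rewrite divr_ge0 ?(ltW e1)//; exact: ell_ge0 sF.
have ue : ell0 F = u * e by rewrite /u divfK// gt_eqF.
pose v n := ell0 (Fn n) / e.
have ve n : ell0 (Fn n) = v n * e by rewrite /v divfK// gt_eqF.
have mA n G : mf E G -> mf E (fun x => (t n)%:E * G x + ((t n - 1) * C)%:E)%E.
  move=> mG; apply: emeasurable_funD; last exact: mf_cst.
  by apply: (mf_wmul (w := fun=> t n)); [exact: mf_cst|].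
have iA n G : nneg G -> mf E G -> tint E mu (fun x => (t n)%:E * G x + ((t n - 1) * C)%:E)%E =
    ((t n)%:E * tint E mu G + ((t n - 1) * C)%:E)%E.
  move=> G0 mG; rewrite (tint_add code_inj) //.
  - by rewrite (tint_scale code_inj)// (tint_cst code_inj muT)//.
  - by move=> x; rewrite mule_ge0// lee_fin.
  - by move=> x; rewrite lee_fin.
  - by apply: (mf_wmul (w := fun=> t n)); [exact: mf_cst|].
  - exact: mf_cst.
have h1 n : (1 <= n)%N -> I <= t n * v n + (t n - 1) * C.
  move=> n1; rewrite -lee_fin.
  have -> : (t n * v n + (t n - 1) * C)%:E = tint E mu (fun x => (t n)%:E * Fn n x + ((t n - 1) * C)%:E)%E.
    by rewrite iA// iFn -EFinM -EFinD.
  rewrite -IE; apply: (tint_le code_inj) => //; first exact: mA.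
  by move=> x Ex; apply: key => //; [exact: rep_TMS|exact: rep_pfx].
have h2 n : (1 <= n)%N -> v n <= t n * I + (t n - 1) * C.
  move=> n1; rewrite -lee_fin.
  have -> : (t n * I + (t n - 1) * C)%:E = tint E mu (fun x => (t n)%:E * F x + ((t n - 1) * C)%:E)%E.
    by rewrite iA// IE -EFinM -EFinD.
  have -> : (v n)%:E = tint E mu (Fn n) by rewrite iFn.
  apply: (tint_le code_inj) => //; first exact: mA.
  by move=> x Ex; apply: key => //; [exact: rep_TMS|exact: rx].
have h3 n : (1 <= n)%N -> u <= t n * v n + (t n - 1) * C.
  move=> n1; have [sA eA] := ell0_affine (t0 n) (tC n) (sFn n).
  rewrite -(ler_pM2r e1) -ue mulrDl -mulrA -ve -eA; apply: (ell_le sF sA).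
  by move=> x Ex; apply: key => //; [exact: rep_TMS|exact: rep_pfx].
have h4 n : (1 <= n)%N -> v n <= t n * u + (t n - 1) * C.
  move=> n1; have [sA eA] := ell0_affine (t0 n) (tC n) sF.
  rewrite -(ler_pM2r e1) -ve mulrDl -mulrA -ue -eA; apply: (ell_le (sFn n) sA).
  by move=> x Ex; apply: key => //; [exact: rep_TMS|exact: rx].
have tt n : expR (2 * cc * theta ^+ n) = t n * t n by rewrite -expRD; congr expR; ring.
rewrite -/u; apply/eqP; rewrite eq_le; apply/andP; split.
  suff : I + C <= u + C by lra.
  apply: (le_exp_lim theta01 (c := 2 * cc) (n0 := 1%N)) => n n1; rewrite tt -mulrA.
  apply: (@le_trans _ _ (t n * (v n + C))); first by have := h1 n n1; lra.
  by apply: ler_wpM2l => //; have := h4 n n1; lra.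
suff : u + C <= I + C by lra.
apply: (le_exp_lim theta01 (c := 2 * cc) (n0 := 1%N)) => n n1; rewrite tt -mulrA.
apply: (@le_trans _ _ (t n * (v n + C))); first by have := h3 n n1; lra.
by apply: ler_wpM2l => //; have := h2 n n1; lra.
Qed.

End WithMu.

Lemma equilibrium_measure : exists mu : probability (seqM V) R, [/\ mu (TMS E : set (seqM V)) = 1%E,
  forall F, nneg F -> mf E F -> tint E mu (L F) = tint E mu F &
  forall C M F, sreg C M F -> tint E mu F = (ell0 F / ell0 (fun=> 1%E))%:E].
Proof.
have e1 : 0 < ell0 (fun=> 1%E) by exact: lt_le_trans ltr01 ell1_ge1.
set e := ell0 (fun=> 1%E) in e1 *.
pose ic (w : seq V) : (nat -> V) -> \bar R := EFin \o (\1_(cyl w) : _ -> R).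
pose c (w : seq V) : R := ell0 (ic w) / e.
have sic w n : (size w <= n)%N -> sreg (1 / (cc * theta ^+ n)) 1 (ic w) by exact: sreg_icyl.
have c0 w : 0 <= c w by rewrite divr_ge0 ?(ltW e1)//; exact: ell_ge0 (sic w _ (leqnn _)).
have c1 : c [::] = 1.
  rewrite /c (_ : ic [::] = fun=> 1%E) ?divff ?gt_eqF//.
  by apply/funext => x; rewrite /ic /= indicE mem_set.
have csum w : (\sum_(k <oo) (child code c w k)%:E = (c w)%:E)%E.
  pose f k : (nat -> V) -> \bar R := if dec code k is Some b then ic (rcons w b) else fun=> 0%E.
  have f0 k : nneg (f k) by rewrite /f; case: (dec _ _) => [b|] x //; exact: nneg_indic.
  have cyl_rcons b x : cyl (rcons w b) x <-> cyl w x /\ x (size w) = b.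
    rewrite /cyl/= size_rcons; split => [h|[h1 h2] i].
      split => [i iw|]; last by rewrite h// nth_rcons ltnn eqxx.
      by rewrite h ?(leqW iw)// nth_rcons iw.
    rewrite ltnS leq_eqVlt nth_rcons => /predU1P[->|iw]; first by rewrite ltnn eqxx.
    by rewrite iw h1.
  have fE x : (\sum_(k <oo) f k x = ic w x)%E.
    rewrite (nneseries_one (k := code (x (size w)))); last 2 first.
    - by move=> j; exact: f0.
    - move=> j; rewrite /f; case dj : (dec _ _) => [b|//] jk; rewrite /ic/= indicE memNset// => /cyl_rcons[_ xb].
      by apply: jk; rewrite xb (dec_code dj).
    rewrite /f decK// /ic/= !indicE; congr (_%:R%:E); congr nat_of_bool.
    by apply/idP/idP => /set_mem h; apply/mem_set; [case/cyl_rcons : h|apply/cyl_rcons].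
  set n := (size w).+1.
  have fc k : cylfun n (f k).
    rewrite /f; case: (dec _ _) => [b|] //; apply: cylfun_icyl; by rewrite size_rcons.
  have Sle k x : TMS E x -> (\sum_(0 <= i < k) f i x <= 1%:E)%E.
    move=> Ex; apply: (@le_trans _ _ (\sum_(i <oo) f i x)%E).
      by apply: nneseries_lim_ge => i _ _; exact: f0.
    by rewrite fE /ic lee_fin indicE lern1 leq_b1.
  have sS k : sreg (1 / (cc * theta ^+ n)) 1 (fun x => \sum_(0 <= i < k) f i x)%E.
    apply: sreg_cylfun => //; first by move=> x; apply: sume_ge0 => i _; exact: f0.
      exact: Sle.
    by move=> x y Ex Ey xy; apply: eq_bigr => i _; exact: fc.
  have sf k : sreg (1 / (cc * theta ^+ n)) 1 (f k).
    apply: sreg_cylfun => //; move=> x Ex; apply: le_trans (Sle k.+1 x Ex).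
    by rewrite big_nat_recr//= leeDr//; apply: sume_ge0 => i _; exact: f0.
  transitivity (\sum_(k <oo) ((e^-1)%:E * (ell0 (f k))%:E))%E.
    apply: eq_eseriesr => k _; rewrite /child /f; case: (dec _ _) => [b|]; last by rewrite ell0_zero// mule0.
    by rewrite /c -EFinM mulrC.
  rewrite nneseriesZl; last by move=> k _; rewrite lee_fin; exact: ell_ge0 (sf k).
  rewrite (ellS sf sS (sic w n (leqnSn _))); first by rewrite -EFinM mulrC.
  by move=> x _; rewrite fE.
have [mu mucyl] := coded_probability code_inj c0 c1 csum.
have mTMS := measurable_TMS E code_inj.
have muT : mu (TMS E : set (seqM V)) = 1%E.
  have mC : measurable (~` TMS E : set (seqM V)) by exact: measurableC.
  have nC : mu.-negligible (~` TMS E : set (seqM V)).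
    pose B k : set (seqM V) := if dec (wcode code) k is Some w then
        if pselect (exists x, TMS E x /\ cyl w x) is left _ then set0 else cyl w else set0.
    have nB : mu.-negligible (\bigcup_k B k).
      apply: negligible_bigcup => k; rewrite /B; case: (dec _ _) => [w|]; last exact: negligible_set0.
      case: pselect => [_|nw]; first exact: negligible_set0.
      apply/(negligibleP _ (measurable_cyl w)); apply: (etrans (mucyl w)); rewrite /c.
      rewrite (ell_eq (sic w _ (leqnn _)) (ell0_cst (lexx _)).1) ?ell0_zero ?mul0r// => x Ex.
      by rewrite /ic/= indicE memNset// => wx; apply: nw; exists x.
    apply: negligibleS nB => x /= Ex; have [i Ei] : exists i, ~ E (x i) (x i.+1) by apply/existsNP.
    exists (wcode code (pfx i.+2 x)) => //; rewrite /B (decK (wcode_inj code_inj)).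
    case: pselect => [[y [Ey yx]]|_]; last by apply/cylP; rewrite pfx_size.
    apply: Ei; have xy j : (j < i.+2)%N -> y j = x j.
      by move=> ji; rewrite yx ?pfx_size// (nth_map 0%N) ?size_iota// nth_iota.
    by rewrite -!xy//; exact: Ey.
  have := etrans (esym (probability_setC mu mTMS)) (measure_negligible mC nC).
  have [r rE] : exists r, mu (TMS E : set (seqM V)) = r%:E.
    by exists (fine (mu (TMS E : set (seqM V)))); rewrite fineK// fin_num_measure.
  by rewrite rE -EFinB => -[] /eqP; rewrite subr_eq0 => /eqP <-.
have tE := tint_ell muT mucyl.
exists mu; split => // F F0 mF; apply: (dual code_inj muT) => //; first exact: (mf_regw theta01 code_inj g0 greg).
move=> w; have sw := sic w _ (leqnn _).
rewrite (tE _ _ _ (sreg_L theta01 kappa0 g0 greg L1 sw)) mucyl.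
by rewrite (ell0_L theta01 kappa0 g0 greg Ex0 x0a L1 LL1 M01 N1M sw).
Qed.

End EquilibriumMeasure.

(** * Kac inequality, Gibbs bound and tails *)

Section InvariantProbability.
Context {R : realType} {V : pointedType} (E : rel V).
Variable code : V -> nat.
Hypothesis code_inj : injective code.
Variable nu : probability (seqM V) R.
Hypothesis nuinv : shift_inv_prob E nu.
Implicit Types (F G : (nat -> V) -> \bar R).

Lemma tint_sshift F : nneg F -> mf E F -> tint E nu (fun x => F (sshift x)) = tint E nu F.
Proof.
move=> F0 mF; have [nuT nuS] := nuinv; have mTMS := measurable_TMS E code_inj.
have mS := @measurable_sshift V.
rewrite /tint -[RHS](@eq_measure_integral _ (seqM V) R (TMS E) nu (pushforward nu (@sshift V : seqM V -> seqM V)) F); last first.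
  by move=> A mA _; exact: nuS.
rewrite (ge0_integral_pushforward mS nu mTMS mF); last by move=> y _; exact: F0.
have mST : measurable (@sshift V @^-1` TMS E : set (seqM V)) by rewrite -[X in measurable X]setTI; exact: mS.
pose N : set (seqM V) := @sshift V @^-1` TMS E `\` TMS E.
have mN : measurable N by exact: measurableD.
rewrite (@ge0_negligible_integral _ (seqM V) R nu (@sshift V @^-1` TMS E) N)//.
- congr integral; apply/seteqP; split => x.
    by move=> Ex; split; [exact: TMS_sshift|case].
  by move=> [Ex nN]; apply: contrapT => nE; apply: nN.
- apply: (measurable_comp (F := TMS E : set (seqM V)) (f := F : seqM V -> _) (g := @sshift V : seqM V -> seqM V)) => //.
    by move=> _ [x Ex <-].
  exact: measurable_funTS.
- by move=> x _; exact: F0.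
have nuC : nu (~` TMS E : set (seqM V)) = 0%E.
  by rewrite (probability_setC nu mTMS) nuT -EFinB subrr.
apply/eqP; rewrite eq_le measure_ge0 andbT -[leRHS]nuC; apply: le_measure; rewrite ?inE//.
  exact: measurableC.
by move=> x [].
Qed.

Lemma mf_iter_sshift F n : mf E F -> mf E (fun x => F (iter n (@sshift V) x)).
Proof.
move=> mF; elim: n => [//|n IH].
rewrite (_ : (fun x => _) = (fun x => (fun z => F (iter n (@sshift V) z)) (sshift x))).
  exact: (@mf_sshift _ _ _ _ code_inj (fun z => F (iter n (@sshift V) z)) IH).
by apply/funext => x; rewrite -iterSr.
Qed.

Lemma tint_iter_sshift F n : nneg F -> mf E F -> tint E nu (fun x => F (iter n (@sshift V) x)) = tint E nu F.
Proof.
move=> F0 mF; elim: n => [//|n IH]; rewrite -[RHS]IH -[RHS]tint_sshift; last 2 first.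
- by move=> x; exact: F0.
- exact: mf_iter_sshift.
by congr tint; apply/funext => x; rewrite -iterSr.
Qed.

End InvariantProbability.

Section TransferDual.
Context {R : realType} {V : pointedType} (E : rel V).
Variable code : V -> nat.
Hypothesis code_inj : injective code.
Variable g : (nat -> V) -> R.
Hypothesis g0 : forall x, 0 <= g x.
Hypothesis mg : mf E (EFin \o g).
Local Notation L := (transfer E g).
Hypothesis L1 : forall x, TMS E x -> L (fun=> 1%E) x = 1%E.
Variable mu : probability (seqM V) R.
Hypothesis muT : mu (TMS E : set (seqM V)) = 1%E.
Hypothesis muL : forall F : (nat -> V) -> \bar R, nneg F -> mf E F -> tint E mu (L F) = tint E mu F.
Implicit Types (F G : (nat -> V) -> \bar R).
Local Notation mf := (mf E).
Let pL : posop (TMS E) L := po_transfer E g0.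

Lemma transfer_shiftM (k : (nat -> V) -> R) F x : (forall x, 0 <= k x) -> nneg F ->
  L (fun y => (k (sshift y))%:E * F y)%E x = ((k x)%:E * L F x)%E.
Proof.
move=> k0 F0; rewrite /transfer /preop -esumZl//; last by move=> b; rewrite mule_ge0// lee_fin.
apply: eq_esum => b _.
by rewrite /wmul muleCA.
Qed.

Lemma mf_real_shift (k : (nat -> V) -> R) : mf (EFin \o k) -> mf (fun x => (k (sshift x))%:E).
Proof. by move=> mk; exact: (mf_sshift code_inj mk). Qed.

Lemma adjoint (k : (nat -> V) -> R) F : (forall x, 0 <= k x) -> mf (EFin \o k) -> nneg F -> mf F ->
  tint E mu (fun x => (k (sshift x))%:E * F x)%E = tint E mu (fun x => (k x)%:E * L F x)%E.
Proof.
move=> k0 mk F0 mF; rewrite -muL.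
- by congr tint; apply/funext => x; exact: transfer_shiftM.
- by move=> x; rewrite mule_ge0// lee_fin.
- exact: (mf_wmul (mf_real_shift mk) mF).
Qed.

Lemma transfer_inv : shift_inv_prob E mu.
Proof.
split => // A mA; have mA' : measurable (@sshift V @^-1` A : set (seqM V)).
  by rewrite -[X in measurable X]setTI; exact: measurable_sshift.
rewrite -(tint_indicT code_inj muT mA') -(tint_indicT code_inj muT mA).
transitivity (tint E mu (fun x => ((\1_A (sshift x) : R)%:E * (fun=> 1%E) x)%E)).
  by apply: tint_eq => x Ex; rewrite mule1.
rewrite (adjoint (k := \1_A)) //; last 2 first.
- exact: (@mf_indic R V E _ mA).
- exact: mf_cst.
by apply: tint_eq => x Ex; rewrite L1// mule1.
Qed.

Section Kac.
Variable a : V.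
Local Notation A := (taboo a L).
Let pA : posop (TMS E) A := po_taboo a pL.
Local Notation N := (resolvent A).
Local Notation Ia := (\1_(cyl1 a) : (nat -> V) -> R).

Lemma measurable_cyl1 : measurable (cyl1 a : set (seqM V)).
Proof. exact: measurable_coord. Qed.

Lemma mf_taboo F : nneg F -> mf F -> mf (A F).
Proof.
move=> F0 mF; apply: (mf_transfer code_inj) => //; first exact: nneg_wmul.
by apply: mf_wmul => //; exact: (@mf_indic R V E _ (measurableC measurable_cyl1)).
Qed.

Lemma mf_taboo_iter F n : nneg F -> mf F -> mf (iter n A F).
Proof.
by move=> F0 mF; elim: n => [//|n IH]; apply: mf_taboo => //; exact: (po_ge0 (po_iter pA n)).
Qed.

Lemma mf_resolvent F : nneg F -> mf F -> mf (N F).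
Proof. by move=> F0 mF; apply: mf_series => n; [exact: (po_ge0 (po_iter pA n))|exact: mf_taboo_iter]. Qed.

Lemma tint_split F : nneg F -> mf F -> tint E mu F = (tint E mu (wmul Ia F) + tint E mu (A F))%E.
Proof.
move=> F0 mF; rewrite /taboo muL; last 2 first.
- exact: nneg_wmul.
- by apply: mf_wmul => //; exact: (@mf_indic R V E _ (measurableC measurable_cyl1)).
rewrite -(tint_add code_inj) //; last 4 first.
- exact: nneg_wmul.
- exact: nneg_wmul.
- by apply: mf_wmul => //; exact: (@mf_indic R V E _ measurable_cyl1).
- by apply: mf_wmul => //; exact: (@mf_indic R V E _ (measurableC measurable_cyl1)).
apply: tint_eq => x Ex; have [xa|xa] := pselect (cyl1 a x).
  by rewrite wmul_in// wmul_notin ?adde0// => /(_ xa).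
by rewrite wmul_notin// wmul_in// add0e.
Qed.

Hypothesis tail0 : forall e : R, 0 < e -> exists n, (tint E mu (iter n A (fun=> 1%E)) <= e%:E)%E.

Lemma kac_bounded F (M : R) : nneg F -> mf F -> 0 <= M -> (forall x, (F x <= M%:E)%E) ->
  (tint E mu F <= tint E mu (wmul Ia (N F)))%E.
Proof.
move=> F0 mF M_0 FM; have A0 n : nneg (iter n A F) by exact: (po_ge0 (po_iter pA n)).
have mA n := mf_taboo_iter n F0 mF.
have mAI n : mf (wmul Ia (iter n A F)) by apply: mf_wmul => //; exact: (@mf_indic R V E _ measurable_cyl1).
have H n : tint E mu F = (\sum_(0 <= k < n) tint E mu (wmul Ia (iter k A F)) + tint E mu (iter n A F))%E.
  elim: n => [|n IH]; first by rewrite big_geq// add0e.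
  by rewrite IH big_nat_recr//= -addeA; congr (_ + _)%E; exact: tint_split.
have -> : tint E mu (wmul Ia (N F)) = (\sum_(k <oo) tint E mu (wmul Ia (iter k A F)))%E.
  rewrite -(tint_series code_inj)//; last by move=> n; exact: nneg_wmul.
  by apply: tint_eq => x Ex; rewrite /resolvent /wmul nneseriesZl// => k _; exact: A0.
apply/lee_addgt0Pr => e e0.
have [|n hn] := tail0 (e := e / (M + 1)); first by rewrite divr_gt0// ltr_wpDl.
rewrite (H n); apply: leeD.
  by apply: nneseries_lim_ge => k _ _; apply: tint_ge0; exact: nneg_wmul.
have pn := po_iter pA n.
apply: (@le_trans _ _ (tint E mu (fun x => M%:E * iter n A (fun=> 1%E) x)%E)).
  apply: (tint_le code_inj) => //.
    by apply: (mf_wmul (w := fun=> M)); [exact: mf_cst|apply: mf_taboo_iter => //; exact: mf_cst].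
  move=> x Ex; rewrite -(po_scale pn)//; apply: (po_le pn) => //; first by move=> y; rewrite mule1 lee_fin.
  by move=> y Ey; rewrite mule1.
rewrite (tint_scale code_inj) //; last 2 first.
- exact: (po_ge0 pn).
- by apply: mf_taboo_iter => //; exact: mf_cst.
apply: (@le_trans _ _ (M%:E * (e / (M + 1))%:E)%E); first by apply: lee_wpmul2l; rewrite ?lee_fin.
by rewrite -EFinM lee_fin mulrA ler_pdivrMr ?ltr_wpDl// [M * e]mulrC ler_pM2l// lerDl.
Qed.

Lemma kac F : nneg F -> mf F -> (tint E mu F <= tint E mu (wmul Ia (N F)))%E.
Proof.
move=> F0 mF; pose G (j : nat) x := mine (F x) j%:R%:E.
have G0 j : nneg (G j) by move=> x; rewrite /G le_min F0 lee_fin ler0n.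
have mG j : mf (G j) by apply: measurable_mine => //; exact: mf_cst.
have GF j x : (G j x <= F x)%E by rewrite /G ge_min lexx.
have cG x : (fun j => G j x) @ \oo --> F x.
  have [Fx|Fx] := eqVneq (F x) +oo%E.
    rewrite Fx (_ : (fun j => G j x) = (fun j => j%:R%:E)); first exact/cvgeryP/cvgr_idn.
    by apply/funext => j; rewrite /G Fx minye.
  have Ff : F x \is a fin_num by rewrite ge0_fin_numE// lt_neqAle Fx leey.
  apply: cvg_near_cst; near=> j.
  rewrite /G; apply/min_idPl; rewrite -(fineK Ff) lee_fin.
  near: j; exact: nbhs_infty_ger.
have cv : (fun j => tint E mu (G j)) @ \oo --> tint E mu F.
  apply: (tint_mono code_inj) => // n x Ex; rewrite /G le_min !ge_min lexx/= lee_fin ler_nat.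
  by rewrite leqnSn orbT.
rewrite -(cvg_lim _ cv)//; apply: lime_le; first by apply/cvg_ex; exists (tint E mu F).
apply: nearW => j; apply: (@le_trans _ _ (tint E mu (wmul Ia (N (G j))))).
  by apply: (kac_bounded (M := j%:R)) => // x; rewrite /G ge_min lexx orbT.
have pN := po_resolvent pA.
have mI H : nneg H -> mf H -> mf (wmul Ia (N H)).
  by move=> H0 mH; apply: mf_wmul; [exact: (@mf_indic R V E _ measurable_cyl1)|exact: mf_resolvent].
apply: (tint_le code_inj) => //; [|exact: mI|exact: mI|].
  by apply: nneg_wmul; exact: (po_ge0 pN).
move=> x Ex; apply: lee_wpmul2l; first by rewrite lee_fin; exact: indic_ge0'.
by apply: (po_le pN) => // y _; exact: GF.
Unshelve. all: by end_near. Qed.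

End Kac.
End TransferDual.

Section GibbsBound.
Context {R : realType} {V : pointedType} (E : rel V) (theta : R).
Hypothesis theta01 : 0 < theta < 1.
Variable code : V -> nat.
Hypothesis code_inj : injective code.
Variables (g : (nat -> V) -> R) (kappa : R).
Hypothesis kappa0 : 0 <= kappa.
Hypothesis g0 : forall x, 0 < g x.
Hypothesis greg : regw E theta kappa g.
Local Notation L := (transfer E g).
Variable mu : probability (seqM V) R.
Hypothesis muT : mu (TMS E : set (seqM V)) = 1%E.
Hypothesis muL : forall F : (nat -> V) -> \bar R, nneg F -> mf E F -> tint E mu (L F) = tint E mu F.
Implicit Types (F G : (nat -> V) -> \bar R).
Let g0' x : 0 <= g x. Proof. exact: ltW. Qed.
Let pL : posop (TMS E) L := po_transfer E g0'.

Definition lg x := ln (g x).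

Lemma expR_lg x : expR (lg x) = g x. Proof. by rewrite lnK// posrE. Qed.

Lemma wholder_lg : wholder E theta kappa lg.
Proof.
move=> n n2 x y Ex Ey xy.
have H u v : TMS E u -> TMS E v -> agree n u v -> lg u - lg v <= kappa * theta ^+ n.
  move=> Eu Ev uv; rewrite lerBlDr -ler_expR expRD !expR_lg; exact: greg.
rewrite ler_norml H// andbT lerNl opprB; apply: H => //; exact: agree_sym.
Qed.

Lemma preop_ge1 F x b : nneg F -> E b (x 0%N) -> (F (bcons b x) <= preop E F x)%E.
Proof.
move=> F0 Eb; rewrite /preop -[leLHS](@esum_set1 _ _ b (fun b => F (bcons b x)))//.
rewrite esum_mkcond [leRHS]esum_mkcond; apply: le_esum => b' _.
case: ifPn => [|_]; first by rewrite inE => ->; rewrite mem_set.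
by case: ifP => // _; exact: F0.
Qed.

Lemma transfer_iter_ge F N z : nneg F -> TMS E z ->
  ((expR (birk lg N z))%:E * F z <= iter N L F (iter N (@sshift V) z))%E.
Proof.
move=> F0 Ez; elim: N => [|N IH]; first by rewrite birk0 expR0 mul1e.
have I0 : nneg (iter N L F) by exact: (po_ge0 (po_iter pL N)).
set y := iter N (@sshift V) z in IH *; have Ey : TMS E y by exact: TMS_iter.
have := @preop_ge1 (wmul g (iter N L F)) (sshift y) (y 0%N) _ _.
rewrite bcons_sshift => h; rewrite iterS; apply: le_trans (h _ (Ey 0%N)); last first.
  by move=> x; rewrite mule_ge0// lee_fin.
rewrite birkSr expRD mulrC EFinM -muleA /wmul expR_lg.
by apply: lee_wpmul2l; rewrite ?lee_fin.
Qed.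

Lemma agree_cyl n (x : nat -> V) : [set y | agree n x y] = cyl (pfx n x).
Proof.
apply/seteqP; split => y.
  move=> xy; apply/cylP; rewrite pfx_size; apply: (@eq_from_nth _ point); rewrite !pfx_size// => i ni.
  by rewrite !(nth_map 0%N) ?size_iota// nth_iota// add0n xy.
by move=> h i ni; rewrite h ?pfx_size// (nth_map 0%N) ?size_iota// nth_iota.
Qed.

Lemma measurable_agree n (x : nat -> V) : measurable ([set y | agree n x y] : set (seqM V)).
Proof. by rewrite agree_cyl; exact: measurable_cyl. Qed.

Lemma tint_iter_transfer F n : nneg F -> mf E F -> mf E (EFin \o g) -> tint E mu (iter n L F) = tint E mu F.
Proof.
move=> F0 mF mg; have I0 k : nneg (iter k L F) by exact: (po_ge0 (po_iter pL k)).
suff [] : mf E (iter n L F) /\ tint E mu (iter n L F) = tint E mu F by [].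
elim: n => [//|n [m1 IH]]; split; first exact: (mf_transfer code_inj g0' mg (I0 n) m1).
by rewrite iterS muL.
Qed.

Lemma mf_g : mf E (EFin \o g). Proof. exact: (mf_regw theta01 code_inj g0' greg). Qed.

Lemma gibbs_lower N x : TMS E x ->
  ((expR (birk lg N x - holderc theta kappa))%:E * mu ([set y | y 0%N = x N] : set (seqM V))
   <= mu ([set y | agree N.+1 x y] : set (seqM V)))%E.
Proof.
move=> Ex; set c := _ - _; pose F : (nat -> V) -> \bar R := EFin \o (\1_[set y | agree N.+1 x y] : _ -> R).
have mA := measurable_agree N.+1 x; have mB := measurable_coord 0 (x N).
rewrite -(tint_indicT code_inj muT mA) -(tint_indicT code_inj muT mB).
have F0 : nneg F by exact: nneg_indic.
have mF : mf E F by exact: (@mf_indic R V E _ mA).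
rewrite -(tint_iter_transfer N F0 mF mf_g) -(tint_scale code_inj) //; last 2 first.
- exact: nneg_indic.
- exact: (@mf_indic R V E _ mB).
apply: (tint_le code_inj).
- by move=> y; rewrite mule_ge0// ?lee_fin ?expR_ge0//; exact: indic_ge0'.
- by apply: (mf_wmul (w := fun=> expR c)); [exact: mf_cst|exact: (@mf_indic R V E _ mB)].
- suff [] : mf E (iter N L F) /\ nneg (iter N L F) by [].
  elim: N {c mA mB} F F0 mF => [//|n IH] F F0 mF; have [m1 n1] := IH F F0 mF.
  split; first exact: (mf_transfer code_inj g0' mf_g n1 m1).
  exact: (po_ge0 pL).
move=> y Ey /=; rewrite indicE; case: (boolP (_ \in _)) => [|_]; last first.
  by rewrite mule0; exact: (po_ge0 (po_iter pL N)).
rewrite inE /= => y0; pose z i := if (i < N)%N then x i else y (i - N)%N.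
have Ez : TMS E z.
  move=> i; rewrite /z; case: ltngtP => iN.
  - have [h|h] := ltnP i.+1 N; first exact: Ex.
    have -> : N = i.+1 by apply/eqP; rewrite eqn_leq h iN.
    by rewrite subnn y0 (_ : N = i.+1) ?Ex//; apply/eqP; rewrite eqn_leq h iN.
  - rewrite ltnNge (leqW (ltnW iN))/= subSn ?(ltnW iN)//; exact: Ey.
  - by rewrite iN ltnNge leqnSn/= subnn subSnn; exact: Ey.
have zy : iter N (@sshift V) z = y.
  by apply/funext => i; rewrite iter_sshiftE /z ltnNge leq_addl/= addnK.
have xz : agree N.+1 x z.
  move=> i; rewrite ltnS leq_eqVlt /z => /predU1P[->|->//].
  by rewrite ltnn subnn y0.
have := transfer_iter_ge N F0 Ez; rewrite zy; apply: le_trans.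
rewrite /F/= indicE mem_set// mule1 mule1 lee_fin ler_expR.
have := birk_dist theta01 kappa0 wholder_lg (leqnn 1) Ex Ez; rewrite -/lg => h.
have := h N; rewrite addn1 => /(_ xz); rewrite ler_norml => /andP[_].
have : holderc theta kappa * theta ^+ 1 <= holderc theta kappa.
  by rewrite expr1 ler_piMr ?holderc_ge0//; case/andP: theta01 => _ /ltW.
by rewrite /c; lra.
Qed.

Lemma state_mass_pos (b : V) : strongly_connected E -> (forall b, exists2 x, TMS E x & x 0%N = b) ->
  (0 < mu ([set y | y 0%N = b] : set (seqM V)))%E.
Proof.
move=> sc TE; have [v vp] : exists v, (0 < mu ([set y | y 0%N = v] : set (seqM V)))%E.
  apply: contrapT => H.
  have Z v : mu ([set y | y 0%N = v] : set (seqM V)) = 0%E.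
    by apply/eqP; rewrite eq_le measure_ge0 andbT leNgt; apply/negP => h; apply: H; exists v.
  pose B k : set (seqM V) := if dec code k is Some v then [set y | y 0%N = v] else set0.
  have nB : mu.-negligible (\bigcup_k B k).
    apply: negligible_bigcup => k; rewrite /B; case: (dec _ _) => [v|]; last exact: negligible_set0.
    by apply/(negligibleP _ (measurable_coord 0 v)); exact: Z.
  have nT : mu.-negligible (TMS E : set (seqM V)).
    apply: negligibleS nB => x _; exists (code (x 0%N)) => //=.
    by rewrite /B decK.
  have := etrans (esym muT) (measure_negligible (measurable_TMS E code_inj) nT).
  by move=> [] /eqP; rewrite oner_eq0.
apply: (strongly_connected_ind (P := fun b => (0 < mu ([set y | y 0%N = b] : set (seqM V)))%E) sc vp) => b1 b2 E12 p2.
have [x Ex x0] := TE b2; have Ebx : TMS E (bcons b1 x) by apply: TMS_bcons => //; rewrite x0.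
have := gibbs_lower 1 Ebx; rewrite [bcons b1 x 1%N]/= x0 => h.
apply: (lt_le_trans _ (le_trans h _)); first by rewrite mule_gt0// lte_fin expR_gt0.
apply: le_measure; rewrite ?inE; [exact: measurable_agree|exact: measurable_coord|].
by move=> y /(_ 0%N isT) /= <-.
Qed.

End GibbsBound.

Section Tails.
Context {R : realType} {V : pointedType} (E : rel V) (theta : R).
Hypothesis theta01 : 0 < theta < 1.
Variables (g : (nat -> V) -> R) (a : V) (kappa M0 K q : R) (x0 : nat -> V).
Hypothesis kappa0 : 0 <= kappa.
Hypothesis g0 : forall x, 0 <= g x.
Hypothesis greg : regw E theta kappa g.
Hypothesis Ex0 : TMS E x0.
Hypothesis x0a : x0 0%N = a.
Local Notation L := (transfer E g).
Local Notation LL := (loopop a L).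
Local Notation A := (taboo a L).
Local Notation N := (resolvent A).
Hypothesis L1 : forall x, TMS E x -> L (fun=> 1%E) x = 1%E.
Hypothesis LL1 : forall x, TMS E x -> LL (fun=> 1%E) x = 1%E.
Hypothesis M01 : 1 <= M0.
Hypothesis N1M : forall x, TMS E x -> x 0%N = a -> (N (fun=> 1) x <= M0%:E)%E.
Hypothesis K0 : 0 < K.
Hypothesis q01 : 0 < q < 1.
Hypothesis tail : forall n x, TMS E x -> x 0%N = a ->
  (iter n A (entry a L (fun=> 1)) x <= (K * q ^+ n)%:E)%E.
Variable mu : probability (seqM V) R.
Hypothesis muE : forall C M F, sreg E theta kappa C M F ->
  tint E mu F = (ell0 E g a x0 F / ell0 E g a x0 (fun=> 1%E))%:E.
Implicit Types (F G : (nat -> V) -> \bar R).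
Let pL : posop (TMS E) L := po_transfer E g0.
Let pA : posop (TMS E) A := po_taboo a pL.
Let B1 : nneg (entry a L (fun=> 1%E : \bar R)).
Proof. by apply: (po_ge0 (po_entry a pL)) => x. Qed.
Let q1 : 0 <= q < 1. Proof. by case/andP: q01 => /ltW -> ->. Qed.

Lemma taboo_one_tail n x : TMS E x -> x 0%N = a -> (iter n A (fun=> 1) x <= (K / (1 - q) * q ^+ n)%:E)%E.
Proof.
move=> Ex xa; have pn := po_iter pA n.
rewrite (po_eq pn (G := LL (fun=> 1%E))) //; last 2 first.
- by apply: (po_ge0 (po_loop a pL)) => y.
- by move=> y Ey; rewrite LL1.
rewrite /loopop /resolvent (po_sum pn); last by move=> k; exact: (po_ge0 (po_iter pA k)).
apply: (@le_trans _ _ (\sum_(k <oo) ((K * q ^+ n) * q ^+ k)%:E)%E).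
  apply: lee_nneseries => [k _ _|k _]; first by apply: (po_ge0 pn); exact: (po_ge0 (po_iter pA k)).
  by rewrite -iterD -mulrA -exprD; exact: tail.
have Kq : 0 <= K * q ^+ n by rewrite mulr_ge0 ?(ltW K0)// exprn_ge0//; case/andP: q1.
by rewrite geometric_nneseries// mulrAC.
Qed.

Lemma tint_taboo_tail n : (tint E mu (iter n A (fun=> 1%E)) <= (K / (1 - q) ^+ 2 * q ^+ n)%:E)%E.
Proof.
have /andP[q0 ql] := q1.
have s1 : sreg E theta kappa 0 1 (iter n A (fun=> 1%E)).
  split => //; first by apply: (po_ge0 (po_iter pA n)) => x.
    move=> x Ex; elim: n x Ex => [//|n IH] x Ex; rewrite iterS -[leRHS](L1 Ex) /taboo.
    apply: (po_le pL) => //; first by apply: nneg_wmul; apply: (po_ge0 (po_iter pA n)) => z.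
    move=> y Ey; have [ya|ya] := pselect (cyl1 a y); first by rewrite wmul_notin// => /(_ ya).
    by rewrite wmul_in//; exact: IH.
  rewrite (_ : (fun x => _) = iter n A (fun=> 1%E)); last by apply/funext => x; rewrite adde0.
  have pc : 0 <= cc theta kappa := ltW (cc_gt0 theta01 kappa0).
  apply: (@reg_iter _ _ _ _ theta01 A kappa) => //.
  - by move=> c' G G0 rG; exact: reg_taboo.
  - exact: stable_cc.
  - exact: reg_one.
set F := iter n A _ in s1 *; have F0 : nneg F by case: s1.
pose B := K / (1 - q) ^+ 2 * q ^+ n.
have NB x : TMS E x -> x 0%N = a -> (N F x <= B%:E)%E.
  move=> Ex xa; apply: (@le_trans _ _ (\sum_(k <oo) ((K / (1 - q) * q ^+ n) * q ^+ k)%:E)%E).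
    apply: lee_nneseries => [k _ _|k _]; first exact: (po_ge0 (po_iter pA k)).
    by rewrite /F -iterD -mulrA -exprD addnC; exact: taboo_one_tail.
  have Kq : 0 <= K / (1 - q) * q ^+ n by rewrite mulr_ge0 ?divr_ge0 ?exprn_ge0 ?(ltW K0)// subr_ge0 ltW.
  rewrite geometric_nneseries// lee_fin /B le_eqVlt; apply/orP; left; apply/eqP.
  by field; rewrite subr_eq0 gt_eqF.
have B0 : 0 <= B by rewrite mulr_ge0 ?divr_ge0 ?exprn_ge0 ?(ltW K0)// subr_ge0 ltW.
rewrite (muE s1) lee_fin.
have e1 := ell0_one theta01 kappa0 g0 greg Ex0 x0a LL1 M01 N1M.
have e0 := ell0_ge0 theta01 kappa0 g0 greg Ex0 x0a LL1 M01 N1M s1.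
apply: (@le_trans _ _ (ell0 E g a x0 F)).
  by rewrite ler_pdivrMr ?(lt_le_trans ltr01)// ler_peMr.
have cv := ell0_cvg theta01 kappa0 g0 greg Ex0 x0a LL1 M01 N1M s1.
rewrite -(cvg_lim _ cv)//; apply: limr_le; first by apply/cvg_ex; exists (ell0 E g a x0 F).
apply: nearW => k; have NF0 : nneg (N F) by exact: (po_ge0 (po_resolvent pA)).
by have [_] := LLi_fin g0 LL1 k NF0 B0 NB Ex0 x0a.
Qed.

End Tails.

(** * Upper bound for the entropy *)

Section RealIntegral.
Context {R : realType} {V : pointedType} (E : rel V).
Variable code : V -> nat.
Hypothesis code_inj : injective code.
Variable mu : probability (seqM V) R.
Hypothesis muT : mu (TMS E : set (seqM V)) = 1%E.
Implicit Types (k l : (nat -> V) -> R).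

Definition rint k (r : R) := [/\ forall x, 0 <= k x, mf E (EFin \o k) & tint E mu (EFin \o k) = r%:E].

Lemma rint_cst (r : R) : 0 <= r -> rint (fun=> r) r.
Proof. by move=> r0; split => //; [exact: mf_cst|exact: (tint_cst code_inj muT)]. Qed.

Lemma rint_add k l r s : rint k r -> rint l s -> rint (fun x => k x + l x) (r + s).
Proof.
move=> [k0 mk kr] [l0 ml ls]; split; first by move=> x; rewrite addr_ge0.
- by rewrite (_ : EFin \o _ = fun x => ((EFin \o k) x + (EFin \o l) x)%E)//; exact: emeasurable_funD.
by rewrite (_ : EFin \o _ = fun x => ((EFin \o k) x + (EFin \o l) x)%E)// (tint_add code_inj)// kr ls.
Qed.

Lemma rint_scale k r c : 0 <= c -> rint k r -> rint (fun x => c * k x) (c * r).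
Proof.
move=> c0 [k0 mk kr]; have e : EFin \o (fun x => c * k x) = fun x => (c%:E * (EFin \o k) x)%E.
  by apply/funext => x; rewrite /= EFinM.
split; first by move=> x; rewrite mulr_ge0.
- by rewrite e; apply: (mf_wmul (w := fun=> c)); [exact: mf_cst|].
by rewrite e (tint_scale code_inj)// kr EFinM.
Qed.

Lemma rint_sum (I : Type) (s : seq I) (k : I -> (nat -> V) -> R) (r : I -> R) :
  (forall i, rint (k i) (r i)) -> rint (fun x => \sum_(i <- s) k i x) (\sum_(i <- s) r i).
Proof.
move=> h; elim: s => [|i s IH].
  by rewrite big_nil; under eq_fun do rewrite big_nil; exact: rint_cst.
by rewrite big_cons; under eq_fun do rewrite big_cons; exact: rint_add.
Qed.

Lemma rint_indic (A : set (seqM V)) : measurable A -> rint (\1_A : (nat -> V) -> R) (fine (mu A)).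
Proof.
move=> mA; split; [by move=> x; exact: indic_ge0'|exact: (@mf_indic R V E _ mA)|].
by rewrite (tint_indicT code_inj muT mA) fineK// fin_num_measure.
Qed.

Lemma rint_le k l r s : rint k r -> rint l s -> (forall x, TMS E x -> k x <= l x) -> r <= s.
Proof.
move=> [k0 mk kr] [l0 ml ls] kl; rewrite -lee_fin -kr -ls; exact: (tint_le code_inj).
Qed.

Hypothesis muinv : shift_inv_prob E mu.

Lemma rint_shift k r n : rint k r -> rint (fun x => k (iter n (@sshift V) x)) r.
Proof.
move=> [k0 mk kr]; split => //; first exact: (mf_iter_sshift code_inj n mk).
by rewrite -kr -(tint_iter_sshift code_inj muinv n (F := EFin \o k)).
Qed.

Lemma rint_birk k r n : rint k r -> rint (birk k n) (n%:R * r).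
Proof.
move=> kr; rewrite (_ : n%:R * r = \sum_(i < n) r); last by rewrite sumr_const card_ord mulr_natl.
by apply: rint_sum => i; exact: rint_shift.
Qed.

End RealIntegral.

Section FiniteCoordinates.
Context {R : realType} {V : pointedType}.
Variable code : V -> nat.
Hypothesis code_inj : injective code.
Variable nu : probability (seqM V) R.

Definition fincoord (M : nat) (B : set (nat -> V)) := forall x y, agree M x y -> B x -> B y.

Lemma fincoordW M M' B : (M <= M')%N -> fincoord M B -> fincoord M' B.
Proof. by move=> MM' fB x y xy; apply: fB; exact: agreeW xy. Qed.

Lemma fincoord_measurable M B : fincoord M B -> measurable (B : set (seqM V)).
Proof.
move=> fB; have -> : B = \bigcup_(w in [set w | cyl w `<=` B]) cyl w.
  apply/seteqP; split => x; last by case=> w; apply.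
  move=> Bx; exists (pfx M x); last by apply/cylP; rewrite pfx_size.
  move=> z; rewrite -agree_cyl => h; exact: fB Bx.
exact: (measurable_cylfam code_inj).
Qed.

Definition sd (A B : set (nat -> V)) : set (seqM V) := (A `\` B) `|` (B `\` A).

Lemma measurable_sd (A B : set (nat -> V)) : measurable (A : set (seqM V)) -> measurable (B : set (seqM V)) -> measurable (sd A B).
Proof. by move=> mA mB; apply: measurableU; exact: measurableD. Qed.

Definition approximable (A : set (nat -> V)) := measurable (A : set (seqM V)) /\
  forall d : R, 0 < d -> exists M B, fincoord M B /\ (nu (sd A B) <= d%:E)%E.

Lemma approximableU A1 A2 : approximable A1 -> approximable A2 -> approximable (A1 `|` A2).
Proof.
move=> [m1 h1] [m2 h2]; split; first exact: measurableU.
move=> d d0; have [M1 [B1 [f1 n1]]] := h1 (d / 2) (divr_gt0 d0 (ltr0n _ 2)).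
have [M2 [B2 [f2 n2]]] := h2 (d / 2) (divr_gt0 d0 (ltr0n _ 2)).
exists (maxn M1 M2), (B1 `|` B2); split.
  move=> x y xy [Bx|Bx]; [left; apply: f1 Bx|right; apply: f2 Bx].
    by apply: agreeW xy; exact: leq_maxl.
  by apply: agreeW xy; exact: leq_maxr.
have mB1 := fincoord_measurable f1; have mB2 := fincoord_measurable f2.
have s1 := measurable_sd m1 mB1; have s2 := measurable_sd m2 mB2.
apply: (@le_trans _ _ (nu (sd A1 B1 `|` sd A2 B2))).
  apply: le_measure; rewrite ?inE; [apply: measurable_sd; exact: measurableU|exact: measurableU|].
  move=> x [[[a1|a2] /not_orP[b1 b2]]|[[b1|b2] /not_orP[a1 a2]]].
  - by left; left.
  - by right; left.
  - by left; right.
  - by right; right.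
apply: (le_trans (measureU2 nu s1 s2)); apply: (le_trans (leeD n1 n2)).
by rewrite -EFinD -splitr.
Qed.

Lemma measurable_approximable (A : set (seqM V)) : measurable A -> approximable A.
Proof.
apply: smallest_sub; last first.
  move=> _ [i [b ->]]; split; first exact: measurable_coord.
  move=> d d0; exists i.+1, [set x | x i = b]; split.
    by move=> x y xy /= <-; rewrite xy.
  by rewrite /sd setDv setU0 measure0 lee_fin ltW.
have ap0 : approximable set0.
  split; first exact: measurable0.
  move=> d d0; exists 0%N, set0; split => //.
  by rewrite /sd setDv setU0 measure0 lee_fin ltW.
split => //.
  move=> B [mB hB]; rewrite setTD; split; first exact: measurableC.
  move=> d d0; have [M [C [fC nC]]] := hB d d0; exists M, (~` C); split.
    by move=> x y xy Cx Cy; apply: Cx; apply: fC Cy; exact: agree_sym.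
  rewrite (_ : sd (~` B) (~` C) = sd B C)//.
  by rewrite /sd !setDE !setCK setUC [~` C `&` _]setIC [_ `&` C]setIC.
move=> F aF; have mF n : measurable (F n : set (seqM V)) by case: (aF n).
pose S n := \big[setU/set0]_(i < n) F i.
have aS n : approximable (S n).
  by elim: n => [|n IH]; rewrite /S ?big_ord0// big_ord_recr/=; exact: approximableU.
have mU : measurable (\bigcup_k F k : set (seqM V)) by exact: bigcupT_measurable.
split => // d d0; have mS n : measurable (S n : set (seqM V)) by case: (aS n).
have SU n : S n `<=` \bigcup_k F k.
  by move=> x; rewrite /S -bigcup_mkord => -[k _ Fx]; exists k.
have cS : (nu \o S) n @[n --> \oo] --> nu (\bigcup_k F k).
  rewrite (_ : \bigcup_k F k = \bigcup_n S n).
    apply: nondecreasing_cvg_mu => //; first by apply: bigcupT_measurable.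
    move=> m n mn; apply/subsetPset => x; rewrite /S -!bigcup_mkord => -[k /= km Fx].
    by exists k => //=; exact: leq_trans km mn.
  apply/seteqP; split => x [k _]; last exact: SU.
  by move=> Fx; exists k.+1 => //; rewrite /S -bigcup_mkord; exists k => /=.
have nf (B : set (seqM V)) : measurable B -> nu B \is a fin_num by move=> mB; exact: fin_num_measure.
have [n hn] : exists n, (nu (\bigcup_k F k `\` S n : set (seqM V)) <= (d / 2)%:E)%E.
  have /fine_cvgP[_ /cvgrPdist_le/(_ (d / 2) (divr_gt0 d0 (ltr0n _ 2)))[n _ /(_ n (leqnn n))/=]] : (nu \o S) n @[n --> \oo] --> (fine (nu (\bigcup_k F k)))%:E by rewrite fineK ?nf.
  move=> h; exists n; rewrite measureD//; last by rewrite ltey_eq nf.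
  rewrite (_ : _ `&` _ = S n); last by apply/setIidr; exact: SU.
  rewrite -[X in (X - _)%E](fineK (nf _ mU)) -[X in (_ - X)%E](fineK (nf _ (mS n))) -EFinB lee_fin.
  exact: le_trans (ler_norm _) h.
have [_ /(_ (d / 2) (divr_gt0 d0 (ltr0n _ 2)))[M [B [fB nB]]]] := aS n.
exists M, B; split => //; have mB := fincoord_measurable fB.
have mD : measurable (\bigcup_k F k `\` S n : set (seqM V)) by exact: measurableD.
have msd := measurable_sd (mS n) mB.
apply: (@le_trans _ _ (nu ((\bigcup_k F k `\` S n) `|` sd (S n) B))).
  apply: le_measure; rewrite ?inE; [exact: measurable_sd|exact: measurableU|].
  move=> x [[Ux nBx]|[Bx nUx]]; last by right; right; split => // /SU.
  by have [Sx|Sx] := pselect (S n x); [right; left|left].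
apply: (le_trans (measureU2 nu mD msd)); apply: (le_trans (leeD hn nB)).
by rewrite -EFinD -splitr.
Qed.

Lemma label_approx (Q : seq (set (seqM V))) (d : R) : 0 < d -> fin_partition Q ->
  exists M (lab : (nat -> V) -> nat) (Z : set (seqM V)), [/\ measurable Z, (nu Z <= d%:E)%E,
    forall x y, agree M x y -> lab x = lab y &
    forall x j, (j < size Q)%N -> nth set0 Q j x -> ~ Z x -> lab x = j].
Proof.
move=> d0 [mQ dQ cQ]; set s := size Q; pose d' := d / s.+1%:R.
have d'0 : 0 < d' by rewrite divr_gt0.
have H (j : nat) : exists MB : nat * set (nat -> V), fincoord MB.1 MB.2 /\
    ((j < s)%N -> (nu (sd (nth set0 Q j) MB.2) <= d'%:E)%E).
  have [js|js] := ltnP j s; last by exists (0%N, set0); split => //; rewrite ltnNge js.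
  have [_ /(_ _ d'0)[M [B [fB nB]]]] := measurable_approximable (mQ j js).
  by exists (M, B).
have [f fP] := choice H.
pose lab x := find (fun j => `[< (f j).2 x >]) (iota 0 s).
pose M := \max_(j < s) (f j).1.
have mB j : measurable ((f j).2 : set (seqM V)) by case: (fP j) => /fincoord_measurable.
exists M, lab, (\big[setU/set0]_(j < s) sd (nth set0 Q j) (f j).2); split.
- by apply: bigsetU_measurable => j _; apply: measurable_sd => //; exact: mQ.
- apply: (le_trans (Boole_inequality nu (A := fun j => sd (nth set0 Q j) (f j).2) _)).
    by move=> j js; apply: measurable_sd => //; exact: mQ.
  apply: (@le_trans _ _ (\sum_(i < s) d'%:E)%E).
    by apply: lee_sum => j _; case: (fP j) => _; apply.
  rewrite sumEFin lee_fin sumr_const card_ord -(mulr_natr d') /d' mulrAC ler_pdivrMr//.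
  by rewrite ler_pM2l// ler_nat.
- move=> x y xy; apply: eq_in_find => j; rewrite mem_iota/= add0n => js.
  have jM : ((f j).1 <= M)%N by exact: (leq_bigmax (Ordinal js)).
  case: (fP j) => /(fincoordW jM) h _; apply/asboolP/asboolP; apply: h => //; exact: agree_sym.
move=> x j js Qx nZ.
have Bx i : (i < s)%N -> (f i).2 x <-> nth set0 Q i x.
  move=> is_; split => h; apply: contrapT => h'; apply: nZ;
    rewrite -(bigcup_mkord s (fun j => sd (nth set0 Q j) (f j).2)); exists i => //.
    by right.
  by left.
rewrite /lab; set i := find _ _.
have ij : (i <= j)%N.
  rewrite leqNgt; apply/negP => /(before_find 0%N); rewrite nth_iota// add0n => /asboolP; apply.
  by apply/Bx.
have is_ : (i < s)%N by exact: leq_ltn_trans ij js.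
have Qi : nth set0 Q i x.
  have : has (fun j => `[< (f j).2 x >]) (iota 0 s) by rewrite has_find size_iota.
  by move=> /(nth_find 0%N); rewrite -/i nth_iota// add0n => /asboolP/(Bx i is_).
apply: contrapT => nij; have := dQ i j is_ js nij => e.
by have : (nth set0 Q i `&` nth set0 Q j) x by []; rewrite e.
Qed.

End FiniteCoordinates.

Section EntropyUpperBound.
Context {R : realType} {V : pointedType} (E : rel V).
Variable code : V -> nat.
Hypothesis code_inj : injective code.
Variable mu : probability (seqM V) R.
Hypothesis muT : mu (TMS E : set (seqM V)) = 1%E.
Variables (f b : (nat -> V) -> R) (D K : R).
Hypothesis f0 : forall x, 0 <= f x.
Hypothesis b0 : forall x, 0 <= b x.
Hypothesis mf_f : mf E (EFin \o f).
Hypothesis mf_b : mf E (EFin \o b).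
Hypothesis D0 : 0 <= D.
Hypothesis K0 : 0 <= K.
Hypothesis gibbs : forall N x, TMS E x ->
  ((expR (N%:R * D - birk f N x - K - b x - b (iter N (@sshift V) x)))%:E
   <= mu ([set y | agree N.+1 x y] : set (seqM V)))%E.
Variable nu : probability (seqM V) R.
Hypothesis nuinv : shift_inv_prob E nu.
Variable Q : seq (set (seqM V)).
Hypothesis partQ : fin_partition Q.
Local Notation s := (size Q).

Let nuT : nu (TMS E : set (seqM V)) = 1%E. Proof. by case: nuinv. Qed.

Lemma size_gt0 : (0 < s)%N.
Proof. by case: partQ => _ _ /(_ point)[i is_ _]; exact: leq_ltn_trans is_. Qed.

Let s0 : 0 < s%:R :> R. Proof. by rewrite ltr0n size_gt0. Qed.
Let s1 : 1 <= s%:R :> R. Proof. by rewrite ler1n size_gt0. Qed.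

Definition qq (e : R) (j l : nat) : R := if j == l then 1 - e else e / s%:R.

Lemma qq_gt0 e j l : 0 < e < 1 -> 0 < qq e j l.
Proof. by move=> /andP[e0 e1]; rewrite /qq; case: ifP => _; [rewrite subr_gt0|rewrite divr_gt0]. Qed.

Lemma qq_sum e l : 0 < e < 1 -> \sum_(j < s) qq e j l <= 1.
Proof.
move=> /andP[e0 e1].
have sume : \sum_(j < s) (e / s%:R) = e.
  by rewrite sumr_const card_ord -(mulr_natr (e / _)) divfK// gt_eqF.
have [ls|ls] := ltnP l s.
  rewrite (bigD1 (Ordinal ls))//= {1}/qq eqxx.
  apply: (@le_trans _ _ (1 - e + \sum_(j < s) (e / s%:R))); last by rewrite sume subrK.
  rewrite lerD2l [leRHS](bigD1 (Ordinal ls))//= ler_wpDl ?divr_ge0 ?(ltW e0)//.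
  apply: ler_sum => j jl; rewrite /qq ifF//; apply: contraNF jl => /eqP jl.
  by apply/eqP/val_inj.
apply: (@le_trans _ _ (\sum_(j < s) (e / s%:R))); last by rewrite sume ltW.
apply: ler_sum => j _; rewrite /qq ifF//; apply/negbTE; rewrite neq_ltn.
by rewrite (leq_trans (ltn_ord j) ls).
Qed.

Section Comparison.
Variables (M : nat) (lab : (nat -> V) -> nat) (Z : set (seqM V)) (e : R).
Hypothesis mZ : measurable Z.
Hypothesis labM : forall x y, agree M x y -> lab x = lab y.
Hypothesis labZ : forall x j, (j < s)%N -> nth set0 Q j x -> ~ Z x -> lab x = j.
Hypothesis e01 : 0 < e < 1.

Definition wset n (w : {ffun 'I_n -> 'I_s}) : set (nat -> V) :=
  [set x | forall k : 'I_n, nth set0 Q (w k) (iter k (@sshift V) x)].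

Definition qprod n (w : {ffun 'I_n -> 'I_s}) (y : nat -> V) : R :=
  \prod_(k < n) qq e (w k) (lab (iter k (@sshift V) y)).

Lemma qprod_ge0 n w y : 0 <= @qprod n w y.
Proof. by apply: prodr_ge0 => k _; apply: ltW; exact: qq_gt0. Qed.

Lemma qprod_fincoord n w x y : agree (n + M) x y -> @qprod n w x = qprod w y.
Proof.
move=> xy; apply: eq_bigr => k _; congr (qq e (w k) _); apply: labM.
have := @agree_iter _ k _ _ _ xy; apply: agreeW; rewrite -addnBAC ?leq_addl//; exact: ltnW.
Qed.

Lemma mf_qprod n w : mf E (EFin \o @qprod n w).
Proof.
apply: (cont_mf code_inj) => x Ex eps eps0; exists (n + M)%N => y Ey xy.
by rewrite (qprod_fincoord w xy) subrr normr0.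
Qed.

(* A sub-probability on words, to be compared with [nu] by Gibbs' inequality: it charges
   a word through the equilibrium measure, up to label errors of weight [e], and the
   uniform part bounds its logarithm on the bad set. *)
Definition pn n (w : {ffun 'I_n -> 'I_s}) : R :=
  2^-1 * (s%:R ^- n + fine (tint E mu (EFin \o qprod w))).

Lemma tint_qprod_fin n w : tint E mu (EFin \o @qprod n w) \is a fin_num /\
  \sum_(w : {ffun 'I_n -> 'I_s}) fine (tint E mu (EFin \o qprod w)) <= 1.
Proof.
have sumle y : \sum_(w : {ffun 'I_n -> 'I_s}) qprod w y <= 1.
  rewrite -(bigA_distr_bigA (fun (k : 'I_n) (j : 'I_s) => qq e j (lab (iter k (@sshift V) y)))).
  apply: prodr_ile1 => k _; rewrite qq_sum// andbT; apply: sumr_ge0 => j _; exact: ltW (qq_gt0 _ _ e01).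
have le1 w' y : @qprod n w' y <= 1.
  apply: le_trans (sumle y); rewrite (bigD1 w')//= lerDl; apply: sumr_ge0 => *; exact: qprod_ge0.
have n0 w' : nneg (EFin \o @qprod n w') by move=> y; rewrite lee_fin qprod_ge0.
have fin w' : tint E mu (EFin \o @qprod n w') \is a fin_num.
  rewrite ge0_fin_numE; last exact: tint_ge0.
  apply: (@le_lt_trans _ _ 1%E); last exact: ltry.
  rewrite -(tint_cst code_inj muT ler01); apply: (tint_le code_inj) => //; [exact: mf_qprod|exact: mf_cst|].
  by move=> y _; rewrite lee_fin.
split => //; rewrite -lee_fin -sumEFin.
under eq_bigr do rewrite fineK//.
rewrite -(tint_fsum code_inj) //; last exact: mf_qprod.
rewrite -(tint_cst code_inj muT ler01); apply: (tint_le code_inj).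
- by move=> y; apply: sume_ge0 => *; exact: n0.
- by apply: mf_sum => w'; exact: mf_qprod.
- exact: mf_cst.
by move=> y _; rewrite sumEFin lee_fin.
Qed.

Lemma pn_ge n w : 2^-1 * s%:R ^- n <= @pn n w.
Proof. by rewrite /pn ler_pM2l ?invr_gt0// lerDl fine_ge0// tint_ge0// => y; rewrite lee_fin qprod_ge0. Qed.

Lemma pn_gt0 n w : 0 < @pn n w.
Proof. by apply: lt_le_trans (pn_ge w); rewrite mulr_gt0 ?invr_gt0 ?exprn_gt0. Qed.

Lemma pn_sum n : \sum_(w : {ffun 'I_n -> 'I_s}) pn w <= 1.
Proof.
rewrite -mulr_sumr big_split/= sumr_const card_ffun !card_ord.
have -> : s%:R ^- n *+ (s ^ n)%N = 1 :> R.
  by rewrite -(mulr_natr (_ ^- _)) natrX mulVf// gt_eqF// exprn_gt0.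
have [_ h] := tint_qprod_fin ([ffun=> Ordinal size_gt0] : {ffun 'I_n -> 'I_s}).
by move: h; set S := \sum_(w : _) _ => h; lra.
Qed.

Definition cost (x : nat -> V) : R := - ln (1 - e) + ln (s%:R / e) * \1_Z x.

Lemma cost_ge0 x : 0 <= cost x.
Proof.
have /andP[e0 e1] := e01; apply: addr_ge0; first by rewrite oppr_ge0 ln_le0// lerBlDr lerDl ltW.
apply: mulr_ge0; last exact: indic_ge0'.
by apply: ln_ge0; rewrite ler_pdivlMr// mul1r; apply: le_trans s1; exact: ltW.
Qed.

Lemma qprod_cost n (w : {ffun 'I_n -> 'I_s}) x : wset w x -> expR (- birk cost n x) <= qprod w x.
Proof.
have /andP[e0 e1] := e01.
move=> wx; rewrite /birk -sumrN expR_sum; apply: ler_prod => k _; rewrite expR_ge0/=.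
have Qx := wx k; set y := iter k _ x in Qx *; rewrite /cost opprD opprK expRD lnK ?posrE ?subr_gt0//.
rewrite indicE; case: (boolP (_ \in _)) => [_|/negP nZ].
  rewrite mulr1 -lnV ?posrE ?divr_gt0// lnK ?posrE ?invr_gt0 ?divr_gt0// invf_div /qq.
  have es : e / s%:R <= 1.
    by rewrite ler_pdivrMr// mul1r; apply: le_trans s1; exact: ltW.
  by case: ifP => _; [rewrite ler_piMr// subr_ge0 ltW|rewrite ler_piMl ?divr_ge0 ?(ltW e0)// lerBlDr lerDl ltW].
rewrite mulr0 oppr0 expR0 mulr1 /qq ifT//; apply/eqP; symmetry; apply: labZ => // Zy; apply: nZ; exact/mem_set.
Qed.

Lemma pn_good n (w : {ffun 'I_n -> 'I_s}) x : TMS E x -> wset w x ->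
  - ln (pn w) <= ln 2 + K + b x + b (iter (n + M) (@sshift V) x) + birk f (n + M) x - (n + M)%:R * D + birk cost n x.
Proof.
move=> Ex wx; set N := (n + M)%N.
set T := N%:R * D - birk f N x - K - b x - b (iter N (@sshift V) x).
have h1 : expR (- birk cost n x) * expR T <= fine (tint E mu (EFin \o qprod w)).
  rewrite -lee_fin fineK; last by case: (tint_qprod_fin w).
  have mA := measurable_agree N.+1 x.
  apply: (@le_trans _ _ ((expR (- birk cost n x))%:E * mu ([set y | agree N.+1 x y] : set (seqM V)))%E).
    by rewrite EFinM; apply: lee_wpmul2l; [rewrite lee_fin expR_ge0|exact: gibbs].
  rewrite -(tint_indicT code_inj muT mA) -(tint_scale code_inj) //; last 2 first.
  - exact: nneg_indic.
  - exact: (@mf_indic R V E _ mA).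
  apply: (tint_le code_inj).
  - by move=> y; rewrite mule_ge0// ?lee_fin ?expR_ge0//; exact: indic_ge0'.
  - by apply: (mf_wmul (w := fun=> expR (- birk cost n x))); [exact: mf_cst|exact: (@mf_indic R V E _ mA)].
  - exact: mf_qprod.
  move=> y Ey /=; rewrite indicE -EFinM lee_fin; case: (boolP (_ \in _)) => [|_]; last by rewrite mulr0 qprod_ge0.
  rewrite inE /= mulr1 => xy; rewrite -(qprod_fincoord w (x := x)); first exact: qprod_cost.
  by apply: agreeW xy.
have h2 : 2^-1 * (expR (- birk cost n x) * expR T) <= pn w.
  rewrite /pn ler_pM2l ?invr_gt0//; apply: (le_trans h1); rewrite lerDr.
  by rewrite invr_ge0 exprn_ge0// ler0n.
have : ln (2^-1 * (expR (- birk cost n x) * expR T)) <= ln (pn w).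
  by rewrite ler_ln// posrE ?pn_gt0// !mulr_gt0 ?invr_gt0 ?expR_gt0.
rewrite lnM ?posrE ?mulr_gt0 ?invr_gt0 ?expR_gt0// lnV ?posrE// -expRD expRK /T; lra.
Qed.

Lemma pn_bad n (w : {ffun 'I_n -> 'I_s}) : - ln (pn w) <= ln 2 + n%:R * ln s%:R.
Proof.
have : ln (2^-1 * s%:R ^- n) <= ln (pn w :> R).
  by rewrite ler_ln// ?posrE ?pn_gt0 ?mulr_gt0 ?invr_gt0 ?exprn_gt0//; exact: pn_ge.
rewrite lnM ?posrE ?invr_gt0 ?exprn_gt0// lnV ?posrE// lnV ?posrE ?exprn_gt0// lnXn// -mulr_natl; lra.
Qed.

Lemma pn_all n (w : {ffun 'I_n -> 'I_s}) (t : R) x : 0 <= t -> TMS E x -> wset w x ->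
  - ln (pn w) + (n + M)%:R * D <= ln 2 + K + 2 * t + birk f (n + M) x + birk cost n x +
    ((n + M)%:R * D + n%:R * ln s%:R) * (\1_[set x | t < b x] x + \1_[set x | t < b x] (iter (n + M) (@sshift V) x)).
Proof.
move=> t0 Ex wx; have := pn_good Ex wx; move: (n + M)%N => N hg; have B0 : 0 <= birk f N x by apply: sumr_ge0.
have C0 : 0 <= birk cost n x by apply: sumr_ge0 => *; exact: cost_ge0.
have ND : 0 <= N%:R * D by rewrite mulr_ge0.
have ns : 0 <= n%:R * ln s%:R :> R by rewrite mulr_ge0// ln_ge0.
have hb := pn_bad w; have K0' := K0.
rewrite !indicE; case: (boolP (x \in _)) => [_|/negP h1].
  set i2 : R := (_ \in _)%:R; have i20 : 0 <= i2 by rewrite ler0n.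
  have hx : N%:R * D + n%:R * ln s%:R <= (N%:R * D + n%:R * ln s%:R) * (true%:R + i2).
    by rewrite -[leLHS]mulr1 ler_wpM2l ?addr_ge0// lerDl.
  by move: hx; set Y := _ * (_ + i2) => hx; lra.
case: (boolP (_ \in _)) => [_|/negP h2]; first by rewrite (_ : _%:R + _%:R = 1 :> R) ?add0r// mulr1; lra.
have b1 : b x <= t by rewrite leNgt; apply/negP => h; apply: h1; exact/mem_set.
have b2 : b (iter N (@sshift V) x) <= t by rewrite leNgt; apply/negP => h; apply: h2; exact/mem_set.
by rewrite (_ : _%:R + _%:R = 0 :> R) ?addr0// mulr0 addr0; lra.
Qed.

Lemma measurable_wset n w : measurable (@wset n w : set (seqM V)).
Proof.
have -> : @wset n w = \bigcap_(k in [set: 'I_n]) (iter k (@sshift V) @^-1` (nth set0 Q (w k))).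
  by apply/seteqP; split => [x h k _|x h k]; [exact: h|exact: (h k)].
apply: fin_bigcap_measurable => // k _.
have mk j : measurable_fun setT (iter j (@sshift V) : seqM V -> seqM V).
  elim: j => [|j IH]; first exact: measurable_id.
  exact: (measurableT_comp (@measurable_sshift V) IH).
by rewrite -[X in measurable X]setTI; apply: mk => //; case: partQ => + _ _; apply.
Qed.

Lemma wset_uniq n x : exists w : {ffun 'I_n -> 'I_s}, wset w x /\ forall w', wset w' x -> w' = w.
Proof.
have [_ dQ cQ] := partQ.
have H (k : 'I_n) : exists j : 'I_s, nth set0 Q j (iter k (@sshift V) x).
  by have [j js Qj] := cQ (iter k (@sshift V) x); exists (Ordinal js).
have [W hW] := choice H; exists [ffun k => W k]; split => [k|w' h]; first by rewrite ffunE.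
apply/ffunP => k; rewrite ffunE; apply: contrapT => ne.
have nv : val (w' k) <> val (W k) by move=> /val_inj.
have e0 := dQ _ _ (ltn_ord (w' k)) (ltn_ord (W k)) nv.
have : (nth set0 Q (w' k) `&` nth set0 Q (W k)) (iter k (@sshift V) x) by split; [exact: h|exact: hW].
by rewrite e0.
Qed.

Lemma wset_sum n (c : {ffun 'I_n -> 'I_s} -> R) x (r : R) : (forall w, wset w x -> c w = r) ->
  \sum_(w : {ffun 'I_n -> 'I_s}) c w * \1_(wset w) x = r.
Proof.
move=> h; have [w [wx wu]] := wset_uniq n x; rewrite (bigD1 w)//= big1 ?addr0.
  by rewrite indicE mem_set// mulr1; exact: h.
by move=> w' ww'; rewrite indicE memNset ?mulr0// => /wu ew; rewrite ew eqxx in ww'.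
Qed.

Lemma eta_gibbs (v p : R) : 0 <= v -> 0 < p -> eta v <= v * (- ln p) + p - v.
Proof.
rewrite le_eqVlt => /predU1P[<-|v0] p0; first by rewrite /eta !mul0r oppr0 add0r addr0 ltW.
have pv : 0 < p / v by rewrite divr_gt0.
have := @le_ln1Dx R (p / v - 1); rewrite ltrBDr addNr pv => /(_ isT).
rewrite addrCA subrr addr0 lnM ?posrE ?invr_gt0// lnV ?posrE// => h.
have := ler_wpM2l (ltW v0) h; rewrite (_ : v * (p / v - 1) = p - v) /eta; first by lra.
by field; rewrite gt_eqF.
Qed.

Lemma Hjoin_bound n (t F : R) : 0 <= t -> tint E nu (EFin \o f) = F%:E ->
  Hjoin nu Q n + (n + M)%:R * D <= ln 2 + K + 2 * t + (n + M)%:R * F +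
    n%:R * (- ln (1 - e) + ln (s%:R / e) * fine (nu Z)) +
    ((n + M)%:R * D + n%:R * ln s%:R) * (2 * fine (nu (TMS E `&` [set x | t < b x] : set (seqM V)))).
Proof.
move=> t0 fF; set N := (n + M)%N; pose B : set (nat -> V) := TMS E `&` [set x | t < b x].
have mB : measurable (B : set (seqM V)).
  have := mf_b (measurable_TMS E code_inj) (@emeasurable_itv R `]t%:E, +oo[).
  by congr measurable; apply/seteqP; split => x [Ex] /=; rewrite ?in_itv/= ?andbT ?lte_fin.
set X := (_ * D + _ * _); have X0 : 0 <= X by rewrite addr_ge0// mulr_ge0// ln_ge0.
pose v (w : {ffun 'I_n -> 'I_s}) := fine (nu (wset w : set (seqM V))).
have v0 w : 0 <= v w by rewrite fine_ge0.
have rw w : rint E nu (\1_(wset w)) (v w) := rint_indic code_inj nuT (measurable_wset w).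
have v1 : \sum_w v w = 1.
  have h1 := rint_sum code_inj nuT (index_enum _) rw; have h2 := rint_cst code_inj nuT ler01.
  apply/eqP; rewrite eq_le; apply/andP; split.
    apply: (rint_le code_inj h1 h2) => x Ex; have := @wset_sum n (fun=> 1) x 1 (fun _ _ => erefl).
    by under eq_bigr do rewrite mul1r; move=> ->.
  apply: (rint_le code_inj h2 h1) => x Ex; have := @wset_sum n (fun=> 1) x 1 (fun _ _ => erefl).
  by under eq_bigr do rewrite mul1r; move=> ->.
have p1 (w : {ffun 'I_n -> 'I_s}) : pn w <= 1.
  apply: le_trans (pn_sum n); rewrite (bigD1 w)//= lerDl; apply: sumr_ge0 => *; exact: ltW (pn_gt0 _).
have c0 (w : {ffun 'I_n -> 'I_s}) : 0 <= - ln (pn w) by rewrite oppr_ge0 ln_le0.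
have h1 : Hjoin nu Q n <= \sum_w (- ln (pn w)) * v w.
  apply: (@le_trans _ _ (\sum_w (v w * (- ln (pn w)) + pn w - v w))).
    by apply: ler_sum => w _; apply: eta_gibbs; [exact: v0|exact: pn_gt0].
  rewrite sumrB big_split/= v1; have := pn_sum n.
  rewrite (_ : \sum_w - ln (pn w) * v w = \sum_w v w * - ln (pn w)); first by lra.
  by apply: eq_bigr => w _; rewrite mulrC.
have ND : 0 <= N%:R * D by rewrite mulr_ge0.
have rl := rint_add code_inj (rint_sum code_inj nuT (index_enum _) (fun w => rint_scale code_inj (c0 w) (rw w))) (rint_cst code_inj nuT ND).
have /andP[e0 e1] := e01.
have c00 : 0 <= - ln (1 - e) by rewrite oppr_ge0 ln_le0// lerBlDr lerDl ltW.
have c10 : 0 <= ln (s%:R / e) by apply: ln_ge0; rewrite ler_pdivlMr// mul1r; apply: le_trans s1; exact: ltW.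
have rcost := rint_add code_inj (rint_cst code_inj nuT c00) (rint_scale code_inj c10 (rint_indic code_inj nuT mZ)).
have rf : rint E nu f F by split.
have rB := rint_indic code_inj nuT mB.
have k0 : 0 <= ln 2 + K + 2 * t by rewrite !addr_ge0 ?mulr_ge0 ?ln_ge0 ?ler1n.
have rr := rint_add code_inj (rint_add code_inj (rint_add code_inj (rint_cst code_inj nuT k0) (rint_birk code_inj nuT nuinv N rf))
  (rint_birk code_inj nuT nuinv n rcost)) (rint_scale code_inj X0 (rint_add code_inj rB (rint_shift code_inj nuinv N rB))).
apply: le_trans (_ : \sum_w (- ln (pn w)) * v w + N%:R * D <= _); first by rewrite lerD2r.
rewrite [2 * fine _]mulr_natl mulr2n; apply: (rint_le code_inj rl rr) => x Ex /=.
have [w [wx wu]] := wset_uniq n x.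
rewrite (wset_sum (r := - ln (pn w))); last by move=> w' /wu ->.
apply: le_trans (pn_all t0 Ex wx) _; rewrite lerD2l ler_wpM2l//.
have IBE y : TMS E y -> \1_[set x | t < b x] y = \1_B y :> R.
  by move=> Ey; rewrite !indicE; congr (_%:R); congr nat_of_bool; apply/idP/idP => /set_mem h; apply/mem_set => //; case: h.
by rewrite !IBE//; exact: TMS_iter.
Qed.

End Comparison.

Lemma tail_small (d : R) : 0 < d -> exists2 t : R, 0 <= t &
  fine (nu (TMS E `&` [set x | t < b x] : set (seqM V))) <= d.
Proof.
move=> d0; pose B (n : nat) : set (seqM V) := TMS E `&` [set x | n%:R < b x].
have mB n : measurable (B n).
  have := mf_b (measurable_TMS E code_inj) (@emeasurable_itv R `]n%:R%:E, +oo[).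
  by congr measurable; apply/seteqP; split => x [Ex] /=; rewrite ?in_itv/= ?andbT ?lte_fin.
have c : (nu \o B) n @[n --> \oo] --> nu (\bigcap_n B n).
  apply: nonincreasing_cvg_mu => //.
  - by apply: (le_lt_trans (probability_le1 nu (mB 0%N))); exact: ltry.
  - exact: bigcap_measurableType.
  by move=> m n mn; apply/subsetPset => x [Ex /= nb]; split => //=; apply: le_lt_trans nb; rewrite ler_nat.
have e : \bigcap_n B n = set0.
  apply/seteqP; split => // x h; have [_ /=] := h (Num.trunc (b x)).+1 I.
  by apply/negP; rewrite -leNgt ltW// truncnS_gt.
rewrite e measure0 in c; move/fine_cvgP : c => [_ /cvgrPdist_le/(_ d d0)[n _ /(_ n (leqnn n))/=]].
rewrite sub0r normrN => h; exists n%:R => //.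
exact: le_trans (ler_norm _) h.
Qed.

Theorem entropy_le : (hpart nu Q + D%:E <= tint E nu (EFin \o f))%E.
Proof.
have f0' : (0 <= tint E nu (EFin \o f))%E by apply: tint_ge0 => x; rewrite lee_fin.
case fF : (tint E nu (EFin \o f)) f0' => [F| |]// F0; last by rewrite leey.
rewrite -leeBrDr// -EFinB; apply/lee_addgt0Pr => e4 e40.
pose e := e4 / 4; have e0 : 0 < e by rewrite divr_gt0.
pose ep := 1 - expR (- e).
have ep01 : 0 < ep < 1.
  apply/andP; split; first by rewrite subr_gt0 -[ltRHS]expR0 ltr_expR oppr_lt0.
  by rewrite ltrBlDr ltrDl expR_gt0.
have lep : - ln (1 - ep) = e by rewrite /ep opprB addrC subrK expRK opprK.
have /andP[ep0 ep1] := ep01.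
pose c1 := ln (s%:R / ep).
have c10 : 0 <= c1 by apply: ln_ge0; rewrite ler_pdivlMr// mul1r; apply: le_trans s1; exact: ltW.
have [|M [lab [Z [mZ nZ labM labZ]]]] := label_approx code_inj nu (d := e / (c1 + 1)) _ partQ.
  by rewrite divr_gt0// ltr_wpDl.
pose X := D + ln s%:R; have X0 : 0 <= X by rewrite addr_ge0// ln_ge0.
have [|t t0 tb] := @tail_small (e / (2 * X + 1)); first by rewrite divr_gt0// ltr_wpDl// mulr_ge0.
set be := fine _ in tb; have be0 : 0 <= be by rewrite fine_ge0.
have z1 : c1 * fine (nu Z) <= e.
  have z : fine (nu Z) <= e / (c1 + 1) by rewrite -lee_fin fineK// fin_num_measure.
  apply: (le_trans (ler_wpM2l c10 z)); rewrite mulrA ler_pdivrMr ?ltr_wpDl//.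
  by rewrite mulrC ler_pM2l// lerDl.
have b1 : 2 * X * be <= e.
  apply: (le_trans (ler_wpM2l (mulr_ge0 (ler0n _ 2) X0) tb)); rewrite mulrA ler_pdivrMr ?ltr_wpDl ?mulr_ge0//.
  by rewrite mulrC ler_pM2l// lerDl.
pose T := ln 2 + K + 2 * t + M%:R * F + M%:R * D * (2 * be).
have T0 : 0 <= T.
  by rewrite /T !addr_ge0 ?mulr_ge0 ?ln_ge0 ?ler1n//; move: F0; rewrite lee_fin.
apply: limn_esup_le; exists (Num.trunc (T / e)).+1 => // n /= hn.
have n0 : 0 < n.+1%:R :> R by rewrite ltr0n.
have Tn : T <= n.+1%:R * e.
  rewrite -ler_pdivrMr//; apply: le_trans (ltW (truncnS_gt _)) _.
  by rewrite ler_nat (leq_trans hn).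
have H := Hjoin_bound mZ labM labZ ep01 n.+1 t0 fF.
rewrite -/be lep -/c1 in H.
rewrite -EFinD lee_fin mulrC ler_pdivrMr//.
have n1 : n.+1%:R * (c1 * fine (nu Z)) <= n.+1%:R * e by rewrite ler_pM2l.
have n2 : n.+1%:R * (2 * X * be) <= n.+1%:R * e by rewrite ler_pM2l.
have MD : 0 <= M%:R * D by rewrite mulr_ge0.
have e44 : e4 = 4 * e by rewrite /e; lra.
rewrite natrD in H; move: H n1 n2 Tn MD; rewrite /T /X e44.
by move: (Hjoin nu Q n.+1) => hj; clear; move: (n.+1%:R : R) => {}n H n1 n2 Tn MD; lra.
Qed.

End EntropyUpperBound.

(** * Lower bound for the entropy *)

Section EntropyLowerBound.
Context {R : realType} {V : pointedType} (E : rel V).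
Variable code : V -> nat.
Hypothesis code_inj : injective code.
Variable g : (nat -> V) -> R.
Hypothesis g0 : forall x, 0 < g x.
Hypothesis mg : mf E (EFin \o g).
Local Notation L := (transfer E g).
Hypothesis L1 : forall x, TMS E x -> L (fun=> 1%E) x = 1%E.
Variable mu : probability (seqM V) R.
Hypothesis muT : mu (TMS E : set (seqM V)) = 1%E.
Hypothesis muL : forall F : (nat -> V) -> \bar R, nneg F -> mf E F -> tint E mu (L F) = tint E mu F.
Implicit Types (F G : (nat -> V) -> \bar R).
Local Notation mf := (mf E).
Let g0' x : 0 <= g x. Proof. exact: ltW. Qed.
Let pL : posop (TMS E) L := po_transfer E g0'.
Local Notation rint := (rint E mu).

Definition infog x : R := Num.max 0 (- lg g x).

Lemma infog_ge0 x : 0 <= infog x. Proof. by rewrite le_max lexx. Qed.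

Lemma g_le1 x : TMS E x -> g x <= 1.
Proof.
move=> Ex; have Es := TMS_sshift Ex; rewrite -lee_fin -(L1 Es) /transfer.
have := @preop_ge1 R V E (wmul g (fun=> 1%E)) (sshift x) (x 0%N) _ (Ex 0%N).
rewrite bcons_sshift /wmul mule1; apply => y; by rewrite mule1 lee_fin.
Qed.

Lemma infogE x : TMS E x -> infog x = - lg g x.
Proof.
by move=> Ex; apply/max_idPr; rewrite oppr_ge0; apply: ln_le0; exact: g_le1.
Qed.

Lemma mfun_ln (k : (nat -> V) -> R) : mf (EFin \o k) -> mf (EFin \o (fun x => ln (k x))).
Proof.
move=> /mf_real mk; apply/measurable_EFinP.
exact: (measurableT_comp (@measurable_ln R) mk).
Qed.

Lemma mf_opp (k : (nat -> V) -> R) : mf (EFin \o k) -> mf (EFin \o (fun x => - k x)).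
Proof. by move=> /mf_real mk; apply/measurable_EFinP; exact: measurable_funN. Qed.

Lemma mf_max (k l : (nat -> V) -> R) : mf (EFin \o k) -> mf (EFin \o l) -> mf (EFin \o (fun x => Num.max (k x) (l x))).
Proof. by move=> /mf_real mk /mf_real ml; apply/measurable_EFinP; exact: measurable_maxr. Qed.

Lemma mf_min (k l : (nat -> V) -> R) : mf (EFin \o k) -> mf (EFin \o l) -> mf (EFin \o (fun x => Num.min (k x) (l x))).
Proof. by move=> /mf_real mk /mf_real ml; apply/measurable_EFinP; exact: measurable_minr. Qed.

Lemma mf_mul (k l : (nat -> V) -> R) : mf (EFin \o k) -> mf (EFin \o l) -> mf (EFin \o (fun x => k x * l x)).
Proof. by move=> /mf_real mk /mf_real ml; apply/measurable_EFinP; exact: measurable_funM. Qed.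

Lemma mf_add (k l : (nat -> V) -> R) : mf (EFin \o k) -> mf (EFin \o l) -> mf (EFin \o (fun x => k x + l x)).
Proof. by move=> /mf_real mk /mf_real ml; apply/measurable_EFinP; exact: measurable_funD. Qed.

Lemma mf_infog : mf (EFin \o infog).
Proof. by apply: mf_max; [exact: mf_cst|apply: mf_opp; exact: mfun_ln]. Qed.

Lemma rint_bounded (k : (nat -> V) -> R) (M : R) : (forall x, 0 <= k x) -> mf (EFin \o k) -> 0 <= M ->
  (forall x, TMS E x -> k x <= M) -> exists2 r, 0 <= r & rint k r.
Proof.
move=> k0 mk M0 kM; have i0 : (0 <= tint E mu (EFin \o k))%E by apply: tint_ge0 => x; rewrite lee_fin.
have iM : (tint E mu (EFin \o k) <= M%:E)%E.
  by rewrite -(tint_cst code_inj muT M0); apply: (tint_le code_inj) => //; exact: mf_cst.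
exists (fine (tint E mu (EFin \o k))); first exact: fine_ge0.
by split => //; rewrite fineK// ge0_fin_numE// (le_lt_trans iM)// ltry.
Qed.

Lemma eta_ge0 (t : R) : 0 <= t <= 1 -> 0 <= eta t.
Proof. by move=> /andP[t0 t1]; rewrite /eta oppr_ge0 mulr_ge0_le0// ln_le0. Qed.

Lemma sum_prob_mul (I J : finType) (c : I -> R) (d : J -> R) : \sum_i c i = 1 ->
  \sum_i \sum_j c i * d j = \sum_j d j.
Proof. by move=> c1; under eq_bigr do rewrite -mulr_sumr; rewrite -mulr_suml c1 mul1r. Qed.

Section Partition.
Variable N : nat.

Definition Rset (i : nat) : set (seqM V) := [set x | minn (code (x 0%N)) N = i].
Definition Rpart : seq (set (seqM V)) := mkseq Rset N.+1.
Arguments Rpart : simpl never.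
Local Notation s := (size Rpart).

Lemma nth_Rpart i : (i < s)%N -> nth set0 Rpart i = Rset i.
Proof. by rewrite size_mkseq => iN; rewrite nth_mkseq. Qed.

Lemma measurable_Rset i : measurable (Rset i).
Proof. by apply: (fincoord_measurable code_inj (M := 1)) => x y xy; rewrite /Rset /= xy. Qed.

Lemma fin_partition_Rpart : fin_partition Rpart.
Proof.
split.
- by move=> i iN; rewrite nth_Rpart//; exact: measurable_Rset.
- move=> i j iN jN ij; rewrite !nth_Rpart//; apply/seteqP; split => // x [xi xj]; apply: ij; rewrite -xi; exact: xj.
move=> x; exists (minn (code (x 0%N)) N); first by rewrite size_mkseq ltnS geq_minr.
by rewrite nth_Rpart// size_mkseq ltnS geq_minr.
Qed.

Definition Rcond (i : nat) (y : nat -> V) : R := Num.min 1 (fine (L (EFin \o \1_(Rset i)) y)).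

Lemma LR_ge0 i : nneg (L (EFin \o (\1_(Rset i) : _ -> R))).
Proof. by apply: (po_ge0 pL); exact: nneg_indic. Qed.

Lemma Rcond01 i y : 0 <= Rcond i y <= 1.
Proof. by rewrite /Rcond ge_min lexx le_min ler01 fine_ge0//=; exact: LR_ge0. Qed.

Lemma RcondE i y : TMS E y -> (Rcond i y)%:E = L (EFin \o \1_(Rset i)) y.
Proof.
move=> Ey; have h : (L (EFin \o (\1_(Rset i) : _ -> R)) y <= 1%:E)%E.
  rewrite -(L1 Ey); apply: (po_le pL) => //; first exact: nneg_indic.
  by move=> x _; rewrite lee_fin indicE lern1 leq_b1.
have hf : L (EFin \o (\1_(Rset i) : _ -> R)) y \is a fin_num.
  by rewrite ge0_fin_numE ?(le_lt_trans h) ?ltry//; exact: LR_ge0.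
rewrite /Rcond (_ : Num.min _ _ = fine (L (EFin \o \1_(Rset i)) y)) ?fineK//.
by apply/min_idPr; rewrite -lee_fin fineK.
Qed.

Lemma mf_Rcond i : mf (EFin \o Rcond i).
Proof.
apply: (@eq_measurable_fun _ _ (seqM V) (\bar R) (TMS E) (L (EFin \o (\1_(Rset i) : _ -> R)))).
  by move=> x /set_mem Ex /=; rewrite RcondE.
apply: (mf_transfer code_inj g0' mg); first exact: nneg_indic.
exact: (@mf_indic R V E _ (measurable_Rset i)).
Qed.

Lemma Rcond_sum y : TMS E y -> \sum_(i < s) Rcond i y = 1.
Proof.
move=> Ey; apply/EFin_inj; rewrite -sumEFin.
under eq_bigr do rewrite RcondE//.
rewrite -(po_fsum pL); last by move=> i; exact: nneg_indic.
rewrite -[RHS](L1 Ey); congr (L _ y); apply/funext => x.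
have ix : (minn (code (x 0%N)) N < s)%N by rewrite size_mkseq ltnS geq_minr.
rewrite (bigD1 (Ordinal ix))//= big1; first by rewrite adde0 indicE mem_set.
by move=> j jx; rewrite indicE memNset// /Rset /= => e; move: jx; rewrite -val_eqE /= e eqxx.
Qed.

Definition etaR i y := eta (Rcond i y).

Lemma etaR01 i y : 0 <= etaR i y <= 1.
Proof.
rewrite /etaR; apply/andP; split; first by apply: eta_ge0; exact: Rcond01.
have /andP[r0 _] := Rcond01 i y; have := eta_gibbs r0 ltr01; rewrite ln1; lra.
Qed.

Lemma mf_etaR i : mf (EFin \o etaR i).
Proof. by apply: mf_opp; apply: mf_mul; [exact: mf_Rcond|apply: mfun_ln; exact: mf_Rcond]. Qed.

Local Notation preS A i := (Rset i `&` (@sshift V @^-1` A)).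

Lemma measurable_preS (A : set (seqM V)) i : measurable A -> measurable (preS A i : set (seqM V)).
Proof.
move=> mA; apply: measurableI; first exact: measurable_Rset.
by rewrite -[X in measurable X]setTI; exact: measurable_sshift.
Qed.

Lemma rint_RcondM (A : set (seqM V)) i : measurable A ->
  rint (fun y => \1_A y * Rcond i y) (fine (mu (preS A i : set (seqM V)))).
Proof.
move=> mA; have mP := measurable_preS i mA; have [_ _ h] := rint_indic code_inj muT mP.
split; first by move=> y; rewrite mulr_ge0 ?indic_ge0'//; case/andP: (Rcond01 i y).
- by apply: mf_mul; [exact: (@mf_indic R V E _ mA)|exact: mf_Rcond].
rewrite -h; have mI := @mf_indic R V E _ (measurable_Rset i).
transitivity (tint E mu (fun x => ((\1_A (sshift x) : R)%:E * (EFin \o \1_(Rset i)) x)%E)); last first.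
  apply: tint_eq => x Ex; rewrite /= indicI; congr (_%:E); rewrite mulrC; congr (_ * _).
rewrite (adjoint code_inj g0' muL (k := \1_A)) //; last 2 first.
- exact: (@mf_indic R V E _ mA).
- exact: nneg_indic.
by apply: tint_eq => y Ey; rewrite -RcondE.
Qed.

Lemma jensen (A : set (seqM V)) (I : nat -> R) : measurable A ->
  (forall i, rint (fun y => \1_A y * etaR i y) (I i)) ->
  eta (fine (mu A)) + \sum_(i < s) I i <= \sum_(i < s) eta (fine (mu (preS A i : set (seqM V)))).
Proof.
move=> mA hI; set m := fine (mu A); pose v i := fine (mu (preS A i : set (seqM V))).
have rA : rint (\1_A) m := rint_indic code_inj muT mA.
have rv i := rint_RcondM i mA; rewrite -/(v _) in rv.
have v0 i : 0 <= v i by rewrite fine_ge0.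
have m0 : 0 <= m by rewrite fine_ge0.
have vm : \sum_(i < s) v i = m.
  have r1 := rint_sum code_inj muT (index_enum 'I_s) (fun i : 'I_s => rv i).
  apply/eqP; rewrite eq_le; apply/andP; split.
    by apply: (rint_le code_inj r1 rA) => x Ex; rewrite -mulr_sumr Rcond_sum// mulr1.
  by apply: (rint_le code_inj rA r1) => x Ex; rewrite -mulr_sumr Rcond_sum// mulr1.
have key i (t : R) : 0 < t -> I i + v i <= v i * (- ln t) + t * m \/ 0 < ln t.
  move=> t0; have [lt|lt] := ltP 0 (ln t); [by right|left].
  have c0 : 0 <= - ln t by rewrite oppr_ge0.
  have h1 := rint_add code_inj (hI i) (rv i).
  have h2 := rint_add code_inj (rint_scale code_inj c0 (rv i)) (rint_scale code_inj (ltW t0) rA).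
  rewrite mulrC; apply: (rint_le code_inj h1 h2) => x Ex; rewrite /= !indicE; case: (_ \in _); last by rewrite !mul0r !mulr0 !addr0.
  rewrite !mul1r mulr1; have /andP[r0 _] := Rcond01 i x; have := eta_gibbs r0 t0; rewrite -/(etaR i x); lra.
have term i : I i - v i * ln m <= eta (v i).
  have [vz|vp] := eqVneq (v i) 0.
    rewrite vz mul0r subr0 /eta mul0r oppr0.
    rewrite leNgt; apply/negP => Ip.
    pose t := Num.min 1 (I i / (2 * (m + 1))).
    have m1 : 0 < m + 1 by rewrite ltr_wpDl.
    have t0 : 0 < t by rewrite lt_min ltr01 divr_gt0// mulr_gt0.
    have t1 : t <= 1 by rewrite ge_min lexx.
    have ti : t * (m + 1) <= I i / 2.
      rewrite -ler_pdivlMr//; apply: (@le_trans _ _ (I i / (2 * (m + 1)))); first by rewrite ge_min lexx orbT.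
      by rewrite invfM mulrA.
    have [|] := key i t t0; last by rewrite ltNge ln_le0.
    rewrite vz mul0r add0r addr0 => h.
    have : t * m <= t * (m + 1) by rewrite ler_pM2l// lerDl.
    lra.
  have vp' : 0 < v i by rewrite lt_neqAle eq_sym vp v0.
  have vim : v i <= m.
    apply: (rint_le code_inj (rv i) rA) => x Ex; have /andP[_ r1] := Rcond01 i x.
    by rewrite ler_piMr// indic_ge0'.
  have mp : 0 < m by exact: lt_le_trans vim.
  have t0 : 0 < v i / m by rewrite divr_gt0.
  have [|] := key i _ t0; last first.
    by rewrite ltNge ln_le0// ler_pdivrMr// mul1r.
  rewrite divfK ?gt_eqF// lnM ?posrE ?invr_gt0// lnV ?posrE// /eta => h; lra.
have : \sum_(i < s) (I i - v i * ln m) <= \sum_(i < s) eta (v i) by apply: ler_sum => i _; exact: term.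
rewrite sumrB -mulr_suml vm /eta; lra.
Qed.

Definition ffcons n (i : 'I_s) (w : {ffun 'I_n -> 'I_s}) : {ffun 'I_n.+1 -> 'I_s} :=
  [ffun k => if unlift ord0 k is Some k' then w k' else i].

Lemma wset_ffcons n i (w : {ffun 'I_n -> 'I_s}) : wset (ffcons i w) = preS (wset w) i :> set (nat -> V).
Proof.
apply/seteqP; split => [x h|x [xi xw] k].
  split; first by have := h ord0; rewrite ffunE unlift_none nth_Rpart.
  by move=> k; have := h (lift ord0 k); rewrite ffunE liftK /= -iterSr.
rewrite ffunE; case: unliftP => [k' ->|->]; last by rewrite nth_Rpart.
by have := xw k'; rewrite -iterSr.
Qed.

Lemma Hjoin_succ n (e : R) : rint (fun y => \sum_(i < s) etaR i y) e ->
  Hjoin mu Rpart n + e <= Hjoin mu Rpart n.+1.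
Proof.
move=> he; have fP := fin_partition_Rpart.
have mW (w : {ffun 'I_n -> 'I_s}) := measurable_wset fP w.
have exI (w : {ffun 'I_n -> 'I_s}) i : exists r, rint (fun y => \1_(wset w) y * etaR i y) r.
  have h0 y : 0 <= (\1_(wset w) y : R) * etaR i y.
    by rewrite mulr_ge0 ?indic_ge0'//; case/andP: (etaR01 i y).
  have hm : mf (EFin \o (fun y => (\1_(wset w) y : R) * etaR i y)).
    by apply: mf_mul; [exact: (@mf_indic R V E _ (mW w))|exact: mf_etaR].
  have h1 y : TMS E y -> (\1_(wset w) y : R) * etaR i y <= 1.
    move=> _; have /andP[r0 r1] := etaR01 i y; rewrite -[leRHS]mul1r; exact: ler_pM.
  by have [r _ rr] := rint_bounded h0 hm ler01 h1; exists r.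
have [I0 I0P] := choice (fun p : {ffun 'I_n -> 'I_s} * nat => exI p.1 p.2).
pose I w i := I0 (w, i); have IP w i : rint (fun y => \1_(wset w) y * etaR i y) (I w i) by exact: (I0P (w, i)).
have eI : e = \sum_(w : {ffun 'I_n -> 'I_s}) \sum_(i < s) I w i.
  have r1 := rint_sum code_inj muT (index_enum _) (fun w => rint_sum code_inj muT (index_enum 'I_s) (fun i : 'I_s => IP w i)).
  have hx x : \sum_(w : {ffun 'I_n -> 'I_s}) \sum_(i < s) \1_(wset w) x * etaR i x = \sum_(i < s) etaR i x.
    apply: sum_prob_mul; rewrite -[RHS](@wset_sum R V Rpart fP n (fun=> 1) x _ (fun _ _ => erefl)).
    by apply: eq_bigr => w _; rewrite mul1r.
  apply/eqP; rewrite eq_le; apply/andP; split.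
    by apply: (rint_le code_inj he r1) => x Ex; rewrite hx.
  by apply: (rint_le code_inj r1 he) => x Ex; rewrite hx.
rewrite eI /Hjoin -big_split/=.
apply: (@le_trans _ _ (\sum_(w : {ffun 'I_n -> 'I_s}) \sum_(i < s) eta (fine (mu (preS (wset w) i : set (seqM V)))))).
  by apply: ler_sum => w _; exact: (jensen (mW w) (IP w)).
rewrite exchange_big pair_big/= le_eqVlt; apply/orP; left; apply/eqP.
rewrite [RHS](reindex (fun p : 'I_s * {ffun 'I_n -> 'I_s} => ffcons p.1 p.2)).
  by apply: eq_bigr => -[i w] _ /=; rewrite -wset_ffcons.
exists (fun w : {ffun 'I_n.+1 -> 'I_s} => (w ord0, [ffun k : 'I_n => w (lift ord0 k)])) => [[i w] _|w _] /=.
  congr pair; first by rewrite ffunE unlift_none.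
  by apply/ffunP => k; rewrite !ffunE liftK.
by apply/ffunP => k; rewrite ffunE; case: unliftP => [k' ->|->]; rewrite ?ffunE.
Qed.

Lemma Hjoin_ge (e : R) n : rint (fun y => \sum_(i < s) etaR i y) e -> n%:R * e <= Hjoin mu Rpart n.
Proof.
move=> he; elim: n => [|n IH]; last first.
  by apply: le_trans (Hjoin_succ n he); rewrite -natr1 mulrDl mul1r lerD2r.
rewrite mul0r /Hjoin; apply: sumr_ge0 => w _; apply: eta_ge0; rewrite fine_ge0//=.
rewrite -lee_fin fineK; first by apply: probability_le1; exact: (measurable_wset fin_partition_Rpart w).
apply: fin_num_measure; exact: (measurable_wset fin_partition_Rpart w).
Qed.

Lemma limn_esup_ge (u : nat -> \bar R) (l : \bar R) : (forall n, (l <= u n)%E) -> (l <= limn_esup u)%E.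
Proof.
move=> lu; apply: le_ereal_inf_tmp => _ [W [n _ nW] <-].
by apply: le_trans (lu n) _; apply: ereal_sup_ubound; exists n => //; apply: nW; rewrite /= leqnn.
Qed.

Lemma KS_ge (e : R) : rint (fun y => \sum_(i < s) etaR i y) e -> (e%:E <= KSentropy mu)%E.
Proof.
move=> he; apply: (@le_trans _ _ (hpart mu Rpart)); last first.
  by apply: ereal_sup_ubound; exists Rpart => //; exact: fin_partition_Rpart.
apply: limn_esup_ge => n; rewrite lee_fin mulrC ler_pdivlMr// mulrC; exact: Hjoin_ge.
Qed.

Definition infogN x := infog x * \1_[set x : nat -> V | (code (x 0%N) < N)%N] x.

Lemma infogN_ge0 x : 0 <= infogN x.
Proof. by rewrite mulr_ge0 ?infog_ge0 ?indic_ge0'. Qed.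

Lemma mf_infogN : mf (EFin \o infogN).
Proof.
apply: mf_mul; first exact: mf_infog.
apply: mf_indic; apply: (fincoord_measurable code_inj (M := 1)) => x y xy /=.
by rewrite xy.
Qed.

Lemma transfer_infogN y : TMS E y -> (L (EFin \o infogN) y <= (\sum_(i < s) etaR i y)%:E)%E.
Proof.
move=> Ey; have iN0 : nneg (EFin \o infogN) by move=> x; rewrite lee_fin infogN_ge0.
have gN0 : nneg (wmul g (EFin \o infogN)) by move=> x; rewrite mule_ge0// lee_fin.
have eta0 i : 0 <= etaR i y by case/andP: (etaR01 i y).
rewrite /transfer (preop_series E code_inj y gN0) (@nneseries_from2 _ _ N).
- apply: (@le_trans _ _ (\sum_(0 <= i < N) (etaR i y)%:E)%E); last first.
    rewrite sumEFin lee_fin -(big_mkord xpredT (fun i => etaR i y)) size_mkseq big_nat_recr//= lerDl.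
    exact: eta0.
  rewrite !big_mkord; apply: lee_sum => k' _; move: (nat_of_ord k') (ltn_ord k') => k kN; case dk : (dec code k) => [b|]; last by rewrite lee_fin.
  case: ifP => Eb; last by rewrite lee_fin.
  have Eby := TMS_bcons Eb Ey; have cb := dec_code dk.
  have gR : Rcond k y = g (bcons b y).
    apply/EFin_inj; rewrite RcondE// /transfer.
    have gR0 : nneg (wmul g (EFin \o \1_(Rset k))) by move=> x; rewrite mule_ge0// lee_fin ?indic_ge0'.
    rewrite (preop_series E code_inj y gR0) (nneseries_one (k := k)).
    - by rewrite dk Eb /wmul/= indicE mem_set ?mule1// /Rset/= cb; apply/minn_idPl; exact: ltnW.
    - by move=> j; case: (dec _ _) => // b'; case: ifP => // _; exact: gR0.
    move=> j; case dj : (dec _ _) => [b'|//] jk; case: ifP => // Eb'.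
    rewrite /wmul/= indicE memNset ?mule0// /Rset/= (dec_code dj) => e; apply: jk.
    by move: e; rewrite /minn; case: ifP => // _ Nk; move: kN; rewrite Nk ltnn.
  rewrite /wmul -EFinM lee_fin /infogN indicE mem_set /= ?cb// mulr1 infogE// /etaR gR /eta /lg.
  by rewrite mulrN.
- by move=> k; case: (dec _ _) => // b; case: ifP => // _; exact: gN0.
move=> k Nk; case dk : (dec _ _) => [b|//]; case: ifP => // _.
by rewrite /wmul/= /infogN indicE memNset ?mulr0 ?mule0// /= (dec_code dk) ltnNge Nk.
Qed.

Lemma tint_infogN : (tint E mu (EFin \o infogN) <= KSentropy mu)%E.
Proof.
have h0 y : 0 <= \sum_(i < s) etaR i y by apply: sumr_ge0 => i _; case/andP: (etaR01 i y).
have hm : mf (EFin \o (fun y => \sum_(i < s) etaR i y)).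
  rewrite (_ : EFin \o _ = fun y => (\sum_(i < s) (EFin \o etaR i) y)%E); last first.
    by apply/funext => y; rewrite /= sumEFin.
  by apply: mf_sum => i; exact: mf_etaR.
have h1 y : TMS E y -> \sum_(i < s) etaR i y <= s%:R.
  move=> _; apply: (@le_trans _ _ (\sum_(i < s) 1)); last by rewrite sumr_const card_ord.
  by apply: ler_sum => i _; case/andP: (etaR01 i y).
have [e _ he] := rint_bounded h0 hm (ler0n _ _) h1; apply: le_trans (KS_ge he).
have iN0 : nneg (EFin \o infogN) by move=> x; rewrite lee_fin infogN_ge0.
case: he => _ _ <-; rewrite -(muL iN0 mf_infogN); apply: (tint_le code_inj) => //.
- exact: (po_ge0 pL).
- exact: (mf_transfer code_inj g0' mg iN0 mf_infogN).
exact: transfer_infogN.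
Qed.

End Partition.

Lemma KS_ge_info : (tint E mu (EFin \o infog) <= KSentropy mu)%E.
Proof.
have cv : (fun N => tint E mu (EFin \o infogN N)) @ \oo --> tint E mu (EFin \o infog).
  apply: (tint_mono code_inj).
  - by move=> n x; rewrite lee_fin infogN_ge0.
  - by move=> n; exact: mf_infogN.
  - move=> n x _; rewrite lee_fin ler_wpM2l ?infog_ge0// !indicE ler_nat.
    by case: (boolP (_ \in _)) => // /set_mem /= h; rewrite mem_set//= leqW.
  move=> x _; apply: cvg_near_cst; near=> N; rewrite /= /infogN indicE mem_set ?mulr1//=.
  near: N; exact: nbhs_infty_gt.
rewrite -(cvg_lim _ cv)//; apply: lime_le; first by apply/cvg_ex; exists (tint E mu (EFin \o infog)).
by apply: nearW => N; exact: tint_infogN.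
Unshelve. all: by end_near. Qed.

End EntropyLowerBound.

Section FiniteInformation.
Context {R : realType} {V : pointedType} (E : rel V).
Variable code : V -> nat.
Hypothesis code_inj : injective code.
Variables (g : (nat -> V) -> R) (a : V) (K q K' k : R).
Hypothesis g0 : forall x, 0 < g x.
Hypothesis mg : mf E (EFin \o g).
Local Notation L := (transfer E g).
Local Notation L0 := (transfer E (fun=> 1 : R)).
Local Notation A := (taboo a L).
Local Notation B := (entry a L).
Local Notation N := (resolvent A).
Hypothesis L1 : forall x, TMS E x -> L (fun=> 1%E) x = 1%E.
Hypothesis LL1 : forall x, TMS E x -> loopop a L (fun=> 1%E) x = 1%E.
Hypothesis K0 : 0 < K.
Hypothesis q01 : 0 < q < 1.
Hypothesis K'0 : 0 < K'.
Hypothesis k0 : 0 <= k.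
Hypothesis tail : forall n x, TMS E x -> x 0%N = a -> (iter n A (B (fun=> 1)) x <= (K * q ^+ n)%:E)%E.
Hypothesis count : forall n x, TMS E x -> x 0%N = a ->
  (iter n (taboo a L0) (entry a L0 (fun=> 1)) x <= (K' * expR (n.+1%:R * k))%:E)%E.
Variable mu : probability (seqM V) R.
Hypothesis muT : mu (TMS E : set (seqM V)) = 1%E.
Hypothesis muL : forall F : (nat -> V) -> \bar R, nneg F -> mf E F -> tint E mu (L F) = tint E mu F.
Hypothesis tail0 : forall e : R, 0 < e -> exists n, (tint E mu (iter n A (fun=> 1%E)) <= e%:E)%E.
Implicit Types (F G H Z : (nat -> V) -> \bar R).
Local Notation mf := (mf E).
Let g0' x : 0 <= g x. Proof. exact: ltW. Qed.
Let pL : posop (TMS E) L := po_transfer E g0'.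
Let pL0 : posop (TMS E) L0 := po_transfer E (fun=> ler01).
Let pA : posop (TMS E) A := po_taboo a pL.
Local Notation f := (infog g).

(* The pointwise bound [t * (- ln t) <= c * t + expR (- c - 1)], the Legendre transform of
   [t * ln t], with [c] left free: in this form it is preserved by transfer operators. *)
Definition gibbs_dominated G H Z := forall c d : R, 0 <= d -> 0 <= c + d -> forall y, TMS E y ->
  (G y + d%:E * H y <= (c + d)%:E * H y + (expR (- c - 1))%:E * Z y)%E.

Lemma gibbs_step (D : set (nat -> V)) G H Z : nneg G -> nneg H -> nneg Z -> gibbs_dominated G H Z ->
  gibbs_dominated (L (wmul \1_D (fun x => G x + (f x)%:E * H x)%E)) (L (wmul \1_D H)) (L0 (wmul \1_D Z)).
Proof.
move=> G0 H0 Z0 gd c d d0 cd y Ey.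
have fH0 : nneg (fun x => G x + (f x)%:E * H x)%E.
  by move=> x; rewrite adde_ge0// mule_ge0// lee_fin infog_ge0.
rewrite -(po_scale pL)//; last exact: nneg_wmul.
rewrite -(po_scale pL)//; last exact: nneg_wmul.
rewrite -(po_scale pL0)//; last exact: nneg_wmul.
have nn r F : 0 <= r -> nneg F -> nneg (fun x => r%:E * wmul (\1_D : _ -> R) F x)%E.
  by move=> r0 F0 x; rewrite mule_ge0//; exact: nneg_wmul.
rewrite -(po_add pL); [|exact: nneg_wmul|exact: nn].
have ww w F : (forall x, 0 <= w x) -> nneg F -> nneg (wmul w F).
  by move=> w0 F0 x; rewrite mule_ge0// lee_fin.
rewrite /transfer -(po_add (po_preop E)); last 2 first.
- by apply: ww => //; exact: nn.
- by apply: ww => //; apply: nn => //; exact: expR_ge0.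
apply: (po_le (po_preop E)) => //.
- by apply: ww => // x; rewrite adde_ge0//; [exact: nneg_wmul|exact: nn].
- by move=> x; rewrite adde_ge0//; apply: ww => //; apply: nn => //; exact: expR_ge0.
move=> x Ex; rewrite /wmul !indicE; case: (_ \in D); last by rewrite /= !(mul0e, mule0, adde0).
rewrite /= !mul1e; have fx : 0 <= f x := infog_ge0 g x.
have := gd (c - f x) (d + f x); rewrite addrA [c - f x + d]addrAC subrK => /(_ (addr_ge0 d0 fx) cd x Ex) h.
have -> : (G x + (f x)%:E * H x + d%:E * H x = G x + (d + f x)%:E * H x)%E.
  by rewrite EFinD ge0_muleDl ?lee_fin// -addeA [(d%:E * _ + _)%E]addeC.
apply: (le_trans (lee_wpmul2l _ h)); first by rewrite lee_fin.
rewrite ge0_muleDr; [|by rewrite mule_ge0// lee_fin|by rewrite mule_ge0// lee_fin expR_ge0].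
rewrite leeD2l// muleA -EFinM; apply: lee_wpmul2r => //; rewrite lee_fin.
rewrite (_ : - (c - f x) - 1 = f x + (- c - 1)); last by ring.
by rewrite expRD (infogE g0 L1 Ex) expRN (expR_lg g0) mulrA divff ?mul1r// gt_eqF.
Qed.

Fixpoint S (n : nat) : (nat -> V) -> \bar R :=
  if n is m.+1 then A (fun x => S m x + (f x)%:E * iter m A (B (fun=> 1)) x)%E else B (EFin \o f).

Local Notation t n := (iter n A (B (fun=> 1%E))).
Local Notation zn n := (iter n (taboo a L0) (entry a L0 (fun=> 1%E))).

Lemma t_ge0 n : nneg (t n).
Proof. by apply: (po_ge0 (po_iter pA n)); apply: (po_ge0 (po_entry a pL)) => x. Qed.

Lemma zn_ge0 n : nneg (zn n).
Proof. by apply: (po_ge0 (po_iter (po_taboo a pL0) n)); apply: (po_ge0 (po_entry a pL0)) => x. Qed.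

Lemma fM_ge0 F : nneg F -> nneg (fun x => (f x)%:E * F x)%E.
Proof. by move=> F0 x; rewrite mule_ge0// lee_fin infog_ge0. Qed.

Lemma S_ge0 n : nneg (S n).
Proof.
elim: n => [|n IH] /=; first by apply: (po_ge0 (po_entry a pL)) => x; rewrite lee_fin infog_ge0.
by apply: (po_ge0 pA) => x; rewrite adde_ge0//; apply: fM_ge0; exact: t_ge0.
Qed.

Lemma S_dominated n : gibbs_dominated (S n) (t n) (zn n).
Proof.
elim: n => [|n IH] /=; last by apply: gibbs_step => //; [exact: S_ge0|exact: t_ge0|exact: zn_ge0].
rewrite (_ : B (EFin \o f) = L (wmul \1_(cyl1 a) (fun x => (fun=> 0) x + (f x)%:E * (fun=> 1) x)))%E; last first.
  by rewrite /entry; congr (L (wmul _ _)); apply/funext => x; rewrite add0e mule1.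
apply: gibbs_step => // c d d0 cd y Ey.
rewrite add0e !mule1 -EFinD lee_fin.
have := expR_ge1Dx (- c - 1); lra.
Qed.

Lemma S_bound : exists2 r, 0 <= r & forall x, TMS E x -> x 0%N = a -> (\sum_(n <oo) S n x <= r%:E)%E.
Proof.
have /andP[q0 q1] := q01.
pose dl := - ln q / 2; have dl0 : 0 < dl by rewrite divr_gt0// oppr_gt0 ln_lt0.
have qE n : q ^+ n = expR (- dl * n%:R) * expR (- dl * n%:R).
  have qe : q = expR (ln q) by rewrite lnK ?posrE.
  by rewrite {1}qe -expRM_natl -expRD; congr expR; rewrite /dl; field.
pose c1 := k + 1; have c10 : 0 <= c1 by rewrite addr_ge0.
pose r1 := c1 * K * (dl^-1 * expR dl); pose r2 := K'.
have r10 : 0 <= r1 by rewrite !mulr_ge0 ?invr_ge0 ?expR_ge0 ?(ltW K0) ?(ltW dl0).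
have e1 : 0 <= expR (- dl) < 1 by rewrite expR_ge0 -[ltRHS]expR0 ltr_expR oppr_lt0.
have e2 : 0 <= (expR (- 1) : R) < 1 by rewrite expR_ge0 -[ltRHS]expR0 ltr_expR oppr_lt0 ltr01.
exists (r1 / (1 - expR (- dl)) + r2 / (1 - expR (- 1))).
  have h1 : 0 <= 1 - expR (- dl) by rewrite subr_ge0; case/andP: e1 => _ /ltW.
  have h2 : 0 <= 1 - (expR (- 1) : R) by rewrite subr_ge0; case/andP: e2 => _ /ltW.
  by rewrite addr_ge0// divr_ge0// ltW.
move=> x Ex xa; rewrite EFinD -!geometric_nneseries//; last exact: ltW.
have g1 n : (0 <= (r1 * expR (- dl) ^+ n)%:E)%E by rewrite lee_fin mulr_ge0// exprn_ge0// expR_ge0.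
have g2 n : (0 <= (r2 * expR (- 1) ^+ n)%:E)%E by rewrite lee_fin mulr_ge0 ?(ltW K'0)// exprn_ge0// expR_ge0.
rewrite -nneseriesD//; apply: lee_nneseries => [n _ _|n _]; first exact: S_ge0.
have c0 : 0 <= c1 * n.+1%:R by rewrite mulr_ge0.
have := S_dominated n (lexx 0) _ Ex => /(_ (c1 * n.+1%:R)); rewrite addr0 mul0e adde0 => /(_ c0) h.
apply: (le_trans h); apply: leeD.
  apply: (@le_trans _ _ ((c1 * n.+1%:R)%:E * (K * q ^+ n)%:E)%E); first by apply: lee_wpmul2l; rewrite ?lee_fin ?tail.
  rewrite -EFinM lee_fin qE -expRM_natl /r1 (_ : n%:R * - dl = - dl * n%:R); last by rewrite mulrC.
  set e := expR (- dl * n%:R); have e0 : 0 <= e by exact: expR_ge0.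
  have ne : n.+1%:R * e <= dl^-1 * expR dl.
    rewrite -ler_pdivlMr ?expR_gt0// -mulrA -expRN -expRD -(ler_pM2l dl0) mulrA divff ?gt_eqF// mul1r.
    have := expR_ge1Dx (dl + - (- dl * n%:R)); rewrite -natr1; lra.
  have cKe : 0 <= c1 * K * e by rewrite !mulr_ge0// ltW.
  have := ler_wpM2l cKe ne; lra.
apply: (@le_trans _ _ ((expR (- (c1 * n.+1%:R) - 1))%:E * (K' * expR (n.+1%:R * k))%:E)%E).
  by apply: lee_wpmul2l; rewrite ?lee_fin ?expR_ge0//; exact: count.
rewrite -EFinM lee_fin mulrCA ler_pM2l// -expRD -expRM_natl ler_expR /c1 -natr1.
by have : 0 <= n%:R :> R by []; move: (n%:R : R) => u u0; nra.
Qed.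

Lemma info_fin : exists2 r : R, 0 <= r & (tint E mu (EFin \o f) <= r%:E)%E.
Proof.
have [r r0 Sr] := S_bound; exists r => //.
have f0 : nneg (EFin \o f) by move=> x; rewrite lee_fin infog_ge0.
have mff : mf (EFin \o f) := mf_infog mg.
have Lf0 : nneg (L (EFin \o f)) by exact: (po_ge0 pL).
have mLf : mf (L (EFin \o f)) by exact: (mf_transfer code_inj g0' mg).
rewrite -muL//; apply: (le_trans (kac code_inj g0' mg muL tail0 Lf0 mLf)).
pose T x := (\sum_(n <oo) S n x)%E.
have T0 : nneg T by move=> x; apply: nneseries_ge0 => n _ _; exact: S_ge0.
have TE x : TMS E x -> (L (EFin \o f) x + A T x = T x)%E.
  move=> Ex; rewrite {2}/T nneseries_recl//; last by move=> n _; exact: S_ge0.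
  rewrite -(@nneseries_addn _ (fun n => S n x) 1); last by move=> n; exact: S_ge0.
  have fT0 : nneg (fun y => T y + (EFin \o f) y)%E by move=> y; rewrite adde_ge0.
  have -> : (\sum_(n <oo) S (n + 1) x = A (fun y => T y + (EFin \o f) y) x)%E.
    under eq_eseriesr do rewrite addn1 /=.
    rewrite -(po_sum pA); last first.
      by move=> n y; rewrite adde_ge0//; [exact: S_ge0|apply: fM_ge0; exact: t_ge0].
    apply: (po_eq pA) => //.
      move=> y; apply: nneseries_ge0 => n _ _; rewrite adde_ge0//; [exact: S_ge0|apply: fM_ge0; exact: t_ge0].
    move=> y Ey; have e1 n : (0 <= S n y)%E by exact: S_ge0.
    have e2 n : (0 <= (f y)%:E * t n y)%E by apply: fM_ge0; exact: t_ge0.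
    rewrite nneseriesD//.
    congr (_ + _)%E; rewrite nneseriesZl; last by move=> n _; exact: t_ge0.
    by have := LL1 Ey; rewrite /loopop /resolvent => ->; rewrite mule1.
  rewrite (po_add pA)// (taboo_entry a pL (F := EFin \o f))//.
  by rewrite /= addeAC [X in (X + _)%E]addeC addeC.
have NT x : TMS E x -> (N (L (EFin \o f)) x <= T x)%E by apply: (resolvent_min pA Lf0 T0) => z Ez; rewrite TE.
rewrite -(tint_cst code_inj muT r0); apply: (tint_le code_inj).
- by apply: nneg_wmul; exact: (po_ge0 (po_resolvent pA)).
- apply: mf_wmul; first exact: (@mf_indic R V E _ (measurable_cyl1 a)).
  exact: (mf_resolvent code_inj g0' mg).
- exact: mf_cst.
move=> x Ex; have [xa|xa] := pselect (cyl1 a x); last by rewrite wmul_notin// lee_fin.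
by rewrite wmul_in//; apply: le_trans (Sr x Ex xa); exact: NT.
Qed.

End FiniteInformation.

Section Equilibrium.
Context {R : realType} {V : pointedType} (E : rel V).
Variable code : V -> nat.
Hypothesis code_inj : injective code.
Implicit Types (nu : probability (seqM V) R).

Lemma tint_csub nu (phi f : (nat -> V) -> R) (c : R) : nu (TMS E : set (seqM V)) = 1%E ->
  (forall x, 0 <= f x) -> mf E (EFin \o f) -> (forall x, TMS E x -> phi x = c - f x) ->
  (tint E nu (EFin \o phi) = c%:E - tint E nu (EFin \o f))%E.
Proof.
move=> nuT f0 mff phiE; have mT := measurable_TMS E code_inj.
transitivity (tint E nu (fun x => (c - f x)%:E)); first by apply: tint_eq => x Ex /=; rewrite phiE.
have i0 : (0 <= tint E nu (EFin \o f))%E by apply: tint_ge0 => x; rewrite lee_fin.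
case fF : (tint E nu (EFin \o f)) i0 => [F| |]// _.
  have intf : nu.-integrable (TMS E) (EFin \o f).
    apply/integrableP; split => //; rewrite (_ : (fun x => _) = EFin \o f); last first.
      by apply/funext => x; rewrite /= ger0_norm.
    by have := fF; rewrite /tint => ->; rewrite ltry.
  have intc : nu.-integrable (TMS E) (EFin \o (fun=> c)) by apply: finite_measure_integrable_cst.
  have := integralB_EFin mT intc intf; rewrite /tint => ->.
  have -> : (\int[nu]_(x in TMS E) (EFin \o f) x = F%:E)%E by [].
  by rewrite integral_cst//= nuT mule1.
rewrite /= /tint integralE.
have -> : (\int[nu]_(x in (TMS E : set (seqM V))) ((fun x => (c - f x)%:E)^\- x) = +oo)%E.
  have mm : mf E ((fun x => (c - f x)%:E)^\-)%E.
    have mcf : mf E (EFin \o (fun x => c - f x)) by apply: mf_add; [exact: mf_cst|exact: mf_opp].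
    by apply: measurable_funeneg.
  have h : (+oo <= `|c|%:E + tint E nu (fun x => (c - f x)%:E)^\-)%E.
    rewrite -fF -{1}(tint_cst code_inj nuT (normr_ge0 c)) -(tint_add code_inj) //; last exact: mf_cst.
    apply: (tint_le code_inj) => //.
      by apply: emeasurable_funD => //; exact: mf_cst.
    move=> x Ex; rewrite funenegE /= -EFin_max -EFinD lee_fin.
    have := ler_norm c; have : - (c - f x) <= Num.max (- (c - f x)) 0 by rewrite le_max lexx.
    lra.
  move: h; rewrite /tint leye_eq; case: (\int[nu]_(x in _) _)%E => [r| |] //.
by rewrite /= addeNy.
Qed.

Definition clamp (j t : R) := Num.max (- j) (Num.min j t).

Lemma clampP (j t : R) : 0 <= j ->
  [\/ t <= - j /\ clamp j t = - j, - j <= t <= j /\ clamp j t = t | j <= t /\ clamp j t = j].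
Proof.
move=> j0; rewrite /clamp; have [jt|tj] := leP j t.
  by apply: Or33; split => //; apply/max_idPr; lra.
have [h|h] := leP t (- j); first by apply: Or31; split => //; apply/max_idPl.
by apply: Or32; split => //; lra.
Qed.

Lemma clamp_mono (s t j : R) : 0 <= j ->
  Num.max 0 (clamp j s - clamp j t) <= Num.max 0 (clamp (j + 1) s - clamp (j + 1) t).
Proof.
move=> j0; have j1 : 0 <= j + 1 by rewrite addr_ge0.
rewrite ge_max !le_max lexx /=; apply/orP.
case: (clampP s j0) => -[h1 ->]; case: (clampP t j0) => -[h2 ->];
case: (clampP s j1) => -[h3 ->]; case: (clampP t j1) => -[h4 ->];
  first [left; lra|right; lra].
Qed.

Lemma clamp_le (s t j : R) : 0 <= j -> Num.max 0 (clamp j s - clamp j t) <= Num.max 0 (s - t).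
Proof.
move=> j0; rewrite ge_max !le_max lexx /=; apply/orP.
by case: (clampP s j0) => -[h1 ->]; case: (clampP t j0) => -[h2 ->]; first [left; lra|right; lra].
Qed.

Lemma coboundary_tint nu (u vp vm : (nat -> V) -> R) : shift_inv_prob E nu -> mf E (EFin \o u) ->
  (forall x, 0 <= vp x) -> (forall x, 0 <= vm x) -> mf E (EFin \o vp) -> mf E (EFin \o vm) ->
  (forall x, TMS E x -> vp x = Num.max 0 (u (sshift x) - u x)) ->
  (forall x, TMS E x -> vm x = Num.max 0 (u x - u (sshift x))) ->
  (tint E nu (EFin \o vm) <= tint E nu (EFin \o vp))%E.
Proof.
move=> nuinv mu_ vp0 vm0 mvp mvm vpE vmE; have nuT : nu (TMS E : set (seqM V)) = 1%E by case: nuinv.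
pose cl (k : nat) (t : R) := clamp k%:R t.
have mcl k : mf E (EFin \o (fun x => cl k (u x))).
  by apply: mf_max; [exact: mf_cst|apply: mf_min => //; exact: mf_cst].
have clb k t : - k%:R <= cl k t <= k%:R.
  have k0 : 0 <= k%:R :> R by [].
  by rewrite /cl /clamp le_max lexx /= ge_max ge_min lexx andbT /= (le_trans _ k0)// oppr_le0.
pose wp k x := Num.max 0 (cl k (u (sshift x)) - cl k (u x)).
pose wm k x := Num.max 0 (cl k (u x) - cl k (u (sshift x))).
have msh (k : (nat -> V) -> R) : mf E (EFin \o k) -> mf E (EFin \o (fun x => k (sshift x))).
  by move=> mk; exact: (mf_sshift code_inj mk).
have mwp k : mf E (EFin \o wp k).
  apply: mf_max; first exact: mf_cst.
  by apply: mf_add; [exact: (msh (fun x => cl k (u x)))|exact: mf_opp].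
have mwm k : mf E (EFin \o wm k).
  apply: mf_max; first exact: mf_cst.
  by apply: mf_add; [|apply: mf_opp; exact: (msh (fun x => cl k (u x)))].
have w0 k x : 0 <= wp k x /\ 0 <= wm k x by rewrite !le_max !lexx.
have eqw k : tint E nu (EFin \o wm k) = tint E nu (EFin \o wp k).
  have b0 : 0 <= 2 * k%:R :> R by rewrite mulr_ge0.
  have [rp _ hp] : exists2 r, 0 <= r & rint E nu (wp k) r.
    apply: (rint_bounded code_inj nuT (M := 2 * k%:R)) => //; first by move=> x; case: (w0 k x).
    move=> x _; rewrite ge_max b0/=; have /andP[] := clb k (u x); have /andP[] := clb k (u (sshift x)); lra.
  have [rm _ hm] : exists2 r, 0 <= r & rint E nu (wm k) r.
    apply: (rint_bounded code_inj nuT (M := 2 * k%:R)) => //; first by move=> x; case: (w0 k x).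
    move=> x _; rewrite ge_max b0/=; have /andP[] := clb k (u x); have /andP[] := clb k (u (sshift x)); lra.
  have [rc _ hc] : exists2 r, 0 <= r & rint E nu (fun x => cl k (u x) + k%:R) r.
    apply: (rint_bounded code_inj nuT (M := 2 * k%:R)) => //.
    - by move=> x; have /andP[] := clb k (u x); lra.
    - by apply: mf_add => //; exact: mf_cst.
    by move=> x _; have /andP[] := clb k (u x); lra.
  have hcs := rint_shift code_inj nuinv 1 hc.
  have h1 := rint_add code_inj hp hc; have h2 := rint_add code_inj hm hcs.
  have e x : wp k x + (cl k (u x) + k%:R) = wm k x + (cl k (u (sshift x)) + k%:R).
    rewrite /wp /wm; move: (cl k (u x)) (cl k (u (sshift x))) => s t.
    by rewrite /Num.max; do 2 case: ifP; lra.
  have : rp + rc = rm + rc.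
    apply/eqP; rewrite eq_le (rint_le code_inj h1 h2) ?(rint_le code_inj h2 h1)// => x Ex; by rewrite e.
  by move=> /addIr rE; case: hp => _ _ ->; case: hm => _ _ ->; rewrite rE.
have cleq k t : `|t| <= k%:R -> cl k t = t.
  by rewrite ler_norml /cl /clamp => /andP[h1 h2]; rewrite (min_idPr h2) (max_idPr h1).
have mono (k : nat) (s t : R) := clamp_mono s t (ler0n R k).
have bnd (k : nat) (s t : R) := clamp_le s t (ler0n R k).
have cv : (fun k => tint E nu (EFin \o wm k)) @ \oo --> tint E nu (EFin \o vm).
  apply: (tint_mono code_inj) => //.
  - by move=> n x; rewrite lee_fin; case: (w0 n x).
  - by move=> n x _; rewrite lee_fin /wm /cl -natr1; exact: mono.
  move=> x Ex; apply: cvg_near_cst; near=> k; rewrite /= vmE// /wm !cleq//; near: k; exact: nbhs_infty_ger.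
rewrite -(cvg_lim _ cv)//; apply: lime_le; first by apply/cvg_ex; exists (tint E nu (EFin \o vm)).
apply: nearW => k; rewrite eqw; apply: (tint_le code_inj) => //.
  by move=> x; rewrite lee_fin; case: (w0 k x).
by move=> x Ex; rewrite lee_fin vpE//; exact: bnd.
Unshelve. all: by end_near. Qed.

End Equilibrium.

(** * The variational principle *)

Section VariationalPrinciple.
Context {R : realType} {V : pointedType} (E : rel V) (theta : R).
Hypothesis theta01 : 0 < theta < 1.
Variable code : V -> nat.
Hypothesis code_inj : injective code.
Hypothesis mixE : top_mixing E.
Variables (g : (nat -> V) -> R) (a : V) (kappa K q K' k : R).
Hypothesis kappa0 : 0 <= kappa.
Hypothesis g0 : forall x, 0 < g x.
Hypothesis greg : regw E theta kappa g.
Local Notation L := (transfer E g).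
Local Notation L0 := (transfer E (fun=> 1 : R)).
Local Notation A := (taboo a L).
Local Notation B := (entry a L).
Hypothesis L1 : forall x, TMS E x -> L (fun=> 1%E) x = 1%E.
Hypothesis LL1 : forall x, TMS E x -> loopop a L (fun=> 1%E) x = 1%E.
Hypothesis K0 : 0 < K.
Hypothesis q01 : 0 < q < 1.
Hypothesis K'0 : 0 < K'.
Hypothesis k0 : 0 <= k.
Hypothesis tail : forall n x, TMS E x -> x 0%N = a -> (iter n A (B (fun=> 1)) x <= (K * q ^+ n)%:E)%E.
Hypothesis count : forall n x, TMS E x -> x 0%N = a ->
  (iter n (taboo a L0) (entry a L0 (fun=> 1)) x <= (K' * expR (n.+1%:R * k))%:E)%E.
Variable mu : probability (seqM V) R.
Hypothesis muT : mu (TMS E : set (seqM V)) = 1%E.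
Hypothesis muL : forall F : (nat -> V) -> \bar R, nneg F -> mf E F -> tint E mu (L F) = tint E mu F.
Hypothesis tail0 : forall e : R, 0 < e -> exists n, (tint E mu (iter n A (fun=> 1%E)) <= e%:E)%E.
Variables (phi u : (nat -> V) -> R) (C P : R).
Hypothesis phiC : forall x, TMS E x -> phi x <= C.
Hypothesis mphi : mf E (EFin \o phi).
Hypothesis mfu : mf E (EFin \o u).
Hypothesis lgE : forall x, TMS E x -> lg g x = phi x - P + u x - u (sshift x).
Local Notation mf := (mf E).
Let g0' x : 0 <= g x. Proof. exact: ltW. Qed.
Let mg : mf (EFin \o g) := mf_regw theta01 code_inj g0' greg.

Lemma birk_lg N x : TMS E x -> birk (lg g) N x = birk phi N x - N%:R * P + u x - u (iter N (@sshift V) x).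
Proof.
move=> Ex; elim: N => [|N IH]; first by rewrite !birk0 mul0r; ring.
by rewrite !birkSr IH lgE ?iterS; [ring|exact: TMS_iter].
Qed.

Let D := Num.max 0 (C - P).
Let f x := Num.max 0 (P + D - phi x).
Let mass (v : V) := fine (mu ([set y | y 0%N = v] : set (seqM V))).
Let b x := Num.max (u x) (- u x) + `|ln (mass (x 0%N))|.

Lemma mass_gt0 v : 0 < mass v.
Proof.
apply: fine_gt0; apply/andP; split.
  apply: (state_mass_pos theta01 code_inj kappa0 g0 greg muT muL); first by case: mixE.
  exact: TMS_ex.
by rewrite ltey_eq fin_num_measure//; exact: measurable_coord.
Qed.

Lemma fE x : TMS E x -> f x = P + D - phi x.
Proof.
move=> Ex; apply/max_idPr; have := phiC Ex; have : C - P <= D by rewrite le_max lexx orbT.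
lra.
Qed.

Lemma phiE_f x : TMS E x -> phi x = P + D - f x.
Proof. by move=> Ex; rewrite fE//; ring. Qed.

Lemma birk_f N x : TMS E x -> birk f N x = N%:R * (P + D) - birk phi N x.
Proof.
move=> Ex; elim: N => [|N IH]; first by rewrite !birk0 mul0r subrr.
by rewrite !birkSr IH fE; [rewrite -natr1; ring|exact: TMS_iter].
Qed.

Lemma press_upper nu : shift_inv_prob E nu -> (press_fun E phi nu <= P%:E)%E.
Proof.
move=> nuinv; have nuT : nu (TMS E : set (seqM V)) = 1%E by case: nuinv.
have f0 x : 0 <= f x by rewrite le_max lexx.
have D0 : 0 <= D by rewrite le_max lexx.
have mff : mf (EFin \o f).
  apply: mf_max; first exact: mf_cst.
  by apply: mf_add; [exact: mf_cst|exact: mf_opp].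
have mfb : mf (EFin \o b).
  apply: mf_add; first by apply: mf_max => //; exact: mf_opp.
  apply: (cont_mf code_inj) => x Ex e e0; exists 1%N => y Ey xy; rewrite xy// subrr normr0//.
have b0 x : 0 <= b x.
  by rewrite addr_ge0// le_max; case: (leP 0 (u x)) => //= h; rewrite oppr_ge0 ltW.
have Kc0 : 0 <= holderc theta kappa by exact: holderc_ge0.
have gb N x : TMS E x -> ((expR (N%:R * D - birk f N x - holderc theta kappa - b x - b (iter N (@sshift V) x)))%:E
   <= mu ([set y | agree N.+1 x y] : set (seqM V)))%E.
  move=> Ex; have := gibbs_lower theta01 code_inj kappa0 g0 greg muT muL N Ex.
  apply: le_trans; set y := iter N _ x.
  have -> : x N = y 0%N by rewrite /y iter_sshiftE.
  have mE : mu ([set z | z 0%N = y 0%N] : set (seqM V)) = (mass (y 0%N))%:E.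
    by rewrite /mass fineK// fin_num_measure//; exact: measurable_coord.
  rewrite mE -EFinM lee_fin -[X in _ <= _ * X](lnK (_ : mass (y 0%N) \is Num.pos)) ?posrE ?mass_gt0//.
  rewrite -expRD ler_expR birk_lg// birk_f// /b -/y.
  have := ler_norm (- ln (mass (y 0%N))); rewrite normrN.
  have h1 : - u x <= Num.max (u x) (- u x) by rewrite le_max lexx orbT.
  have h2 : u y <= Num.max (u y) (- u y) by rewrite le_max lexx.
  have h3 : 0 <= `|ln (mass (x 0%N))| by [].
  lra.
have ub Q (pQ : fin_partition Q) := entropy_le code_inj muT f0 mff mfb D0 Kc0 gb nuinv pQ.
have ip := tint_csub code_inj nuT f0 mff phiE_f.
rewrite /press_fun -[X in (_ + X <= _)%E]/(tint E nu (EFin \o phi)) ip.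
have i0 : (0 <= tint E nu (EFin \o f))%E by apply: tint_ge0 => x; rewrite lee_fin.
case fF : (tint E nu (EFin \o f)) i0 ub => [F| |]// _ ub; last by rewrite /= addeNy leNye.
have h : (KSentropy nu <= (F - D)%:E)%E.
  by apply: ge_ereal_sup => _ [Q pQ <-]; rewrite EFinB leeBrDr//; exact: ub.
apply: (le_trans (leeD2r _ h)); rewrite -EFinB -EFinD lee_fin; lra.
Qed.

Lemma rint_dom (l1 l2 : (nat -> V) -> R) r : (forall x, 0 <= l1 x) -> mf (EFin \o l1) -> rint E mu l2 r ->
  (forall x, TMS E x -> l1 x <= l2 x) -> exists2 r', 0 <= r' & rint E mu l1 r'.
Proof.
move=> l0 ml [l20 ml2 hr] l12.
have i0 : (0 <= tint E mu (EFin \o l1))%E by apply: tint_ge0 => x; rewrite lee_fin.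
have i1 : (tint E mu (EFin \o l1) <= r%:E)%E by rewrite -hr; apply: (tint_le code_inj).
exists (fine (tint E mu (EFin \o l1))); first exact: fine_ge0.
by split => //; rewrite fineK// ge0_fin_numE// (le_lt_trans i1)// ltry.
Qed.

Lemma press_lower : (P%:E <= press_fun E phi mu)%E.
Proof.
have minv := transfer_inv code_inj g0' L1 muT muL.
pose I := infog g; have I0 x : 0 <= I x := infog_ge0 g x.
have mI : mf (EFin \o I) := mf_infog mg.
have [F0 _ iF0] := info_fin code_inj g0 mg L1 LL1 K0 q01 K'0 k0 tail count muT muL tail0.
have [F _ hF] : exists2 F, 0 <= F & rint E mu I F.
  have i0 : (0 <= tint E mu (EFin \o I))%E by apply: tint_ge0 => x; rewrite lee_fin.
  exists (fine (tint E mu (EFin \o I))); first exact: fine_ge0.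
  by split => //; rewrite fineK// ge0_fin_numE// (le_lt_trans iF0)// ltry.
have KSF : (F%:E <= KSentropy mu)%E by case: hF => _ _ <-; exact: (KS_ge_info code_inj g0 mg L1 muT muL).
pose vp x := Num.max 0 (u (sshift x) - u x); pose vm x := Num.max 0 (u x - u (sshift x)).
have mus : mf (EFin \o (fun x => u (sshift x))) by exact: (mf_sshift code_inj mfu).
have mvp : mf (EFin \o vp) by apply: mf_max; [exact: mf_cst|apply: mf_add => //; exact: mf_opp].
have mvm : mf (EFin \o vm) by apply: mf_max; [exact: mf_cst|apply: mf_add => //; exact: mf_opp].
have vp0 x : 0 <= vp x by rewrite le_max lexx.
have vm0 x : 0 <= vm x by rewrite le_max lexx.
have phiE x : TMS E x -> phi x = P - I x + (u (sshift x) - u x).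
  by move=> Ex; rewrite /I (infogE g0 L1 Ex) lgE//; ring.
have D0 : 0 <= D by rewrite le_max lexx.
have [p _ hp] : exists2 p, 0 <= p & rint E mu vp p.
  apply: (rint_dom vp0 mvp (rint_add code_inj hF (rint_cst code_inj muT D0))) => x Ex.
  rewrite ge_max addr_ge0//=; have := phiC Ex; have : C - P <= D by rewrite le_max lexx orbT.
  have := phiE x Ex; lra.
have vmp : (tint E mu (EFin \o vm) <= p%:E)%E.
  by case: hp => _ _ <-; exact: (coboundary_tint code_inj minv mfu vp0 vm0 mvp mvm).
have [m _ hm] : exists2 m, 0 <= m & rint E mu vm m.
  have i0 : (0 <= tint E mu (EFin \o vm))%E by apply: tint_ge0 => x; rewrite lee_fin.
  exists (fine (tint E mu (EFin \o vm))); first exact: fine_ge0.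
  by split => //; rewrite fineK// ge0_fin_numE// (le_lt_trans vmp)// ltry.
have mp : m <= p by case: hm => _ _ hm; rewrite -lee_fin -hm.
have f0 x : 0 <= f x by rewrite le_max lexx.
have mff : mf (EFin \o f).
  apply: mf_max; first exact: mf_cst.
  by apply: mf_add; [exact: mf_cst|exact: mf_opp].
have r2 := rint_add code_inj (rint_add code_inj hF (rint_cst code_inj muT D0)) hm.
have key x : TMS E x -> f x + vp x = I x + D + vm x.
  move=> Ex; rewrite fE// (phiE _ Ex) /vp /vm; move: (u x) (u (sshift x)) => s t.
  have -> : Num.max 0 (t - s) = Num.max 0 (s - t) + (t - s).
    by have [h|h] := leP s t; [rewrite (max_r (_ : 0 <= t - s)) ?(max_l (_ : s - t <= 0)); lra|rewrite (max_l (_ : t - s <= 0)) ?(max_r (_ : 0 <= s - t)); lra].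
  ring.
have [r _ hr] : exists2 r, 0 <= r & rint E mu f r.
  by apply: (rint_dom f0 mff r2) => x Ex; rewrite -key// lerDl.
have rE : r + p <= F + D + m.
  apply: (rint_le code_inj (rint_add code_inj hr hp) r2) => x Ex; by rewrite key.
have ip := tint_csub code_inj muT f0 mff phiE_f; case: hr => _ _ hr; rewrite hr in ip.
rewrite /press_fun -[X in (_ <= _ + X)%E]/(tint E mu (EFin \o phi)) ip.
apply: (@le_trans _ _ (F%:E + ((P + D)%:E - r%:E))%E); last exact: leeD2r.
by rewrite -EFinB -EFinD lee_fin; lra.
Qed.

Lemma mu_equilibrium : equilibrium E phi mu.
Proof.
split; first exact: (transfer_inv code_inj g0' L1 muT muL).
by move=> nu nuinv; exact: (le_trans (press_upper nuinv) press_lower).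
Qed.

End VariationalPrinciple.

(** * Poisson's equation *)

Lemma posneg {R : realDomainType} (t : R) : t = Num.max 0 t - Num.max 0 (- t).
Proof. by case: (leP 0 t) => h; case: (leP 0 (- t)) => h'; lra. Qed.

Section RealOperator.
Context {R : realType} {X : Type} (D : set X) (T : (X -> \bar R) -> X -> \bar R).
Hypothesis pT : posop D T.
Implicit Types (f l : X -> R).

Definition realop f l := (forall x, 0 <= f x) /\ forall x, D x -> T (EFin \o f) x = (l x)%:E.

Definition lrel f l := exists f1 f2 l1 l2, [/\ realop f1 l1, realop f2 l2,
  forall x, D x -> f x = f1 x - f2 x & forall x, D x -> l x = l1 x - l2 x].

Lemma realop_add f l f' l' : realop f l -> realop f' l' ->
  realop (fun x => f x + f' x) (fun x => l x + l' x).
Proof.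
move=> [f0 fl] [f'0 fl']; split=> [x|x Dx]; first exact: addr_ge0.
by rewrite EFinD -fl// -fl'// -(po_add pT)// => y /=; rewrite lee_fin.
Qed.

Lemma realop_scale (c : R) f l : 0 <= c -> realop f l -> realop (fun x => c * f x) (fun x => c * l x).
Proof.
move=> c0 [f0 fl]; split=> [x|x Dx]; first exact: mulr_ge0.
by rewrite EFinM -fl// -(po_scale pT)// => y /=; rewrite lee_fin.
Qed.

Lemma realop_le f l f' l' : realop f l -> realop f' l' -> (forall x, D x -> f x <= f' x) ->
  forall x, D x -> l x <= l' x.
Proof.
move=> [f0 fl] [f'0 fl'] ff' x Dx; rewrite -lee_fin -fl// -fl'//.
by apply: (po_le pT) => // y /=; rewrite ?lee_fin; auto.
Qed.

Lemma lrel_sub f l f' l' : lrel f l -> lrel f' l' ->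
  lrel (fun x => f x - f' x) (fun x => l x - l' x).
Proof.
move=> [f1 [f2 [l1 [l2 [r1 r2 fE lE]]]]] [f1' [f2' [l1' [l2' [r1' r2' fE' lE']]]]].
exists (fun x => f1 x + f2' x), (fun x => f2 x + f1' x), (fun x => l1 x + l2' x), (fun x => l2 x + l1' x).
split; [exact: realop_add..| |] => x Dx; first by rewrite fE// fE'//; ring.
by rewrite lE// lE'//; ring.
Qed.

Lemma lrel_add f l f' l' : lrel f l -> lrel f' l' ->
  lrel (fun x => f x + f' x) (fun x => l x + l' x).
Proof.
move=> [f1 [f2 [l1 [l2 [r1 r2 fE lE]]]]] [f1' [f2' [l1' [l2' [r1' r2' fE' lE']]]]].
exists (fun x => f1 x + f1' x), (fun x => f2 x + f2' x), (fun x => l1 x + l1' x), (fun x => l2 x + l2' x).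
split; [exact: realop_add..| |] => x Dx; first by rewrite fE// fE'//; ring.
by rewrite lE// lE'//; ring.
Qed.

Lemma lrel_le f l f' l' : lrel f l -> lrel f' l' -> (forall x, D x -> f x <= f' x) ->
  forall x, D x -> l x <= l' x.
Proof.
move=> [f1 [f2 [l1 [l2 [r1 r2 fE lE]]]]] [f1' [f2' [l1' [l2' [r1' r2' fE' lE']]]]] ff' x Dx.
rewrite lE// lE'//.
have := realop_le (realop_add r1 r2') (realop_add r1' r2) _ Dx.
suff /[swap]/[apply] : forall y, D y -> f1 y + f2' y <= f1' y + f2 y by lra.
by move=> y Dy; have := ff' y Dy; rewrite fE// fE'//; lra.
Qed.

Lemma lrel_eq f l f' l' : lrel f l -> (forall x, D x -> f' x = f x) -> (forall x, D x -> l' x = l x) -> lrel f' l'.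
Proof.
move=> [f1 [f2 [l1 [l2 [r1 r2 fE lE]]]]] ff ll; exists f1, f2, l1, l2; split => // x Dx.
  by rewrite ff// fE.
by rewrite ll// lE.
Qed.

Lemma realop_lrel f l : realop f l -> lrel f l.
Proof.
move=> r; exists f, (fun=> 0), l, (fun=> 0); split => //; [|by move=> x _; rewrite subr0..].
by split => // x Dx; rewrite -[RHS](po_0 pT x).
Qed.

Hypothesis T1 : forall x, D x -> T (fun=> 1%E) x = 1%E.

Lemma realop_cst (c : R) : 0 <= c -> realop (fun=> c) (fun=> c).
Proof.
move=> c0; split => // x Dx; rewrite (_ : EFin \o _ = fun y => (c%:E * (fun=> 1%E) y)%E).
  by rewrite (po_scale pT)// T1// mule1.
by apply/funext => y; rewrite mule1.
Qed.

Lemma lrel_bound f l (c : R) : lrel f l -> (forall x, D x -> `|f x| <= c) ->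
  forall x, D x -> `|l x| <= c.
Proof.
move=> fl fc x Dx; have c0 : 0 <= c by exact: le_trans (fc x Dx).
have r1 := realop_lrel (realop_cst c0).
have rN := lrel_sub (realop_lrel (realop_cst (lexx 0))) r1.
rewrite ler_norml; apply/andP; split; last first.
  by apply: (lrel_le fl r1) => // y Dy; exact: le_trans (ler_norm _) (fc y Dy).
rewrite -[- c]sub0r; apply: (lrel_le rN fl) => // y Dy; rewrite sub0r.
by have := fc y Dy; rewrite ler_norml => /andP[].
Qed.

Lemma realop_ex f (G : X -> R) l : realop G l -> (forall x, 0 <= f x) -> (forall x, D x -> f x <= G x) ->
  exists2 l', realop f l' & forall x, D x -> 0 <= l' x <= l x.
Proof.
move=> [G0 GE] f0 fG; exists (fun x => fine (T (EFin \o f) x)).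
  split => // x Dx; rewrite fineK// ge0_fin_numE; last by apply: (po_ge0 pT) => y; rewrite lee_fin.
  apply: (@le_lt_trans _ _ (l x)%:E); last exact: ltry.
  by rewrite -GE//; apply: (po_le pT) => // y; rewrite /= ?lee_fin; auto.
move=> x Dx; have h0 : (0 <= T (EFin \o f) x)%E by apply: (po_ge0 pT) => y; rewrite lee_fin.
have h1 : (T (EFin \o f) x <= (l x)%:E)%E.
  by rewrite -GE//; apply: (po_le pT) => // y; rewrite /= ?lee_fin; auto.
by rewrite fine_ge0//= -lee_fin fineK// ge0_fin_numE// (le_lt_trans h1)// ltry.
Qed.

End RealOperator.

Lemma geometric_sum_limit {R : realType} (w : nat -> R) (rho K : R) : 0 <= rho < 1 -> 0 <= K ->
  (forall j, `|w j.+1| <= K * rho ^+ j) ->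
  forall J, `|limn (fun n => \sum_(j < n) w j) - \sum_(j < J.+1) w j| <= K / (1 - rho) * rho ^+ J.
Proof.
move=> /andP[r0 r1] K0 wK; pose s n := \sum_(j < n) w j.
have r1' : 0 < 1 - rho by rewrite subr_gt0.
have H J k : `|s (J.+1 + k)%N - s J.+1| <= K / (1 - rho) * rho ^+ J * (1 - rho ^+ k).
  elim: k => [|k IH]; first by rewrite addn0 subrr normr0 expr0 subrr mulr0.
  rewrite addnS /s big_ord_recr/= -/(s _) addrAC; apply: (le_trans (ler_normD _ _)).
  rewrite -/(s J.+1); apply: (le_trans (lerD IH (wK _))).
  have -> : rho ^+ (J + k) = rho ^+ J * rho ^+ k by rewrite exprD.
  rewrite (_ : K * (rho ^+ J * rho ^+ k) = K / (1 - rho) * rho ^+ J * (rho ^+ k * (1 - rho))).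
    by rewrite -mulrDr exprS le_eqVlt; apply/orP; left; apply/eqP; ring.
  by field; rewrite gt_eqF.
have H' J n : (J.+1 <= n)%N -> `|s n - s J.+1| <= K / (1 - rho) * rho ^+ J.
  move=> Jn; rewrite -(subnKC Jn); apply: (le_trans (H _ _)); rewrite ler_piMr//.
    by rewrite mulr_ge0 ?exprn_ge0// divr_ge0// ltW.
  by rewrite lerBlDr lerDl exprn_ge0.
have cg : (fun n => K / (1 - rho) * rho ^+ n) @ \oo --> (0 : R).
  rewrite -[X in _ --> X](mulr0 (K / (1 - rho))); apply: cvgMr; apply: cvg_expr; by rewrite ger0_norm.
have cs : cvgn s.
  apply/cauchy_cvgP/cauchy_exP => e e0.
  have /cvgrPdist_lt/(_ _ e0)[J _ /(_ J (leqnn J))/=] := cg.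
  rewrite sub0r normrN => hJ; exists (s J.+1); exists J.+1 => // n /= Jn; rewrite /ball/= distrC.
  exact: (le_lt_trans (H' J n Jn) (le_lt_trans (ler_norm _) hJ)).
move=> J; rewrite -/s -/(s J.+1) ler_distl; apply/andP; split.
  by apply: (limr_ge cs); exists J.+1 => // n /= /(H' J); rewrite ler_distl => /andP[].
by apply: (limr_le cs); exists J.+1 => // n /= /(H' J); rewrite ler_distl => /andP[].
Qed.

Lemma geometric_le0 {R : realType} (rho K x : R) : 0 <= rho < 1 -> (forall J, `|x| <= K * rho ^+ J) -> x = 0.
Proof.
move=> /andP[r0 r1] h; apply/eqP; rewrite -normr_le0.
have cg : (fun n => K * rho ^+ n) @ \oo --> (0 : R).
  rewrite -[X in _ --> X](mulr0 K); apply: cvgMr; apply: cvg_expr; by rewrite ger0_norm.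
rewrite -(cvg_lim _ cg)//; apply: limr_ge; first by apply/cvg_ex; exists 0.
exact: nearW.
Qed.

Lemma defect_le {R : realType} (s t u v w b c r : R) : `|u - (t - w + v)| <= b * r -> `|v| <= c * r ->
  `|s - t| <= b * r -> `|u - (s - w)| <= (b + c + b) * r.
Proof.
by rewrite !ler_norml => /andP[? ?] /andP[? ?] /andP[? ?]; apply/andP; split; lra.
Qed.

Section Poisson.
Context {R : realType} {V : pointedType} (E : rel V) (theta : R).
Hypothesis theta01 : 0 < theta < 1.
Hypothesis mixE : top_mixing E.
Variables (g : (nat -> V) -> R) (a : V) (kappa K q M0 : R) (x0 : nat -> V).
Hypothesis kappa0 : 0 <= kappa.
Hypothesis g0 : forall x, 0 < g x.
Hypothesis greg : regw E theta kappa g.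
Hypothesis Ex0 : TMS E x0.
Hypothesis x0a : x0 0%N = a.
Local Notation L := (transfer E g).
Local Notation LL := (loopop a L).
Local Notation A := (taboo a L).
Local Notation B := (entry a L).
Local Notation N := (resolvent A).
Local Notation cc := (cc theta kappa).
Local Notation rho := (rho theta kappa).
Hypothesis L1 : forall x, TMS E x -> L (fun=> 1%E) x = 1%E.
Hypothesis LL1 : forall x, TMS E x -> LL (fun=> 1%E) x = 1%E.
Hypothesis M01 : 1 <= M0.
Hypothesis N1M : forall x, TMS E x -> x 0%N = a -> (N (fun=> 1) x <= M0%:E)%E.
Implicit Types (x y z : nat -> V) (F G : (nat -> V) -> \bar R).
Let g0' x : 0 <= g x. Proof. exact: ltW. Qed.
Let M00 : 0 <= M0. Proof. exact: le_trans ler01 M01. Qed.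
Let pL : posop (TMS E) L. Proof. exact: po_transfer. Qed.
Let pA : posop (TMS E) A. Proof. exact: po_taboo. Qed.
Let pB : posop (TMS E) B. Proof. exact: po_entry. Qed.
Let pN : posop (TMS E) N. Proof. exact: po_resolvent. Qed.
Let pLL : posop (TMS E) LL. Proof. exact: po_loop. Qed.
Let n1 : nneg (fun _ : nat -> V => 1%E : \bar R). Proof. by []. Qed.
Let N0 F : nneg F -> nneg (N F). Proof. exact: (po_ge0 pN). Qed.
Let cc0 : 0 < cc. Proof. exact: cc_gt0. Qed.
Let r01 : 0 <= rho < 1. Proof. exact: rho01. Qed.

Lemma N1_fin x : TMS E x -> (N (fun=> 1) x < +oo)%E.
Proof.
move=> Ex; have sc : strongly_connected E by case: mixE.
have rN := reg_Ncc theta01 a kappa0 g0' greg n1 (reg_one theta01 kappa0).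
suff H : forall b y, TMS E y -> y 0%N = b -> (N (fun=> 1) y < +oo)%E by exact: (H (x 0%N) x).
apply: (strongly_connected_ind (a := a) sc).
  by move=> y Ey ya; apply: le_lt_trans (N1M Ey ya) (ltry _).
move=> b b' Ebb' IH y Ey yb.
have [ba|ba] := eqVneq b a; first by apply: le_lt_trans (N1M Ey _) (ltry _); rewrite yb.
have [y' Ey' y'b] := TMS_ex mixE b'.
have Ebc : TMS E (bcons b y') by apply: TMS_bcons => //; rewrite y'b.
have := IH y' Ey' y'b; rewrite (resolventE pA)// => h.
have h2 : (A (N (fun=> 1)) y' < +oo)%E by apply: le_lt_trans h; rewrite leeDr.
have w0 : nneg (wmul g (wmul (\1_(~` cyl1 a)) (N (fun=> 1%E)))).
  by move=> z; rewrite /wmul !mule_ge0 ?lee_fin//; exact: N0.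
have Ey'b : E b (y' 0%N) by rewrite y'b.
have h3 := @preop_ge1 _ _ E _ y' b w0 Ey'b.
have h4 := le_lt_trans h3 h2.
apply: (reg_ltoo theta01 (N0 n1) (ltW cc0) rN Ebc Ey); first by rewrite yb.
move: h4; rewrite /wmul indicE mem_set ?mul1e; last by move=> /=; apply/eqP.
case: (N _ _) => [r _| |]//; first by rewrite ltry.
by rewrite gt0_muley ?lte_fin.
Qed.

Definition n1r x := fine (N (fun=> 1%E) x).

Lemma n1rE x : TMS E x -> (n1r x)%:E = N (fun=> 1%E) x.
Proof. by move=> Ex; rewrite /n1r fineK// ge0_fin_numE ?N1_fin//; exact: N0. Qed.

Lemma n1r_ge0 x : 0 <= n1r x. Proof. by apply: fine_ge0; exact: N0. Qed.

Lemma n1r_ge1 x : TMS E x -> 1 <= n1r x.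
Proof. by move=> Ex; rewrite -lee_fin n1rE// (resolventE pA)// leeDl//; apply: (po_ge0 pA); exact: N0. Qed.

Lemma entry_bound F (r : R) x : nneg F -> 0 <= r -> (forall y, TMS E y -> y 0%N = a -> (F y <= r%:E)%E) ->
  TMS E x -> (B F x <= r%:E)%E.
Proof.
move=> F0 r0 Fr Ex; apply: (@le_trans _ _ (L (fun=> r%:E) x)).
  apply: (le_trans (entry_le pL F0 _ Fr Ex)) => [y|]; first by rewrite lee_fin.
  by rewrite (taboo_entry a pL) ?leeDr//; apply: (po_ge0 pA) => y; rewrite lee_fin.
by have [_ ->] := realop_cst pL L1 r0.
Qed.

Section Resolvent.
Variables (F : (nat -> V) -> \bar R) (M : R).
Hypothesis F0 : nneg F.
Hypothesis M_0 : 0 <= M.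
Hypothesis FM : forall x, TMS E x -> (F x <= M%:E)%E.
Local Notation BN := (fun G => B (N G)).

Definition loopN j x := fine (iter j LL (N F) x).
Definition entryN j x := fine (iter j BN F x).

Let I0 j : nneg (iter j LL (N F)). Proof. by apply: (po_ge0 (po_iter pLL j)); exact: N0. Qed.
Let J0 j : nneg (iter j BN F).
Proof. by elim: j => [//|j IH]; apply: (po_ge0 pB); exact: N0. Qed.

Lemma loopN_ge0 j x : 0 <= loopN j x. Proof. by apply: fine_ge0; exact: I0. Qed.

Lemma iter_LLN j : iter j LL (N F) = N (iter j BN F).
Proof. by elim: j => [//|j IH]; rewrite iterS IH. Qed.

Lemma e_bound j x : TMS E x -> x 0%N = a -> (iter j LL (N F) x <= (M0 * M)%:E)%E.
Proof.
move=> Ex xa; have NFb y : TMS E y -> y 0%N = a -> (N F y <= (M0 * M)%:E)%E.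
  by move=> *; exact: (N_bound g0' N1M).
have [-> ] := LLi_fin g0' LL1 j (N0 F0) (mulr_ge0 M00 M_0) NFb Ex xa.
by rewrite lee_fin.
Qed.

Lemma loopNE j x : TMS E x -> (loopN j x)%:E = iter j LL (N F) x.
Proof.
move=> Ex; have i0 := I0 j x; rewrite /loopN fineK// ge0_fin_numE//; case: j {i0} => [|j].
  apply: (@le_lt_trans _ _ (M%:E * N (fun=> 1) x)%E); last first.
    by rewrite -n1rE// -EFinM ltry.
  rewrite -(po_scale pN)//; apply: (po_le pN) => //; first by move=> y; rewrite mule1 lee_fin.
  by move=> y Ey; rewrite mule1; apply: FM.
apply: (@le_lt_trans _ _ (M0 * M)%:E); last exact: ltry.
exact: (LL_bound g0' LL1 (I0 j) (mulr_ge0 M00 M_0) (@e_bound j) Ex).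
Qed.

Lemma entryNE j x : TMS E x -> (entryN j x)%:E = iter j BN F x.
Proof.
move=> Ex; have i0 := J0 j x; rewrite /entryN fineK// ge0_fin_numE//; case: j {i0} => [|j].
  by apply: le_lt_trans (FM Ex) (ltry _).
apply: (@le_lt_trans _ _ (M0 * M)%:E); last exact: ltry.
by rewrite iterS -iter_LLN; apply: entry_bound => //; [exact: mulr_ge0|exact: e_bound].
Qed.

Lemma realop_loopN j : realop (TMS E) L (loopN j) (fun x => loopN j x - entryN j x + entryN j.+1 x).
Proof.
split=> [x|x Ex]; first exact: loopN_ge0.
have e1 : L (EFin \o loopN j) x = L (N (iter j BN F)) x.
  apply: (po_eq pL) => //.
  - by move=> y; rewrite /= lee_fin loopN_ge0.
  - by rewrite -iter_LLN.
  - by move=> y Ey /=; rewrite loopNE// iter_LLN.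
have e2 := taboo_entry a pL x (N0 (J0 j)).
have e3 := resolventE pA x (J0 j).
have e4 := loopNE j Ex; have e5 := entryNE j Ex; have e6 := entryNE j.+1 Ex.
rewrite e1 e2; rewrite iter_LLN in e4; rewrite iterS in e6.
rewrite -e4 -e5 in e3; rewrite -e6.
move: e3; case: (A _ _) => [t| |]// [->].
by rewrite -EFinD; congr EFin; ring.
Qed.

End Resolvent.

Lemma lee_distl_add (T : ((nat -> V) -> \bar R) -> (nat -> V) -> \bar R) F G (u v r : R) x : posop (TMS E) T ->
  (forall F G x, nneg F -> nneg G -> (forall y, TMS E y -> y 0%N = a -> (F y <= G y)%E) ->
     TMS E x -> (T F x <= T G x)%E) ->
  (forall r x, 0 <= r -> TMS E x -> (T (fun=> r%:E) x <= r%:E)%E) ->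
  nneg F -> nneg G -> 0 <= r -> TMS E x ->
  (forall y, TMS E y -> y 0%N = a -> (F y <= G y + r%:E)%E /\ (G y <= F y + r%:E)%E) ->
  T F x = u%:E -> T G x = v%:E -> `|u - v| <= r.
Proof.
move=> pT Tle Tc F0 G0 r0 Ex FG Fu Gv.
have H F' G' u' v' : nneg F' -> nneg G' -> (forall y, TMS E y -> y 0%N = a -> (F' y <= G' y + r%:E)%E) ->
    T F' x = u'%:E -> T G' x = v'%:E -> u' <= v' + r.
  move=> F0' G0' h e1 e2; rewrite -lee_fin EFinD -e1 -e2.
  apply: (@le_trans _ _ (T (fun y => G' y + r%:E)%E x)).
    by apply: Tle => // y; rewrite adde_ge0.
  by rewrite (po_add pT)//; apply: leeD2l; exact: Tc.
have h1 := H _ _ _ _ F0 G0 (fun y Ey ya => (FG y Ey ya).1) Fu Gv.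
have h2 := H _ _ _ _ G0 F0 (fun y Ey ya => (FG y Ey ya).2) Gv Fu.
by rewrite ler_distl; apply/andP; split; lra.
Qed.

Lemma reg_cont F : nneg F -> reg E theta cc F -> (forall x, TMS E x -> (F x < +oo)%E) ->
  cont_on_TMS E (fun x => fine (F x)).
Proof.
move=> F0 rF Ffin x Ex e e0.
have FE y : TMS E y -> F y = (fine (F y))%:E by move=> Ey; rewrite fineK// ge0_fin_numE// Ffin.
have c1 : (fun n : nat => (expR (cc * theta ^+ n) - 1) * (fine (F x) * expR (cc * theta ^+ n))) @ \oo --> (1 - 1) * (fine (F x) * 1).
  apply: cvgM; first by apply: cvgB; [exact: expR_geom_cvg|exact: cvg_cst].
  by apply: cvgMr; exact: expR_geom_cvg.
rewrite subrr mul0r in c1.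
have /cvgrPdist_lt/(_ _ e0)[n _ hn] := c1.
exists n.+1 => y Ey xy; have {hn} := hn n.+1 (leqnSn n) => /=; rewrite sub0r normrN => h.
apply: le_lt_trans (le_lt_trans (ler_norm _) h).
set s := expR _; have t0 : 0 <= theta ^+ n.+1 by rewrite exprn_ge0//; case/andP: theta01 => /ltW.
have s1 : 1 <= s by rewrite -expR0 ler_expR mulr_ge0// ltW.
have := rF n.+1 x y (ltn0Sn n) Ex Ey xy; have := rF n.+1 y x (ltn0Sn n) Ey Ex (agree_sym xy).
rewrite (FE x Ex) (FE y Ey) -!EFinM !lee_fin /= -/s => h1 h2.
have fx : 0 <= fine (F x) by exact: fine_ge0.
have fy : 0 <= fine (F y) by exact: fine_ge0.
rewrite ler_distl; move: h1 h2 fx fy s1; move: s (fine (F x)) (fine (F y)) => s u v h1 h2 u0 v0 s1.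
apply/andP; split; nra.
Qed.

Lemma loopN_cont F M j : nneg F -> 0 <= M -> (forall x, TMS E x -> (F x <= M%:E)%E) -> reg E theta cc F ->
  cont_on_TMS E (loopN F j).
Proof.
move=> F0 M_0 FM rF; apply: reg_cont.
- by apply: (po_ge0 (po_iter pLL j)); exact: N0.
- elim: j => [|j IH]; first exact: (reg_Ncc theta01 a kappa0 g0' greg F0 rF).
  have I0 : nneg (iter j LL (N F)) by apply: (po_ge0 (po_iter pLL j)); exact: N0.
  apply: (reg_ccW theta01 kappa0); first exact: (po_ge0 pLL).
  have h := reg_LLcc theta01 a kappa0 g0' greg I0 IH; by rewrite iterS.
by move=> x Ex; rewrite -(loopNE F0 M_0 FM)// ltry.
Qed.

Definition wfun F c j x := loopN F j x - c * loopN (fun=> 1%E) j x.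

Section Source.
Variables (psi : (nat -> V) -> R) (S : R).
Hypothesis S0 : 0 <= S.
Hypothesis psiS : forall x, TMS E x -> `|psi x| <= S.
Hypothesis psiH : forall n x y, TMS E x -> TMS E y -> agree n x y -> `|psi x - psi y| <= S * theta ^+ n.
(* The shift by [lam * S] makes [psi + lam * S] log-regular with constant [cc]. *)
Let lam := 1 + cc^-1.
Let F x : \bar R := (Num.max 0 (psi x + lam * S))%:E.
Let M := (lam + 1) * S.
Let cp := ell0 E g a x0 F / ell0 E g a x0 (fun=> 1%E).
Let lam1 : 1 <= lam. Proof. by rewrite /lam lerDl invr_ge0 ltW. Qed.
Let M_0 : 0 <= M. Proof. by rewrite /M mulr_ge0// addr_ge0// (le_trans ler01). Qed.
Let F0 : nneg F. Proof. by move=> x; rewrite lee_fin le_max lexx. Qed.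

Lemma sourceE x : TMS E x -> F x = (psi x + lam * S)%:E.
Proof.
move=> Ex; rewrite /F; congr EFin; apply/max_idPr; have := psiS Ex; rewrite ler_norml => /andP[h _].
by have := ler_wpM2r S0 lam1; rewrite mul1r; lra.
Qed.

Lemma source_le x : TMS E x -> (F x <= M%:E)%E.
Proof.
move=> Ex; rewrite sourceE// lee_fin (_ : M = S + lam * S) ?lerD2r; last by rewrite /M; ring.
exact: le_trans (ler_norm _) (psiS Ex).
Qed.

Lemma source_reg : reg E theta cc F.
Proof.
move=> n x y n1' Ex Ey xy; rewrite !sourceE// -EFinM lee_fin.
have t0 : 0 <= theta ^+ n by rewrite exprn_ge0//; case/andP: theta01 => /ltW.
have h1 := psiH Ex Ey xy; have := psiS Ey; rewrite ler_norml => /andP[h2 _].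
have h3 : S <= cc * (psi y + lam * S).
  have -> : cc * (psi y + lam * S) = cc * (psi y + S) + S by rewrite /lam; field; exact: lt0r_neq0.
  by rewrite lerDr mulr_ge0 ?(ltW cc0)//; lra.
have h4 : 1 + cc * theta ^+ n <= expR (cc * theta ^+ n) by exact: expR_ge1Dx.
have h5 : 0 <= psi y + lam * S by have := ler_wpM2r S0 lam1; rewrite mul1r; lra.
apply: (le_trans _ (ler_wpM2r h5 h4)).
have h6 := ler_wpM2r t0 h3; move: h1; rewrite ler_distl => /andP[_ h1].
have -> : (1 + cc * theta ^+ n) * (psi y + lam * S) = psi y + lam * S + cc * (psi y + lam * S) * theta ^+ n by ring.
by rewrite addrAC lerD2r; apply: (le_trans h1); rewrite lerD2l.
Qed.

Lemma source_sreg : sreg E theta kappa 0 M F.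
Proof.
split => //; first exact: source_le.
by move=> n x y n1' Ex Ey xy; rewrite !adde0; exact: source_reg.
Qed.

Lemma one_sreg : sreg E theta kappa 0 1 (fun=> 1%E : \bar R).
Proof. by split => // n x y n1' Ex Ey xy; rewrite !adde0; exact: (reg_one theta01 kappa0). Qed.

Let l1 : 1 <= ell0 E g a x0 (fun=> 1%E). Proof. exact: (ell0_one theta01 kappa0 g0' greg Ex0 x0a LL1 M01 N1M). Qed.

Lemma cp_bounds : 0 <= cp <= M0 * M.
Proof.
have e0 := ell0_ge0 theta01 kappa0 g0' greg Ex0 x0a LL1 M01 N1M source_sreg.
have e1 : ell0 E g a x0 F <= M0 * M.
  have cF := ell0_cvg theta01 kappa0 g0' greg Ex0 x0a LL1 M01 N1M source_sreg.
  rewrite -(cvg_lim _ cF)//; apply: limr_le; first by apply/cvg_ex; exists (ell0 E g a x0 F).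
  by apply: nearW => k; have [_ ] := sreg_fin g0' LL1 M01 N1M k source_sreg Ex0 x0a.
have l0 : 0 < ell0 E g a x0 (fun=> 1%E) by exact: lt_le_trans ltr01 l1.
rewrite /cp divr_ge0 ?(ltW l0)//= ler_pdivrMr//; apply: (le_trans e1).
by rewrite ler_peMr// mulr_ge0.
Qed.

Let K1 := M0 * M + M0 * M * M0.
Let K1_0 : 0 <= K1. Proof. exact: addr_ge0 (mulr_ge0 M00 M_0) (mulr_ge0 (mulr_ge0 M00 M_0) M00). Qed.

Lemma wfun_base j x : TMS E x -> x 0%N = a -> `|wfun F cp j x| <= K1 * rho ^+ j.
Proof.
move=> Ex xa; have /andP[c0 c1] := cp_bounds.
have h1 := ell0_dist theta01 kappa0 g0' greg Ex0 x0a LL1 M01 N1M source_sreg j Ex xa.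
have h2 := ell0_dist theta01 kappa0 g0' greg Ex0 x0a LL1 M01 N1M one_sreg j Ex xa.
have l0 : 0 < ell0 E g a x0 (fun=> 1%E) by exact: lt_le_trans ltr01 l1.
have -> : wfun F cp j x = (loopN F j x - ell0 E g a x0 F) - cp * (loopN (fun=> 1%E) j x - ell0 E g a x0 (fun=> 1%E)).
  by rewrite /wfun /cp; field; exact: lt0r_neq0.
have r0 : 0 <= rho ^+ j by rewrite exprn_ge0//; case/andP: r01.
apply: (le_trans (ler_normB _ _)); rewrite normrM (ger0_norm c0).
have h3 := ler_pM c0 (normr_ge0 _) c1 h2.
apply: (le_trans (lerD h1 h3)); rewrite /K1 le_eqVlt; apply/orP; left; apply/eqP; ring.
Qed.

Let cmp j y : TMS E y -> y 0%N = a -> let r := K1 * rho ^+ j in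
  (iter j LL (N F) y <= cp%:E * iter j LL (N (fun=> 1)) y + r%:E)%E /\
  (cp%:E * iter j LL (N (fun=> 1)) y <= iter j LL (N F) y + r%:E)%E.
Proof.
move=> Ey ya r; have := wfun_base j Ey ya; rewrite -(loopNE F0 M_0 source_le)//.
rewrite -(loopNE n1 ler01 (fun _ _ => lexx _))// -EFinM -!EFinD !lee_fin -/r /wfun ler_distl => /andP[].
by split; lra.
Qed.

Lemma wfun_step j x : TMS E x -> `|wfun F cp j.+1 x| <= K1 * rho ^+ j.
Proof.
move=> Ex; have /andP[c0 c1] := cp_bounds.
have I0 G : nneg G -> nneg (iter j LL (N G)) by move=> G0; apply: (po_ge0 (po_iter pLL j)); exact: N0.
have rj : 0 <= K1 * rho ^+ j by apply: mulr_ge0 => //; rewrite exprn_ge0//; case/andP: r01.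
have G0 : nneg (fun y => (cp%:E * iter j LL (N (fun=> 1)) y)%E) by move=> y; rewrite mule_ge0// I0.
apply: (lee_distl_add pLL _ _ (I0 _ F0) G0 rj Ex (@cmp j)).
- by move=> F' G' z F0' G0'; exact: (loop_le pL).
- by move=> r z r0 Ez; rewrite (LL_cst g0' LL1).
- by rewrite (loopNE F0 M_0 source_le j.+1).
by rewrite (po_scale pLL)//; [rewrite [RHS]EFinM (loopNE n1 ler01 (fun _ _ => lexx _) j.+1)|exact: I0].
Qed.

Lemma entryN_step j x : TMS E x -> `|entryN F j.+1 x - cp * entryN (fun=> 1%E) j.+1 x| <= K1 * rho ^+ j.
Proof.
move=> Ex; have /andP[c0 c1] := cp_bounds.
have I0 G : nneg G -> nneg (iter j LL (N G)) by move=> G0; apply: (po_ge0 (po_iter pLL j)); exact: N0.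
have rj : 0 <= K1 * rho ^+ j by apply: mulr_ge0 => //; rewrite exprn_ge0//; case/andP: r01.
have G0 : nneg (fun y => (cp%:E * iter j LL (N (fun=> 1)) y)%E) by move=> y; rewrite mule_ge0// I0.
apply: (lee_distl_add pB _ _ (I0 _ F0) G0 rj Ex (@cmp j)).
- by move=> F' G' z F0' G0'; exact: (entry_le pL).
- by move=> r z r0 Ez; apply: entry_bound => // y; rewrite lee_fin.
- by rewrite (entryNE F0 M_0 source_le j.+1)// iterS iter_LLN.
rewrite (po_scale pB)//; last exact: I0.
by rewrite [RHS]EFinM (entryNE n1 ler01 (fun _ _ => lexx _) j.+1)// iterS iter_LLN.
Qed.

Lemma realop_wfun j : lrel (TMS E) L (wfun F cp j)
  (fun x => wfun F cp j x - (entryN F j x - cp * entryN (fun=> 1%E) j x) + (entryN F j.+1 x - cp * entryN (fun=> 1%E) j.+1 x)).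
Proof.
have /andP[c0 c1] := cp_bounds.
have r1 := realop_loopN F0 M_0 source_le j.
have r2 := realop_scale pL c0 (realop_loopN n1 ler01 (fun _ _ => lexx _) j).
apply: (lrel_eq (lrel_sub pL (realop_lrel pL r1) (realop_lrel pL r2))) => [//|x Ex].
by rewrite /wfun; ring.
Qed.

Definition usum J x := \sum_(j < J) wfun F cp j x.

Lemma lrel_usum J : lrel (TMS E) L (usum J)
  (fun x => usum J x - (entryN F 0 x - cp * entryN (fun=> 1%E) 0 x) + (entryN F J x - cp * entryN (fun=> 1%E) J x)).
Proof.
elim: J => [|J IH].
  apply: (lrel_eq (realop_lrel pL (realop_cst pL L1 (lexx 0)))) => x Ex; rewrite /usum big_ord0//; ring.
apply: (lrel_eq (lrel_add pL IH (realop_wfun J))) => x Ex; rewrite /usum big_ord_recr//=; ring.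
Qed.

Definition usol x := limn (fun n => usum n x).

Let K3 := K1 / (1 - rho).
Let rho0 : 0 <= rho. Proof. by case/andP: r01. Qed.
Let K3_0 : 0 <= K3. Proof. by apply: divr_ge0 => //; rewrite subr_ge0 ltW//; case/andP: r01. Qed.

Lemma usol_dist J x : TMS E x -> `|usol x - usum J.+1 x| <= K3 * rho ^+ J.
Proof.
move=> Ex; apply: (geometric_sum_limit r01 K1_0 (w := fun j => wfun F cp j x)) => j; exact: wfun_step.
Qed.

Lemma usol_bound x : TMS E x -> `|usol x| <= (M + M0 * M + K3) * n1r x.
Proof.
move=> Ex; have /andP[c0 c1] := cp_bounds; have h := usol_dist 0 Ex; rewrite expr0 mulr1 in h.
have n1x := n1r_ge1 Ex.
have e0 : loopN F 0 x <= M * n1r x.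
  rewrite -lee_fin (loopNE F0 M_0 source_le)// EFinM n1rE// -(po_scale pN)//.
  apply: (po_le pN) => //; first by move=> y; rewrite mule1 lee_fin.
  by move=> y Ey; rewrite mule1; exact: source_le.
have e00 : 0 <= loopN F 0 x by exact: loopN_ge0.
have s1 : usum 1 x = loopN F 0 x - cp * n1r x by rewrite /usum big_ord1.
have d1 : cp * n1r x <= M0 * M * n1r x by apply: ler_wpM2r => //; exact: n1r_ge0.
have d0 : 0 <= cp * n1r x by rewrite mulr_ge0// n1r_ge0.
have K3n : K3 <= K3 * n1r x by rewrite ler_peMr.
rewrite s1 ler_distl in h; case/andP: h => h1 h2.
have gen (u e c k b m mm : R) : e - c - b <= u -> u <= e - c + b -> e <= m -> 0 <= e -> c <= mm ->
    0 <= c -> b <= k -> - (m + mm + k) <= u <= m + mm + k.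
  by move=> *; apply/andP; split; lra.
by rewrite !mulrDl ler_norml; exact: gen h1 h2 e0 e00 d1 d0 K3n.
Qed.

Lemma cont_add (f h : (nat -> V) -> R) : cont_on_TMS E f -> cont_on_TMS E h -> cont_on_TMS E (fun x => f x + h x).
Proof.
move=> cf ch x Ex e e0; have e2 : 0 < e / 2 by rewrite divr_gt0.
have [n hn] := cf x Ex _ e2; have [m hm] := ch x Ex _ e2; exists (maxn n m) => y Ey xy.
have h1 := hn y Ey (agreeW (leq_maxl n m) xy); have h2 := hm y Ey (agreeW (leq_maxr n m) xy).
rewrite opprD addrACA; apply: (le_lt_trans (ler_normD _ _)).
by rewrite [ltRHS]splitr; exact: ltrD.
Qed.

Lemma cont_scale (c : R) (f : (nat -> V) -> R) : cont_on_TMS E f -> cont_on_TMS E (fun x => c * f x).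
Proof.
move=> cf x Ex e e0; have e2 : 0 < e / (`|c| + 1) by rewrite divr_gt0// ltr_wpDl.
have [n hn] := cf x Ex _ e2; exists n => y Ey xy.
rewrite -mulrBr normrM; have := hn y Ey xy; rewrite ltr_pdivlMr ?ltr_wpDl// mulrDr mulr1 mulrC.
by apply: le_lt_trans; rewrite lerDl.
Qed.

Lemma usum_cont J : cont_on_TMS E (usum J).
Proof.
have cw j : cont_on_TMS E (wfun F cp j).
  have c1 := loopN_cont j F0 M_0 source_le source_reg.
  have c2 := loopN_cont j n1 ler01 (fun _ _ => lexx _) (reg_one theta01 kappa0).
  rewrite (_ : wfun F cp j = fun x => loopN F j x + (- cp) * loopN (fun=> 1%E) j x); first exact: cont_add (cont_scale _ c2).
  by apply/funext => x; rewrite mulNr.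
elim: J => [|J IH].
  by move=> x Ex e e0; exists 0%N => y Ey _; rewrite /usum !big_ord0 subrr normr0.
rewrite (_ : usum J.+1 = fun x => usum J x + wfun F cp J x); first exact: cont_add.
by apply/funext => x; rewrite /usum big_ord_recr.
Qed.

Lemma usol_cont : cont_on_TMS E usol.
Proof.
move=> x Ex e e0; have e3 : 0 < e / 3 by rewrite divr_gt0.
have cg : (fun n => K3 * rho ^+ n) @ \oo --> (0 : R).
  rewrite -[X in _ --> X](mulr0 K3); apply: cvgMr; apply: cvg_expr; by rewrite ger0_norm//; case/andP: r01.
have /cvgrPdist_lt/(_ _ e3)[J _ /(_ J (leqnn J))/=] := cg.
rewrite sub0r normrN => /(le_lt_trans (ler_norm _)) hJ.
have [n hn] := usum_cont J.+1 Ex e3; exists n => y Ey xy.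
have h1 := le_lt_trans (usol_dist J Ex) hJ; have h2 := le_lt_trans (usol_dist J Ey) hJ; have h3 := hn y Ey xy.
move: h1 h2 h3; rewrite !ltr_distl; move: (usol x) (usol y) (usum J.+1 x) (usum J.+1 y) => s t u v.
move=> /andP[? ?] /andP[? ?] /andP[? ?]; apply/andP; split; lra.
Qed.

Lemma realop_n1r : realop (TMS E) L n1r (fun x => n1r x - 1 + entryN (fun=> 1%E) 1 x).
Proof.
have := realop_loopN n1 ler01 (fun _ _ => lexx _) 0; rewrite (_ : loopN (fun=> 1%E) 0 = n1r)//.
Qed.

Lemma lrel_usol : lrel (TMS E) L usol (fun x => usol x - (entryN F 0 x - cp * entryN (fun=> 1%E) 0 x)).
Proof.
have Kn0 x : 0 <= (M + M0 * M + K3) by rewrite !addr_ge0// mulr_ge0.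
have rn := realop_scale pL (Kn0 x0) realop_n1r.
have [t1 r1] : exists l', realop (TMS E) L (fun x => Num.max 0 (usol x)) l'.
  suff [l' ? _] : exists2 l', realop (TMS E) L (fun x => Num.max 0 (usol x)) l' & forall x, TMS E x -> 0 <= l' x <= (M + M0 * M + K3) * (n1r x - 1 + entryN (fun=> 1%E) 1 x) by exists l'.
  apply: (realop_ex pL rn) => [x|x Ex]; first by rewrite le_max lexx.
  by rewrite ge_max (le_trans (normr_ge0 _) (usol_bound Ex))/= (le_trans (ler_norm _) (usol_bound Ex)).
have [t2 r2] : exists l', realop (TMS E) L (fun x => Num.max 0 (- usol x)) l'.
  suff [l' ? _] : exists2 l', realop (TMS E) L (fun x => Num.max 0 (- usol x)) l' & forall x, TMS E x -> 0 <= l' x <= (M + M0 * M + K3) * (n1r x - 1 + entryN (fun=> 1%E) 1 x) by exists l'.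
  apply: (realop_ex pL rn) => [x|x Ex]; first by rewrite le_max lexx.
  rewrite ge_max (le_trans (normr_ge0 _) (usol_bound Ex))/=.
  by apply: (le_trans _ (usol_bound Ex)); rewrite -normrN ler_norm.
have ru : lrel (TMS E) L usol (fun x => t1 x - t2 x).
  apply: (lrel_eq (lrel_sub pL (realop_lrel pL r1) (realop_lrel pL r2))) => // x Ex.
  exact: posneg.
apply: (lrel_eq ru) => // x Ex; apply/eqP; rewrite -subr_eq0; apply/eqP.
apply: (geometric_le0 r01 (K := K3 + K1 + K3)) => J.
have h1 := lrel_bound pL L1 (lrel_sub pL ru (lrel_usum J.+1)) (fun x Ex => usol_dist J Ex) Ex.
have h2 := entryN_step J Ex; have h3 := usol_dist J Ex.
rewrite distrC; exact: (defect_le h1 h2 h3).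
Qed.

Lemma entryN0_source x : TMS E x -> entryN F 0 x - cp * entryN (fun=> 1%E) 0 x = psi x + lam * S - cp.
Proof. by move=> Ex; rewrite /entryN [iter 0 _ F]/= sourceE//= mulr1. Qed.

End Source.

Lemma poisson : exists2 K2, 0 <= K2 & forall psi S, 0 <= S ->
  (forall x, TMS E x -> `|psi x| <= S) ->
  (forall n x y, TMS E x -> TMS E y -> agree n x y -> `|psi x - psi y| <= S * theta ^+ n) ->
  exists u c, [/\ cont_on_TMS E u, forall x, TMS E x -> `|u x| <= K2 * S * n1r x &
    lrel (TMS E) L u (fun x => u x - psi x + c)].
Proof.
pose lam1 := 1 + cc^-1 + 1.
have lam0 : 0 <= lam1 by rewrite /lam1 !addr_ge0// invr_ge0 ltW.
have r1 : 0 <= 1 - rho by rewrite subr_ge0 ltW//; case/andP: r01.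
exists (lam1 + M0 * lam1 + (M0 * lam1 + M0 * lam1 * M0) / (1 - rho)).
  have m1 : 0 <= M0 * lam1 by exact: mulr_ge0.
  by rewrite addr_ge0//; [exact: addr_ge0|rewrite divr_ge0// addr_ge0// mulr_ge0].
move=> psi S S0 psiS psiH; set F := fun x => (Num.max 0 (psi x + (1 + cc^-1) * S))%:E.
set cp := ell0 E g a x0 F / ell0 E g a x0 (fun=> 1%E).
exists (usol psi S), (cp - (1 + cc^-1) * S); split.
- exact: usol_cont.
- move=> x Ex; apply: (le_trans (usol_bound S0 psiS psiH Ex)).
  by rewrite le_eqVlt; apply/orP; left; apply/eqP; rewrite /lam1; ring.
apply: (lrel_eq (lrel_usol S0 psiS psiH)) => // x Ex.
by rewrite entryN0_source// -/cp; ring.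
Qed.

End Poisson.

(** * Asymptotic variance *)

Lemma sqr_addl_le {R : realFieldType} (e x y : R) : 0 < e ->
  (x + y) ^+ 2 <= (1 + e) * x ^+ 2 + (1 + e^-1) * y ^+ 2.
Proof.
move=> e0; rewrite -subr_ge0 (_ : _ - _ = e * (x - e^-1 * y) ^+ 2); last by field; rewrite gt_eqF.
by rewrite mulr_ge0 ?sqr_ge0// ltW.
Qed.

Lemma le_of_perturbation {R : realFieldType} (x y : R) : (forall e, 0 < e -> x <= (1 + e) * y) -> x <= y.
Proof.
move=> h; have [y0|y0] := leP y 0.
  by have := h 1 ltr01; lra.
apply/ler_addgt0Pr => e e0; have := h (e / y) (divr_gt0 e0 y0).
by rewrite mulrDl mul1r divfK ?gt_eqF.
Qed.

Lemma cvg_perturbation {R : realType} (s t : nat -> R) (Q C : R) : 0 <= C -> 0 <= Q ->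
  t @ \oo --> Q ->
  (forall n e, 0 < e -> s n.+1 <= (1 + e) * t n.+1 + (1 + e^-1) * C / n.+1%:R) ->
  (forall n e, 0 < e -> t n.+1 <= (1 + e) * s n.+1 + (1 + e^-1) * C / n.+1%:R) ->
  s @ \oo --> Q.
Proof.
move=> C0 Q0 tQ st ts; apply/cvgrPdist_le => d d0.
pose D := 2 * (Q + 1) + 2 * C.
have D0 : 0 < D by rewrite /D; move: Q0 C0; lra.
pose e := Num.min 1 (d / 4 / D).
have e0 : 0 < e by rewrite lt_min ltr01 !divr_gt0.
have e1 : e <= 1 by rewrite ge_min lexx.
have eD : e * D <= d / 4 by rewrite -ler_pdivlMr// ge_min lexx orbT.
have ei : 0 < e^-1 by rewrite invr_gt0.
have t1 : \forall n \near \oo, `|Q - t n| <= Num.min 1 (d / 4).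
  by move/cvgrPdist_le : tQ; apply; rewrite lt_min ltr01 divr_gt0.
have t2 : \forall n \near \oo, (1 + e^-1) * C / n%:R <= d / 4.
  have K0 : 0 <= (1 + e^-1) * C by rewrite mulr_ge0// addr_ge0// ltW.
  near=> n; have n0 : (0 : R) < n%:R by rewrite ltr0n; near: n; exists 1%N.
  rewrite ler_pdivrMr//; have d4 : 0 < d / 4 by rewrite divr_gt0.
  rewrite [leRHS]mulrC -ler_pdivrMr//; near: n.
  exists (Num.truncn ((1 + e^-1) * C / (d / 4))).+1 => // m /= hm.
  by apply: ltW; apply: lt_le_trans (truncnS_gt _) _; rewrite ler_nat.
near=> n; have n0 : (0 < n)%N by near: n; exists 1%N.
have h1 : `|Q - t n| <= Num.min 1 (d / 4) by near: n.
have h2 : (1 + e^-1) * C / n%:R <= d / 4 by near: n.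
rewrite le_min in h1; case/andP: h1 => h1 h1'.
have := st n.-1 e e0; have := ts n.-1 e e0; have := st n.-1 1 ltr01; rewrite prednK// => s1 s2 s3.
have n1 : (1 : R) <= n%:R by rewrite ler1n.
have h3 : (1 + 1^-1) * C / n%:R <= 2 * C.
  by rewrite invr1 ler_pdivrMr ?ltr0n// ler_peMr// mulr_ge0.
move: h1 h1' h2 s1 s2 s3 h3 eD; rewrite /D !ler_distl.
move: (t n) (s n) (_ / n%:R) (_ / n%:R) => T S a b /andP[h1 h1'] /andP[h2 h2'] h3 s1 s2 s3 h4 eD.
have eT : e * T <= e * (2 * (Q + 1) + 2 * C) by rewrite ler_pM2l//; lra.
have eS : e * S <= e * (2 * (Q + 1) + 2 * C) by rewrite ler_pM2l//; lra.
apply/andP; split; lra.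
Unshelve. all: by end_near.
Qed.

Lemma perturb_div {R : realFieldType} (n : nat) (e z q y W : R) : 0 <= e -> z <= (1 + e) * q + (1 + e^-1) * y ->
  y <= W -> n.+1%:R^-1 * z <= (1 + e) * (n.+1%:R^-1 * q) + (1 + e^-1) * W / n.+1%:R.
Proof.
move=> e0 h yW; have n0 : (0 : R) < n.+1%:R^-1 by rewrite invr_gt0.
have h2 : z <= (1 + e) * q + (1 + e^-1) * W.
  by apply: (le_trans h); rewrite lerD2l ler_wpM2l// addr_ge0// invr_ge0.
have := ler_wpM2l (ltW n0) h2; move: (n.+1%:R^-1) => t; lra.
Qed.

Section PseudoHuber.
Context {R : realType}.
Implicit Types s t : R.

Definition phuber t := Num.sqrt (1 + t ^+ 2).
Definition dphuber t := t / phuber t.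

Lemma phuber_sqr t : phuber t ^+ 2 = 1 + t ^+ 2.
Proof. by rewrite sqr_sqrtr// addr_ge0// sqr_ge0. Qed.

Lemma phuber_gt0 t : 0 < phuber t.
Proof. by rewrite sqrtr_gt0 ltr_wpDr// sqr_ge0. Qed.

Lemma phuberM_ge s t : 1 + s * t <= phuber s * phuber t.
Proof.
rewrite /phuber -sqrtrM; last by rewrite addr_ge0// sqr_ge0.
apply: (le_trans (ler_norm _)); rewrite -sqrtr_sqr ler_wsqrtr//.
by rewrite -subr_ge0 (_ : _ - _ = (s - t) ^+ 2) ?sqr_ge0//; ring.
Qed.

Lemma phuber_gapE s t : phuber s - phuber t - dphuber t * (s - t) = (phuber s * phuber t - (1 + s * t)) / phuber t.
Proof.
have t0 : phuber t != 0 by rewrite gt_eqF ?phuber_gt0.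
apply: (mulIf t0); rewrite divfK// mulrBl mulrBl -expr2 phuber_sqr /dphuber.
by field.
Qed.

Lemma phuber_gap_ge0 s t : 0 <= phuber s - phuber t - dphuber t * (s - t).
Proof. by rewrite phuber_gapE divr_ge0 ?subr_ge0 ?phuberM_ge// ltW// phuber_gt0. Qed.

Lemma phuber_gap_eq0 s t : phuber s - phuber t - dphuber t * (s - t) = 0 -> s = t.
Proof.
have t0 : phuber t != 0 by rewrite gt_eqF ?phuber_gt0.
rewrite phuber_gapE => /eqP; rewrite mulf_eq0 invr_eq0 (negPf t0) orbF subr_eq0 => /eqP h.
have : (phuber s * phuber t) ^+ 2 = (1 + s * t) ^+ 2 by rewrite h.
rewrite exprMn !phuber_sqr => h2; apply/eqP; rewrite -subr_eq0 -sqrf_eq0; apply/eqP; move: h2; nra.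
Qed.

Lemma dphuber_le1 t : `|dphuber t| <= 1.
Proof.
rewrite normrM normfV (gtr0_norm (phuber_gt0 t)) ler_pdivrMr ?phuber_gt0// mul1r.
by rewrite -sqrtr_sqr ler_wsqrtr// lerDr.
Qed.

Lemma phuber_lip s t : `|phuber s - phuber t| <= `|s - t|.
Proof.
have H u v : phuber v - phuber u <= `|u - v|.
  have h1 := phuber_gap_ge0 u v; have : - `|dphuber v * (u - v)| <= dphuber v * (u - v).
    by rewrite lerNl -normrN ler_norm.
  have : `|dphuber v * (u - v)| <= `|u - v| by rewrite normrM ler_piMl// dphuber_le1.
  by move: h1; lra.
by rewrite ler_norml lerNl opprB H/= distrC H.
Qed.

Lemma continuous_phuber : continuous phuber.
Proof.
move=> t; apply: (@continuous_comp _ _ _ (fun u : R => 1 + u ^+ 2) Num.sqrt); last exact: sqrt_continuous.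
by apply: cvgD; [exact: cvg_cst|exact: exprn_continuous].
Qed.

Lemma continuous_dphuber : continuous dphuber.
Proof.
move=> t; apply: cvgM; first exact: cvg_id.
by apply: cvgV; [rewrite gt_eqF ?phuber_gt0|exact: continuous_phuber].
Qed.

End PseudoHuber.

Section SquareIntegrable.
Context {R : realType} {V : pointedType} (E : rel V).
Variable code : V -> nat.
Hypothesis code_inj : injective code.
Variable mu : probability (seqM V) R.
Hypothesis muT : mu (TMS E : set (seqM V)) = 1%E.
Local Notation mf := (mf E).
Local Notation I f := (Rintegral mu (TMS E : set (seqM V)) f).
Local Notation itg f := (mu.-integrable (TMS E : set (seqM V)) (EFin \o (f : seqM V -> R))).
Implicit Types (f h k : (nat -> V) -> R).

Let mTMS := measurable_TMS E code_inj.

Lemma mf_eq f h : mf (EFin \o f) -> (forall x, TMS E x -> f x = h x) -> mf (EFin \o h).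
Proof.
move=> mk kl; apply: (@eq_measurable_fun _ _ (seqM V) (\bar R) (TMS E) (EFin \o f)) => // x /set_mem Ex /=.
by rewrite kl.
Qed.

Lemma mf_sqr f : mf (EFin \o f) -> mf (EFin \o (fun x => f x ^+ 2)).
Proof. by move=> m1; apply: (mf_eq (mf_mul m1 m1)) => x _; rewrite expr2. Qed.

Lemma mf_scale (c : R) f : mf (EFin \o f) -> mf (EFin \o (fun x => c * f x)).
Proof. by move=> m1; apply: mf_mul => //; exact: mf_cst. Qed.

Lemma mf_sub f h : mf (EFin \o f) -> mf (EFin \o h) -> mf (EFin \o (fun x => f x - h x)).
Proof. by move=> m1 m2; apply: mf_add => //; exact: mf_opp. Qed.

Definition L2 f := mf (EFin \o f) /\ (tint E mu (EFin \o (fun x => (f x ^+ 2)%R)) < +oo)%E.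

Lemma itg_le f h : mf (EFin \o f) -> itg h -> (forall x, TMS E x -> `|f x| <= `|h x|) -> itg f.
Proof.
by move=> m1 ih fh; apply: (le_integrable mTMS _ _ ih).
Qed.

Lemma itg_eq f h : itg f -> (forall x, TMS E x -> f x = h x) -> itg h.
Proof.
move=> i fh; have [m1 _] := (integrableP _ _ _ i); apply: (itg_le _ i); first exact: (mf_eq m1).
by move=> x Ex; rewrite fh.
Qed.

Lemma I_eq f h : (forall x, TMS E x -> f x = h x) -> I f = I h.
Proof. by move=> fh; apply: eq_Rintegral => x /set_mem; exact: fh. Qed.

Lemma itg_add f h : itg f -> itg h -> itg (fun x => f x + h x).
Proof. by move=> i1 i2; exact: (integrableD mTMS i1 i2). Qed.

Lemma itg_scale (c : R) f : itg f -> itg (fun x => c * f x).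
Proof. by move=> i1; exact: (integrableZl mTMS c i1). Qed.

Lemma I_add f h : itg f -> itg h -> I (fun x => f x + h x) = I f + I h.
Proof. by move=> i1 i2; exact: RintegralD. Qed.

Lemma I_scale (c : R) f : itg f -> I (fun x => c * f x) = c * I f.
Proof. by move=> i1; exact: RintegralZl. Qed.

Lemma I_sub f h : itg f -> itg h -> I (fun x => f x - h x) = I f - I h.
Proof. by move=> i1 i2; exact: RintegralB. Qed.

Lemma I_le f h : itg f -> itg h -> (forall x, TMS E x -> f x <= h x) -> I f <= I h.
Proof. by move=> i1 i2 fh; exact: le_Rintegral. Qed.

Lemma abs_tint f : (forall x, 0 <= f x) ->
  (\int[mu]_(x in (TMS E : set (seqM V))) `|(EFin \o (f : seqM V -> R)) x|)%E = tint E mu (EFin \o f).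
Proof. by move=> f0; apply: eq_integral => x _; rewrite /= ger0_norm. Qed.

Let sqr0 f x : 0 <= f x ^+ 2 :> R. Proof. exact: sqr_ge0. Qed.

Lemma itg_sqr f : L2 f -> itg (fun x => f x ^+ 2).
Proof.
by move=> [m1 h]; apply/integrableP; split; [exact: mf_sqr|rewrite abs_tint].
Qed.

Lemma itg_sqr_L2 f : mf (EFin \o f) -> itg (fun x => f x ^+ 2) -> L2 f.
Proof. by move=> m1 /integrableP[_]; rewrite abs_tint. Qed.

Lemma L2_le f h : mf (EFin \o f) -> L2 h -> (forall x, TMS E x -> `|f x| <= `|h x|) -> L2 f.
Proof.
move=> m1 [m2 h2] fh; split => //; apply: le_lt_trans h2; apply: (tint_le code_inj).
- by move=> x; rewrite lee_fin sqr_ge0.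
- exact: mf_sqr.
- exact: mf_sqr.
move=> x Ex; rewrite lee_fin -(real_normK (num_real (f x))) -(real_normK (num_real (h x))).
by rewrite ler_sqr ?nnegrE//; exact: fh.
Qed.

Lemma L2_eq f h : L2 f -> (forall x, TMS E x -> f x = h x) -> L2 h.
Proof. by move=> l fh; apply: (L2_le _ l) => [|x Ex]; [exact: (mf_eq l.1)|rewrite fh]. Qed.

Lemma L2_add f h : L2 f -> L2 h -> L2 (fun x => f x + h x).
Proof.
move=> l1 l2; have m := mf_add l1.1 l2.1; split => //.
have : itg (fun x => 2 * f x ^+ 2 + 2 * h x ^+ 2) by apply: itg_add; apply: itg_scale; exact: itg_sqr.
move=> /integrableP[m2]; apply: le_lt_trans; apply: (tint_le code_inj).
- by move=> x; rewrite lee_fin sqr_ge0.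
- exact: mf_sqr.
- by apply: measurableT_comp.
move=> x Ex; rewrite /= lee_fin; apply: (le_trans _ (ler_norm _)).
by have := sqr_addl_le (f x) (h x) ltr01; rewrite invr1.
Qed.

Lemma L2_scale (c : R) f : L2 f -> L2 (fun x => c * f x).
Proof.
move=> l1; apply: itg_sqr_L2; first exact: (mf_scale c l1.1).
by apply: (itg_eq (itg_scale (c ^+ 2) (itg_sqr l1))) => x _; rewrite exprMn.
Qed.

Lemma L2_sub f h : L2 f -> L2 h -> L2 (fun x => f x - h x).
Proof. by move=> l1 l2; apply: (L2_eq (L2_add l1 (L2_scale (-1) l2))) => x _; rewrite mulN1r. Qed.

Lemma L2_cst (c : R) : L2 (fun=> c).
Proof.
split; first exact: mf_cst.
by rewrite (_ : EFin \o _ = (fun=> (c ^+ 2)%:E))// (tint_cst code_inj muT) ?sqr_ge0// ltry.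
Qed.

Lemma L2_mul f h : L2 f -> L2 h -> itg (fun x => f x * h x).
Proof.
move=> l1 l2; apply: (itg_le (mf_mul l1.1 l2.1) (itg_add (itg_sqr l1) (itg_sqr l2))) => x Ex.
rewrite [leRHS]ger0_norm ?addr_ge0 ?sqr_ge0// ler_norml; move: (f x) (h x) => s t; apply/andP; split; nra.
Qed.

Lemma L2_itg f : L2 f -> itg f.
Proof. by move=> l1; apply: (itg_eq (L2_mul l1 (L2_cst 1))) => x _; rewrite mulr1. Qed.

Lemma I_cst (c : R) : I (fun=> c) = c.
Proof. rewrite Rintegral_cst// [X in fine X](_ : _ = 1%E) ?mulr1//; exact: muT. Qed.

Lemma I_sqr_ge0 f : 0 <= I (fun x => f x ^+ 2).
Proof. by apply: Rintegral_ge0 => x _; exact: sqr_ge0. Qed.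

Lemma I_sqr_add_le f h (e : R) : 0 < e -> L2 f -> L2 h ->
  I (fun x => (f x + h x) ^+ 2) <= (1 + e) * I (fun x => f x ^+ 2) + (1 + e^-1) * I (fun x => h x ^+ 2).
Proof.
move=> e0 l1 l2; have i1 := itg_sqr l1; have i2 := itg_sqr l2.
rewrite -!I_scale// -I_add; [|exact: itg_scale..].
apply: I_le; [exact: (itg_sqr (L2_add l1 l2))|by apply: itg_add; exact: itg_scale|] => x _.
exact: sqr_addl_le.
Qed.

Hypothesis minv : shift_inv_prob E mu.

Lemma itg_shift f : itg f -> itg (fun x => f (sshift x)).
Proof.
move=> /integrableP[m1 h]; apply/integrableP; split; first exact: (mf_sshift code_inj m1).
have := tint_sshift code_inj minv (F := fun x => `|(f x)%:E|%E); rewrite /tint => ->//.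
by apply: measurableT_comp.
Qed.

Lemma L2_shift f : L2 f -> L2 (fun x => f (sshift x)).
Proof.
move=> l1; apply: itg_sqr_L2; first exact: (mf_sshift code_inj l1.1).
exact: (itg_shift (itg_sqr l1)).
Qed.

Lemma L2_shiftn f n : L2 f -> L2 (fun x => f (iter n (@sshift V) x)).
Proof.
move=> l1; elim: n => [//|n /L2_shift h]; apply: (L2_eq h) => x _; by rewrite -iterSr.
Qed.

Lemma I_shift f : itg f -> I (fun x => f (sshift x)) = I f.
Proof.
move=> i1; have [m1 _] := integrableP _ _ _ i1.
have mp : mf (EFin \o (fun x => Num.max 0 (f x))) by apply: mf_max => //; exact: mf_cst.
have mn : mf (EFin \o (fun x => Num.max 0 (- f x))) by apply: mf_max; [exact: mf_cst|exact: mf_opp].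
have ip : itg (fun x => Num.max 0 (f x)).
  apply: (itg_le mp i1) => x _; case: (leP 0 (f x)) => h; rewrite ?normr0//.
have im : itg (fun x => Num.max 0 (- f x)).
  apply: (itg_le mn i1) => x _; case: (leP 0 (- f x)) => h; rewrite ?normr0 ?normrN//.
have H k : (forall x, 0 <= k x) -> mf (EFin \o k) -> I (fun x => k (sshift x)) = I k.
  by move=> k0 mk; congr fine; exact: (tint_sshift code_inj minv (F := EFin \o k)).
rewrite (I_eq (h := fun x => Num.max 0 (f (sshift x)) - Num.max 0 (- f (sshift x)))); last by move=> x _; exact: posneg.
rewrite [RHS](I_eq (h := fun x => Num.max 0 (f x) - Num.max 0 (- f x))); last by move=> x _; exact: posneg.
rewrite !I_sub//; [|exact: (itg_shift ip)|exact: (itg_shift im)].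
rewrite (H (fun x => Num.max 0 (f x)))// ?(H (fun x => Num.max 0 (- f x)))// => x; by rewrite le_max lexx.
Qed.

Lemma I_shiftn f n : itg f -> I (fun x => f (iter n (@sshift V) x)) = I f /\ itg (fun x => f (iter n (@sshift V) x)).
Proof.
move=> i1; elim: n => [//|n [IH i2]].
have e x : f (iter n.+1 (@sshift V) x) = (fun y => f (iter n (@sshift V) y)) (sshift x) by rewrite -iterSr.
split; first by rewrite (I_eq (fun x _ => e x)) (I_shift i2).
by apply: (itg_eq (itg_shift i2)) => x _; rewrite -iterSr.
Qed.

Lemma I_coboundary f : mf (EFin \o f) -> itg (fun x => f x - f (sshift x)) -> I (fun x => f x - f (sshift x)) = 0.
Proof.
move=> m1 i1.
have ms : mf (EFin \o (fun x => f (sshift x))) by exact: (mf_sshift code_inj m1).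
pose vp x := Num.max 0 (f (sshift x) - f x); pose vm x := Num.max 0 (f x - f (sshift x)).
have mp : mf (EFin \o vp) by apply: mf_max; [exact: mf_cst|exact: mf_sub].
have mn : mf (EFin \o vm) by apply: mf_max; [exact: mf_cst|exact: mf_sub].
have p0 x : 0 <= vp x by rewrite le_max lexx.
have n0 x : 0 <= vm x by rewrite le_max lexx.
have ip : itg vp.
  apply: (itg_le mp i1) => x _; rewrite /vp distrC; case: (leP 0 (f (sshift x) - f x)) => h; rewrite ?normr0//.
have im : itg vm.
  apply: (itg_le mn i1) => x _; rewrite /vm; case: (leP 0 (f x - f (sshift x))) => h; rewrite ?normr0//.
have c1 := coboundary_tint code_inj minv m1 p0 n0 mp mn (fun _ _ => erefl) (fun _ _ => erefl).
have c2 : (tint E mu (EFin \o vp) <= tint E mu (EFin \o vm))%E.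
  apply: (coboundary_tint code_inj minv (mf_opp m1) n0 p0 mn mp) => x _; rewrite /vm /vp; congr Num.max; ring.
have c3 : I vp = I vm by congr fine; apply/eqP; rewrite eq_le; apply/andP; split; [exact: c2|exact: c1].
rewrite (I_eq (h := fun x => vm x - vp x)).
  by rewrite I_sub// c3 subrr.
by move=> x _; rewrite /vm /vp [LHS]posneg opprB.
Qed.

Lemma I_eq0_ae f : (forall x, TMS E x -> 0 <= f x) -> itg f -> I f = 0 -> ae_eq mu (TMS E : set (seqM V)) (EFin \o f) (cst 0%E).
Proof.
move=> f0 i1 h; have [m1 fin] := integrableP _ _ _ i1.
apply/ae_eq_integral_abs => //; move: h; rewrite /Rintegral.
have -> : (\int[mu]_(x in (TMS E : set (seqM V))) `|(EFin \o f) x| = \int[mu]_(x in (TMS E : set (seqM V))) (f x)%:E)%E.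
  by apply: eq_integral => x /set_mem Ex /=; rewrite ger0_norm// f0.
have := integrable_fin_num mTMS i1; by case: (integral _ _ _) => // r _ /= ->.
Qed.

Lemma ae_I_eq0 f : mf (EFin \o f) -> (forall x, 0 <= f x) -> ae_eq mu (TMS E : set (seqM V)) (EFin \o f) (cst 0%E) -> I f = 0.
Proof.
move=> m1 f0 /(ae_eq_integral_abs mu mTMS m1); rewrite /Rintegral => h.
by rewrite (eq_integral (fun x : seqM V => `|(EFin \o f) x|%E)) ?h// => x _ /=; rewrite ger0_norm.
Qed.

End SquareIntegrable.
Arguments I_eq {R V E mu f h} _.

Section Variance.
Context {R : realType} {V : pointedType} (E : rel V).
Variable code : V -> nat.
Hypothesis code_inj : injective code.
Variable mu : probability (seqM V) R.
Hypothesis minv : shift_inv_prob E mu.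
Local Notation mf := (mf E).
Local Notation L2 := (L2 E mu).
Local Notation I f := (Rintegral mu (TMS E : set (seqM V)) f).
Local Notation itg f := (mu.-integrable (TMS E : set (seqM V)) (EFin \o (f : seqM V -> R))).
Implicit Types (f h k chi l psi vphi r : (nat -> V) -> R).
Let muT : mu (TMS E : set (seqM V)) = 1%E. Proof. by case: minv. Qed.

Definition reverse_martingale chi := L2 chi /\ forall b, L2 b -> I (fun x => chi x * b (sshift x)) = 0.

Definition martingale_coboundary psi chi l (c : R) := [/\ reverse_martingale chi, L2 l &
  forall x, TMS E x -> psi x = chi x + l (sshift x) - l x + c].

Lemma L2_birk f n : L2 f -> L2 (birk f n).
Proof.
move=> l1; elim: n => [|n IH].
  by apply: (L2_eq code_inj (L2_cst code_inj muT 0)) => x _; rewrite birk0.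
apply: (L2_eq code_inj (L2_add code_inj IH (L2_shiftn code_inj minv n l1))) => x _.
by rewrite birkSr.
Qed.

Lemma I_martingale chi : reverse_martingale chi -> I chi = 0.
Proof.
move=> [_ h]; rewrite -(h (fun=> 1) (L2_cst code_inj muT 1)).
by apply: I_eq => x _; rewrite mulr1.
Qed.

Lemma I_birk_sqr chi n : reverse_martingale chi -> I (fun x => birk chi n x ^+ 2) = n%:R * I (fun x => chi x ^+ 2).
Proof.
move=> [lc mc]; elim: n => [|n IH].
  by rewrite mul0r (I_eq (h := fun=> 0)) ?(I_cst code_inj muT)// => x _; rewrite birk0 expr0n.
have lb := L2_birk n lc; have lbs := L2_shift code_inj minv lb.
rewrite (I_eq (h := fun x => chi x ^+ 2 + (2 * (chi x * birk chi n (sshift x)) + birk chi n (sshift x) ^+ 2))); last first.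
  by move=> x _; rewrite birkS; ring.
have i1 := itg_sqr lc; have i2 := L2_mul code_inj lc lbs; have i3 := itg_sqr lbs.
have i2' := itg_scale code_inj 2 i2.
rewrite (I_add code_inj i1 (itg_add code_inj i2' i3)) (I_add code_inj i2' i3) (I_scale code_inj 2 i2) (mc _ lb).
have e := I_shift code_inj minv (itg_sqr lb).
rewrite IH in e; rewrite [X in _ + (_ + X)]e -(natr1 n); ring.
Qed.

Lemma birk_decomposition psi chi l c n x : martingale_coboundary psi chi l c -> TMS E x ->
  birk psi n x = birk chi n x + l (iter n (@sshift V) x) - l x + n%:R * c.
Proof.
move=> [_ _ dE] Ex; elim: n => [|n IH]; first by rewrite !birk0 mul0r /=; ring.
by rewrite !birkSr IH dE ?iterS; [rewrite -natr1; ring|exact: TMS_iter].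
Qed.

Lemma I_coboundary_n l n : L2 l -> I (fun x => l (iter n (@sshift V) x) - l x) = 0.
Proof.
move=> ll; have [e i] := I_shiftn code_inj minv n (L2_itg code_inj muT ll).
by rewrite (I_sub code_inj i (L2_itg code_inj muT ll)) [X in X - _]e subrr.
Qed.

Lemma I_birk psi chi l c n : martingale_coboundary psi chi l c -> I (birk psi n) = n%:R * c.
Proof.
move=> d; have [[lc mc] ll _] := d; have lb := L2_birk n lc.
rewrite (I_eq (h := fun x => birk chi n x + ((l (iter n (@sshift V) x) - l x) + n%:R * c))); last first.
  by move=> x Ex; rewrite (birk_decomposition n d Ex); ring.
have l3 := L2_sub code_inj (L2_shiftn code_inj minv n ll) ll.
have l4 := L2_cst code_inj muT (n%:R * c).
rewrite (I_add code_inj (L2_itg code_inj muT lb) (L2_itg code_inj muT (L2_add code_inj l3 l4))).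
rewrite (I_add code_inj (L2_itg code_inj muT l3) (L2_itg code_inj muT l4)) I_coboundary_n// (I_cst code_inj muT).
suff -> : I (birk chi n) = 0 by rewrite !add0r.
elim: n {lb l3 l4} => [|n IH].
  by rewrite (I_eq (h := fun=> 0)) ?(I_cst code_inj muT)// => x _; rewrite birk0.
have lbs := L2_shift code_inj minv (L2_birk n lc).
rewrite (I_eq (h := fun x => chi x + birk chi n (sshift x))); last by move=> x _; rewrite birkS.
rewrite (I_add code_inj (L2_itg code_inj muT lc) (L2_itg code_inj muT lbs)) I_martingale// add0r -[RHS]IH.
exact: (I_shift code_inj minv (L2_itg code_inj muT (L2_birk n lc))).
Qed.

Lemma var_seq_cvg psi chi l c : martingale_coboundary psi chi l c -> var_seq E mu psi @ \oo --> I (fun x => chi x ^+ 2).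
Proof.
move=> d; have [[lc mc] ll _] := d; set Q := I _.
have Q0 : 0 <= Q by exact: I_sqr_ge0.
pose W := 4 * I (fun x => l x ^+ 2).
have W0 : 0 <= W by rewrite mulr_ge0//; exact: I_sqr_ge0.
pose Y n x := l (iter n (@sshift V) x) - l x.
have lY n : L2 (Y n) by exact: (L2_sub code_inj (L2_shiftn code_inj minv n ll) ll).
have YW n : I (fun x => Y n x ^+ 2) <= W.
  have lN : L2 (fun x => - 1 * l x) by exact: (L2_scale code_inj).
  have := I_sqr_add_le code_inj ltr01 (L2_shiftn code_inj minv n ll) lN.
  have [-> _] := I_shiftn code_inj minv n (itg_sqr ll).
  rewrite (I_eq (f := fun x => (l (iter n (@sshift V) x) + - 1 * l x) ^+ 2) (h := fun x => Y n x ^+ 2)); last first.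
    by move=> x _; rewrite mulN1r.
  rewrite (I_eq (f := fun x => (- 1 * l x) ^+ 2) (h := fun x => l x ^+ 2)); last by move=> x _; rewrite mulN1r sqrrN.
  rewrite invr1 /W; lra.
have vE n : var_seq E mu psi n = n%:R^-1 * I (fun x => (birk chi n x + Y n x) ^+ 2).
  rewrite /var_seq; congr (_ * _); apply: I_eq => x Ex; rewrite (I_birk n d) (birk_decomposition n d Ex) /Y.
  by congr (_ ^+ 2); ring.
have lB n := L2_birk n lc; have IB n := I_birk_sqr n (conj lc mc).
apply: (cvg_perturbation W0 Q0 (cvg_cst Q)) => n e e0; rewrite vE.
  have := I_sqr_add_le code_inj e0 (lB n.+1) (lY n.+1); rewrite IB -/Q => h.
  by have := perturb_div n (ltW e0) h (YW n.+1); rewrite mulKf// pnatr_eq0.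
have lN : L2 (fun x => - 1 * Y n.+1 x) by exact: (L2_scale code_inj).
have := I_sqr_add_le code_inj e0 (L2_add code_inj (lB n.+1) (lY n.+1)) lN.
rewrite (@I_eq _ _ _ _ (fun x => (birk chi n.+1 x + Y n.+1 x + - 1 * Y n.+1 x) ^+ 2) (fun x => birk chi n.+1 x ^+ 2)); last first.
  by move=> x _; rewrite mulN1r addrK.
rewrite (@I_eq _ _ _ _ (fun x => (- 1 * Y n.+1 x) ^+ 2) (fun x => Y n.+1 x ^+ 2)); last by move=> x _; rewrite mulN1r sqrrN.
rewrite IB -/Q => h; have := perturb_div n (ltW e0) h (YW n.+1).
by rewrite mulKf// pnatr_eq0.
Qed.

Lemma mf_comp (F : R -> R) f : continuous F -> mf (EFin \o f) -> mf (EFin \o (fun x => F (f x))).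
Proof.
move=> cF /mf_real m1; apply/measurable_EFinP.
by apply: (measurableT_comp (f := F)) => //; exact: continuous_measurable_fun.
Qed.

Lemma reverse_martingale_sub chi chi' : reverse_martingale chi -> reverse_martingale chi' ->
  reverse_martingale (fun x => chi x - chi' x).
Proof.
move=> [l1 h1] [l2 h2]; split; first exact: (L2_sub code_inj).
move=> b lb; have lbs := L2_shift code_inj minv lb.
rewrite (I_eq (h := fun x => chi x * b (sshift x) - chi' x * b (sshift x))); last by move=> x _; rewrite mulrBl.
by rewrite (I_sub code_inj (L2_mul code_inj l1 lbs) (L2_mul code_inj l2 lbs)) h1// h2// subrr.
Qed.

(* Integrating the convexity gap of [phuber] between [r] and [r \o sshift] kills
   the linear term, because [chi] is orthogonal to functions of [sshift x], and
   the increment of [phuber \o r], because it is a coboundary. *)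
Lemma martingale_coboundary_eq0 chi r c : reverse_martingale chi -> mf (EFin \o r) ->
  (forall x, TMS E x -> chi x = r x - r (sshift x) + c) -> I (fun x => chi x ^+ 2) = 0.
Proof.
move=> mc mr chiE; have [lc oc] := mc.
have mrs : mf (EFin \o (fun x => r (sshift x))) by exact: (mf_sshift code_inj mr).
have c0 : c = 0.
  have ld := L2_sub code_inj lc (L2_cst code_inj muT c).
  have id : itg (fun x => r x - r (sshift x)).
    by apply: (itg_eq code_inj (L2_itg code_inj muT ld)) => x Ex; rewrite chiE// addrK.
  have := I_coboundary code_inj minv mr id.
  rewrite (I_eq (h := fun x => chi x - c)); last by move=> x Ex; rewrite chiE// addrK.
  rewrite (I_sub code_inj (L2_itg code_inj muT lc) (L2_itg code_inj muT (L2_cst code_inj muT c))).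
  by rewrite (I_cst code_inj muT) I_martingale// sub0r => /eqP; rewrite oppr_eq0 => /eqP.
have {}chiE x : TMS E x -> chi x = r x - r (sshift x) by move=> Ex; rewrite chiE// c0 addr0.
have lb : L2 (fun x => dphuber (r x)).
  apply: (L2_le code_inj _ (L2_cst code_inj muT 1)); first exact: (mf_comp continuous_dphuber mr).
  by move=> x _; rewrite normr1; exact: dphuber_le1.
have lbs := L2_shift code_inj minv lb.
pose w x := phuber (r x).
have mw : mf (EFin \o w) by exact: (mf_comp continuous_phuber mr).
have iw : itg (fun x => w x - w (sshift x)).
  apply: (itg_le code_inj _ (L2_itg code_inj muT lc)).
    by apply: mf_sub => //; exact: (mf_sshift code_inj mw).
  by move=> x Ex; rewrite chiE//; exact: phuber_lip.
have i2 := L2_mul code_inj lc lbs.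
pose gap x := (w x - w (sshift x)) - chi x * dphuber (r (sshift x)).
have ig : itg gap.
  by apply: (itg_eq code_inj (itg_add code_inj iw (itg_scale code_inj (-1) i2))) => x _; rewrite mulN1r.
have gapE x : TMS E x -> gap x = phuber (r x) - phuber (r (sshift x)) - dphuber (r (sshift x)) * (r x - r (sshift x)).
  by move=> Ex; rewrite /gap chiE// [X in _ - X]mulrC.
have gap0 : I gap = 0 by rewrite (I_sub code_inj iw i2) (I_coboundary code_inj minv mw iw) [X in _ - X](oc _ lb) subrr.
have ae0 : ae_eq mu (TMS E : set (seqM V)) (EFin \o gap) (cst 0%E).
  by apply: (I_eq0_ae code_inj) => // x Ex; rewrite gapE//; exact: phuber_gap_ge0.
apply: (ae_I_eq0 code_inj); [exact: (mf_sqr lc.1)|by move=> x; exact: sqr_ge0|].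
apply: filterS ae0 => x + Ex; move=> /(_ Ex) /= [] g0.
have e : r x = r (sshift x) by apply: phuber_gap_eq0; rewrite -gapE.
by rewrite chiE// -e subrr expr0n.
Qed.

Lemma cohomologous_variance psi vphi chi chi' l l' c c' r d : martingale_coboundary psi chi l c ->
  martingale_coboundary vphi chi' l' c' -> mf (EFin \o r) ->
  (forall x, TMS E x -> psi x - vphi x = r x - r (sshift x) + d) ->
  I (fun x => chi x ^+ 2) = I (fun x => chi' x ^+ 2).
Proof.
move=> [m1 ll dE] [m2 ll' dE'] mr pE; have m3 := reverse_martingale_sub m1 m2.
have z : I (fun x => (chi x - chi' x) ^+ 2) = 0.
  apply: (martingale_coboundary_eq0 (r := fun x => r x + (l x - l' x)) (c := d - c + c') m3).
    by apply: mf_add => //; apply: mf_sub; [exact: ll.1|exact: ll'.1].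
  by move=> x Ex; have := pE x Ex; rewrite dE// dE'//; lra.
have z' : I (fun x => (chi' x - chi x) ^+ 2) = 0.
  by rewrite -z; apply: I_eq => x _; rewrite -sqrrN opprB.
have H k k' : L2 k -> L2 k' -> I (fun x => (k x - k' x) ^+ 2) = 0 -> I (fun x => k x ^+ 2) <= I (fun x => k' x ^+ 2).
  move=> lk lk' z0; apply: le_of_perturbation => e e0.
  have := I_sqr_add_le code_inj e0 lk' (L2_sub code_inj lk lk'); rewrite z0 mulr0 addr0.
  by rewrite (@I_eq _ _ _ _ (fun x => (k' x + (k x - k' x)) ^+ 2) (fun x => k x ^+ 2)) // => x _; rewrite subrKC.
by apply/eqP; rewrite eq_le !H//; [exact: m2.1|exact: m1.1|exact: m1.1|exact: m2.1].
Qed.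

Lemma sigma_mE psi chi l c : martingale_coboundary psi chi l c ->
  sigma_m E mu psi = Num.sqrt (I (fun x => chi x ^+ 2)).
Proof. by move=> d; congr Num.sqrt; apply: cvg_lim => //; exact: (var_seq_cvg d). Qed.

End Variance.

(** * Martingale decomposition *)

Lemma geometric_ratio {F : fieldType} (K q t : F) n : t ^- n * (K * q ^+ n) = K * (q / t) ^+ n.
Proof. by rewrite expr_div_n mulrCA [t ^- n * _]mulrC. Qed.

Lemma amgm_le1 {F : realFieldType} (r s : F) : 0 <= r -> r <= 1 -> 0 < s -> r <= (s ^+ 2 + r) / (2 * s).
Proof.
move=> r0 r1 s0; rewrite ler_pdivlMr ?mulr_gt0//.
have h1 := sqr_ge0 (s - r); have h2 : 0 <= r * (1 - r) by rewrite mulr_ge0// subr_ge0.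
by move: h1 h2; lra.
Qed.

Section Decomposition.
Context {R : realType} {V : pointedType} (E : rel V) (theta : R).
Hypothesis theta01 : 0 < theta < 1.
Variable code : V -> nat.
Hypothesis code_inj : injective code.
Hypothesis mixE : top_mixing E.
Variables (g : (nat -> V) -> R) (a : V) (kappa M0 K q : R) (x0 : nat -> V).
Hypothesis kappa0 : 0 <= kappa.
Hypothesis g0 : forall x, 0 < g x.
Hypothesis greg : regw E theta kappa g.
Hypothesis Ex0 : TMS E x0.
Hypothesis x0a : x0 0%N = a.
Local Notation L := (transfer E g).
Local Notation LL := (loopop a L).
Local Notation A := (taboo a L).
Local Notation N := (resolvent A).
Hypothesis L1 : forall x, TMS E x -> L (fun=> 1%E) x = 1%E.
Hypothesis LL1 : forall x, TMS E x -> LL (fun=> 1%E) x = 1%E.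
Hypothesis M01 : 1 <= M0.
Hypothesis N1M : forall x, TMS E x -> x 0%N = a -> (N (fun=> 1) x <= M0%:E)%E.
Variable mu : probability (seqM V) R.
Hypothesis muT : mu (TMS E : set (seqM V)) = 1%E.
Hypothesis muL : forall F : (nat -> V) -> \bar R, nneg F -> mf E F -> tint E mu (L F) = tint E mu F.
Hypothesis q01 : 0 < q < 1.
Hypothesis K0 : 0 <= K.
Hypothesis tailmu : forall n, (tint E mu (iter n A (fun=> 1%E)) <= (K * q ^+ n)%:E)%E.
Local Notation mf := (mf E).
Local Notation L2 := (L2 E mu).
Local Notation I f := (Rintegral mu (TMS E : set (seqM V)) f).
Local Notation itg f := (mu.-integrable (TMS E : set (seqM V)) (EFin \o (f : seqM V -> R))).
Local Notation n1r := (n1r E g a).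
Implicit Types (f h k l u psi b : (nat -> V) -> R).
Let g0' x : 0 <= g x. Proof. exact: ltW. Qed.
Let mg : mf (EFin \o g) := mf_regw theta01 code_inj g0' greg.
Let minv := transfer_inv code_inj g0' L1 muT muL.
Let pL : posop (TMS E) L. Proof. exact: po_transfer. Qed.
Let pA : posop (TMS E) A. Proof. exact: po_taboo. Qed.
Let pN : posop (TMS E) N. Proof. exact: po_resolvent. Qed.
Let n1 : nneg (fun _ : nat -> V => 1%E : \bar R). Proof. by []. Qed.
Let n1rE x (Ex : TMS E x) : (n1r x)%:E = N (fun=> 1%E) x := n1rE theta01 mixE kappa0 g0 greg N1M Ex.
Let n1r_ge1 x (Ex : TMS E x) : 1 <= n1r x := n1r_ge1 theta01 mixE kappa0 g0 greg N1M Ex.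

Let A1 n : nneg (iter n A (fun=> 1%E)). Proof. exact: (po_ge0 (po_iter pA n)). Qed.

Lemma taboo_iter_le1 n x : TMS E x -> (iter n A (fun=> 1) x <= 1)%E.
Proof.
elim: n x => [//|n IH] x Ex; rewrite iterS -[leRHS](L1 Ex).
apply: (@le_trans _ _ (L (iter n A (fun=> 1%E)) x)).
  by rewrite (taboo_entry a pL) ?leeDl//; apply: (po_ge0 (po_entry a pL)).
by apply: (po_le pL).
Qed.

Lemma mf_n1r : mf (EFin \o n1r).
Proof.
have mN : mf (N (fun=> 1%E)) by apply: (mf_resolvent code_inj g0' mg) => //; exact: mf_cst.
apply: (@eq_measurable_fun _ _ (seqM V) (\bar R) (TMS E) (N (fun=> 1%E))) => // x /set_mem Ex /=.
by rewrite n1rE.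
Qed.

Let t := (1 + q) / 2.
Let t01 : 0 < t < 1.
Proof. by case/andP: q01 => h1 h2; rewrite /t; apply/andP; split; lra. Qed.
Let W x := (\sum_(n <oo) (t ^- n)%:E * iter n A (fun=> 1) x)%E.

(* Cauchy-Schwarz for the series of the [iter n A 1], which are at most 1. *)
Lemma n1r_sqr_le x : TMS E x -> ((n1r x ^+ 2)%:E <= ((1 - t)^-1)%:E * W x)%E.
Proof.
move=> Ex; have /andP[t0 t1] := t01; have t1' : 0 < 1 - t by rewrite subr_gt0.
have tn n : 0 <= t ^- n by rewrite invr_ge0 exprn_ge0// ltW.
have W0 n : (0 <= (t ^- n)%:E * iter n A (fun=> 1) x)%E by rewrite mule_ge0 ?lee_fin//; exact: A1.
have T1 := n1r_ge1 Ex; set T := n1r x in T1 *.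
pose lam := (1 - t) * T; have lam0 : 0 < lam by rewrite mulr_gt0// (lt_le_trans ltr01).
have key : (T%:E <= (T / 2)%:E + ((2 * lam)^-1)%:E * W x)%E.
  rewrite n1rE// /resolvent.
  have -> : (T / 2)%:E = (\sum_(n <oo) ((lam / 2) * t ^+ n)%:E)%E.
    rewrite geometric_nneseries ?(ltW t0)//; last by rewrite divr_ge0// ltW.
    by rewrite /lam; congr EFin; field; rewrite gt_eqF.
  rewrite -nneseriesZl//.
  rewrite -nneseriesD//; last 2 first.
  - by move=> n _ _; rewrite lee_fin mulr_ge0// ?exprn_ge0 ?(ltW t0)// divr_ge0// (ltW lam0).
  - by move=> n _ _; rewrite mule_ge0// lee_fin invr_ge0 mulr_ge0// (ltW lam0).
  apply: lee_nneseries => [n _ _|n _]; first exact: A1.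
  have := taboo_iter_le1 n Ex; have := A1 n x.
  case: (iter n A (fun=> 1%E) x) => [r| |]//; rewrite -!EFinM -EFinD !lee_fin => r0 r1.
  have tn' : 0 < t ^+ n by exact: exprn_gt0.
  have -> : (2 * lam)^-1 * (t ^- n * r) = r / (2 * lam * t ^+ n).
    by field; rewrite !gt_eqF.
  set s := lam * t ^+ n; have s0 : 0 < s by rewrite mulr_gt0.
  have -> : lam / 2 * t ^+ n + r / (2 * lam * t ^+ n) = (s ^+ 2 + r) / (2 * s).
    by rewrite /s; field; rewrite !gt_eqF.
  exact: amgm_le1.
have Wx0 : (0 <= W x)%E by apply: nneseries_ge0 => n _ _; exact: W0.
move: key Wx0; case: (W x) => [w| |]//; last first.
  by move=> _ _; rewrite gt0_muley ?lte_fin ?invr_gt0// leey.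
rewrite -!EFinM -EFinD !lee_fin => key w0.
have T0 : 0 < T by exact: lt_le_trans ltr01 T1.
have : T / 2 * (2 * lam) <= w by rewrite -ler_pdivlMr ?mulr_gt0// mulrC; lra.
rewrite ler_pdivlMl// /lam => h; apply: le_trans h.
by rewrite le_eqVlt; apply/orP; left; apply/eqP; field.
Qed.

Lemma n1r_L2 : L2 n1r.
Proof.
split; first exact: mf_n1r.
have /andP[t0 t1] := t01; have t1' : 0 < 1 - t by rewrite subr_gt0.
have /andP[q0 q1] := q01; have qt : q < t by rewrite /t; lra.
have mA n : mf (iter n A (fun=> 1%E)) by apply: (mf_taboo_iter code_inj g0' mg) => //; exact: mf_cst.
have tn n : 0 <= t ^- n by rewrite invr_ge0 exprn_ge0// ltW.
have W0 n : nneg (fun x => (t ^- n)%:E * iter n A (fun=> 1) x)%E by move=> x; rewrite mule_ge0 ?lee_fin//; exact: A1.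
have mW n : mf (fun x => (t ^- n)%:E * iter n A (fun=> 1) x)%E by apply: (@mf_wmul R V E (fun=> t ^- n)) => //; exact: mf_cst.
have mWs : mf W by exact: mf_series.
have Ws0 : nneg W by move=> x; apply: nneseries_ge0 => n _ _; exact: W0.
apply: (@le_lt_trans _ _ (tint E mu (fun x => ((1 - t)^-1)%:E * W x)%E)).
  apply: (tint_le code_inj).
  - by move=> x; rewrite lee_fin sqr_ge0.
  - exact: (mf_sqr mf_n1r).
  - by apply: (@mf_wmul R V E (fun=> (1 - t)^-1)) => //; exact: mf_cst.
  - exact: n1r_sqr_le.
rewrite (tint_scale code_inj)//; last by rewrite invr_ge0 ltW.
rewrite (tint_series code_inj)//.
apply: (@le_lt_trans _ _ (((1 - t)^-1)%:E * (\sum_(n <oo) (K * (q / t) ^+ n)%:E))%E).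
  rewrite lee_wpmul2l ?lee_fin ?invr_ge0 ?(ltW t1')//; apply: lee_nneseries => [n _ _|n _].
    by apply: tint_ge0; exact: W0.
  rewrite (tint_scale code_inj)//.
  apply: (@le_trans _ _ ((t ^- n)%:E * (K * q ^+ n)%:E)%E); first by rewrite lee_wpmul2l ?lee_fin.
  by rewrite -EFinM lee_fin geometric_ratio.
rewrite geometric_nneseries//; first by rewrite -EFinM ltry.
by rewrite divr_ge0 ?ltW//= ltr_pdivrMr// mul1r.
Qed.

Lemma realop_mf f l : realop (TMS E) L f l -> mf (EFin \o f) -> mf (EFin \o l).
Proof.
move=> [f0 fl] m1; have F0 : nneg (EFin \o f) by move=> x; rewrite lee_fin.
apply: (@eq_measurable_fun _ _ (seqM V) (\bar R) (TMS E) (L (EFin \o f))); last exact: (mf_transfer code_inj g0' mg F0 m1).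
by move=> x /set_mem Ex; rewrite fl.
Qed.

Lemma realop_adjoint f l b : realop (TMS E) L f l -> L2 f -> L2 l -> L2 b ->
  I (fun x => f x * b (sshift x)) = I (fun x => l x * b x).
Proof.
move=> [f0 fl] lf ll lb; have F0 : nneg (EFin \o f) by move=> x; rewrite lee_fin.
have H k : (forall x, 0 <= k x) -> mf (EFin \o k) -> I (fun x => f x * k (sshift x)) = I (fun x => l x * k x).
  move=> k0 mk; congr fine; have := adjoint code_inj g0' muL k0 mk F0 lf.1; rewrite /tint => h.
  transitivity (tint E mu (fun x => ((k (sshift x))%:E * (EFin \o f) x)%E)).
    by apply: tint_eq => x _ /=; rewrite -EFinM mulrC.
  rewrite /tint h; apply: tint_eq => x Ex; rewrite fl//= -EFinM mulrC//.
have lp : L2 (fun x => Num.max 0 (b x)).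
  apply: (L2_le code_inj _ lb) => [|x _]; first by apply: mf_max; [exact: mf_cst|exact: lb.1].
  by case: (leP 0 (b x)) => h; rewrite ?normr0.
have ln : L2 (fun x => Num.max 0 (- b x)).
  apply: (L2_le code_inj _ lb) => [|x _].
    by apply: mf_max; [exact: mf_cst|apply: mf_opp; exact: lb.1].
  by case: (leP 0 (- b x)) => h; rewrite ?normr0 ?normrN.
have lps := L2_shift code_inj minv lp; have lns := L2_shift code_inj minv ln.
rewrite (I_eq (h := fun x => f x * Num.max 0 (b (sshift x)) - f x * Num.max 0 (- b (sshift x)))); last first.
  by move=> x _; rewrite -mulrBr -posneg.
rewrite [RHS](I_eq (h := fun x => l x * Num.max 0 (b x) - l x * Num.max 0 (- b x))); last first.
  by move=> x _; rewrite -mulrBr -posneg.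
rewrite (I_sub code_inj (L2_mul code_inj lf lps) (L2_mul code_inj lf lns)).
rewrite (I_sub code_inj (L2_mul code_inj ll lp) (L2_mul code_inj ll ln)).
by rewrite (H _ _ lp.1) ?(H _ _ ln.1)// => x; rewrite le_max lexx.
Qed.

Lemma lrel_martingale u l G lG : lrel (TMS E) L u l -> mf (EFin \o u) -> realop (TMS E) L G lG ->
  (forall x, TMS E x -> `|u x| <= G x) -> L2 G -> L2 lG ->
  [/\ L2 u, L2 l, forall x, TMS E x -> `|l x| <= lG x &
    reverse_martingale E mu (fun x => u x - l (sshift x))].
Proof.
move=> ul mfu rG uG LG LlG.
have lp0 x : 0 <= Num.max 0 (u x) by rewrite le_max lexx.
have ln0 x : 0 <= Num.max 0 (- u x) by rewrite le_max lexx.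
have mp : mf (EFin \o (fun x => Num.max 0 (u x))) by apply: mf_max => //; exact: mf_cst.
have mn : mf (EFin \o (fun x => Num.max 0 (- u x))) by apply: mf_max; [exact: mf_cst|exact: mf_opp].
have pG x : TMS E x -> Num.max 0 (u x) <= G x.
  by move=> Ex; rewrite ge_max (le_trans (normr_ge0 _) (uG x Ex))/= (le_trans (ler_norm _) (uG x Ex)).
have nG x : TMS E x -> Num.max 0 (- u x) <= G x.
  by move=> Ex; rewrite ge_max (le_trans (normr_ge0 _) (uG x Ex))/= (le_trans _ (uG x Ex))// -normrN ler_norm.
have [l1 r1 l1G] := realop_ex pL rG lp0 pG; have [l2 r2 l2G] := realop_ex pL rG ln0 nG.
have lE x : TMS E x -> l x = l1 x - l2 x.
  have d := lrel_sub pL (realop_lrel pL r1) (realop_lrel pL r2).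
  move=> Ex; apply/eqP; rewrite eq_le; apply/andP; split.
    by apply: (lrel_le pL ul d) => // y _; rewrite -posneg.
  by apply: (lrel_le pL d ul) => // y _; rewrite -posneg.
have Lu : L2 u by apply: (L2_le code_inj mfu LG) => x Ex; rewrite (le_trans (uG x Ex))// ler_norm.
have Lp : L2 (fun x => Num.max 0 (u x)).
  by apply: (L2_le code_inj mp LG) => x Ex; rewrite ger0_norm// (le_trans (pG x Ex))// ler_norm.
have Ln : L2 (fun x => Num.max 0 (- u x)).
  by apply: (L2_le code_inj mn LG) => x Ex; rewrite ger0_norm// (le_trans (nG x Ex))// ler_norm.
have Ll1 : L2 l1.
  apply: (L2_le code_inj (realop_mf r1 mp) LlG) => x Ex; have /andP[h1 h2] := l1G x Ex.
  by rewrite ger0_norm// (le_trans h2)// ler_norm.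
have Ll2 : L2 l2.
  apply: (L2_le code_inj (realop_mf r2 mn) LlG) => x Ex; have /andP[h1 h2] := l2G x Ex.
  by rewrite ger0_norm// (le_trans h2)// ler_norm.
have Ll : L2 l by apply: (L2_eq code_inj (L2_sub code_inj Ll1 Ll2)) => x Ex; rewrite lE.
have Lls := L2_shift code_inj minv Ll.
split => //.
  move=> x Ex; rewrite lE//; have /andP[? ?] := l1G x Ex; have /andP[? ?] := l2G x Ex.
  by rewrite ler_norml; apply/andP; split; lra.
split; first exact: (L2_sub code_inj Lu Lls).
move=> b lb; have lbs := L2_shift code_inj minv lb.
rewrite (I_eq (h := fun x => (Num.max 0 (u x) * b (sshift x) - Num.max 0 (- u x) * b (sshift x)) - l (sshift x) * b (sshift x))); last first.
  by move=> x _; rewrite -mulrBl -posneg mulrBl.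
have i1 := L2_mul code_inj Lp lbs; have i2 := L2_mul code_inj Ln lbs; have i3 := L2_mul code_inj Lls lbs.
have i12 : itg (fun x => Num.max 0 (u x) * b (sshift x) - Num.max 0 (- u x) * b (sshift x)).
  by apply: (itg_eq code_inj (L2_mul code_inj Lu lbs)) => x _; rewrite -mulrBl -posneg.
rewrite (I_sub code_inj i12 i3) (I_sub code_inj i1 i2) (realop_adjoint r1 Lp Ll1 lb) (realop_adjoint r2 Ln Ll2 lb).
rewrite -(I_sub code_inj (L2_mul code_inj Ll1 lb) (L2_mul code_inj Ll2 lb)).
have e := I_shift code_inj minv (L2_mul code_inj Ll lb).
rewrite [X in _ - X]e (I_eq (h := fun x => l x * b x)) ?subrr// => x Ex.
by rewrite -mulrBl lE.
Qed.

Lemma holder_cont psi S : (forall n x y, TMS E x -> TMS E y -> agree n x y -> `|psi x - psi y| <= S * theta ^+ n) ->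
  cont_on_TMS E psi.
Proof.
move=> h x Ex e e0.
have cg : (fun n => S * theta ^+ n) @ \oo --> (0 : R).
  rewrite -[X in _ --> X](mulr0 S); apply: cvgMr; apply: cvg_expr; rewrite ger0_norm; case/andP: theta01 => // t0 _.
  exact: ltW.
have /cvgrPdist_lt/(_ _ e0)[n _ /(_ n (leqnn n))/=] := cg.
rewrite sub0r normrN => /(le_lt_trans (ler_norm _)) hn.
by exists n => y Ey xy; rewrite distrC; exact: le_lt_trans (h n x y Ex Ey xy) hn.
Qed.

Lemma cont_shift f : cont_on_TMS E f -> cont_on_TMS E (fun x => f (sshift x)).
Proof.
move=> cf x Ex e e0; have [n hn] := cf _ (TMS_sshift Ex) e e0; exists n.+1 => y Ey xy.
by apply: hn => [|i ni]; [exact: TMS_sshift|exact: xy].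
Qed.

Lemma decomposition : exists2 M1, 0 <= M1 & forall psi S, 0 <= S ->
  (forall x, TMS E x -> `|psi x| <= S) ->
  (forall n x y, TMS E x -> TMS E y -> agree n x y -> `|psi x - psi y| <= S * theta ^+ n) ->
  exists chi l c, [/\ martingale_coboundary E mu psi chi l c, cont_on_TMS E chi, cont_on_TMS E l &
    I (fun x => chi x ^+ 2) <= (M1 * S) ^+ 2].
Proof.
have [K2 K20 hp] := poisson theta01 mixE kappa0 g0 greg Ex0 x0a L1 LL1 M01 N1M.
have rn := realop_n1r theta01 mixE kappa0 g0 greg L1 LL1 M01 N1M.
set ln := (X in realop _ _ _ X) in rn.
have ln0 x : TMS E x -> 0 <= ln x.
  move=> Ex; have [n0 h] := rn; rewrite -lee_fin -h//; apply: (po_ge0 pL) => y; by rewrite lee_fin.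
have Ln1 := n1r_L2.
have Lln : L2 ln.
  have l2 := L2_add code_inj Ln1 (L2_cst code_inj muT M0).
  apply: (L2_le code_inj (realop_mf rn mf_n1r) l2) => x Ex; rewrite ger0_norm ?ln0//.
  apply: (le_trans _ (ler_norm _)); rewrite /ln -addrA lerD2l.
  have h : entryN E g a (fun=> 1%E) 1 x <= M0.
    have M00 : 0 <= M0 by exact: le_trans ler01 M01.
    rewrite -lee_fin (entryNE g0 L1 LL1 M01 N1M n1 ler01 (fun _ _ => lexx _) 1 Ex)/=.
    by apply: (entry_bound g0 L1) => //; exact: (po_ge0 pN).
  by move: h; lra.
pose Q := I (fun x => n1r x ^+ 2) + I (fun x => ln x ^+ 2).
have Q0 : 0 <= Q by rewrite addr_ge0//; exact: I_sqr_ge0.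
exists (K2 * Num.sqrt (2 * Q)); first by rewrite mulr_ge0// sqrtr_ge0.
move=> psi S S0 psiS psiH; have [u [c [cu uK ul]]] := hp psi S S0 psiS psiH.
have K2S : 0 <= K2 * S by rewrite mulr_ge0.
set l := (X in lrel _ _ _ X) in ul.
have mfu := cont_mf code_inj cu.
have rG := realop_scale pL K2S rn.
have [Lu Ll lG mart] := lrel_martingale ul mfu rG uK (L2_scale code_inj (K2 * S) Ln1) (L2_scale code_inj (K2 * S) Lln).
have cl : cont_on_TMS E l.
  apply: cont_add; last by move=> x Ex e e0; exists 0%N => y _ _; rewrite subrr normr0.
  apply: cont_add => // x Ex e e0; have [n hn] := holder_cont psiH Ex e0; exists n => y Ey xy.
  by rewrite -opprD normrN -[X in _ + X]opprK opprK; have := hn y Ey xy; rewrite distrC addrC.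
exists (fun x => u x - l (sshift x)), l, c; split => //.
- by split => // x Ex; rewrite /l; ring.
- apply: cont_add => //; have := cont_shift cl => h x Ex e e0; have [n hn] := h x Ex e e0; exists n => y Ey xy.
  by rewrite -opprD normrN; have := hn y Ey xy.
have Lls := L2_shift code_inj minv Ll.
have LlsN : L2 (fun x => - l (sshift x)).
  by apply: (L2_eq code_inj (L2_scale code_inj (-1) Lls)) => x _; rewrite mulN1r.
apply: (le_trans (I_sqr_add_le code_inj ltr01 Lu LlsN)).
have e1 : I (fun x => (- l (sshift x)) ^+ 2) = I (fun x => l x ^+ 2).
  rewrite (I_eq (h := fun x => l (sshift x) ^+ 2)); last by move=> x _; rewrite sqrrN.
  exact: (I_shift code_inj minv (itg_sqr Ll)).
have b1 : I (fun x => u x ^+ 2) <= (K2 * S) ^+ 2 * I (fun x => n1r x ^+ 2).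
  rewrite -(I_scale code_inj _ (itg_sqr Ln1)); apply: (I_le code_inj (itg_sqr Lu) (itg_scale code_inj _ (itg_sqr Ln1))).
  move=> x Ex; rewrite -exprMn -(real_normK (num_real (u x))) ler_sqr ?nnegrE ?uK//.
  exact: le_trans (normr_ge0 _) (uK x Ex).
have b2 : I (fun x => l x ^+ 2) <= (K2 * S) ^+ 2 * I (fun x => ln x ^+ 2).
  rewrite -(I_scale code_inj _ (itg_sqr Lln)); apply: (I_le code_inj (itg_sqr Ll) (itg_scale code_inj _ (itg_sqr Lln))).
  move=> x Ex; rewrite -exprMn -(real_normK (num_real (l x))) ler_sqr ?nnegrE ?lG//.
  exact: le_trans (normr_ge0 _) (lG x Ex).
rewrite e1 invr1 (_ : (_ * S) ^+ 2 = 2 * ((K2 * S) ^+ 2 * Q)); last first.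
  rewrite mulrAC exprMn sqr_sqrtr ?mulr_ge0//; ring.
by rewrite /Q mulrDr; move: b1 b2; lra.
Qed.

Lemma full_support f : cont_on_TMS E f -> L2 f -> I (fun x => f x ^+ 2) = 0 -> forall x, TMS E x -> f x = 0.
Proof.
move=> cf lf If x Ex; apply: contrapT => /eqP fx.
have d0 : 0 < `|f x| / 2 by rewrite divr_gt0// normr_gt0.
have [n hn] := cf x Ex _ d0; set d := `|f x| / 2 in d0 hn.
pose U := [set y | agree n.+1 x y].
have mU := measurable_agree n.+1 x.
have U0 : (0 < mu (U : set (seqM V)))%E.
  apply: lt_le_trans (gibbs_lower theta01 code_inj kappa0 g0 greg muT muL n Ex).
  rewrite mule_gt0 ?lte_fin ?expR_gt0//.
  apply: (state_mass_pos theta01 code_inj kappa0 g0 greg muT muL); first by case: mixE.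
  exact: TMS_ex.
have h : ((d ^+ 2)%:E * mu (U : set (seqM V)) <= tint E mu (EFin \o (fun x => (f x ^+ 2)%R)))%E.
  rewrite -(tint_indicT code_inj muT mU) -(tint_scale code_inj) ?sqr_ge0//; last 2 first.
  - by move=> y; rewrite lee_fin; exact: indic_ge0'.
  - exact: (@mf_indic R V E _ mU).
  apply: (tint_le code_inj).
  - by move=> y; rewrite mule_ge0 ?lee_fin ?sqr_ge0//; exact: indic_ge0'.
  - by apply: (@mf_wmul R V E (fun=> d ^+ 2)); [exact: mf_cst|exact: (@mf_indic R V E _ mU)].
  - exact: (mf_sqr lf.1).
  move=> y Ey /=; rewrite -EFinM lee_fin indicE.
  have [/set_mem Uy|_] := boolP (y \in _); last by rewrite mulr0 sqr_ge0.
  have := hn y Ey (agreeW (leqnSn n) Uy); rewrite mulr1 => h.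
  rewrite -(real_normK (num_real (f y))) ler_sqr ?nnegrE ?(ltW d0)//.
  have := ler_normB (f x) (f x - f y); rewrite subKr distrC => h2.
  have : `|f x| <= `|f y| + `|f y - f x|.
    by rewrite -[X in `|X| <= _](subrK (f y)) addrC distrC; apply: (le_trans (ler_normD _ _)); rewrite lerD2l distrC.
  by move: h; rewrite /d; lra.
have [_ fin] := lf; have z : tint E mu (EFin \o (fun x => (f x ^+ 2)%R)) = 0%E.
  have t0 : (0 <= tint E mu (EFin \o (fun x => (f x ^+ 2)%R)))%E by apply: tint_ge0 => y; rewrite lee_fin sqr_ge0.
  by rewrite -[LHS]fineK ?ge0_fin_numE//; congr EFin; exact: If.
by move: h; rewrite z leNgt mule_gt0// lte_fin exprn_gt0.
Qed.

End Decomposition.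

(** * Main result *)

Section HolderNorm.
Context {R : realType} {V : pointedType} (E : rel V) (theta beta : R).
Hypothesis beta0 : 0 < beta.
Hypothesis beta_theta : expR (- beta) <= theta.
Variable psi : (nat -> V) -> R.
Hypothesis psiH : in_H E beta psi.

Lemma HnormE : Hnorm E beta psi = (fine (Hnorm E beta psi))%:E /\ 0 <= fine (Hnorm E beta psi).
Proof.
have h0 : (0 <= Hnorm E beta psi)%E by apply: adde_ge0; apply: ereal_sup_ubound; left.
by split; [rewrite fineK// ge0_fin_numE|exact: fine_ge0].
Qed.

Let S := fine (Hnorm E beta psi).

Lemma Hnorm_sup x : TMS E x -> `|psi x| <= S.
Proof.
move=> Ex; rewrite -lee_fin -(HnormE.1) /Hnorm -[leLHS]adde0; apply: leeD; last by apply: ereal_sup_ubound; left.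
by apply: ereal_sup_ubound; right; exists x.
Qed.

Lemma Hnorm_holder n x y : TMS E x -> TMS E y -> agree n x y -> `|psi x - psi y| <= S * theta ^+ n.
Proof.
move=> Ex Ey xy; have S0 : 0 <= S by exact: HnormE.2.
have th0 : 0 < theta by exact: lt_le_trans (expR_gt0 _) beta_theta.
have [xey|xny] := pselect (x = y).
  by rewrite xey subrr normr0 mulr_ge0// exprn_ge0// ltW.
have ex : exists i, x i != y i.
  apply: contrapT => h; apply: xny; apply/funext => i; apply/eqP/negPn/negP => xyi.
  by apply: h; exists i.
pose t := ex_minn ex; have [xt mint] : x t != y t /\ forall i, x i != y i -> (t <= i)%N.
  by rewrite /t; case: ex_minnP.
have nt : (n <= t)%N by rewrite leqNgt; apply/negP => /xy /eqP; rewrite (negPf xt).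
have txy : agree t x y.
  by move=> i it; apply/eqP/negPn/negP => /mint; rewrite leqNgt it.
have h : `|psi x - psi y| * expR (beta * t%:R) <= S.
  rewrite -lee_fin -(HnormE.1) /Hnorm -[leLHS]add0e; apply: leeD; apply: ereal_sup_ubound; first by left.
  by right; exists t, x, y; split => //; apply/eqP.
have -> : `|psi x - psi y| = `|psi x - psi y| * expR (beta * t%:R) * expR (- beta) ^+ t.
  by rewrite -expRM_natr -mulrA -expRD mulNr subrr expR0 mulr1.
apply: (@le_trans _ _ (S * expR (- beta) ^+ t)); first by rewrite ler_wpM2r// exprn_ge0// expR_ge0.
rewrite ler_wpM2l//; apply: (@le_trans _ _ (expR (- beta) ^+ n)).
  by rewrite ler_wiXn2l// ?expR_ge0// -expR0 ler_expR oppr_le0 ltW.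
by rewrite lerXn2r// nnegrE ?expR_ge0// ltW.
Qed.

End HolderNorm.

Lemma pressure_fin (R : realType) (V : pointedType) (E : rel V) (phi : (nat -> V) -> R) (C : R) (a : V) :
  (forall x, TMS E x -> phi x <= C) -> (PG E (fun _ : nat -> V => 0%R : R) a < +oo)%E ->
  (growth (Zfirst E phi a) < PG E phi a)%E -> PG E phi a = (fine (PG E phi a))%:E.
Proof.
move=> phiC entropy_fin SPRa; have [k k0 [K K0 kK]] := perset_zero_bound entropy_fin.
rewrite fineK// fin_numE -ltey -ltNye (le_lt_trans (leNye _) SPRa)/=.
apply: le_lt_trans (ltry (C + k)); apply: (growth_le K0) => n; first by rewrite ZperE perset_ge0.
rewrite ZperE; apply: (@le_trans _ _ ((expR (n.+1%:R * C))%:E * \esum_(y in perset E a false n.+1) expbirk (fun=> 0%R) n.+1 y)%E).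
  rewrite -esumZl ?expR_ge0//; last by move=> y; apply: expbirk_ge0.
  by apply: le_esum => y [Ey _ _ _]; exact: (expbirk_le phiC).
apply: (@le_trans _ _ ((expR (n.+1%:R * C))%:E * (K * expR (n.+1%:R * k))%:E)%E).
  by apply: lee_wpmul2l; rewrite ?lee_fin ?expR_ge0.
by rewrite -EFinM lee_fin mulrCA -expRD -mulrDr.
Qed.

Section UniqueEquilibrium.
Context {R : realType} {V : pointedType} (E : rel V) (theta : R).
Variables (phi : (nat -> V) -> R) (m : probability (seqM V) R).
Hypothesis countV : countable [set: V].
Hypothesis mixE : top_mixing E.
Hypothesis entropy_fin : finite_gurevich_entropy R E.
Hypothesis theta01 : 0 < theta < 1.
Hypothesis phiH : weakly_holder E theta phi.
Hypothesis phiSPR : SPR E phi.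
Hypothesis phi_bounded : exists C : R, forall x, TMS E x -> phi x <= C.
Hypothesis m_unique : forall nu : probability (seqM V) R, equilibrium E phi nu ->
     forall A : set (seqM V), measurable A -> nu A = m A.

Lemma equilibrium_decomposition : (exists2 M1, 0 <= M1 & forall psi S, 0 <= S ->
    (forall x, TMS E x -> `|psi x| <= S) ->
    (forall n x y, TMS E x -> TMS E y -> agree n x y -> `|psi x - psi y| <= S * theta ^+ n) ->
    exists chi l c, [/\ martingale_coboundary E m psi chi l c, cont_on_TMS E chi, cont_on_TMS E l &
      Rintegral m (TMS E : set (seqM V)) (fun x => chi x ^+ 2) <= (M1 * S) ^+ 2]) /\
  forall f, cont_on_TMS E f -> L2 E m f -> Rintegral m (TMS E : set (seqM V)) (fun x => f x ^+ 2) = 0 ->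
    forall x, TMS E x -> f x = 0.
Proof.
have [code code_inj'] : exists code : V -> nat, {in [set: V] &, injective code} by exact/countable_injP.
have code_inj : injective code by move=> b b' h; apply: code_inj'; rewrite ?in_setT.
have [a SPRa] := phiSPR; have [C phiC] := phi_bounded; have ea := entropy_fin a.
have PGE := pressure_fin phiC ea SPRa; set P := fine _ in PGE.
have [A0 hA0] := phiH; pose A := Num.max A0 0.
have A_0 : 0 <= A by rewrite le_max lexx orbT.
have phiA : wholder E theta A phi.
  move=> n n2 x y Ex Ey xy; apply: (le_trans (hA0 n n2 x y Ex Ey xy)).
  by rewrite ler_wpM2r ?exprn_ge0 ?le_max ?lexx//; case/andP: theta01 => /ltW.
have [h [h0 hreg hL hLL hfin]] := eigenfunction theta01 mixE A_0 phiA phiC ea PGE SPRa.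
have [p1 p1P [K1 K10 tb]] := taboo_bound theta01 A_0 phiA phiC ea PGE SPRa.
have [k k0 [K' K'0 zb]] := taboo_zero_bound theta01 A_0 ea.
pose c := holderc theta A; have c0 : 0 <= c by exact: holderc_ge0.
pose w := wphi phi P; have w0 x : 0 < w x by exact: expR_gt0.
have wreg : regw E theta A w by exact: regw_wphi.
pose g := gn E w h; pose kappa := kappan theta A c.
have g0 x : 0 < g x by exact: (gn_gt0 w0 hfin).
have g0' x : 0 <= g x by exact: ltW.
have th0 : 0 < theta by case/andP: theta01.
have kappa0 : 0 <= kappa by apply: addr_ge0; [exact: addr_ge0|exact: divr_ge0 c0 (ltW th0)].
have greg : regw E theta kappa g by exact: (regw_gn theta01 w0 wreg h0 hreg hfin).
have L1 : forall x, TMS E x -> transfer E g (fun=> 1%E) x = 1%E by exact: (Ln1 w0 h0 hfin hL).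
have LL1 : forall x, TMS E x -> loopop a (transfer E g) (fun=> 1%E) x = 1%E by exact: (loop1 w0 h0 hfin hLL).
have [x0 Ex0 x0a] := TMS_ex mixE a.
pose q := expR (p1 - P); have q0 : 0 < q by exact: expR_gt0.
have q01 : 0 < q < 1 by rewrite q0 /q expR_lt1 subr_lt0.
have K1q : 0 < K1 * q by rewrite mulr_gt0.
have tail := taboo_tail theta01 w0 h0 c0 hreg hfin K1q q0.
have {}tail : forall n x, TMS E x -> x 0%N = a ->
    (iter n (taboo a (transfer E g)) (entry a (transfer E g) (fun=> 1)) x <= (expR c * (K1 * q) * q ^+ n)%:E)%E.
  apply: tail => n x Ex xa; rewrite (iter_taboo_LP phi a P n Ex).
  apply: (@le_trans _ _ ((expR (- (n.+1%:R * P)))%:E * (K1 * expR (n.+1%:R * p1))%:E)%E).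
    by rewrite lee_wpmul2l ?lee_fin ?expR_ge0// tb.
  rewrite -EFinM lee_fin le_eqVlt; apply/orP; left; apply/eqP.
  by rewrite mulrCA -expRD -mulrA -exprS /q -expRM_natl mulrBr [- _ + _]addrC.
pose K := expR c * (K1 * q); have K0 : 0 < K by rewrite mulr_gt0 ?expR_gt0.
have count : forall n x, TMS E x -> x 0%N = a ->
    (iter n (taboo a (transfer E (fun=> 1%R : R))) (entry a (transfer E (fun=> 1%R : R)) (fun=> 1)) x <= (K' * expR (n.+1%:R * k))%:E)%E.
  move=> n x Ex xa; have := zb n x Ex xa; rewrite presum_taboo//.
  by rewrite (_ : (fun x : nat -> V => expR (0 : R)) = fun=> 1)//; apply/funext => y; rewrite expR0.
have [M0 M01 N1M] := N1_bound g0' LL1 K0 q01 tail.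
have [mu [muT muL muE]] := equilibrium_measure theta01 code_inj kappa0 g0' greg Ex0 x0a L1 LL1 M01 N1M.
have tailmu := tint_taboo_tail theta01 kappa0 g0' greg Ex0 x0a L1 LL1 M01 N1M K0 q01 tail muE.
have K2_0 : 0 <= K / (1 - q) ^+ 2 by rewrite divr_ge0 ?(ltW K0)// sqr_ge0.
have tail0 (e : R) : 0 < e -> exists n, (tint E mu (iter n (taboo a (transfer E g)) (fun=> 1%E)) <= e%:E)%E.
  move=> e0; have cg : (fun n => K / (1 - q) ^+ 2 * q ^+ n) @ \oo --> (0 : R).
    by rewrite -[X in _ --> X](mulr0 (K / (1 - q) ^+ 2)); apply: cvgMr; apply: cvg_expr; rewrite gtr0_norm//; case/andP: q01.
  have /cvgrPdist_lt/(_ _ e0)[n _ /(_ n (leqnn n))/=] := cg.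
  rewrite sub0r normrN => /(le_lt_trans (ler_norm _)) hn.
  by exists n; apply: (le_trans (tailmu n)); rewrite lee_fin ltW.
have mphi : mf E (EFin \o phi).
  have := mfun_ln (mf_regw theta01 code_inj (fun x => ltW (w0 x)) wreg) => h1.
  have h2 : mf E (EFin \o (fun=> P)) by exact: mf_cst.
  by apply: (mf_eq (mf_add h1 h2)) => x _; rewrite /w /wphi expRK subrK.
have mhr : mf E (EFin \o hr E h).
  apply: (@eq_measurable_fun _ _ (seqM V) (\bar R) (TMS E) h); last exact: (mf_reg theta01 code_inj h0 hreg).
  by move=> x /set_mem Ex /=; rewrite hrE.
have lgE x : TMS E x -> lg g x = phi x - P + ln (hr E h x) - ln (hr E h (sshift x)).
  move=> Ex; have hp z : hr E h z \is Num.pos by rewrite posrE; exact: hr_gt0.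
  by rewrite /lg /g /gn ln_div ?posrE ?mulr_gt0 ?w0 ?hr_gt0// lnM ?posrE ?w0 ?hr_gt0// expRK.
have mu_eq := mu_equilibrium theta01 code_inj mixE kappa0 g0 greg L1 LL1 K0 q01 K'0 k0 tail count muT muL tail0 phiC mphi (mfun_ln mhr) lgE.
have mu_m := m_unique mu_eq.
have tE F : tint E m F = tint E mu F by apply: eq_measure_integral => B mB _; first [exact: (mu_m B mB)|exact: (esym (mu_m B mB))].
have mT : m (TMS E : set (seqM V)) = 1%E by exact: etrans (esym (mu_m _ (measurable_TMS E code_inj))) muT.
have mL F : nneg F -> mf E F -> tint E m (transfer E g F) = tint E m F by move=> F0 mF; rewrite !tE muL.
have tailm n : (tint E m (iter n (taboo a (transfer E g)) (fun=> 1%E)) <= (K / (1 - q) ^+ 2 * q ^+ n)%:E)%E by rewrite tE.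
split; first exact: (decomposition theta01 code_inj mixE kappa0 g0 greg Ex0 x0a L1 LL1 M01 N1M mT mL q01 K2_0 tailm).
exact: (full_support theta01 code_inj mixE kappa0 g0 greg mT mL).
Qed.

End UniqueEquilibrium.

Theorem theorem3p4 (R : realType) (V : pointedType) (E : rel V) (theta : R)
  (phi : (nat -> V) -> R) (m : probability (seqM V) R) :
  countable [set: V] ->
  top_mixing E ->
  finite_gurevich_entropy R E ->
  0 < theta < 1 ->
  weakly_holder E theta phi ->
  SPR E phi ->
  (exists C : R, forall x, TMS E x -> phi x <= C) ->
  equilibrium E phi m ->
  (forall nu : probability (seqM V) R, equilibrium E phi nu ->
     forall A : set (seqM V), measurable A -> nu A = m A) ->
  (forall beta : R, 0 < beta -> expR (- beta) <= theta ->
     (* the asymptotic variance exists *)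
     (forall psi, in_H E beta psi -> cvgn (var_seq E m psi)) /\
     (* (1) *)
     (forall psi, in_H E beta psi ->
        (sigma_m E m psi = 0 <->
         exists (r : (nat -> V) -> R) (c : R), cont_on_TMS E r /\
           forall x, TMS E x -> psi x = r x - r (sshift x) + c)) /\
     (* (2) *)
     (forall (psi vphi r : (nat -> V) -> R) (c : R),
        in_H E beta psi -> in_H E beta vphi -> cont_on_TMS E r ->
        (forall x, TMS E x -> psi x - vphi x = r x - r (sshift x) + c) ->
        sigma_m E m psi = sigma_m E m vphi)) /\
  (* (3) *)
  (exists M : R, 1 < M /\
     forall beta : R, 0 < beta -> expR (- beta) <= theta ->
       forall psi, in_H E beta psi ->
         ((sigma_m E m psi)%:E <= M%:E * Hnorm E beta psi)%E).
Proof.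
move=> cV mixE ent th01 phiH phiSPR phiC [minv _] uniq.
have [[M1 M10 dec] supp] := equilibrium_decomposition cV mixE ent th01 phiH phiSPR phiC uniq.
have [code code_inj'] : exists code : V -> nat, {in [set: V] &, injective code} by exact/countable_injP.
have code_inj : injective code by move=> b b' h; apply: code_inj'; rewrite ?in_setT.
have decH beta psi : 0 < beta -> expR (- beta) <= theta -> in_H E beta psi ->
    exists chi l c, [/\ martingale_coboundary E m psi chi l c, cont_on_TMS E chi, cont_on_TMS E l &
      Rintegral m (TMS E : set (seqM V)) (fun x => chi x ^+ 2) <= (M1 * fine (Hnorm E beta psi)) ^+ 2].
  move=> b0 bt pH; apply: dec; [by have [] := HnormE pH|exact: Hnorm_sup|exact: Hnorm_holder].
split; last first.
  exists (M1 + 2); split; first by lra.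
  move=> beta b0 bt psi pH; have [chi [l [c [d _ _ h]]]] := decH beta psi b0 bt pH.
  have [-> S0] := HnormE pH; set S := fine _ in S0 h *.
  rewrite -EFinM lee_fin (sigma_mE code_inj minv d); apply: (@le_trans _ _ (M1 * S)).
    by rewrite -[leRHS]ger0_norm ?mulr_ge0// -sqrtr_sqr ler_wsqrtr.
  by rewrite ler_wpM2r//; lra.
move=> beta b0 bt; split=> [psi pH|].
  have [chi [l [c [d _ _ _]]]] := decH beta psi b0 bt pH.
  by apply/cvg_ex; eexists; exact: (var_seq_cvg code_inj minv d).
have part2 (psi vphi r : (nat -> V) -> R) (c : R) : in_H E beta psi -> in_H E beta vphi -> cont_on_TMS E r ->
    (forall x, TMS E x -> psi x - vphi x = r x - r (sshift x) + c) -> sigma_m E m psi = sigma_m E m vphi.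
  move=> pH vH cr hr; have [chi [l [d [D _ _ _]]]] := decH beta psi b0 bt pH.
  have [chi' [l' [d' [D' _ _ _]]]] := decH beta vphi b0 bt vH.
  rewrite (sigma_mE code_inj minv D) (sigma_mE code_inj minv D').
  by rewrite (cohomologous_variance code_inj minv D D' (cont_mf code_inj cr) hr).
split => // psi pH; split.
  have [chi [l [c [D cchi cl _]]]] := decH beta psi b0 bt pH.
  rewrite (sigma_mE code_inj minv D) => /eqP; rewrite sqrtr_eq0 => h.
  have h0 : Rintegral m (TMS E : set (seqM V)) (fun x => chi x ^+ 2) = 0.
    by apply/eqP; rewrite eq_le h; exact: I_sqr_ge0.
  have [[lchi _] _ pE] := D.
  have chi0 := supp chi cchi lchi h0.
  exists (fun x => - l x), c; split.
    by move=> x Ex e e0; have [n hn] := cl x Ex e e0; exists n => y Ey xy; rewrite -opprD normrN; exact: hn.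
  by move=> x Ex; rewrite pE// chi0//; ring.
move=> [r [c [cr hr]]].
have zH : in_H E beta (fun=> 0 : R).
  rewrite /in_H /Hnorm (_ : [set 0%E] `|` _ = [set 0%E]); last first.
    by apply/seteqP; split=> [z [->//|[x Ex <-]]|z ->]; [rewrite normr0|left].
  rewrite (_ : [set 0%E] `|` _ = [set 0%E]); last first.
    apply/seteqP; split=> [z [->//|[n [x [y [_ _ _ _ ->]]]]]|z ->]; last by left.
    by rewrite subrr normr0 mul0r.
  by rewrite !ereal_sup1 adde0 ltry.
rewrite (part2 psi (fun=> 0) r c)//; last by move=> x Ex; rewrite subr0 hr.
rewrite /sigma_m /asym_var (_ : var_seq E m (fun=> 0) = fun=> 0) ?lim_cst ?sqrtr0//.
apply/funext => n; rewrite /var_seq.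
have e x : birk (fun _ : nat -> V => 0 : R) n x = 0 by rewrite /birk big1.
have e1 : Rintegral m (TMS E : set (seqM V)) (birk (fun=> 0) n) = 0.
  rewrite (I_eq (h := fun=> 0)) ?(I_cst code_inj minv.1)// => x _; exact: e.
rewrite e1 (I_eq (h := fun=> 0)) ?(I_cst code_inj minv.1) ?mulr0// => x _; by rewrite e subr0 expr0n.
Qed.
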